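(* Let $$P^{ij} = g^{ij}(u(x)) \frac{d}{dx} + b^{ij}_k (u(x))\, u^k_x + \sum_{m=1}^L \sum_{n=1}^L \mu^{mn} (w_m)^i_k (u(x)) u^k_x \left(\frac{d}{dx}\right)^{-1} \circ (w_n)^j_s (u(x)) u^s_x ,$$ with $\det(g^{ij}(u)) \neq 0$ and $\mu^{mn}$ a nondegenerate symmetric constant matrix, be a Hamiltonian operator. Then the metric $g^{ij}(u)$ is flat if and only if this operator defines a pencil of compatible Hamiltonian operators, i.e. if and only if for arbitrary constants $\lambda_1$ and $\lambda_2$ the operator $$P^{ij}_{\lambda_1,\lambda_2} = \lambda_1\left( g^{ij}(u(x)) \frac{d}{dx} + b^{ij}_k(u(x))\, u^k_x\right) + \lambda_2 \sum_{m=1}^L\sum_{n=1}^L \mu^{mn} (w_m)^i_k(u(x)) u^k_x \left(\frac{d}{dx}\right)^{-1}\circ (w_n)^j_s(u(x)) u^s_x$$ is Hamiltonian.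
   Context: Here $u=(u^1,\dots,u^N)$ are local coordinates, $u^i(x)$ are fields depending on one variable $x$, all coefficients $g^{ij},b^{ij}_k,(w_n)^i_j$ are smooth functions of $u$, repeated upper/lower indices are summed from $1$ to $N$, and all considerations are local. An operator $P^{ij}$ is Hamiltonian if the bracket $\{I,J\}=\int \frac{\delta I}{\delta u^i(x)}P^{ij}\frac{\delta J}{\delta u^j(x)}dx$ on functionals of the fields is skew-symmetric and satisfies the Jacobi identity. Two Hamiltonian operators are compatible if any linear combination of them with constant coefficients is Hamiltonian. The paper works with the following known criterion (Ferapontov): an operator of the form displayed for $P^{ij}$ (nondegenerate $g^{ij}$, nondegenerate symmetric constant $\mu^{mn}$) is Hamiltonian if and only if $g^{ij}=g^{ji}$ and 1) $b^{ij}_k=-g^{is}\Gamma^j_{sk}$, where $\Gamma^j_{sk}$ is the Levi-Civita connection of the (pseudo-Riemannian) contravariant metric $g^{ij}$; 2) $g^{ik}(w_n)^j_k=g^{jk}(w_n)^i_k$; 3) $\nabla_k(w_n)^i_j=\nabla_j(w_n)^i_k$, with $\nabla$ the Levi-Civita covariant derivative; 4) $g^{is}R^j_{skl}=\sum_{m,n=1}^L\mu^{mn}\left((w_m)^i_l(w_n)^j_k-(w_m)^j_l(w_n)^i_k\right)$, where $R^j_{skl}$ is the Riemannian curvature tensor; 5) $(w_n)^i_s(w_m)^s_j=(w_m)^i_s(w_n)^s_j$. *)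

(* Defs.v *)
From HB Require Import structures.
From mathcomp Require Import all_boot all_order all_algebra.
From mathcomp Require Import all_classical all_reals all_analysis.

Set Implicit Arguments.
Unset Strict Implicit.
Unset Printing Implicit Defensive.

Import Order.TTheory GRing.Theory Num.Theory.
Import numFieldNormedType.Exports.

Local Open Scope classical_set_scope.
Local Open Scope ring_scope.

Section Smoothness.
Context {R : realType}.

(* [A] is meant to be open.  The successor case asks for Frechet
   differentiability and for [C^k] regularity of every directional
   derivative; in finite dimension this is the usual class [C^k]. *)
Fixpoint Ck (V W : normedModType R) (k : nat) (A : set V) (f : V -> W) : Prop :=
  match k with
  | 0%N => forall p, A p -> {for p, continuous f}
  | k'.+1 => (forall p, A p -> differentiable f p) /\
             (forall v : V, Ck k' A (fun p => 'D_v f p))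
  end.

Definition smooth_on (V W : normedModType R) (A : set V) (f : V -> W) : Prop :=
  forall k, Ck k A f.

Definition compactly_supported (V : normedModType R) (f : R -> V) : Prop :=
  exists r : R, forall x, r < `|x| -> f x = 0.

Definition test_fun (V : normedModType R) (f : R -> V) : Prop :=
  smooth_on [set: R] f /\ compactly_supported f.

End Smoothness.

Section HamiltonianOperators.
Context {R : realType} {N : nat}.

Notation path := (R -> 'rV[R]_N).

(* The fields: smooth curves in the coordinate domain [U], constant near
   [-oo] and near [+oo].  Thus [u + t eta], with [eta] a test function, is
   again a field for all small [t], and all the integrals below are integrals
   of compactly supported continuous functions. *)
Definition field (U : set 'rV[R]_N) (u : path) : Prop :=
  [/\ smooth_on [set: R] u, (forall x, U (u x)) & compactly_supported (derive1 u)].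

Definition pairing (f X : path) : R :=
  \int[lebesgue_measure]_x (\sum_i f x 0 i * X x 0 i).

(* [f] is the variational derivative [delta I / delta u] at [u]. *)
Definition is_vder (I : path -> R) (u f : path) : Prop :=
  test_fun f /\
  forall eta : path, test_fun eta ->
    is_derive (0 : R) (1 : R) (fun t : R => I (fun x => u x + t *: eta x))
      (pairing f eta).

(* A variational derivative is unique when it exists; the value is
   irrelevant otherwise. *)
Definition vder (I : path -> R) (u : path) : path :=
  xget (fun=> 0) [set f | is_vder I u f].

(* Smooth functionals of fields with values in [U]: at every field there is a
   variational derivative, and it depends smoothly on the field (tested on
   two-parameter affine families), with locally uniform support.
   Every [\int h (x, u, u_x, ..., u_(k)) dx] with [h] smooth and compactly
   supported in [x] is such a functional. *)
Definition functional (U : set 'rV[R]_N) (I : path -> R) : Prop :=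
  (forall u, field U u -> is_vder I u (vder I u)) /\
  (forall u eta zeta, field U u -> test_fun eta -> test_fun zeta ->
    exists e r : R, 0 < e /\
      let A := [set p : R * R * R | `|p.1.1| < e /\ `|p.1.2| < e] in
      let D := fun p : R * R * R =>
        vder I (fun x => u x + p.1.1 *: eta x + p.1.2 *: zeta x) p.2 in
      smooth_on A D /\ (forall p, A p -> r < `|p.2| -> D p = 0)).

(* An operator [P] sends a field [u] and a covector field [f] along [u] to the
   vector field [(P f)^i = P^{ij} f_j] along [u]. *)
Definition operator := path -> path -> path.

Definition bracket (P : operator) (I J : path -> R) : path -> R :=
  fun u => pairing (vder I u) (P u (vder J u)).

Definition hamiltonian (U : set 'rV[R]_N) (P : operator) : Prop :=
  (forall I J, functional U I -> functional U J ->
     forall u, field U u -> bracket P I J u = - bracket P J I u) /\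
  (forall I J K, functional U I -> functional U J -> functional U K ->
     forall u, field U u ->
       bracket P (bracket P I J) K u + bracket P (bracket P J K) I u
         + bracket P (bracket P K I) J u = 0).

(* The inverse of d/dx, normalised to be skew-symmetric. *)
Definition Dinv (h : R -> R) : R -> R := fun x =>
  2^-1 * (\int[lebesgue_measure]_(y in `]-oo, x]) h y
          - \int[lebesgue_measure]_(y in `[x, +oo[) h y).

(* In what follows [g i j], [b i j k] and [w n i j] stand for g^{ij},
   b^{ij}_k and (w_n)^i_j. *)

Definition hydro_op (g : 'I_N -> 'I_N -> 'rV[R]_N -> R)
    (b : 'I_N -> 'I_N -> 'I_N -> 'rV[R]_N -> R) : operator :=
  fun u f x => \row_i \sum_j
    (g i j (u x) * derive1 f x 0 j
     + \sum_k b i j k (u x) * derive1 u x 0 k * f x 0 j).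

Definition nonlocal_op (L : nat) (mu : 'M[R]_L)
    (w : 'I_L -> 'I_N -> 'I_N -> 'rV[R]_N -> R) : operator :=
  fun u f x => \row_i \sum_m \sum_n
    mu m n * (\sum_k w m i k (u x) * derive1 u x 0 k) *
    Dinv (fun y => \sum_j (\sum_s w n j s (u y) * derive1 u y 0 s) * f y 0 j) x.

Definition lin_comb (l1 l2 : R) (P Q : operator) : operator :=
  fun u f x => l1 *: P u f x + l2 *: Q u f x.

Definition metric_mx (g : 'I_N -> 'I_N -> 'rV[R]_N -> R) (p : 'rV[R]_N) : 'M[R]_N :=
  \matrix_(i, j) g i j p.

(* [g] is the contravariant metric; its inverse is the covariant one. *)
Definition cometric (g : 'I_N -> 'I_N -> 'rV[R]_N -> R) (i j : 'I_N)
    (p : 'rV[R]_N) : R := invmx (metric_mx g p) i j.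

Definition partial (k : 'I_N) (f : 'rV[R]_N -> R) : 'rV[R]_N -> R :=
  fun p => 'D_(delta_mx 0 k : 'rV[R]_N) f p.

(* [christoffel g j s k] is Gamma^j_{sk}. *)
Definition christoffel (g : 'I_N -> 'I_N -> 'rV[R]_N -> R) (j s k : 'I_N)
    (p : 'rV[R]_N) : R :=
  2^-1 * \sum_l g j l p *
    (partial s (cometric g l k) p + partial k (cometric g l s) p
     - partial l (cometric g s k) p).

(* [riemann g j s k l] is R^j_{skl}. *)
Definition riemann (g : 'I_N -> 'I_N -> 'rV[R]_N -> R) (j s k l : 'I_N)
    (p : 'rV[R]_N) : R :=
  partial k (christoffel g j l s) p - partial l (christoffel g j k s) p
  + \sum_q (christoffel g j k q p * christoffel g q l s p
            - christoffel g j l q p * christoffel g q k s p).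

Definition flat (U : set 'rV[R]_N) (g : 'I_N -> 'I_N -> 'rV[R]_N -> R) : Prop :=
  forall p, U p -> forall j s k l, riemann g j s k l p = 0.

End HamiltonianOperators.

(* Main.v *)
(* An operator is Hamiltonian iff it is skew and its Schouten bracket [P, P]
   vanishes.  Let A and B be the local and the nonlocal part.  The bracket of
   l1 A + l2 B is l1^2 [A, A] + l1 l2 ([A, B] + [B, A]) + l2^2 [B, B], and it
   vanishes at l1 = l2 = 1.  Hence it suffices to see that [A, A] = 0 iff g is
   flat, and that flatness implies [B, B] = 0.  Ferapontov's criterion is not
   used.

   The skew-symmetry of A + B and its Jacobi identity at constant fields, where
   B vanishes, say that b is given by the Levi-Civita connection.  Then [A, A]
   is the integral of an expression linear in the curvature.  If it vanishes,
   the curvature with raised indices is cyclic in three indices, and its usual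
   symmetries force it to be zero.

   Now let g be flat, so [A, B] + [B, A] + [B, B] = 0.  Test covectors h and k
   that vanish near a point x0 isolate the commutators of the flows w_m u_x at
   x0, contracted with the nonlocal tails of h and k, against terms
   proportional to u_x.  Replacing u by u o phi, where phi moves only points
   near x0, phi (x0) = x0, phi' (x0) = -1 and phi'' (x0) = 0, keeps the former
   and flips the sign of the latter: the contracted commutators vanish.  If only
   h vanishes near x0, then phi' (x0) = 0 and phi'' (x0) = 1 isolate the Codazzi
   defects nabla_l w^i_j - nabla_j w^i_l contracted with the tails of h; once
   these are zero, so is the remaining term, which is algebraic in the w_m.
   Finally, the tails at x0 of covectors that vanish near x0 span the tails of
   all covectors, and [B, B] = 0 follows. *)
From HB Require Import structures.
Require Import Defs.
From mathcomp Require Import all_boot all_order all_algebra.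
From mathcomp Require Import all_classical all_reals all_analysis.
From mathcomp Require Import ring lra.

Set Implicit Arguments.
Unset Strict Implicit.
Unset Printing Implicit Defensive.

Import Order.TTheory GRing.Theory Num.Theory.
Import numFieldNormedType.Exports.

Local Open Scope classical_set_scope.
Local Open Scope ring_scope.

(** * Calculus of smooth maps *)

(** The flows [w_m u_x] may be linearly dependent, so conditions on individual pairs of affinors
    cannot be read off from the Jacobi identity. Only contractions with tails are visible; they
    alone are shown to vanish, and they are all that enters [B, B]. A second obstacle is that the
    bracket mixes values at x0 with nonlocal quantities. The tail at x0 of a covector that vanishes
    near x0 sees [u] only away from x0, so reparametrising [u] near x0 changes its local jet there
    and nothing else. Since only the new field matters, phi may fold the line, which is how phi'
    (x0) = 0 or -1 is possible while phi is the identity far away. On the analytic side, a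
    functional is known only through its variational derivative, so each differentiation under the
    integral rests on expansions uniform in x. In the bracket of functionals the second variations
    cancel because they are self-adjoint, and linear functionals turn the Jacobi identity into one
    for arbitrary test covectors. *)

Section NearDifferentiable.
Context {R : realType} {V W : normedModType R}.

(** [g - f] vanishes near [p], hence has the zero map as differential there, and [g] is the sum of
    [f] and [g - f]. *)
Lemma near_eq_differentiable (f g : V -> W) (p : V) :
  {near p, f =1 g} -> differentiable f p -> differentiable g p.
Proof.
move=> fg df.
have dh : differentiable (g \- f) p.
  have h0 : \forall y \near p, (g \- f) y = 0.
    by near do (rewrite /=; apply/eqP; rewrite subr_eq0; apply/eqP/esym).
  have hp : (g \- f) p = 0 by exact: nbhs_singleton h0.
  have E : (g \- f) \o shift p = cst ((g \- f) p) + \0 +o_ 0 id.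
    have h1 : \forall z \near (0 : V), g (z + p) - f (z + p) = 0.
      by move: h0; rewrite (near_shift 0 p) /= subr0.
    apply/eqaddoP => e e0; near=> y.
    rewrite hp !fctE /= addr0 subr0.
    have -> : g (y + p) - f (y + p) = 0 by near: y; exact: h1.
    by rewrite normr0 mulr_ge0// ltW.
  have c0 : continuous (\0 : {linear V -> W}) by move=> x; exact: cst_continuous.
  apply/diff_locallyP; rewrite (diff_unique c0 E); split => //.
suff -> : g = f + (g \- f) by exact: differentiableD.
by apply/funext => x; rewrite fctE /= addrC subrK.
Unshelve. all: by end_near. Qed.

End NearDifferentiable.

Section CkCalculus.
Context {R : realType}.
Implicit Types V W : normedModType R.

Lemma Ck_continuous V W k (A : set V) (f : V -> W) p :
  Ck k A f -> A p -> {for p, continuous f}.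
Proof.
by case: k => [|k] /= h Ap; [exact: h | exact: differentiable_continuous (h.1 _ Ap)].
Qed.

(** Openness turns agreement on [A] into agreement near each of its points, which the induction on
    derivatives requires. *)
Lemma Ck_ext V W k (A : set V) (f g : V -> W) : open A ->
  (forall p, A p -> f p = g p) -> Ck k A f -> Ck k A g.
Proof.
move=> oA; elim: k f g => [|k IH] f g fg /= cf.
  move=> p Ap; have nfg : {near p, f =1 g}.
    by have := open_nbhs_nbhs (conj oA Ap); apply: filterS => q; exact: fg.
  have := cf p Ap; rewrite /prop_for /continuous_at (fg p Ap).
  by apply: cvg_trans; exact: near_eq_cvg.
have nfg p : A p -> {near p, f =1 g}.
  by move=> Ap; have := open_nbhs_nbhs (conj oA Ap); apply: filterS => q; exact: fg.
split=> [p Ap|v]; first exact: near_eq_differentiable (nfg p Ap) (cf.1 p Ap).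
by apply: IH (cf.2 v) => p Ap; apply: near_eq_derive; exact: nfg.
Qed.

Lemma CkS V W k (A : set V) (f : V -> W) : Ck k.+1 A f -> Ck k A f.
Proof.
elim: k f => [|k IH] f; first by move=> cf p Ap; exact: Ck_continuous cf Ap.
by move=> [d c]; split => // v; apply: IH; exact: c.
Qed.

Lemma Ck_cst V W k (A : set V) (a : W) : Ck k A (cst a).
Proof.
elim: k a => [|k IH] a /=; first by move=> p _; exact: cst_continuous.
split=> [p _|v]; first exact: differentiable_cst.
suff -> : (fun p => 'D_v (cst a) p) = cst 0 by exact: IH.
by apply/funext => p; rewrite derive_cst.
Qed.

Lemma CkD V W k (A : set V) (f g : V -> W) : open A ->
  Ck k A f -> Ck k A g -> Ck k A (fun p => f p + g p).
Proof.
move=> oA; elim: k f g => [|k IH] f g /= cf cg.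
  by move=> p Ap; apply: cvgD; [exact: cf | exact: cg].
split=> [p Ap|v]; first exact: differentiableD (cf.1 p Ap) (cg.1 p Ap).
apply: Ck_ext (IH _ _ (cf.2 v) (cg.2 v)) => // p Ap.
by rewrite -deriveD //; apply: diff_derivable; [exact: cf.1|exact: cg.1].
Qed.

Lemma CkZ V W k (A : set V) (a : R) (f : V -> W) : open A ->
  Ck k A f -> Ck k A (fun p => a *: f p).
Proof.
move=> oA; elim: k f => [|k IH] f /= cf.
  by move=> p Ap; apply: cvgZl_tmp; exact: cf.
split=> [p Ap|v]; first exact: differentiableZ (cf.1 p Ap).
apply: Ck_ext (IH _ (cf.2 v)) => // p Ap.
by rewrite -deriveZ //; apply: diff_derivable; exact: cf.1.
Qed.

Lemma CkN V W k (A : set V) (f : V -> W) : open A ->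
  Ck k A f -> Ck k A (fun p => - f p).
Proof.
move=> oA cf; have := CkZ (-1) oA cf.
by apply: Ck_ext => // p _; rewrite scaleN1r.
Qed.

Lemma Ck_sum V W k (A : set V) (I : Type) (r : seq I) (f : I -> V -> W) : open A ->
  (forall i, Ck k A (f i)) -> Ck k A (fun p => \sum_(i <- r) f i p).
Proof.
move=> oA cf; elim: r => [|i r IH].
  by rewrite (_ : (fun p => _) = cst 0); [exact: Ck_cst | apply/funext => p; rewrite big_nil].
rewrite (_ : (fun p => _) = (fun p => f i p + \sum_(j <- r) f j p)); first exact: CkD.
by apply/funext => p; rewrite big_cons.
Qed.

Lemma CkM V k (A : set V) (f g : V -> R) : open A ->
  Ck k A f -> Ck k A g -> Ck k A (fun p => f p * g p).
Proof.
move=> oA; elim: k f g => [|k IH] f g cf cg.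
  by move=> p Ap; apply: cvgM; [exact: cf | exact: cg].
split=> [p Ap|v]; first exact: differentiableM (cf.1 p Ap) (cg.1 p Ap).
apply: (@Ck_ext _ _ _ _ (fun p => f p * 'D_v g p + g p * 'D_v f p)) => //.
  by move=> p Ap; rewrite -deriveM //; apply: diff_derivable; [exact: cf.1|exact: cg.1].
apply: CkD => //; apply: IH; [exact: CkS|exact: cg.2|exact: CkS|exact: cf.2].
Qed.

Lemma CkV V k (A : set V) (f : V -> R) : open A -> (forall p, A p -> f p != 0) ->
  Ck k A f -> Ck k A (fun p => (f p)^-1).
Proof.
move=> oA f0; elim: k f f0 => [|k IH] f f0 cf.
  by move=> p Ap; apply: cvgV; [exact: f0 | exact: cf].
split=> [p Ap|v]; first by apply: differentiableV; [exact: cf.1 | exact: f0].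
apply: (@Ck_ext _ _ _ _ (fun p => - ((f p)^-1 * (f p)^-1 * 'D_v f p))) => //.
  move=> p Ap; rewrite deriveV ?f0 //; last by apply: diff_derivable; exact: cf.1.
  by rewrite /GRing.scale /= mulNr expr2 invfM.
by apply: CkN => //; apply: CkM => //; [apply: CkM => //; apply: IH => //; exact: CkS|exact: cf.2].
Qed.

Lemma Ck_linear V W k (A : set V) (f : {linear V -> W}) : continuous f -> Ck k A f.
Proof.
move=> cf; case: k => [|k] /=; first by move=> p _; exact: cf.
split=> [p _|v]; first exact: linear_differentiable.
rewrite (_ : (fun p => _) = cst (f v)); first exact: Ck_cst.
apply/funext => p; rewrite deriveE; last exact: linear_differentiable.
by rewrite diff_lin.
Qed.

(** Along the line the derivative in direction [v] is [v] times ['D_d f], again restricted to the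
    line, so the induction applies to ['D_d f]. *)
Lemma Ck_line V W k (A : set V) (B : set R) (f : V -> W) (c d : V) : open B ->
  (forall x, B x -> A (c + x *: d)) -> Ck k A f -> Ck k B (fun x => f (c + x *: d)).
Proof.
move=> oB BA; elim: k f => [|k IH] f cf.
  move=> x Bx; apply: (@cvg_comp _ _ _ (fun x => c + x *: d) f _ (nbhs (c + x *: d))); last exact: cf (BA _ Bx).
  by apply: cvgD; [exact: cvg_cst | apply: cvgZr_tmp; exact: cvg_id].
have dl x : is_diff x (fun x : R => c + x *: d) (fun x => x *: d).
  have := is_diffD (is_diff_cst c x) (is_diff_scalel x d).
  rewrite (_ : 0 + _ = (fun x => x *: d)) //.
  by apply/funext => y; rewrite fctE /= add0r.
have dd x : B x -> is_diff x (fun x => f (c + x *: d)) ('d f (c + x *: d) \o (fun x => x *: d)).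
  by move=> Bx; apply: is_diff_comp; apply: differentiableP; apply: cf.1 (BA _ Bx).
split=> [x Bx|v]; first by have := dd x Bx; case.
have H : Ck k B (fun x => v *: 'D_d f (c + x *: d)).
  by apply: CkZ => //; exact: (IH (fun p => 'D_d f p) (cf.2 d)).
apply: Ck_ext H => //.
  move=> x Bx; rewrite [RHS]deriveE; last by have := dd x Bx; case.
  have := dd x Bx => -[_ ->]; rewrite /= linearZ deriveE //.
  by apply: cf.1 (BA _ Bx).
Qed.

Lemma Ck_comp1 V k (A : set V) (B : set R) (f : R -> R) (phi : V -> R) : open A ->
  (forall p, A p -> B (phi p)) -> Ck k B f -> Ck k A phi -> Ck k A (f \o phi).
Proof.
move=> oA AB; elim: k f => [|k IH] f cf cp.
  by move=> p Ap; apply: continuous_comp; [exact: cp | exact: cf (AB _ Ap)].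
have dd p : A p -> is_diff p (f \o phi) ('d f (phi p) \o 'd phi p).
  move=> Ap; apply: is_diff_comp; apply: differentiableP; [exact: cp.1|exact: cf.1 (AB _ Ap)].
split=> [p Ap|v]; first by have := dd p Ap; case.
apply: (@Ck_ext _ _ _ _ (fun p => 'D_v phi p * ('D_1 f \o phi) p)) => //.
  move=> p Ap; rewrite [RHS]deriveE; last by have := dd p Ap; case.
  have := dd p Ap => -[_ ->] /=; rewrite !deriveE //; last exact: cp.1.
  - by rewrite -[in RHS](mulr1 ('d phi p v)) -[RHS]/('d f (phi p) (_ *: 1)) linearZ.
  - exact: cf.1 (AB _ Ap).
by apply: CkM => //; [exact: cp.2 | apply: IH; [exact: cf.2 | exact: CkS]].
Qed.

End CkCalculus.

(** * Matrix-valued maps and the chain rule *)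

Section CkMatrix.
Context {R : realType}.
Implicit Types V W : normedModType R.

Lemma Ck_lincomp V W (W' : normedModType R) k (A : set V) (L : {linear W -> W'})
    (f : V -> W) : open A -> continuous L -> Ck k A f -> Ck k A (fun p => L (f p)).
Proof.
move=> oA cL; elim: k f => [|k IH] f cf.
  by move=> p Ap; apply: (@continuous_comp _ _ _ f L); [exact: cf | exact: cL].
have dd p : A p -> is_diff p (L \o f) (L \o 'd f p).
  move=> Ap; have dL : differentiable L (f p) by exact: linear_differentiable.
  have := is_diff_comp (differentiableP (cf.1 p Ap)) (differentiableP dL).
  by rewrite diff_lin.
split=> [p Ap|v]; first by have := dd p Ap; case.
apply: Ck_ext (IH _ (cf.2 v)) => // p Ap.
rewrite [RHS]deriveE; last by have := dd p Ap; case.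
have := dd p Ap => -[_ ->]; rewrite /= deriveE //; exact: cf.1.
Qed.

Lemma Ck_scalel V W k (A : set V) (f : V -> R) (a : W) : open A ->
  Ck k A f -> Ck k A (fun p => f p *: a).
Proof.
move=> oA; elim: k f => [|k IH] f cf.
  by move=> p Ap; apply: cvgZr_tmp; exact: cf.
split=> [p Ap|v]; first exact: differentiableZl (cf.1 p Ap).
apply: Ck_ext (IH _ (cf.2 v)) => // p Ap.
rewrite [RHS]deriveE; last exact: differentiableZl (cf.1 p Ap).
by rewrite diffZl ?deriveE //; exact: cf.1.
Qed.

Lemma Ck_coord V m n k (A : set V) (f : V -> 'M[R]_(m, n)) i j : open A ->
  Ck k A f -> Ck k A (fun p => f p i j).
Proof.
move=> oA cf; pose L : 'M[R]_(m, n) -> R := fun M => M i j.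
have lL : linear L by move=> a x y; rewrite /L !mxE.
pose L' := GRing.isLinear.Build _ _ _ _ L lL.
pose LL : {linear 'M[R]_(m, n) -> R} := HB.pack L L'.
apply: (@Ck_lincomp _ _ _ k A LL f) => //.
exact: coord_continuous.
Qed.

Lemma Ck_mx V m n k (A : set V) (f : V -> 'M[R]_(m, n)) : open A ->
  (forall i j, Ck k A (fun p => f p i j)) -> Ck k A f.
Proof.
move=> oA cf.
rewrite (_ : f = (fun p => \sum_i \sum_j f p i j *: delta_mx i j)).
  by apply: Ck_sum => // i; apply: Ck_sum => // j; apply: Ck_scalel.
by apply/funext => p; rewrite [LHS]matrix_sum_delta.
Qed.

Lemma derive_rV n (f : 'rV[R]_n -> R) p v : differentiable f p ->
  'D_v f p = \sum_i v 0 i * 'D_(delta_mx 0 i) f p.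
Proof.
move=> df; rewrite deriveE // [in LHS](row_sum_delta v) linear_sum.
by apply: eq_bigr => i _; rewrite linearZ deriveE.
Qed.

Lemma is_derive_comp_rV V n (f : 'rV[R]_n -> R) (phi : V -> 'rV[R]_n) p v :
  differentiable f (phi p) -> differentiable phi p ->
  is_derive p v (fun q => f (phi q)) ('D_('D_v phi p) f (phi p)).
Proof.
move=> df dphi; have dc := differentiable_comp dphi df.
apply: DeriveDef; first exact: diff_derivable.
by rewrite [LHS]deriveE // diff_comp //= !deriveE.
Qed.

(** The chain rule differentiates [f] in the moving direction ['D_v phi p]. Expanding this direction
    over the coordinates leaves the fixed maps ['D_(delta_mx 0 i) f], to which the induction
    hypothesis applies. *)
Lemma Ck_comp V n k (A : set V) (B : set 'rV[R]_n) (f : 'rV[R]_n -> R)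
    (phi : V -> 'rV[R]_n) : open A ->
  (forall p, A p -> B (phi p)) -> Ck k B f -> Ck k A phi -> Ck k A (fun p => f (phi p)).
Proof.
move=> oA AB; elim: k f => [|k IH] f cf cp.
  by move=> p Ap; apply: (@continuous_comp _ _ _ phi f); [exact: cp | exact: cf (AB _ Ap)].
split=> [p Ap|v].
  by apply: (@differentiable_comp _ _ _ _ phi f); [exact: cp.1 | exact: cf.1 (AB _ Ap)].
have H : Ck k A (fun p => \sum_i 'D_v phi p 0 i * 'D_(delta_mx 0 i) f (phi p)).
  apply: Ck_sum => // i; apply: CkM => //; first exact: Ck_coord (cp.2 v).
  by apply: (IH (fun q => 'D_(delta_mx 0 i) f q)); [exact: cf.2 | exact: CkS].
apply: Ck_ext H => // p Ap.
have df := cf.1 _ (AB _ Ap); have dp := cp.1 _ Ap.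
by have [_ ->] := is_derive_comp_rV v df dp; rewrite -derive_rV.
Qed.

End CkMatrix.

(** * Smooth curves *)

Section SmoothPaths.
Context {R : realType}.
Implicit Types V W : normedModType R.

Lemma deriveT V (f : R -> V) (x v : R) : derivable f x 1 -> 'D_v f x = v *: derive1 f x.
Proof. by move=> df; rewrite deriveE ?deriv1E //; exact/derivable1_diffP. Qed.

Lemma CkS_derive1 V k (f : R -> V) : (forall x : R, derivable f x 1) ->
  Ck k [set: R] (derive1 f) -> Ck k.+1 [set: R] f.
Proof.
move=> df cf; split=> [x _|v]; first exact/derivable1_diffP.
apply: Ck_ext (CkZ v openT cf) => [|x _]; first exact: openT.
by rewrite deriveT.
Qed.

Lemma smooth_derivable V (f : R -> V) (x : R) : smooth_on [set: R] f -> derivable f x 1.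
Proof. by move=> /(_ 1%N) [d _]; apply/derivable1_diffP; exact: d. Qed.

Lemma smooth_is_derive V (f : R -> V) (x : R) : smooth_on [set: R] f ->
  is_derive x 1 f (derive1 f x).
Proof. by move=> /smooth_derivable d; rewrite derive1E; exact: derivableP. Qed.

Lemma smooth_derive1 V (f : R -> V) : smooth_on [set: R] f ->
  smooth_on [set: R] (derive1 f).
Proof.
move=> sf k; have [_ /(_ 1)] := sf k.+1.
by rewrite (_ : (fun p => _) = derive1 f) //; apply/funext => x; rewrite derive1E.
Qed.

Lemma smooth_continuous V W (A : set V) (f : V -> W) p :
  smooth_on A f -> A p -> {for p, continuous f}.
Proof. by move=> /(_ 0%N); exact. Qed.

Lemma smooth_differentiable V W (A : set V) (f : V -> W) p :
  smooth_on A f -> A p -> differentiable f p.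
Proof. by move=> /(_ 1%N) [d _]; exact: d. Qed.

Lemma smooth_derive V W (A : set V) (f : V -> W) v :
  smooth_on A f -> smooth_on A (fun p => 'D_v f p).
Proof. by move=> sf k; have [_ ] := sf k.+1; exact. Qed.

(** Gives smoothness to functions known through their derivative, such as [Dinv h]. *)
Lemma smooth_primitive V (f : R -> V) (g : R -> V) :
  (forall x : R, is_derive x 1 f (g x)) -> smooth_on [set: R] g -> smooth_on [set: R] f.
Proof.
move=> df sg [|k].
  by move=> x _; apply: differentiable_continuous; apply/derivable1_diffP; have := df x; case.
apply: CkS_derive1 => [x|]; first by have := df x; case.
rewrite (_ : derive1 f = g) //; apply/funext => x.
by rewrite derive1E; have := df x; case.
Qed.

End SmoothPaths.

(** * Integrals of compactly supported functions and the operator [Dinv] *)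

Section CompactSupportIntegral.
Context {R : realType}.
Implicit Types f h : R -> R.
Local Notation mu := (@lebesgue_measure R).

Definition cc f := continuous f /\ compactly_supported f.

Definition Int f : R := \int[mu]_x f x.

Lemma cc_integrable f (D : set R) : cc f -> measurable D ->
  mu.-integrable D (EFin \o f).
Proof.
move=> [cf [r fr]] mD; apply: (@integrableS _ _ _ mu setT) => //.
have -> : EFin \o f = (EFin \o f) \_ `[-r, r]%classic.
  apply/funext => x; rewrite patchE; case: ifPn => //= /negP xr.
  rewrite fr // ltNge ler_norml; apply/negP => xr'; apply: xr.
  by rewrite inE /= in_itv.
apply/(integrable_mkcond _ _).1 => //.
apply: continuous_compact_integrable; first exact: segment_compact.
exact: continuous_subspaceT.
Qed.

Lemma cc0 : cc (fun=> 0).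
Proof. by split; [exact: cst_continuous | exists 0]. Qed.

Lemma ccD f h : cc f -> cc h -> cc (fun x => f x + h x).
Proof.
move=> [cf [r fr]] [ch [s hs]]; split; first by move=> x; apply: cvgD; [exact: cf|exact: ch].
exists (Num.max r s) => x; rewrite gt_max => /andP[rx sx].
by rewrite fr // hs // addr0.
Qed.

Lemma ccMl f h : continuous f -> cc h -> cc (fun x => f x * h x).
Proof.
move=> cf [ch [s hs]]; split; first by move=> x; apply: cvgM; [exact: cf|exact: ch].
by exists s => x sx; rewrite hs // mulr0.
Qed.

Lemma ccMr f h : cc f -> continuous h -> cc (fun x => f x * h x).
Proof.
by move=> ccf ch; rewrite (_ : (fun x => _) = (fun x => h x * f x));
  [exact: ccMl | apply/funext => x; rewrite mulrC].
Qed.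

Lemma ccZ a f : cc f -> cc (fun x => a * f x).
Proof. by move=> cf; apply: ccMl => //; exact: cst_continuous. Qed.

Lemma ccN f : cc f -> cc (fun x => - f x).
Proof.
by move=> cf; rewrite (_ : (fun x => _) = (fun x => -1 * f x));
  [exact: ccZ | apply/funext => x; rewrite mulN1r].
Qed.

Lemma ccB f h : cc f -> cc h -> cc (fun x => f x - h x).
Proof. by move=> cf ch; apply: ccD => //; exact: ccN. Qed.

Lemma cc_sum (I : Type) (s : seq I) (F : I -> R -> R) :
  (forall i, cc (F i)) -> cc (fun x => \sum_(i <- s) F i x).
Proof.
move=> cF; elim: s => [|i s IH].
  by rewrite (_ : (fun x => _) = (fun=> 0)); [exact: cc0 | apply/funext => x; rewrite big_nil].
rewrite (_ : (fun x => _) = (fun x => F i x + \sum_(j <- s) F j x)); first exact: ccD.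
by apply/funext => x; rewrite big_cons.
Qed.

Lemma IntD f h : cc f -> cc h -> Int (fun x => f x + h x) = Int f + Int h.
Proof. by move=> cf ch; rewrite /Int RintegralD //; exact: cc_integrable. Qed.

Lemma IntZ a f : cc f -> Int (fun x => a * f x) = a * Int f.
Proof. by move=> cf; rewrite /Int RintegralZl //; exact: cc_integrable. Qed.

Lemma IntN f : cc f -> Int (fun x => - f x) = - Int f.
Proof.
move=> cf; rewrite -mulN1r -IntZ //.
by congr Int; apply/funext => x; rewrite mulN1r.
Qed.

Lemma IntB f h : cc f -> cc h -> Int (fun x => f x - h x) = Int f - Int h.
Proof. by move=> cf ch; rewrite IntD ?IntN //; exact: ccN. Qed.

Lemma Int0 : Int (fun=> 0) = 0.
Proof. by rewrite /Int Rintegral_cst // mul0r. Qed.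

Lemma Int_sum (I : Type) (s : seq I) (F : I -> R -> R) :
  (forall i, cc (F i)) ->
  Int (fun x => \sum_(i <- s) F i x) = \sum_(i <- s) Int (F i).
Proof.
move=> cF; elim: s => [|i s IH].
  by rewrite big_nil -[RHS]Int0; congr Int; apply/funext => x; rewrite big_nil.
rewrite big_cons -IH -IntD //; last exact: cc_sum.
by congr Int; apply/funext => x; rewrite big_cons.
Qed.

Lemma Int_itv f r : (forall x, r < `|x| -> f x = 0) ->
  Int f = \int[mu]_(x in `[-r, r]) f x.
Proof.
move=> fr; rewrite /Int [RHS]Rintegral_mkcond; apply: eq_Rintegral => x _.
rewrite patchE; case: ifPn => //= /negP xr.
rewrite fr // ltNge ler_norml; apply/negP => xr'; apply: xr.
by rewrite inE /= in_itv.
Qed.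

Lemma Int_bound f r M : continuous f -> 0 <= r -> (forall x, r < `|x| -> f x = 0) ->
  (forall x, `|x| <= r -> `|f x| <= M) -> `|Int f| <= 2 * r * M.
Proof.
move=> cf r0 fr fM; have ccf : cc f by split => //; exists r.
rewrite (Int_itv fr); apply: le_trans (le_normr_Rintegral _ _) _ => //.
  exact: cc_integrable.
have ccn : cc (fun x => `|f x|).
  split; first by move=> x; apply: cvg_norm; exact: cf.
  by exists r => x rx; rewrite fr // normr0.
have -> : 2 * r * M = \int[mu]_(x in `[-r, r]) M.
  rewrite Rintegral_cst //=.
  rewrite lebesgue_measure_itv /= lte_fin.
  case: ltP => [|rr]; first by move=> _; rewrite -EFinB /=; ring.
  have -> : r = 0 by lra.
  by rewrite /=; ring.
apply: le_Rintegral => //.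
- exact: (cc_integrable ccn).
- apply: continuous_compact_integrable; first exact: segment_compact.
  by apply: continuous_subspaceT; exact: cst_continuous.
- by move=> x /=; rewrite in_itv /= => xr; apply: fM; rewrite ler_norml.
Qed.

End CompactSupportIntegral.

(** * Primitives and the skew-symmetric inverse of d/dx *)

Section Primitive.
Context {R : realType}.
Implicit Types f h : R -> R.
Local Notation mu := (@lebesgue_measure R).

Definition Prim f (x : R) : R := \int[mu]_(y in `]-oo, x]) f y.

Lemma is_derive_Prim f (x : R) : cc f -> is_derive x 1 (Prim f) (f x).
Proof.
(* The fundamental theorem asks for an interval reaching beyond [x]; the right end [x + 1] is
   arbitrary. *)
move=> cf; have [d e] := @continuous_FTC1 R f -oo%O x (x + 1) (ltr_pwDr ltr01 (lexx x))
  (cc_integrable cf (measurable_itv _)) (ltNyr x) (cf.1 x).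
by apply: DeriveDef; [exact: d|rewrite -derive1E; exact: e].
Qed.

Lemma Prim_left f r x : (forall x, r < `|x| -> f x = 0) -> x < - r -> Prim f x = 0.
Proof.
move=> fr xr; rewrite /Prim (@eq_Rintegral _ _ _ _ _ (fun=> 0)) ?Rintegral_cst ?mul0r //.
move=> y; rewrite inE /= in_itv /= => yx.
by apply: fr; rewrite -normrN; apply: (lt_le_trans _ (ler_norm (- y))); lra.
Qed.

Lemma Prim_right f r x : (forall x, r < `|x| -> f x = 0) -> r <= x -> Prim f x = Int f.
Proof.
move=> fr rx; rewrite /Prim Rintegral_mkcond; apply: eq_Rintegral => y _.
rewrite patchE; case: ifPn => //= /negP yx; rewrite fr //.
apply: (lt_le_trans _ (ler_norm y)); apply: (le_lt_trans rx); rewrite ltNge; apply/negP => xy.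
by apply: yx; rewrite inE /= in_itv.
Qed.

(** The two half-line integrals add up to [Int f], so the study of [Dinv] reduces to that of the
    primitive from the left. *)
Lemma DinvE f x : cc f -> Dinv f x = Prim f x - 2^-1 * Int f.
Proof.
move=> cf; rewrite /Dinv -/(Prim f x).
have -> : \int[mu]_(y in `[x, +oo[) f y = Int f - Prim f x.
  have := @Rintegral_itvB R f -oo%O +oo%O x (cc_integrable cf (measurable_itv _)) isT isT.
  by rewrite set_itvE -Rintegral_itv_obnd_cbnd //; exact: cc_integrable.
by field.
Qed.

Lemma is_derive_Dinv f (x : R) : cc f -> is_derive x 1 (Dinv f) (f x).
Proof.
move=> cf; rewrite (_ : Dinv f = (fun x => Prim f x - 2^-1 * Int f)); last first.
  by apply/funext => y; exact: DinvE.
have := is_deriveB (is_derive_Prim x cf) (is_derive_cst (2^-1 * Int f) x 1).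
by rewrite subr0.
Qed.

Lemma Dinv_left f r x : cc f -> (forall x, r < `|x| -> f x = 0) -> x < - r ->
  Dinv f x = - (2^-1 * Int f).
Proof. by move=> cf fr xr; rewrite DinvE // (Prim_left fr xr) sub0r. Qed.

Lemma Dinv_right f r x : cc f -> (forall x, r < `|x| -> f x = 0) -> r <= x ->
  Dinv f x = 2^-1 * Int f.
Proof. by move=> cf fr rx; rewrite DinvE // (Prim_right fr rx); field. Qed.

Lemma continuous_Dinv f : cc f -> continuous (Dinv f).
Proof.
move=> cf x; apply: differentiable_continuous; apply/derivable1_diffP.
by have := is_derive_Dinv x cf; case.
Qed.

(** [F] and [Prim f] have the same derivative, hence differ by a constant; comparing them at two
    points beyond the support gives the increment of [F]. *)
Lemma Int_derive (F f : R -> R) (r a b : R) : cc f ->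
  (forall x : R, is_derive x 1 F (f x)) ->
  (forall x, x < - r -> F x = a) -> (forall x, r < x -> F x = b) -> Int f = b - a.
Proof.
move=> cf dF Fa Fb; have [_ [s fs]] := cf.
have K x y : Prim f x - F x = Prim f y - F y.
  apply: (@is_derive_0_is_cst R (fun x => Prim f x - F x)) => z.
  by have := is_deriveB (is_derive_Prim z cf) (dF z); rewrite subrr.
(* Beyond both the radius [r] from which [F] is constant and the support radius [s] of [f]. *)
pose m := Num.max (Num.max r s) 0 + 1.
have m0 : 1 <= m by rewrite lerDr le_max lexx orbT.
have rm : r < m by rewrite ltr_pwDr // !le_max lexx.
have sm : s < m by rewrite ltr_pwDr // !le_max lexx orbT.
have := K (- m) m; rewrite (Prim_left fs) ?(Prim_right fs (ltW sm)); last by rewrite ltrN2.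
rewrite (Fa (- m)) ?(Fb m) //; last by rewrite ltrN2.
by move=> /eqP; rewrite sub0r eq_sym subr_eq => /eqP ->; rewrite addrC.
Qed.

Lemma Int_derive0 (F f : R -> R) : cc F -> cc f ->
  (forall x : R, is_derive x 1 F (f x)) -> Int f = 0.
Proof.
move=> [_ [r Fr]] cf dF; rewrite -(subrr 0); apply: (@Int_derive F f r 0 0) => //.
- by move=> x xr; apply: Fr; rewrite -normrN; apply: (lt_le_trans _ (ler_norm (- x))); lra.
- by move=> x xr; apply: Fr; apply: (lt_le_trans xr); exact: ler_norm.
Qed.

(* The boundary terms cancel: [Dinv f] tends to [- Int f / 2] and to [Int f / 2]. *)
Lemma Dinv_skew f h : cc f -> cc h ->
  Int (fun x => f x * Dinv h x) = - Int (fun x => Dinv f x * h x).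
Proof.
move=> cf ch; apply/eqP; rewrite -subr_eq0 opprK; apply/eqP.
have c1 : cc (fun x => f x * Dinv h x) by apply: ccMr => //; exact: continuous_Dinv.
have c2 : cc (fun x => Dinv f x * h x) by apply: ccMl => //; exact: continuous_Dinv.
rewrite -IntD //; have [_ [r fr]] := cf; have [_ [s hs]] := ch.
pose m := Num.max r s.
have H (x : R) : is_derive x 1 (fun x => Dinv f x * Dinv h x) (f x * Dinv h x + Dinv f x * h x).
  have D := is_deriveM (is_derive_Dinv x cf) (is_derive_Dinv x ch).
  by apply: (is_derive_eq D); rewrite /GRing.scale /= addrC (mulrC (f x)).
pose e := 2^-1 * Int f * (2^-1 * Int h).
rewrite -(subrr e); apply: (@Int_derive _ _ m e e (ccD c1 c2) H).
- move=> x; rewrite ltrNr gt_max => /andP[rx sx].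
  by rewrite (Dinv_left cf fr) ?(Dinv_left ch hs) ?mulrNN // ltrNr.
- move=> x; rewrite gt_max => /andP[rx sx].
  by rewrite (Dinv_right cf fr) ?(Dinv_right ch hs) // ltW.
Qed.

Lemma DinvD f h x : cc f -> cc h -> Dinv (fun y => f y + h y) x = Dinv f x + Dinv h x.
Proof.
move=> cf ch; rewrite !DinvE ?IntD //; last exact: ccD.
rewrite /Prim RintegralD //; [by ring|exact: cc_integrable..].
Qed.

Lemma DinvZ a f x : cc f -> Dinv (fun y => a * f y) x = a * Dinv f x.
Proof.
move=> cf; rewrite !DinvE ?IntZ //; last exact: ccZ.
by rewrite /Prim RintegralZl //; [ring|exact: cc_integrable].
Qed.

Lemma Dinv0 x : Dinv (fun=> 0 : R) x = 0.
Proof.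
rewrite DinvE; last exact: cc0.
by rewrite Int0 /Prim Rintegral_cst // mul0r mulr0 subrr.
Qed.

Lemma Dinv_sum (I : Type) (s : seq I) (F : I -> R -> R) x :
  (forall i, cc (F i)) ->
  Dinv (fun y => \sum_(i <- s) F i y) x = \sum_(i <- s) Dinv (F i) x.
Proof.
move=> cF; elim: s => [|i s IH].
  by rewrite big_nil -[RHS](Dinv0 x); congr (Dinv _ x); apply/funext => y; rewrite big_nil.
rewrite big_cons -IH -DinvD //; last exact: cc_sum.
by congr (Dinv _ x); apply/funext => y; rewrite big_cons.
Qed.

(** Each half-line integral is at most the integral of the absolute value, hence at most
    [2 * r * M]; the factor 1/2 in [Dinv] compensates for having two of them. *)
Lemma Dinv_bound f r M x : continuous f -> 0 <= r -> (forall x, r < `|x| -> f x = 0) ->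
  (forall x, `|x| <= r -> `|f x| <= M) -> `|Dinv f x| <= 2 * r * M.
Proof.
move=> cf r0 fr fM; have ccf : cc f by split => //; exists r.
have ccn : cc (fun x => `|f x|).
  split; first by move=> y; apply: cvg_norm; exact: cf.
  by exists r => y ry; rewrite fr // normr0.
have nM : Int (fun x => `|f x|) <= 2 * r * M.
  apply: le_trans (ler_norm _) _; apply: Int_bound => //; first exact: ccn.1.
  - by move=> y ry; rewrite fr // normr0.
  - by move=> y yr; rewrite normr_id fM.
have P (A : set R) : measurable A -> `|\int[mu]_(y in A) f y| <= 2 * r * M.
  move=> mA; apply: le_trans (le_normr_Rintegral _ _) _ => //; first exact: cc_integrable.
  apply: le_trans nM; rewrite /Int Rintegral_mkcond.
  apply: le_Rintegral => //.
  - have -> : EFin \o ((fun x => `|f x|) \_ A) = (EFin \o (fun x => `|f x|)) \_ A.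
      by apply/funext => y; rewrite /= !patchE; case: ifP.
    apply/(integrable_mkcond (mu := mu) (EFin \o (fun x => `|f x|)) mA).1.
    exact: (cc_integrable ccn).
  - exact: (cc_integrable ccn).
  - by move=> y _; rewrite patchE; case: (y \in A) => //=; exact: normr_ge0.
rewrite /Dinv normrM ger0_norm ?invr_ge0 //.
have := ler_normB (\int[mu]_(y in `]-oo, x]) f y) (\int[mu]_(y in `[x, +oo[) f y).
have := P _ (measurable_itv `]-oo, x]); have := P _ (measurable_itv `[x, +oo[).
lra.
Qed.

End Primitive.

(** * Bump functions and the fundamental lemma *)

Lemma is_derive_comp1 {R : realType} (f g : R -> R) (x : R) (df dg : R) :
  is_derive (g x) 1 f df -> is_derive x 1 g dg -> is_derive x 1 (fun y => f (g y)) (dg * df).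
Proof. by move=> Df Dg; rewrite mulrC; exact: (is_derive1_comp Df Dg). Qed.

Section FlatFunction.
Context {R : realType}.

(* The family [x ^- n * exp (- 1 / x)] is stable under differentiation, up to
   linear combinations. *)
Definition flatexp (n : nat) (x : R) : R :=
  if 0 < x then x ^- n * expR (- x^-1) else 0.

Lemma flatexp_ge0 n x : 0 <= flatexp n x.
Proof.
rewrite /flatexp; case: ifP => // x0.
by rewrite mulr_ge0 ?expR_ge0 // invr_ge0 exprn_ge0 // ltW.
Qed.

Lemma flatexp_gt0 n x : 0 < x -> 0 < flatexp n x.
Proof. by move=> x0; rewrite /flatexp x0 mulr_gt0 ?expR_gt0 // invr_gt0 exprn_gt0. Qed.

Lemma flatexp_le0 n x : x <= 0 -> flatexp n x = 0.
Proof. by move=> x0; rewrite /flatexp ltNge x0. Qed.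

(** With y = 1/x, taking the power n+1 of exp (y / (n+1)) >= y / (n+1) gives exp y >= (y / (n+1)) ^
    (n+1). One more power than the prefactor x ^ -n leaves a factor x, hence the limit 0 at the
    origin. *)
Lemma flatexp_bound n x : flatexp n x <= n.+1%:R ^+ n.+1 * `|x|.
Proof.
have [x0|x0] := ltP 0 x; last first.
  by rewrite flatexp_le0 // mulr_ge0 // exprn_ge0.
rewrite /flatexp x0 gtr0_norm // expRN.
have H : (x^-1 / n.+1%:R) ^+ n.+1 <= expR (x^-1).
  have -> : expR x^-1 = expR (x^-1 / n.+1%:R) ^+ n.+1.
    by rewrite -expRM_natl -mulr_natl mulrC divfK.
  apply: lerXn2r; rewrite ?nnegrE ?expR_ge0 ?divr_ge0 ?invr_ge0 ?ltW //.
  by apply: lt_le_trans (expR_ge1Dx _); rewrite ltrDr.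
have y0 : 0 < (x^-1 / n.+1%:R) ^+ n.+1 by rewrite exprn_gt0 // divr_gt0 ?invr_gt0.
apply: le_trans (_ : x ^- n * ((x^-1 / n.+1%:R) ^+ n.+1)^-1 <= _).
  rewrite ler_wpM2l //; first by rewrite invr_ge0 exprn_ge0 // ltW.
  by rewrite lef_pV2 // posrE expR_gt0.
rewrite le_eqVlt; apply/orP; left; apply/eqP.
have xn : x ^+ n != 0 by rewrite expf_neq0 // gt_eqF.
have mn : n.+1%:R ^+ n.+1 != 0 :> R by rewrite expf_neq0.
have xx : x != 0 by rewrite gt_eqF.
rewrite expr_div_n exprVn (exprS x); field.
by rewrite xn xx mn.
Qed.

Lemma is_derive_flatexp n (x : R) :
  is_derive x 1 (flatexp n) (- n%:R * flatexp n.+1 x + flatexp n.+2 x).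
Proof.
have [x0|x0|->] := ltgtP x 0.
- rewrite !flatexp_le0 ?ltW // mulr0 addr0.
  apply: (@near_eq_is_derive _ _ _ (cst 0)).
  by near=> y; rewrite flatexp_le0 // ltW //; near: y; exact: lt_nbhsl.
- have N : \forall y \near x, (y ^+ n)^-1 * expR (- y^-1) = flatexp n y.
    by near=> y; rewrite /flatexp ifT //; near: y; exact: lt_nbhsr.
  have xn : x ^+ n != 0 by rewrite expf_neq0 // gt_eqF.
  have xx : x != 0 by rewrite gt_eqF.
  have D1 : is_derive x 1 (fun y : R => (y ^+ n)^-1) (- n%:R * (x ^+ n.+1)^-1).
    have d : derivable (fun y : R => y ^+ n) x 1 by exact: exprn_derivable.
    apply: DeriveDef; first exact: derivableV.
    rewrite deriveV // exp_derive /GRing.scale /= mulr1.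
    case: (n) xn => [|m] xn; first by rewrite mul0r !mulr0 oppr0 mul0r.
    have xm : x ^+ m != 0 by rewrite expf_neq0.
    by rewrite -pred_Sn !exprS expr0; field; rewrite xx xm.
  have D2 : is_derive x 1 (fun y : R => - y^-1) (x^-2).
    have d : derivable (fun y : R => y) x 1 by exact: derivable_id.
    have dV := derivableV xx d.
    apply: DeriveDef; first exact: derivableN.
    by rewrite deriveN // deriveV // derive_id /GRing.scale /= mulr1 opprK.
  have D3 := @is_derive_comp1 _ expR (fun y : R => - y^-1) x _ _ (is_derive_expR (- x^-1)) D2.
  have D := is_deriveM D1 D3.
  apply: (is_derive_eq (near_eq_is_derive N D)).
  rewrite /flatexp x0 /GRing.scale /=.
  by rewrite !exprS expr0; field; rewrite xx xn.
(* At 0 the difference quotient of [flatexp n] is [flatexp n.+1], which tends to 0 by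
   [flatexp_bound]. *)
- rewrite !flatexp_le0 // mulr0 addr0.
  have C : (fun h : R => h^-1 *: ((flatexp n \o shift 0) (h *: 1) - flatexp n 0)) @ 0^' --> (0 : R).
    apply/cvgrPdist_le => /= e e0; near=> h.
    have h0 : h != 0 by near: h; exact: nbhs_dnbhs_neq.
    rewrite sub0r normrN addr0 /GRing.scale /= mulr1 (flatexp_le0 _ (lexx 0)) subr0.
    rewrite normrM normfV (ger0_norm (flatexp_ge0 _ _)).
    have : `|h|^-1 * flatexp n h = flatexp n.+1 h.
      have [hp|hp] := ltP 0 h; last by rewrite !flatexp_le0 // mulr0.
      by rewrite /flatexp hp gtr0_norm // mulrA exprS invfM.
    move=> ->; apply: le_trans (flatexp_bound _ _) _.
    have Cp : 0 < n.+2%:R ^+ n.+2 :> R by rewrite exprn_gt0.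
    rewrite mulrC -ler_pdivlMr //.
    near: h; apply: dnbhs0_le; exact: divr_gt0.
  by apply: DeriveDef; [apply/cvg_ex; exists 0 | exact/cvg_lim].
Unshelve. all: by end_near. Qed.

Lemma smooth_flatexp n : smooth_on [set: R] (flatexp n).
Proof.
move=> k; elim: k n => [|k IH] n.
  move=> x _; apply: differentiable_continuous; apply/derivable1_diffP.
  by have := is_derive_flatexp n x; case.
apply: CkS_derive1 => [x|]; first by have := is_derive_flatexp n x; case.
rewrite (_ : derive1 _ = (fun x => - n%:R *: flatexp n.+1 x + flatexp n.+2 x)).
  by apply: CkD => //; [exact: openT | apply: CkZ => //; exact: openT].
by apply/funext => x; rewrite derive1E; have := is_derive_flatexp n x; case.
Qed.

Definition smoothstep (x : R) : R := flatexp 0 x / (flatexp 0 x + flatexp 0 (1 - x)).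

Lemma smoothstep_denom x : 0 < flatexp 0 x + flatexp 0 (1 - x).
Proof.
have [x0|x0] := ltP 0 x; first by rewrite ltr_pwDl ?flatexp_gt0 ?flatexp_ge0.
by rewrite ltr_wpDl ?flatexp_ge0 ?flatexp_gt0 //; lra.
Qed.

Lemma smoothstep_ge0 x : 0 <= smoothstep x.
Proof. by rewrite divr_ge0 ?flatexp_ge0 // ltW // smoothstep_denom. Qed.

Lemma smoothstep0 x : x <= 0 -> smoothstep x = 0.
Proof. by move=> x0; rewrite /smoothstep flatexp_le0 // mul0r. Qed.

Lemma smoothstep1 x : 1 <= x -> smoothstep x = 1.
Proof.
move=> x1; rewrite /smoothstep (flatexp_le0 _ (_ : 1 - x <= 0)); last by lra.
by rewrite addr0 divff // gt_eqF // flatexp_gt0 //; lra.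
Qed.

Lemma smooth_cst (V W : normedModType R) (A : set V) (c : W) : smooth_on A (cst c).
Proof. by move=> k; exact: Ck_cst. Qed.

Lemma smooth_id : smooth_on [set: R] (fun x : R => x).
Proof.
apply: (smooth_primitive (f := fun x : R => x) (g := cst (1 : R))); exact: smooth_cst.
Qed.

Lemma smooth_smoothstep : smooth_on [set: R] smoothstep.
Proof.
move=> k; have o := @openT R; have f0 := smooth_flatexp 0 k.
have f1 : Ck k [set: R] (fun x => flatexp 0 (1 - x)).
  apply: (Ck_comp1 (B := [set: R]) (f := flatexp 0) (phi := fun x : R => 1 - x)) => //.
  apply: CkD => //; first exact: Ck_cst.
  by apply: CkN => //; exact: smooth_id.
apply: CkM => //; apply: CkV => //; last exact: CkD.
by move=> x _; rewrite gt_eqF // smoothstep_denom.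
Qed.

(** The argument of [smoothstep] is at least 1 up to distance d/2 from [x0] and negative from
    distance d on; a square replaces the absolute value to stay smooth at [x0]. *)
Definition bump (x0 d x : R) : R := smoothstep (2 - 4 * ((x - x0) / d) ^+ 2).

Lemma bump_ge0 x0 d x : 0 <= bump x0 d x.
Proof. exact: smoothstep_ge0. Qed.

Lemma bump0 x0 d x : 0 < d -> d <= `|x - x0| -> bump x0 d x = 0.
Proof.
move=> d0 dx; apply: smoothstep0.
have : 1 <= `|(x - x0) / d| by rewrite normrM normfV (gtr0_norm d0) ler_pdivlMr // mul1r.
move=> /(exprn_ege1 2); rewrite real_normK ?num_real //; lra.
Qed.

Lemma bump1 x0 d x : 0 < d -> `|x - x0| <= d / 2 -> bump x0 d x = 1.
Proof.
move=> d0 dx; apply: smoothstep1.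
have : `|(x - x0) / d| <= 2^-1 by rewrite normrM normfV (gtr0_norm d0) ler_pdivrMr // mulrC.
move=> h; have n0 := normr_ge0 ((x - x0) / d).
have : `|(x - x0) / d| ^+ 2 <= 4^-1 by rewrite expr2; nra.
by rewrite real_normK ?num_real // => ?; lra.
Qed.

Lemma smooth_bump x0 d : smooth_on [set: R] (bump x0 d).
Proof.
move=> k; have o := @openT R.
apply: (Ck_comp1 (B := [set: R]) (f := smoothstep)
  (phi := fun x : R => 2 - 4 * ((x - x0) / d) ^+ 2)) => //; first exact: smooth_smoothstep.
apply: CkD => //; first exact: Ck_cst.
apply: CkN => //; apply: CkM => //; first exact: Ck_cst.
have c : Ck k [set: R] (fun x => (x - x0) / d).
  apply: CkM => //; last exact: Ck_cst.
  by apply: CkD => //; [exact: smooth_id | exact: Ck_cst].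
exact: CkM.
Qed.

End FlatFunction.

(** * Algebra of smooth maps and matrix derivatives *)

Section SmoothClosure.
Context {R : realType}.
Implicit Types V W : normedModType R.

Lemma smoothD V W (A : set V) (f g : V -> W) : open A ->
  smooth_on A f -> smooth_on A g -> smooth_on A (fun p => f p + g p).
Proof. by move=> oA sf sg k; apply: CkD. Qed.

Lemma smoothN V W (A : set V) (f : V -> W) : open A ->
  smooth_on A f -> smooth_on A (fun p => - f p).
Proof. by move=> oA sf k; apply: CkN. Qed.

Lemma smoothB V W (A : set V) (f g : V -> W) : open A ->
  smooth_on A f -> smooth_on A g -> smooth_on A (fun p => f p - g p).
Proof. by move=> oA sf sg; apply: smoothD => //; exact: smoothN. Qed.

Lemma smoothZ V W (A : set V) (a : R) (f : V -> W) : open A ->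
  smooth_on A f -> smooth_on A (fun p => a *: f p).
Proof. by move=> oA sf k; apply: CkZ. Qed.

Lemma smooth_sum V W (A : set V) (I : Type) (r : seq I) (f : I -> V -> W) : open A ->
  (forall i, smooth_on A (f i)) -> smooth_on A (fun p => \sum_(i <- r) f i p).
Proof. by move=> oA sf k; apply: Ck_sum => // i; exact: sf. Qed.

Lemma smoothM V (A : set V) (f g : V -> R) : open A ->
  smooth_on A f -> smooth_on A g -> smooth_on A (fun p => f p * g p).
Proof. by move=> oA sf sg k; apply: CkM. Qed.

Lemma smoothV V (A : set V) (f : V -> R) : open A -> (forall p, A p -> f p != 0) ->
  smooth_on A f -> smooth_on A (fun p => (f p)^-1).
Proof. by move=> oA f0 sf k; apply: CkV. Qed.

Lemma smooth_prod V (A : set V) (I : Type) (r : seq I) (f : I -> V -> R) : open A ->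
  (forall i, smooth_on A (f i)) -> smooth_on A (fun p => \prod_(i <- r) f i p).
Proof.
move=> oA sf; elim: r => [|i r IH].
  rewrite (_ : (fun p => _) = cst 1); first exact: smooth_cst.
  by apply/funext => p; rewrite big_nil.
rewrite (_ : (fun p => _) = (fun p => f i p * \prod_(j <- r) f j p)); first exact: smoothM.
by apply/funext => p; rewrite big_cons.
Qed.

Lemma smooth_coord V m n (A : set V) (f : V -> 'M[R]_(m, n)) i j : open A ->
  smooth_on A f -> smooth_on A (fun p => f p i j).
Proof. by move=> oA sf k; apply: Ck_coord. Qed.

Lemma smooth_mx V m n (A : set V) (f : V -> 'M[R]_(m, n)) : open A ->
  (forall i j, smooth_on A (fun p => f p i j)) -> smooth_on A f.
Proof. by move=> oA sf k; apply: Ck_mx => // i j; exact: sf. Qed.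

Lemma smooth_mulmx V m n q (A : set V) (f : V -> 'M[R]_(m, n)) (g : V -> 'M[R]_(n, q)) :
  open A -> smooth_on A f -> smooth_on A g -> smooth_on A (fun p => f p *m g p).
Proof.
move=> oA sf sg; apply: smooth_mx => // i j.
rewrite (_ : (fun p => _) = (fun p => \sum_k f p i k * g p k j)).
  by apply: smooth_sum => // k; apply: smoothM => //; exact: smooth_coord.
by apply/funext => p; rewrite !mxE.
Qed.

Lemma smooth_trmx V m n (A : set V) (f : V -> 'M[R]_(m, n)) : open A ->
  smooth_on A f -> smooth_on A (fun p => (f p)^T).
Proof.
move=> oA sf; apply: smooth_mx => // i j.
rewrite (_ : (fun p => _) = (fun p => f p j i)); first exact: smooth_coord.
by apply/funext => p; rewrite !mxE.
Qed.

Lemma smooth_scale V m n (A : set V) (c : V -> R) (f : V -> 'M[R]_(m, n)) : open A ->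
  smooth_on A c -> smooth_on A f -> smooth_on A (fun p => c p *: f p).
Proof.
move=> oA sc sf; apply: smooth_mx => // i j.
rewrite (_ : (fun p => _) = (fun p => c p * f p i j)).
  by apply: smoothM => //; exact: smooth_coord.
by apply/funext => p; rewrite !mxE.
Qed.

Lemma smooth_comp V n (A : set V) (B : set 'rV[R]_n) (f : 'rV[R]_n -> R)
    (phi : V -> 'rV[R]_n) : open A ->
  (forall p, A p -> B (phi p)) -> smooth_on B f -> smooth_on A phi ->
  smooth_on A (fun p => f (phi p)).
Proof. by move=> oA AB sf sp k; apply: Ck_comp AB _ _. Qed.

Lemma smooth_comp1 V (A : set V) (f : R -> R) (phi : V -> R) : open A ->
  smooth_on [set: R] f -> smooth_on A phi -> smooth_on A (fun p => f (phi p)).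
Proof. by move=> oA sf sp k; apply: (Ck_comp1 (B := [set: R]) (f := f)). Qed.

Lemma smooth_ext V W (A : set V) (f g : V -> W) : open A ->
  (forall p, A p -> f p = g p) -> smooth_on A f -> smooth_on A g.
Proof. by move=> oA fg sf k; apply: Ck_ext (sf k). Qed.

Lemma smoothT_continuous W (f : R -> W) : smooth_on [set: R] f -> continuous f.
Proof. by move=> sf x; exact: smooth_continuous sf _. Qed.

Lemma is_derive_mx V m n (M : V -> 'M[R]_(m, n)) (D : 'M[R]_(m, n)) t v :
  (forall i j, is_derive t v (fun x => M x i j) (D i j)) -> is_derive t v M D.
Proof.
move=> dM; have d : derivable M t v by apply/derivable_mxP => i j; have := dM i j; case.
apply: DeriveDef => //; rewrite derive_mx //; apply/matrixP => i j; rewrite mxE.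
by have [_ ->] := dM i j.
Qed.

Lemma is_derive_coord V m n (M : V -> 'M[R]_(m, n)) (D : 'M[R]_(m, n)) t v i j :
  is_derive t v M D -> is_derive t v (fun x => M x i j) (D i j).
Proof.
move=> [d <-]; have /derivable_mxP dij := d.
by apply: DeriveDef => //; rewrite derive_mx // mxE.
Qed.

Lemma is_derive_mulmx V m n q (M : V -> 'M[R]_(m, n)) (K : V -> 'M[R]_(n, q)) D E t v :
  is_derive t v M D -> is_derive t v K E ->
  is_derive t v (fun x => M x *m K x) (D *m K t + M t *m E).
Proof.
move=> dM dK; apply: is_derive_mx => i j.
rewrite (_ : (fun x => _) = \sum_k (fun x => M x i k * K x k j)); last first.
  by apply/funext => x; rewrite mxE fct_sumE.
have dk k := is_deriveM (is_derive_coord i k dM) (is_derive_coord k j dK).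
apply: (is_derive_eq (is_derive_sum dk)).
rewrite !mxE -big_split /=; apply: eq_bigr => k _.
by rewrite addrC; congr (_ + _); exact: mulrC.
Qed.

Lemma is_derive_trmx V m n (M : V -> 'M[R]_(m, n)) D t v :
  is_derive t v M D -> is_derive t v (fun x => (M x)^T) D^T.
Proof.
move=> dM; apply: is_derive_mx => i j; rewrite mxE.
rewrite (_ : (fun x => _) = (fun x => M x j i)); first exact: is_derive_coord.
by apply/funext => x; rewrite mxE.
Qed.

Lemma is_derive_scale V m n (c : V -> R) (M : V -> 'M[R]_(m, n)) a D t v :
  is_derive t v c a -> is_derive t v M D ->
  is_derive t v (fun x => c x *: M x) (a *: M t + c t *: D).
Proof.
move=> dc dM; apply: is_derive_mx => i j; rewrite !mxE.
rewrite (_ : (fun x => _) = (fun x => c x * M x i j)); last first.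
  by apply/funext => x; rewrite mxE.
apply: (is_derive_eq (is_deriveM dc (is_derive_coord i j dM))).
by rewrite addrC; congr (_ + _); exact: mulrC.
Qed.

Lemma derive1_coord m n (f : R -> 'M[R]_(m, n)) (x : R) i j :
  derivable f x 1 -> derive1 f x i j = derive1 (fun y => f y i j) x.
Proof.
move=> df; rewrite !derive1E; have := is_derive_coord i j (derivableP df).
by case=> _ ->.
Qed.

Lemma is_derive1 W (f : R -> W) (x : R) (d : W) : is_derive x 1 f d -> derive1 f x = d.
Proof. by case=> _ <-; rewrite derive1E. Qed.

Lemma derive1_near W (f g : R -> W) (x : R) :
  {near x, f =1 g} -> derive1 f x = derive1 g x.
Proof. by move=> fg; rewrite !derive1E; exact: near_eq_derive. Qed.

End SmoothClosure.

(** * Test functions *)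

Section TestFunctions.
Context {R : realType}.

Lemma compact_derive1 (W : normedModType R) (f : R -> W) r :
  (forall x, r < `|x| -> f x = 0) -> forall x, r < `|x| -> derive1 f x = 0.
Proof.
move=> fr x rx; rewrite (_ : 0 = derive1 (cst 0 : R -> W) x); last first.
  by rewrite derive1E derive_cst.
apply: derive1_near; near=> y; rewrite fr //.
near: y; apply: (@cvgr_gt _ _ _ _ (fun y : R => `|y|) `|x|) => //.
by apply: cvg_norm; exact: cvg_id.
Unshelve. all: by end_near. Qed.

Lemma test_derive1 (W : normedModType R) (f : R -> W) : test_fun f -> test_fun (derive1 f).
Proof.
move=> [sf [r fr]]; split; first exact: smooth_derive1.
by exists r; exact: compact_derive1.
Qed.

Lemma test_cc (f : R -> R) : test_fun f -> cc f.
Proof. by move=> [sf cf]; split => //; exact: smoothT_continuous. Qed.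

Lemma test0 (W : normedModType R) : test_fun (fun _ : R => 0 : W).
Proof. by split; [exact: smooth_cst | exists 0]. Qed.

Lemma testD (W : normedModType R) (f g : R -> W) :
  test_fun f -> test_fun g -> test_fun (fun x => f x + g x).
Proof.
move=> [sf [r fr]] [sg [s gs]]; split; first by apply: smoothD => //; exact: openT.
exists (Num.max r s) => x; rewrite gt_max => /andP[rx sx].
by rewrite fr // gs // addr0.
Qed.

Lemma testZ (W : normedModType R) a (f : R -> W) :
  test_fun f -> test_fun (fun x => a *: f x).
Proof.
move=> [sf [r fr]]; split; first by apply: smoothZ => //; exact: openT.
by exists r => x rx; rewrite fr // scaler0.
Qed.

Lemma testN (W : normedModType R) (f : R -> W) : test_fun f -> test_fun (fun x => - f x).
Proof.
move=> [sf [r fr]]; split; first by apply: smoothN => //; exact: openT.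
by exists r => x rx; rewrite fr // oppr0.
Qed.

Lemma testB (W : normedModType R) (f g : R -> W) :
  test_fun f -> test_fun g -> test_fun (fun x => f x - g x).
Proof. by move=> tf tg; apply: testD => //; exact: testN. Qed.

Lemma test_sum (W : normedModType R) (I : Type) (s : seq I) (F : I -> R -> W) :
  (forall i, test_fun (F i)) -> test_fun (fun x => \sum_(i <- s) F i x).
Proof.
move=> tF; elim: s => [|i s IH].
  rewrite (_ : (fun x => _) = (fun=> 0)); first exact: test0.
  by apply/funext => x; rewrite big_nil.
rewrite (_ : (fun x => _) = (fun x => F i x + \sum_(j <- s) F j x)); first exact: testD.
by apply/funext => x; rewrite big_cons.
Qed.

Lemma testMl (f g : R -> R) : smooth_on [set: R] f -> test_fun g ->
  test_fun (fun x => f x * g x).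
Proof.
move=> sf [sg [s gs]]; split; first by apply: smoothM => //; exact: openT.
by exists s => x sx; rewrite gs // mulr0.
Qed.

Lemma testMr (f g : R -> R) : test_fun f -> smooth_on [set: R] g ->
  test_fun (fun x => f x * g x).
Proof.
move=> [sf [s fs]] sg; split; first by apply: smoothM => //; exact: openT.
by exists s => x sx; rewrite fs // mul0r.
Qed.

Lemma test_scalel m n (c : R -> R) (f : R -> 'M[R]_(m, n)) :
  smooth_on [set: R] c -> test_fun f -> test_fun (fun x => c x *: f x).
Proof.
move=> sc [sf [s fs]]; split; first by apply: smooth_scale => //; exact: openT.
by exists s => x sx; rewrite fs // scaler0.
Qed.

Lemma test_scaler m n (c : R -> R) (f : R -> 'M[R]_(m, n)) :
  test_fun c -> smooth_on [set: R] f -> test_fun (fun x => c x *: f x).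
Proof.
move=> [sc [s cs]] sf; split; first by apply: smooth_scale => //; exact: openT.
by exists s => x sx; rewrite cs // scale0r.
Qed.

Lemma test_coord m n (f : R -> 'M[R]_(m, n)) i j : test_fun f -> test_fun (fun x => f x i j).
Proof.
move=> [sf [s fs]]; split; first by apply: smooth_coord => //; exact: openT.
by exists s => x sx; rewrite fs // mxE.
Qed.

Lemma test_mx m n (f : R -> 'M[R]_(m, n)) :
  (forall i j, test_fun (fun x => f x i j)) -> test_fun f.
Proof.
move=> tf; rewrite (_ : f = (fun p => \sum_i \sum_j f p i j *: delta_mx i j)); last first.
  by apply/funext => p; rewrite [LHS]matrix_sum_delta.
apply: test_sum => i; apply: test_sum => j; apply: test_scaler => //; exact: smooth_cst.
Qed.

Lemma test_mulmxr m n q (f : R -> 'M[R]_(m, n)) (g : R -> 'M[R]_(n, q)) :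
  test_fun f -> smooth_on [set: R] g -> test_fun (fun x => f x *m g x).
Proof.
move=> [sf [s fs]] sg; split; first by apply: smooth_mulmx => //; exact: openT.
by exists s => x sx; rewrite fs // mul0mx.
Qed.

Lemma test_bump (x0 d : R) : 0 < d -> test_fun (bump x0 d).
Proof.
move=> d0; split; first exact: smooth_bump.
exists (`|x0| + d) => x xd; apply: bump0 => //.
by have := ler_normD (x - x0) x0; rewrite subrK; lra.
Qed.

Lemma Int_ge_itv (f : R -> R) (a b m : R) : cc f -> (forall x, 0 <= f x) -> a <= b ->
  0 <= m -> (forall x, a <= x <= b -> m <= f x) -> m * (b - a) <= Int f.
Proof.
move=> cf f0 ab m0 fm.
have -> : m * (b - a) = \int[lebesgue_measure]_(x in `[a, b]) m.
  rewrite Rintegral_cst //= lebesgue_measure_itv /= lte_fin.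
  by case: ltgtP ab => // -> _; rewrite /= subrr !mulr0.
rewrite /Int Rintegral_mkcond; apply: le_Rintegral => //.
- have -> : EFin \o (cst m \_ `[a, b]) = (EFin \o cst m) \_ `[a, b].
    by apply/funext => y; rewrite /= !patchE; case: ifP.
  apply/(integrable_mkcond (mu := lebesgue_measure) (EFin \o cst m) (measurable_itv _)).1.
  apply: continuous_compact_integrable; first exact: segment_compact.
  by apply: continuous_subspaceT; exact: cst_continuous.
- exact: (cc_integrable cf).
- move=> y _; rewrite patchE; case: ifPn => [|_]; last exact: f0.
  by rewrite inE /= in_itv /= => /fm.
Qed.

End TestFunctions.

(** * The fundamental lemma of the calculus of variations and prescribed jets *)

Section FundamentalLemma.
Context {R : realType} {N : nat}.
Notation path := (R -> 'rV[R]_N).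

Definition dot (f X : 'rV[R]_N) : R := \sum_i f 0 i * X 0 i.

Lemma pairingE (f X : path) : pairing f X = Int (fun x => dot (f x) (X x)).
Proof. by []. Qed.

Lemma continuous_coordT (X : path) i : continuous X -> continuous (fun x => X x 0 i).
Proof.
move=> cX x; apply: (@continuous_comp _ _ _ X (fun M : 'rV[R]_N => M 0 i)); first exact: cX.
exact: coord_continuous.
Qed.

Lemma cc_dot (f X : path) : test_fun f -> continuous X -> cc (fun x => dot (f x) (X x)).
Proof.
move=> tf cX; apply: cc_sum => i; apply: ccMr; first exact/test_cc/test_coord.
exact: continuous_coordT.
Qed.

(** If a coordinate of [X] were c <> 0 at a point, c times a small bump in that coordinate would
    pair positively with [X]. The tests are confined to [O] because later only covectors supported
    in a small interval are available. *)
Lemma fundamental_lemma (O : set R) (X : path) : open O -> continuous X ->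
  (forall f : path, test_fun f -> (forall x, ~ O x -> f x = 0) -> pairing f X = 0) ->
  forall x, O x -> X x = 0.
Proof.
move=> oO cX H x0 Ox0; apply/rowP => i; rewrite mxE; apply/eqP/negPn/negP => Xi.
pose c := X x0 0 i.
have c2 : 0 < c ^+ 2 by rewrite exprn_even_gt0.
have near1 : \forall x \near x0, c ^+ 2 / 2 < c * X x 0 i.
  have L : (fun x => c * X x 0 i) x @[x --> x0] --> c * c.
    by apply: cvgM; [exact: cvg_cst | exact: continuous_coordT].
  by apply: (cvgr_gt _ L); rewrite -expr2; lra.
have [d /= d0 Bd] : \forall x \near x0, O x /\ c ^+ 2 / 2 < c * X x 0 i.
  by near=> x; split; [near: x; exact: open_nbhs_nbhs | near: x; exact: near1].
pose f : path := fun x => (bump x0 d x * c) *: delta_mx 0 i.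
have tf : test_fun f.
  apply: test_scaler; last exact: smooth_cst.
  by apply: testMr; [exact: test_bump | exact: smooth_cst].
have in_ball x : bump x0 d x != 0 -> O x /\ c ^+ 2 / 2 < c * X x 0 i.
  move=> bx; apply: Bd => /=; rewrite distrC ltNge; apply: contra bx => dx.
  by rewrite bump0.
have := H f tf; rewrite pairingE.
have fX x : dot (f x) (X x) = bump x0 d x * (c * X x 0 i).
  rewrite /dot (bigD1 i) //= big1 ?addr0; first by rewrite !mxE !eqxx mulr1 mulrA.
  by move=> j ji; rewrite !mxE (negbTE ji) andbF mulr0 mul0r.
move=> K; have {}K : Int (fun x => dot (f x) (X x)) = 0.
  apply: K => x Ox; rewrite /f; have [->|/in_ball[]//] := eqVneq (bump x0 d x) 0.
  by rewrite mul0r scale0r.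
(* The bump equals 1 on an interval of length d, where c times the coordinate exceeds c^2 / 2. *)
have : c ^+ 2 / 2 * ((x0 + d / 2) - (x0 - d / 2)) <= Int (fun x => dot (f x) (X x)).
  apply: Int_ge_itv; [exact: cc_dot| |lra|lra|].
    move=> x; rewrite fX; have [->|/in_ball[_ h]] := eqVneq (bump x0 d x) 0.
      by rewrite mul0r.
    by apply: mulr_ge0; [exact: bump_ge0 | lra].
  move=> x xx; have xd : `|x - x0| <= d / 2 by rewrite ler_norml; lra.
  have b1 := bump1 d0 xd; have [_ h] : O x /\ c ^+ 2 / 2 < c * X x 0 i.
    by apply: in_ball; rewrite b1 oner_neq0.
  by rewrite fX b1 mul1r ltW.
rewrite K; nra.
Unshelve. all: by end_near. Qed.

(** The Taylor polynomial multiplied by a bump: the bump is constant near [x0] and leaves the 2-jet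
    alone. *)
Lemma jet_exists (x0 d : R) (c0 c1 c2 : 'rV[R]_N) : 0 < d -> exists k : path,
  [/\ test_fun k, forall x, d <= `|x - x0| -> k x = 0,
      k x0 = c0, derive1 k x0 = c1 & derive1 (derive1 k) x0 = c2].
Proof.
move=> d0; pose q x : 'rV[R]_N := c0 + (x - x0) *: c1 + ((x - x0) ^+ 2 / 2) *: c2.
pose q1 x : 'rV[R]_N := c1 + (x - x0) *: c2.
have dl (x : R) : is_derive x 1 (fun x => x - x0) 1.
  by have := is_deriveB (is_derive_id x 1) (is_derive_cst x0 x 1); rewrite subr0.
have dc (x : R) (c : 'rV[R]_N) : is_derive x 1 (fun _ : R => c) 0 by exact: is_derive_cst.
have dq (x : R) : is_derive x 1 q (q1 x).
  have dsq : is_derive x 1 (fun x => (x - x0) ^+ 2 / 2) (x - x0).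
    have D := is_deriveM (is_deriveM (dl x) (dl x)) (is_derive_cst (2^-1 : R) x 1).
    rewrite (_ : (fun x => _) = (fun x => (x - x0)) * (fun x => (x - x0)) * cst 2^-1); last first.
      by apply/funext => y; rewrite !fctE expr2.
    by apply: (is_derive_eq D); rewrite !fctE /GRing.scale /=; field.
  have D := is_deriveD (is_deriveD (dc x c0) (is_derive_scale (dl x) (dc x c1)))
                       (is_derive_scale dsq (dc x c2)).
  by apply: (is_derive_eq D); rewrite !scaler0 !addr0 add0r scale1r.
have dq1 (x : R) : is_derive x 1 q1 c2.
  have D := is_deriveD (dc x c1) (is_derive_scale (dl x) (dc x c2)).
  by apply: (is_derive_eq D); rewrite scaler0 addr0 add0r scale1r.
have sq1 : smooth_on [set: R] q1.
  apply: (smooth_primitive dq1); exact: smooth_cst.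
have sq : smooth_on [set: R] q by exact: (smooth_primitive dq).
pose k : path := fun x => bump x0 d x *: q x.
have nb : \forall y \near x0, k y = q y.
  near=> y; rewrite /k bump1 ?scale1r //.
  by near: y; exists (d / 2) => /=; [exact: divr_gt0 | move=> y /=; rewrite distrC => /ltW].
have nb1 : \forall y \near x0, derive1 k y = q1 y.
  near=> y; rewrite -(is_derive1 (dq y)); apply: derive1_near.
  by near: y; exact: (near_join nb).
exists k; split.
- by apply: test_scaler => //; exact: test_bump.
- by move=> x xd; rewrite /k bump0 // scale0r.
- by rewrite (nbhs_singleton nb) /q subrr expr0n mul0r !scale0r !addr0.
- by rewrite (nbhs_singleton nb1) /q1 subrr scale0r addr0.
- by rewrite (derive1_near nb1); exact: is_derive1.
Unshelve. all: by end_near. Qed.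

End FundamentalLemma.

(** * First-order expansions uniform in x *)

Section UniformExpansion.
Context {R : realType}.

(** The domain [A] in the definition of [functional]: two small variation parameters and an
    unrestricted position. *)
Definition strip (e : R) : set (R * R * R) := [set p | `|p.1.1| < e /\ `|p.1.2| < e].

Lemma open_strip e : open (strip e).
Proof.
have -> : strip e = (fun p : R * R * R => `|p.1.1|) @^-1` [set y | y < e] `&`
                    (fun p : R * R * R => `|p.1.2|) @^-1` [set y | y < e] by [].
apply: openI; apply: open_comp; try exact: open_lt; move=> p _; apply: cvg_norm.
- by apply: (cvg_comp fst fst); [exact: cvg_fst | exact: cvg_fst].
- by apply: (cvg_comp fst snd); [exact: cvg_fst | exact: cvg_snd].
Qed.

Lemma strip_line e (s t x : R) : `|s| < e -> `|t| < e -> strip e (s, t, x).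
Proof. by []. Qed.

(** Compactness of [-r, r] gives one width valid for all its points, as in the tube lemma. *)
Lemma tube (r : R) (P : R * R * R -> Prop) :
  (forall x, `|x| <= r -> \forall p \near ((0, 0, x) : R * R * R), P p) ->
  exists2 e, 0 < e & forall s t x, `|s| < e -> `|t| < e -> `|x| <= r -> P (s, t, x).
Proof.
move=> H.
have /compact_near_coveringP cK := @segment_compact R (- r) r.
have [x|[A B] /= [[a /= a0 Aa] [b /= b0 Bb]] AB] :=
    cK (R * R)%type (nbhs (0, 0)) (fun q x => P (q, x)) _.
  rewrite /= in_itv /= => xr; have {}xr : `|x| <= r by rewrite ler_norml.
  have [[A B] /= [nA nB] AB] := H x xr.
  exists (B, A) => //= -[y q] [/= By Aq]; exact: (AB (q, y)).
exists (Num.min a b); first by rewrite lt_min a0 b0.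
move=> s t x; rewrite !lt_min => /andP[sa _] /andP[_ tb] xr.
apply: (AB (s, t)) => /=; last by rewrite in_itv /= -ler_norml.
by split; [apply: Aa => /=; rewrite sub0r normrN | apply: Bb => /=; rewrite sub0r normrN].
Qed.

Lemma cvg_axis (x : R) : ((0, 0, q.2) : R * R * R) @[q --> ((0, 0, x) : R * R * R)] --> ((0, 0, x) : R * R * R).
Proof.
apply: (@cvg_pair _ _ _ (nbhs ((0, 0, x) : R * R * R)) (nbhs ((0, 0) : R * R)) (nbhs x) _ _ _
  (fun=> (0, 0)) (fun q => q.2)); [exact: cvg_cst | exact: cvg_snd].
Qed.

Lemma uniform_continuity (F : R * R * R -> R) r eps : 0 < eps ->
  (forall x, {for (0, 0, x), continuous F}) ->
  exists2 e, 0 < e & forall s t x, `|s| < e -> `|t| < e -> `|x| <= r ->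
    `|F (s, t, x) - F (0, 0, x)| <= eps.
Proof.
move=> e0 cF.
apply: (@tube r (fun p => `|F p - F (0, 0, p.2)| <= eps)) => x _.
have C : F p - F (0, 0, p.2) @[p --> ((0, 0, x) : R * R * R)] --> F (0, 0, x) - F (0, 0, x).
  apply: cvgB; first exact: cF.
  by apply: (cvg_comp _ _ (@cvg_axis x)); exact: cF.
rewrite subrr in C; have /cvgrPdist_le := C => /(_ eps e0).
by apply: filterS => p; rewrite sub0r normrN.
Qed.

Lemma uniform_bound (F : R * R * R -> R) r :
  (forall x, {for (0, 0, x), continuous F}) ->
  exists M e, 0 < e /\ 0 <= M /\ forall s t x, `|s| < e -> `|t| < e -> `|x| <= r ->
    `|F (s, t, x)| <= M.
Proof.
move=> cF; have [e e0 He] := uniform_continuity r ltr01 cF.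
have cont : {within `[- r, r], continuous (fun x => `|F (0, 0, x)|)}.
  apply: continuous_subspaceT => x; apply: cvg_norm.
  apply: (@continuous_comp _ _ _ (fun x : R => ((0, 0, x) : R * R * R)) F); last exact: cF.
  apply: (@cvg_pair _ _ _ (nbhs x) (nbhs ((0, 0) : R * R)) (nbhs x) _ _ _
    (fun=> (0, 0)) id); [exact: cvg_cst | exact: cvg_id].
have [r0|r0] := leP 0 r; last first.
  exists 0, e; split => //; split => // s t x _ _ /(le_trans (normr_ge0 _)).
  by rewrite leNgt r0.
have rr : - r <= r by lra.
have [c _ Hc] := EVT_max rr cont.
exists (`|F (0, 0, c)| + 1), e; split => //; split => [|s t x se te xr]; first by rewrite addr_ge0.
have := He s t x se te xr; have := Hc x; rewrite in_itv /= -ler_norml => /(_ xr).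
have := ler_normD (F (s, t, x) - F (0, 0, x)) (F (0, 0, x)); rewrite subrK; lra.
Qed.

Lemma is_derive_line {V W : normedModType R} (F : V -> W) (c d : V) (x : R) :
  differentiable F (c + x *: d) ->
  is_derive x 1 (fun x => F (c + x *: d)) ('D_d F (c + x *: d)).
Proof.
move=> dF.
have dl : is_diff x (fun x : R => c + x *: d) (fun x => x *: d).
  have := is_diffD (is_diff_cst c x) (is_diff_scalel x d).
  rewrite (_ : 0 + _ = (fun x => x *: d)) //.
  by apply/funext => y; rewrite fctE /= add0r.
have dc : is_diff x (fun x => F (c + x *: d)) ('d F (c + x *: d) \o (fun x => x *: d)).
  by apply: is_diff_comp; exact: differentiableP.
apply: DeriveDef; first by apply/diff_derivable; case: dc.
rewrite [LHS]deriveE; last by case: dc.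
by have [_ ->] := dc; rewrite /= scale1r deriveE.
Qed.

(** Mean value theorem on the segment from (0, 0, x) to (s, t, x): the partial derivatives at the
    intermediate point are uniformly close to those at (0, 0, x). *)
Lemma uniform_expansion (F : R * R * R -> R) r e eps : 0 < e -> 0 < eps ->
  Ck 1 (strip e) F ->
  exists2 d, 0 < d & forall s t x, `|s| < d -> `|t| < d -> `|x| <= r ->
    `|F (s, t, x) - F (0, 0, x) - s * 'D_(1, 0, 0) F (0, 0, x)
       - t * 'D_(0, 1, 0) F (0, 0, x)| <= eps * (`|s| + `|t|).
Proof.
move=> e0 eps0 [dF cF].
have c1 x : {for (0, 0, x), continuous (fun p => 'D_(1, 0, 0) F p)}.
  by apply: cF; rewrite /strip /= normr0.
have c2 x : {for (0, 0, x), continuous (fun p => 'D_(0, 1, 0) F p)}.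
  by apply: cF; rewrite /strip /= normr0.
have [d1 d10 H1] := uniform_continuity r eps0 c1.
have [d2 d20 H2] := uniform_continuity r eps0 c2.
exists (Num.min e (Num.min d1 d2)); first by rewrite !lt_min e0 d10 d20.
move=> s t x; rewrite !lt_min => /and3P[se s1 s2] /and3P[te t1 t2] xr.
pose v : R * R * R := (s, t, 0).
have inA (y : R) : 0 <= y <= 1 -> strip e ((0, 0, x) + y *: v).
  move=> /andP[y0 y1]; split => /=; rewrite add0r [_ *: _]/(y * _) normrM ger0_norm //.
    by apply: le_lt_trans se; rewrite ler_piMl.
  by apply: le_lt_trans te; rewrite ler_piMl.
pose f (y : R) := F ((0, 0, x) + y *: v).
have df (y : R) : 0 <= y <= 1 -> is_derive y 1 f ('D_v F ((0, 0, x) + y *: v)).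
  by move=> y01; apply: is_derive_line; apply: dF; exact: inA.
have [||y y01 E] := @MVT R f (fun y => 'D_v F ((0, 0, x) + y *: v)) 0 1 ltr01.
- by move=> y; rewrite in_itv /= => /andP[y0 y1]; apply: df; rewrite !ltW.
- apply: derivable_within_continuous => y; rewrite in_itv /= => y01.
  by have := df y y01; case.
have {}y01 : 0 <= y <= 1 by move: y01; rewrite in_itv /= => /andP[y0 y1]; rewrite !ltW.
have Dv q : strip e q -> 'D_v F q = s * 'D_(1, 0, 0) F q + t * 'D_(0, 1, 0) F q.
  move=> /dF dq; rewrite !deriveE //.
  have -> : v = s *: (1, 0, 0) + t *: (0, 1, 0).
    by rewrite /v; congr (_, _, _); rewrite /= /GRing.scale /= !(mulr1, mulr0, addr0, add0r).
  by rewrite linearD !linearZ.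
have yn : `|y| <= 1 by rewrite ler_norml; lra.
have ys : `|y * s| < d1 /\ `|y * s| < d2.
  by split; rewrite normrM; [apply: le_lt_trans s1|apply: le_lt_trans s2]; rewrite ler_piMl.
have yt : `|y * t| < d1 /\ `|y * t| < d2.
  by split; rewrite normrM; [apply: le_lt_trans t1|apply: le_lt_trans t2]; rewrite ler_piMl.
have Eq : (0, 0, x) + y *: v = (y * s, y * t, x).
  by congr (_, _, _); rewrite /= ?add0r //; rewrite /GRing.scale /= mulr0 addr0.
have f1 : f 1 = F (s, t, x).
  by rewrite /f scale1r; congr (F (_, _, _)); rewrite /= ?add0r ?addr0.
have f0 : f 0 = F (0, 0, x) by rewrite /f scale0r addr0.
rewrite f1 f0 subr0 mulr1 Dv ?Eq in E; last by rewrite -Eq; exact: inA.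
rewrite E.
have K1 := H1 _ _ _ ys.1 yt.1 xr; have K2 := H2 _ _ _ ys.2 yt.2 xr.
set a1 := 'D_(1, 0, 0) F (y * s, y * t, x) in K1 *.
set a2 := 'D_(0, 1, 0) F (y * s, y * t, x) in K2 *.
set b1 := 'D_(1, 0, 0) F (0, 0, x) in K1 *.
set b2 := 'D_(0, 1, 0) F (0, 0, x) in K2 *.
clearbody a1 a2 b1 b2; clear -K1 K2.
have -> : s * a1 + t * a2 - s * b1 - t * b2 = s * (a1 - b1) + t * (a2 - b2) by ring.
apply: le_trans (ler_normD _ _) _; rewrite !normrM mulrDr.
by apply: lerD; rewrite mulrC; apply: ler_wpM2r => //; exact: normr_ge0.
Qed.

Lemma is_derive_small (F : R -> R) (v : R) :
  (forall eps, 0 < eps -> exists2 d, 0 < d & forall t, `|t| < d ->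
     `|F t - F 0 - t * v| <= eps * `|t|) -> is_derive (0 : R) 1 F v.
Proof.
move=> H.
have C : (fun h : R => h^-1 *: ((F \o shift 0) (h *: 1) - F 0)) @ 0^' --> v.
  apply/cvgrPdist_le => /= e e0; have [d d0 Hd] := H e e0.
  near=> h.
  have h0 : h != 0 by near: h; exact: nbhs_dnbhs_neq.
  have hd : `|h| < d by near: h; exact: dnbhs0_lt.
  rewrite addr0 [_ *: 1]mulr1.
  have -> : v - h^-1 *: (F h - F 0) = - (h^-1 * (F h - F 0 - h * v)).
    by rewrite /GRing.scale /=; field.
  rewrite normrN normrM normfV mulrC ler_pdivrMr ?normr_gt0 //.
  exact: Hd.
by apply: DeriveDef; [apply/cvg_ex; exists v | exact/cvg_lim].
Unshelve. all: by end_near. Qed.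

Lemma derive_small (F : R -> R) (v : R) : is_derive (0 : R) 1 F v ->
  forall eps, 0 < eps -> exists2 d, 0 < d & forall t, `|t| < d ->
     `|F t - F 0 - t * v| <= eps * `|t|.
Proof.
move=> [/cvg_ex[l /= C] E] eps e0.
have lv : l = v by rewrite -E; apply/esym/cvg_lim.
rewrite lv in C; have /cvgrPdist_le /(_ eps e0) [d /= d0 Hd] := C.
exists d => // t td; have [->|t0] := eqVneq t 0.
  by rewrite mul0r subrr subr0 normr0 mulr0.
have := Hd t; rewrite /= sub0r normrN => /(_ td t0).
rewrite addr0 [_ *: 1]mulr1.
have -> : v - t^-1 *: (F t - F 0) = - (t^-1 * (F t - F 0 - t * v)).
  by rewrite /GRing.scale /=; field.
by rewrite normrN normrM normfV mulrC ler_pdivrMr ?normr_gt0.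
Qed.

Lemma test_bounded (f : R -> R) : test_fun f -> exists2 M, 0 <= M & forall x, `|f x| <= M.
Proof.
move=> [sf [r fr]]; have cf := smoothT_continuous sf.
have c x : {for (0, 0, x), continuous (fun p : R * R * R => f p.2)}.
  by apply: (@cvg_comp _ _ _ snd f _ (nbhs x)); [exact: cvg_snd | exact: cf].
have [M [e [e0 [M0 H]]]] := uniform_bound (Num.max r 0) c.
exists M => // x; have [rx|rx] := leP `|x| (Num.max r 0).
  by apply: (H 0 0 x); rewrite ?normr0.
by rewrite fr ?normr0 //; apply: le_lt_trans rx; rewrite le_max lexx.
Qed.

End UniformExpansion.

(** * Variational derivatives *)

Section Pairing.
Context {R : realType} {N : nat}.
Notation path := (R -> 'rV[R]_N).
Implicit Types f h X Y : path.

Lemma dotC (f X : 'rV[R]_N) : dot f X = dot X f.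
Proof. by apply: eq_bigr => i _; rewrite mulrC. Qed.

Lemma dotDl (f h X : 'rV[R]_N) : dot (f + h) X = dot f X + dot h X.
Proof. by rewrite /dot -big_split; apply: eq_bigr => i _; rewrite mxE mulrDl. Qed.

Lemma dotZl a (f X : 'rV[R]_N) : dot (a *: f) X = a * dot f X.
Proof. by rewrite /dot mulr_sumr; apply: eq_bigr => i _; rewrite mxE mulrA. Qed.

Lemma dotDr (f h X : 'rV[R]_N) : dot X (f + h) = dot X f + dot X h.
Proof. by rewrite dotC dotDl !(dotC X). Qed.

Lemma dotZr a (f X : 'rV[R]_N) : dot X (a *: f) = a * dot X f.
Proof. by rewrite dotC dotZl dotC. Qed.

Lemma dotNl (f X : 'rV[R]_N) : dot (- f) X = - dot f X.
Proof. by rewrite -scaleN1r dotZl mulN1r. Qed.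

Lemma dotNr (f X : 'rV[R]_N) : dot X (- f) = - dot X f.
Proof. by rewrite dotC dotNl dotC. Qed.

Lemma dot0l (X : 'rV[R]_N) : dot 0 X = 0.
Proof. by rewrite -(scale0r 0) dotZl mul0r. Qed.

Lemma dot0r (X : 'rV[R]_N) : dot X 0 = 0.
Proof. by rewrite dotC dot0l. Qed.

Lemma dot_suml (I : Type) (s : seq I) (F : I -> 'rV[R]_N) (X : 'rV[R]_N) :
  dot (\sum_(i <- s) F i) X = \sum_(i <- s) dot (F i) X.
Proof.
elim: s => [|i s IH]; first by rewrite !big_nil dot0l.
by rewrite !big_cons dotDl IH.
Qed.

Lemma dot_sumr (I : Type) (s : seq I) (F : I -> 'rV[R]_N) (X : 'rV[R]_N) :
  dot X (\sum_(i <- s) F i) = \sum_(i <- s) dot X (F i).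
Proof. by rewrite dotC dot_suml; apply: eq_bigr => i _; rewrite dotC. Qed.

Lemma dot_mulmx (f X : 'rV[R]_N) : dot f X = (f *m X^T) 0 0.
Proof. by rewrite mxE; apply: eq_bigr => i _; rewrite mxE. Qed.

Lemma test_continuous f : test_fun f -> continuous f.
Proof. by case=> sf _; exact: smoothT_continuous. Qed.

Lemma pairingC f X : pairing f X = pairing X f.
Proof. by rewrite !pairingE; congr Int; apply/funext => x; rewrite dotC. Qed.

Lemma pairingDl f h X : test_fun f -> test_fun h -> continuous X ->
  pairing (fun x => f x + h x) X = pairing f X + pairing h X.
Proof.
move=> tf th cX; rewrite !pairingE -IntD; try exact: cc_dot.
by congr Int; apply/funext => x; rewrite dotDl.
Qed.

Lemma pairingZl a f X : test_fun f -> continuous X ->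
  pairing (fun x => a *: f x) X = a * pairing f X.
Proof.
move=> tf cX; rewrite !pairingE -IntZ; last exact: cc_dot.
by congr Int; apply/funext => x; rewrite dotZl.
Qed.

Lemma pairingNl f X : test_fun f -> continuous X ->
  pairing (fun x => - f x) X = - pairing f X.
Proof.
move=> tf cX; rewrite !pairingE -IntN; last exact: cc_dot.
by congr Int; apply/funext => x; rewrite dotNl.
Qed.

Lemma pairingBl f h X : test_fun f -> test_fun h -> continuous X ->
  pairing (fun x => f x - h x) X = pairing f X - pairing h X.
Proof. by move=> tf th cX; rewrite pairingDl ?pairingNl //; exact: testN. Qed.

Lemma pairingDr f X Y : test_fun f -> continuous X -> continuous Y ->
  pairing f (fun x => X x + Y x) = pairing f X + pairing f Y.
Proof.
move=> tf cX cY; rewrite !pairingE -IntD; try exact: cc_dot.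
by congr Int; apply/funext => x; rewrite dotDr.
Qed.

Lemma pairingZr a f X : test_fun f -> continuous X ->
  pairing f (fun x => a *: X x) = a * pairing f X.
Proof.
move=> tf cX; rewrite !pairingE -IntZ; last exact: cc_dot.
by congr Int; apply/funext => x; rewrite dotZr.
Qed.

Lemma pairing_bound f X r M1 M2 : test_fun f -> continuous X -> 0 <= r ->
  (forall x, r < `|x| -> f x = 0) -> 
  (forall x i, `|f x 0 i| <= M1) -> (forall x i, `|x| <= r -> `|X x 0 i| <= M2) ->
  `|pairing f X| <= 2 * r * (N%:R * (M1 * M2)).
Proof.
move=> tf cX r0 fr fM XM; rewrite pairingE; apply: Int_bound => //.
- by case: (cc_dot tf cX).
- by move=> x rx; rewrite fr // dot0l.
- move=> x xr; apply: le_trans (ler_norm_sum _ _ _) _.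
  rewrite -[N in N%:R]card_ord -sum1_card natr_sum mulr_suml; apply: ler_sum => i _.
  by rewrite mul1r normrM ler_pM // XM.
Qed.

Lemma vder_unique (I : path -> R) (u f f' : path) : is_vder I u f -> is_vder I u f' -> f = f'.
Proof.
move=> [tf df] [tf' df']; apply/funext => x; apply/eqP; rewrite -subr_eq0; apply/eqP.
have tff := testB tf tf'.
apply: (@fundamental_lemma _ _ [set: R] (fun x => f x - f' x)) => //; first exact: openT.
  exact: test_continuous.
move=> eta te _; rewrite pairingC pairingBl //; last exact: test_continuous.
have [_ <-] := df eta te; have [_ <-] := df' eta te.
by rewrite subrr.
Qed.

Lemma vderE (I : path -> R) (u f : path) : is_vder I u f -> vder I u = f.
Proof.
move=> H; apply: (@vder_unique I u) => //.
by apply: (@xgetPex _ (fun=> 0) [set f | is_vder I u f]); exists f.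
Qed.

(** Outside the supports of [eta] and [zeta] the field is unchanged; on the compact rest, [tube] and
    the openness of [U] give one bound on the parameters. *)
Lemma field_perturb (U : set 'rV[R]_N) (u eta zeta : path) : open U -> field U u ->
  test_fun eta -> test_fun zeta ->
  exists2 e, 0 < e & forall s t, `|s| < e -> `|t| < e ->
    field U (fun x => u x + s *: eta x + t *: zeta x).
Proof.
move=> oU [su Uu [r ur]] [se [r1 er]] [sz [r2 zr]].
have sw s t : smooth_on [set: R] (fun x => u x + s *: eta x + t *: zeta x).
  by apply: smoothD; [exact: openT|apply: smoothD; [exact: openT| |]|];
    try apply: smoothZ => //; try exact: openT.
pose F (p : R * R * R) := u p.2 + p.1.1 *: eta p.2 + p.1.2 *: zeta p.2.
have cF p : {for p, continuous F}.
  have c2 : (fun q : R * R * R => q.2) @ p --> p.2 by exact: cvg_snd.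
  have c11 : (fun q : R * R * R => q.1.1) @ p --> p.1.1.
    by apply: (cvg_comp fst fst); exact: cvg_fst.
  have c12 : (fun q : R * R * R => q.1.2) @ p --> p.1.2.
    by apply: (cvg_comp fst snd); [exact: cvg_fst | exact: cvg_snd].
  apply: cvgD; [apply: cvgD|].
  - by apply: (cvg_comp _ _ c2); exact: smoothT_continuous su _.
  - by apply: cvgZ => //; apply: (cvg_comp _ _ c2); exact: smoothT_continuous se _.
  - by apply: cvgZ => //; apply: (cvg_comp _ _ c2); exact: smoothT_continuous sz _.
have [x xr|e e0 He] := @tube R (Num.max r1 r2) (fun p => U (F p)).
  have nU : nbhs (F (0, 0, x)) U.
    by apply: open_nbhs_nbhs; split => //; rewrite /F /= !scale0r !addr0.
  exact: cF nU.
exists e => // s t sse tte; split => //.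
  move=> x; have [xr|] := leP `|x| (Num.max r1 r2); first exact: (He s t x).
  by rewrite gt_max => /andP[x1 x2]; rewrite er // zr // !scaler0 !addr0.
exists (Num.max r (Num.max r1 r2)) => x; rewrite !gt_max => /and3P[x0 x1 x2].
have d1 := smooth_is_derive x su; have d2 := smooth_is_derive x se.
have d3 := smooth_is_derive x sz.
have D := is_deriveD (is_deriveD d1 (is_deriveZ s d2)) (is_deriveZ t d3).
rewrite (is_derive1 D) ur // (compact_derive1 er) // (compact_derive1 zr) //.
by rewrite !scaler0 !addr0.
Qed.

Lemma finite_small n (Q : 'I_n -> R -> Prop) :
  (forall i d d', Q i d -> d' <= d -> Q i d') ->
  (forall i, exists2 d, 0 < d & Q i d) -> exists2 d, 0 < d & forall i, Q i d.
Proof.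
move=> mQ H; have /choice [d Hd] : forall i, exists d, 0 < d /\ Q i d.
  by move=> i; have [d d0 q] := H i; exists d.
exists (\big[Num.min/1]_i d i); first by apply: lt_bigmin => // i _; have [] := Hd i.
by move=> i; have [_ q] := Hd i; apply: mQ q _; exact: bigmin_le_cond.
Qed.

End Pairing.

(** * Second variations of functionals *)

Section SecondVariation.
Context {R : realType} {N : nat}.
Notation path := (R -> 'rV[R]_N).
Variables (U : set 'rV[R]_N) (oU : open U).

(** The Hessian of [I] at [u] applied to [eta], taken pointwise in x. *)
Definition vder2 (I : path -> R) (u eta : path) : path :=
  fun x => derive1 (fun t : R => vder I (fun y => u y + t *: eta y) x) 0.

Lemma perturb0 (u zeta : path) s (eta : path) :
  (fun y => u y + s *: eta y + 0 *: zeta y) = (fun y => u y + s *: eta y).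
Proof. by apply/funext => y; rewrite scale0r addr0. Qed.

Lemma perturb0l (u zeta : path) s (eta : path) :
  (fun y => u y + 0 *: zeta y + s *: eta y) = (fun y => u y + s *: eta y).
Proof. by apply/funext => y; rewrite scale0r addr0. Qed.

(** Converts the smoothness of a functional into uniform estimates: common support, bounds, and a
    first-order expansion of the variational derivative. The bound on the x-derivative is there
    because operators differentiate their covector argument. *)
Lemma functional_expansion (I : path -> R) (u eta zeta : path) :
  functional U I -> field U u -> test_fun eta -> test_fun zeta ->
  let v s t := vder I (fun x => u x + s *: eta x + t *: zeta x) in
  exists e r M, [/\ 0 < e, 0 <= r & 0 <= M] /\
  [/\ forall s t, `|s| < e -> `|t| < e ->
        field U (fun x => u x + s *: eta x + t *: zeta x) /\
        forall x, r < `|x| -> v s t x = 0,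
      forall s t x i, `|s| < e -> `|t| < e ->
        `|v s t x 0 i| <= M /\ `|derive1 (v s t) x 0 i| <= M,
      forall eps, 0 < eps -> exists2 d, 0 < d & forall s t x i, `|s| < d -> `|t| < d ->
        `|v s t x 0 i - v 0 0 x 0 i| <= eps /\
        `|v s t x 0 i - v 0 0 x 0 i - s * vder2 I u eta x 0 i - t * vder2 I u zeta x 0 i|
           <= eps * (`|s| + `|t|),
      test_fun (vder2 I u eta) &
      forall x, r < `|x| -> vder2 I u eta x = 0 /\ vder2 I u zeta x = 0].
Proof.
move=> [fI1 fI2] fu te tz v.
have [e1 e10 He1] := field_perturb oU fu te tz.
pose D (p : R * R * R) := vder I (fun x => u x + p.1.1 *: eta x + p.1.2 *: zeta x) p.2.
have [e2 [r [e20 [sD Dr]]]] : exists e r, 0 < e /\ smooth_on (strip e) D /\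
    (forall p, strip e p -> r < `|p.2| -> D p = 0) by exact: fI2.
have sF i : smooth_on (strip e2) (fun p => D p 0 i).
  by apply: smooth_coord => //; exact: open_strip.
have in0 x : strip e2 (0, 0, x) by rewrite /strip /= normr0.
have dD p : strip e2 p -> differentiable D p by exact: smooth_differentiable.
have E1 x : vder2 I u eta x = 'D_(1, 0, 0) D (0, 0, x).
  have := @is_derive_line _ _ _ D (0, 0, x) (1, 0, 0) 0.
  rewrite scale0r addr0 => /(_ (dD _ (in0 x))) H; rewrite -(is_derive1 H) /vder2.
  congr (derive1 _ 0); apply/funext => t; rewrite /D /=.
  rewrite !add0r [t *: 1]mulr1 [t *: 0]mulr0 addr0; congr (vder I _ x).
  by apply/funext => y; rewrite scale0r addr0.
have E2 x : vder2 I u zeta x = 'D_(0, 1, 0) D (0, 0, x).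
  have := @is_derive_line _ _ _ D (0, 0, x) (0, 1, 0) 0.
  rewrite scale0r addr0 => /(_ (dD _ (in0 x))) H; rewrite -(is_derive1 H) /vder2.
  congr (derive1 _ 0); apply/funext => t; rewrite /D /=.
  rewrite !add0r [t *: 1]mulr1 [t *: 0]mulr0 addr0; congr (vder I _ x).
  by apply/funext => y; rewrite scale0r addr0.
have Ei d p i : strip e2 p -> 'D_d D p 0 i = 'D_d (fun p => D p 0 i) p.
  move=> sp; have := is_derive_coord 0 i (derivableP (diff_derivable (v := d) (dD _ sp))).
  by case=> _ ->.
have E3 s t x i : `|s| < e2 -> `|t| < e2 ->
    derive1 (v s t) x 0 i = 'D_(0, 0, 1) (fun p => D p 0 i) (s, t, x).
  move=> se ste; have L : (s, t, 0) + x *: (0, 0, 1) = (s, t, x) :> R * R * R.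
    by congr (_, _, _); rewrite /= ?[_ *: 0]mulr0 ?addr0 // [_ *: 1]mulr1 add0r.
  have := @is_derive_line _ _ _ D (s, t, 0) (0, 0, 1) x.
  rewrite L => /(_ (dD _ (strip_line x se ste))) H; rewrite -Ei // -(is_derive1 H).
  have -> // : v s t = (fun y => D ((s, t, 0) + y *: (0, 0, 1))).
  apply/funext => y; rewrite /D /= /v.
  by rewrite ?[_ *: 0]mulr0 ?addr0 // [_ *: 1]mulr1 add0r.
have cF i x : {for (0, 0, x), continuous (fun p => D p 0 i)}.
  exact: smooth_continuous (sF i) (in0 x).
have cF3 i x : {for (0, 0, x), continuous (fun p => 'D_(0, 0, 1) (fun p => D p 0 i) p)}.
  have sd := smooth_derive ((0, 0, 1) : R * R * R) (sF i); exact: smooth_continuous sd (in0 x).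
have vr s t x : `|s| < e2 -> `|t| < e2 -> r < `|x| -> v s t x = 0.
  by move=> se ste rx; apply: (Dr (s, t, x)).
pose r' := Num.max r 0.
have vr' s t x : `|s| < e2 -> `|t| < e2 -> r' < `|x| -> v s t x = 0.
  by move=> se ste rx; apply: vr => //; apply: le_lt_trans rx; rewrite le_max lexx.
have v2 x : r' < `|x| -> vder2 I u eta x = 0 /\ vder2 I u zeta x = 0.
  move=> rx; rewrite /vder2.
  split; rewrite (_ : 0 = derive1 (cst 0 : R -> 'rV[R]_N) 0); try (by rewrite derive1E derive_cst);
    apply: derive1_near; near=> t.
    by rewrite -(perturb0 u zeta); apply: vr'; rewrite ?normr0 //; near: t; exact: nbhs0_lt.
  by rewrite -(perturb0l u eta); apply: vr'; rewrite ?normr0 //; near: t; exact: nbhs0_lt.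
have tv2 : test_fun (vder2 I u eta).
  split; last by exists r' => x rx; exact: (v2 x rx).1.
  rewrite (_ : vder2 I u eta = (fun x => (fun p => 'D_(1, 0, 0) D p) ((0, 0, 0) + x *: (0, 0, 1)))).
    have sd := smooth_derive ((1, 0, 0) : R * R * R) sD.
    move=> k; apply: (Ck_line (f := fun p => 'D_(1, 0, 0) D p) _ _ (sd k)); first exact: openT.
    by move=> x _; rewrite /strip /= ![_ *: 0]mulr0 !addr0 normr0.
  apply/funext => x; rewrite E1.
  have -> // : (0, 0, 0) + x *: (0, 0, 1) = (0, 0, x) :> R * R * R.
  by congr (_, _, _); rewrite /= ?[_ *: 0]mulr0 ?addr0 // [_ *: 1]mulr1 add0r.
have /choice [B HB] : forall i, exists q : R * R, [/\ 0 <= q.1, 0 < q.2 &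
    forall s t x, `|s| < q.2 -> `|t| < q.2 -> `|x| <= r' ->
      `|D (s, t, x) 0 i| <= q.1 /\ `|'D_(0, 0, 1) (fun p => D p 0 i) (s, t, x)| <= q.1].
  move=> i; have [M1 [d1 [d10 [M10 H1]]]] := uniform_bound r' (cF i).
  have [M2 [d2 [d20 [M20 H2]]]] := uniform_bound r' (cF3 i).
  exists (M1 + M2, Num.min d1 d2) => /=; split; [exact: addr_ge0|by rewrite lt_min d10|].
  move=> s t x; rewrite !lt_min => /andP[s1 s2] /andP[t1 t2] xr.
  by split; [apply: le_trans (H1 _ _ _ s1 t1 xr) _; rewrite lerDl |
             apply: le_trans (H2 _ _ _ s2 t2 xr) _; rewrite lerDr].
have [e3 e30 He3] : exists2 e3, 0 < e3 & forall i, e3 <= (B i).2.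
  apply: (@finite_small _ _ (fun i d => d <= (B i).2)); first by move=> i d d' h /le_trans; apply.
  by move=> i; exists (B i).2 => //; have [] := HB i.
pose M := \sum_i (B i).1.
have BM i : (B i).1 <= M.
  by rewrite /M (bigD1 i) //= lerDl sumr_ge0 // => j _; have [] := HB j.
have M0 : 0 <= M by rewrite sumr_ge0 // => j _; have [] := HB j.
exists (Num.min e1 (Num.min e2 e3)), r', M; split.
  by split => //; [rewrite !lt_min e10 e20 e30 | rewrite le_max lexx orbT].
split => //.
- move=> s t; rewrite !lt_min => /and3P[s1 s2 s3] /and3P[t1 t2 t3].
  by split; [exact: He1 | move=> x; exact: vr'].
- move=> s t x i; rewrite !lt_min => /and3P[s1 s2 s3] /and3P[t1 t2 t3].
  have [_ _ /(_ s t x)] := HB i; have [xr|xr] := leP `|x| r'.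
    case=> //; [exact: lt_le_trans (He3 i)|exact: lt_le_trans (He3 i)|].
    by move=> h1 h2; rewrite E3 //; split; [exact: le_trans h1 (BM i)|exact: le_trans h2 (BM i)].
  move=> _; rewrite (compact_derive1 (f := v s t) (r := r')) //; last by move=> y; exact: vr'.
  by rewrite vr' // mxE normr0.
- move=> eps eps0.
  have [d d0 Hd] : exists2 d, 0 < d & forall i, forall s t x, `|s| < d -> `|t| < d -> `|x| <= r' ->
     `|D (s, t, x) 0 i - D (0, 0, x) 0 i| <= eps /\
     `|D (s, t, x) 0 i - D (0, 0, x) 0 i - s * vder2 I u eta x 0 i - t * vder2 I u zeta x 0 i|
     <= eps * (`|s| + `|t|).
    apply: (@finite_small _ _ (fun i d => forall s t x, `|s| < d -> `|t| < d -> `|x| <= r' -> _)).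
      by move=> i d d' H dd s t x sd td; apply: H; exact: lt_le_trans dd.
    move=> i; have [d1 d10 H1] := uniform_continuity r' eps0 (cF i).
    have [d2 d20 H2] := uniform_expansion r' e20 eps0 (sF i 1%N).
    exists (Num.min d1 d2); first by rewrite lt_min d10.
    move=> s t x; rewrite !lt_min => /andP[s1 s2] /andP[t1 t2] xr; split; first exact: H1.
    have K := H2 s t x s2 t2 xr.
    have e1' := Ei (1, 0, 0) (0, 0, x) i (in0 x).
    have e2' := Ei (0, 1, 0) (0, 0, x) i (in0 x).
    rewrite -E1 in e1'; rewrite -E2 in e2'.
    by rewrite -e1' -e2' in K.
  exists (Num.min d e2); first by rewrite lt_min d0.
  move=> s t x i; rewrite !lt_min => /andP[s1 s2] /andP[t1 t2].
  have [xr|xr] := leP `|x| r'; first exact: (Hd i s t x).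
  have [-> ->] := v2 x xr; rewrite !vr' ?normr0 // !mxE !mulr0 !subr0 normr0.
  by split; [exact: ltW | by apply: mulr_ge0; [exact: ltW | exact: addr_ge0]].
Unshelve. all: by end_near. Qed.

End SecondVariation.

(** * Self-adjointness of the second variation *)

Section SelfAdjoint.
Context {R : realType} {N : nat}.
Notation path := (R -> 'rV[R]_N).
Variables (U : set 'rV[R]_N) (oU : open U).

Lemma test_bounded_row (f : path) : test_fun f ->
  exists2 M, 0 <= M & forall x i, `|f x 0 i| <= M.
Proof.
move=> tf; have /choice [B HB] : forall i, exists B, 0 <= B /\ forall x, `|f x 0 i| <= B.
  by move=> i; have [B ? ?] := test_bounded (test_coord 0 i tf); exists B.
have B0 j : 0 <= B j by have [] := HB j.
exists (\sum_i B i); first exact: sumr_ge0.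
move=> x i; have [_ Bi] := HB i; apply: le_trans (Bi x) _.
by rewrite (bigD1 i) //= lerDl sumr_ge0.
Qed.

Lemma vder2_test (I : path -> R) (u eta : path) :
  functional U I -> field U u -> test_fun eta -> test_fun (vder2 I u eta).
Proof.
move=> fI fu te; have [e [r [M [_ []]]]] := functional_expansion oU fI fu te te.
by [].
Qed.

Lemma is_derive_functional (I : path -> R) (u eta : path) (s : R) :
  functional U I -> field U (fun x => u x + s *: eta x) -> test_fun eta ->
  is_derive s 1 (fun t => I (fun x => u x + t *: eta x))
    (pairing (vder I (fun x => u x + s *: eta x)) eta).
Proof.
move=> [fI1 _] fu te; have [_ /(_ eta te) H] := fI1 _ fu.
have ds : is_derive s 1 (fun t : R => t - s) 1.
  by have := is_deriveB (is_derive_id s 1) (is_derive_cst s s 1); rewrite subr0.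
rewrite -(subrr s) in H.
have D := @is_derive_comp1 _ (fun t => I (fun x => u x + s *: eta x + t *: eta x))
  (fun t => t - s) s _ _ H ds.
rewrite mul1r in D.
rewrite (_ : (fun t => _) = (fun t => I (fun x => u x + s *: eta x + (t - s) *: eta x))) //.
apply/funext => t; congr I; apply/funext => x.
by rewrite -addrA -scalerDl; congr (_ + _ *: _); ring.
Qed.

(** The mean value theorem in direction [eta] produces a difference of two variational derivatives,
    whose expansion in direction [zeta] is the Hessian. *)
Lemma mixed_difference (I : path -> R) (u eta zeta : path) :
  functional U I -> field U u -> test_fun eta -> test_fun zeta ->
  exists2 C, 0 <= C & forall eps, 0 < eps -> exists2 d, 0 < d &
   forall h, 0 < h -> h < d ->
   `|I (fun x => u x + h *: eta x + h *: zeta x) - I (fun x => u x + 0 *: eta x + h *: zeta x)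
     - (I (fun x => u x + h *: eta x + 0 *: zeta x) - I (fun x => u x + 0 *: eta x + 0 *: zeta x))
     - h ^+ 2 * pairing (vder2 I u zeta) eta| <= C * eps * h ^+ 2.
Proof.
move=> fI fu te tz.
have [e [r [M [[e0 r0 M0] [Hf _ Hx tv2 v2r]]]]] := functional_expansion oU fI fu te tz.
have tv2z := vder2_test fI fu tz.
have [Me Me0 HMe] := test_bounded_row te.
(* The shape comes from [pairing_bound]. The 4 absorbs the errors eps (s + h) and eps s of two
   expansions, where s < h is the intermediate point. *)
exists (2 * r * (N%:R * (4 * Me))); first by rewrite !mulr_ge0.
move=> eps eps0; have [d d0 Hd] := Hx eps eps0.
exists (Num.min d e); first by rewrite lt_min d0.
move=> h h0; rewrite lt_min => /andP[hd he].
pose w s t : path := fun x => u x + s *: eta x + t *: zeta x.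
have nh : `|h| = h by rewrite gtr0_norm.
have fw s t : `|s| < e -> `|t| < e -> field U (w s t) by move=> se ste; have [] := Hf s t se ste.
have tvw s t : `|s| < e -> `|t| < e -> test_fun (vder I (w s t)).
  by move=> se ste; have [] := fI.1 _ (fw s t se ste).
have dw (s t : R) : `|s| < e -> `|t| < e ->
    is_derive s 1 (fun s => I (w s t)) (pairing (vder I (w s t)) eta).
  move=> se ste.
  have Es s' : w s' t = (fun x => (u x + t *: zeta x) + s' *: eta x).
    by apply/funext => x; rewrite /w addrAC.
  have := @is_derive_functional I (fun x => u x + t *: zeta x) eta s fI.
  rewrite -Es => /(_ (fw _ _ se ste) te).
  by rewrite (_ : (fun t0 => _) = (fun s => I (w s t))) //; apply/funext => s'; rewrite Es.
pose F s := I (w s h) - I (w s 0).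
pose dF s := pairing (vder I (w s h)) eta - pairing (vder I (w s 0)) eta.
have DF (s : R) : 0 <= s <= h -> is_derive s 1 F (dF s).
  move=> /andP[s0 sh]; have se : `|s| < e by rewrite ger0_norm //; apply: le_lt_trans he.
  by apply: is_deriveB; apply: dw; rewrite ?nh ?normr0.
have [||s sh E] := @MVT R F dF 0 h h0.
- by move=> y; rewrite in_itv /= => /andP[y0 y1]; apply: DF; rewrite !ltW.
- apply: derivable_within_continuous => y; rewrite in_itv /= => y01.
  by have := DF y y01; case.
move: sh; rewrite in_itv /= => /andP[s0 sh].
have ns : `|s| = s by rewrite gtr0_norm.
rewrite -/(w h h) -/(w 0 h) -/(w h 0) -/(w 0 0).
have -> : I (w h h) - I (w 0 h) - (I (w h 0) - I (w 0 0)) = F h - F 0.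
  by rewrite /F; ring.
rewrite E subr0 /dF.
have se : `|s| < e by rewrite ns; exact: lt_trans he.
have he' : `|h| < e by rewrite nh.
have e00 : `|0 : R| < e by rewrite normr0.
have ce := test_continuous te.
rewrite -pairingBl //; [|exact: tvw|exact: tvw].
have -> : forall a b : R, a * h - h ^+ 2 * b = h * (a - h * b) by move=> a b; ring.
have t1 : test_fun (fun x => vder I (w s h) x - vder I (w s 0) x) by apply: testB; exact: tvw.
have t2 : test_fun (fun x => h *: vder2 I u zeta x) by exact: testZ.
rewrite -pairingZl // -(pairingBl t1 t2 ce) normrM nh.
have P : `|pairing (fun x => vder I (w s h) x - vder I (w s 0) x - h *: vder2 I u zeta x) eta|
    <= 2 * r * (N%:R * ((eps * (4 * h)) * Me)).
  apply: pairing_bound => //.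
  - exact: testB t1 t2.
  - move=> x rx; have [_ H1] := Hf s h se he'; have [_ H2] := Hf s 0 se e00.
    by rewrite H1 // H2 // (v2r x rx).2 scaler0 !subr0.
  - move=> x i; rewrite !mxE.
    have sd : `|s| < d by rewrite ns; exact: lt_trans hd.
    have hd' : `|h| < d by rewrite nh.
    have d00 : `|0 : R| < d by rewrite normr0.
    have [_ h2] := Hd s h x i sd hd'; have [_ h1] := Hd s 0 x i sd d00.
    rewrite ns normr0 addr0 mul0r subr0 -/(w s 0) -/(w 0 0) in h1.
    rewrite nh ns -/(w s h) -/(w 0 0) in h2.
    set A := vder I (w s 0) x 0 i in h1 *; set B := vder I (w 0 0) x 0 i in h1 h2 *.
    set C := vder I (w s h) x 0 i in h2 *.
    set a := vder2 I u eta x 0 i in h1 h2; set b := vder2 I u zeta x 0 i in h1 h2 *.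
    clearbody A B C a b.
    have := ler_normB (C - B - s * a - h * b) (A - B - s * a).
    have -> : C - B - s * a - h * b - (A - B - s * a) = C - A - h * b by ring.
    move/le_trans; apply; apply: le_trans (lerD h2 h1) _.
    rewrite -mulrDr; apply: ler_wpM2l; first exact: ltW.
    by lra.
have -> : 2 * r * (N%:R * (4 * Me)) * eps * h ^+ 2 = h * (2 * r * (N%:R * ((eps * (4 * h)) * Me))).
  by ring.
by apply: ler_wpM2l => //; exact: ltW.
Qed.

(** The mixed second difference of [I] is symmetric in [eta] and [zeta]; after division by h^2 both
    pairings are its limit. *)
Lemma vder2_selfadjoint (I : path -> R) (u eta zeta : path) :
  functional U I -> field U u -> test_fun eta -> test_fun zeta ->
  pairing (vder2 I u eta) zeta = pairing (vder2 I u zeta) eta.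
Proof.
move=> fI fu te tz.
have [C C0 HC] := mixed_difference fI fu te tz.
have [C' C0' HC'] := mixed_difference fI fu tz te.
set a := pairing _ _ in HC' *; set b := pairing _ _ in HC *.
apply/eqP; rewrite -subr_eq0 -normr_le0; apply/ler_addgt0Pl => eps eps0; rewrite addr0.
pose eps' := eps / (C + C' + 1).
have CC : 0 < C + C' + 1 by lra.
have eps0' : 0 < eps' by exact: divr_gt0.
have [d d0 Hd] := HC _ eps0'; have [d' d0' Hd'] := HC' _ eps0'.
pose h := Num.min d d' / 2.
have m0 : 0 < Num.min d d' by rewrite lt_min d0.
have h0 : 0 < h by exact: divr_gt0.
have hm : h < Num.min d d' by rewrite /h; lra.
have /andP[hd hd'] : (h < d) && (h < d') by rewrite -lt_min.
have := Hd h h0 hd; have := Hd' h h0 hd'.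
have sw s t : (fun x => u x + s *: zeta x + t *: eta x) = (fun x => u x + t *: eta x + s *: zeta x).
  by apply/funext => x; rewrite addrAC.
rewrite !sw.
set i1 := I _; set i2 := I _; set i3 := I _; set i4 := I _.
clearbody i1 i2 i3 i4 a b.
move=> Ka Kb.
have h2 : 0 < h ^+ 2 by exact: exprn_gt0.
have := ler_normB (i1 - i3 - (i2 - i4) - h ^+ 2 * b) (i1 - i2 - (i3 - i4) - h ^+ 2 * a).
have -> : i1 - i3 - (i2 - i4) - h ^+ 2 * b - (i1 - i2 - (i3 - i4) - h ^+ 2 * a) =
  h ^+ 2 * (a - b) by ring.
move=> /le_trans /(_ (lerD Kb Ka)); rewrite -mulrDl -mulrDl normrM (gtr0_norm h2).
rewrite mulrC ler_pM2r // => /le_trans; apply.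
rewrite /eps' mulrA ler_pdivrMr // mulrC; apply: ler_wpM2l; [exact: ltW | lra].
Qed.

End SelfAdjoint.

(** * The Jacobi identity and the Schouten bracket *)

#[local] Opaque vder2 vder pairing.

Section NearZero.
Context {R : realType}.

Lemma near0P (P : R -> Prop) :
  (exists2 d, 0 < d & forall t, `|t| < d -> P t) <-> \forall t \near (0 : R), P t.
Proof.
split=> [[d d0 H]|[d /= d0 H]].
  by exists d => // t /=; rewrite sub0r normrN; exact: H.
by exists d => // t td; apply: H; rewrite /= sub0r normrN.
Qed.

Lemma is_derive_near (F : R -> R) (v : R) :
  (forall eps, 0 < eps -> \forall t \near (0 : R), `|F t - F 0 - t * v| <= eps * `|t|) ->
  is_derive (0 : R) 1 F v.
Proof. by move=> H; apply: is_derive_small => eps /H /near0P. Qed.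

Lemma derive_near (F : R -> R) (v eps : R) : is_derive (0 : R) 1 F v -> 0 < eps ->
  \forall t \near (0 : R), `|F t - F 0 - t * v| <= eps * `|t|.
Proof. by move=> H e0; apply/near0P; exact: derive_small. Qed.

Lemma derive_near_cvg (F : R -> R) (v eps : R) : is_derive (0 : R) 1 F v -> 0 < eps ->
  \forall t \near (0 : R), `|F t - F 0| <= eps.
Proof.
move=> [d _] e0; have /derivable1_diffP /differentiable_continuous := d.
move=> /cvgrPdist_le /(_ eps e0); apply: filterS => t.
by rewrite distrC.
Qed.

End NearZero.

(** The numerical end of [bracket_is_vder]: [a1] is the bracket at the perturbed field, [b2] its
    value at [u], and [b4 - a9 + b3] the proposed derivative. The other variables are the
    intermediate pairings. *)
Lemma remainder_bound {R : realType} (t C ep M2 Mf1 Mf : R)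
    (a1 a2 a3 a4 a5 a6 a7 a8 a9 b1 b2 b3 b4 : R) :
  `|a1 - a2 - t * - a3| <= C * (ep * `|t| * M2) ->
  `|a3 - a4| <= C * (ep * Mf1) ->
  `|a6 - a7 - t * a8| <= C * (ep * `|t| * Mf) ->
  `|a4 - a5| <= ep -> `|a8 - a9| <= ep -> `|b1 - b2 - t * b3| <= ep * `|t| ->
  b4 = - a5 -> a2 = - a6 -> a7 = - b1 ->
  `|a1 - b2 - t * (b4 - a9 + b3)| <= ep * (C * M2 + C * Mf1 + C * Mf + 3) * `|t|.
Proof.
move=> T1 T2 T3 D2 D4 D5 s1 s2 s3.
have -> : a1 - b2 - t * (b4 - a9 + b3) =
   (a1 - a2 - t * (- a3)) - t * ((a3 - a4) + (a4 - a5)) - (a6 - a7 - t * a8) - t * (a8 - a9)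
   + (b1 - b2 - t * b3).
  by rewrite s1 s2 s3; ring.
move: (a1 - a2 - t * - a3) T1 (a3 - a4) T2 (a6 - a7 - t * a8) T3 (a4 - a5) D2 (a8 - a9) D4
  (b1 - b2 - t * b3) D5 => c1 T1 c2 T2 c3 T3 c4 D2 c5 D4 c6 D5.
have n1 := ler_normD (c1 - t * (c2 + c4) - c3 - t * c5) c6.
have n2 := ler_normB (c1 - t * (c2 + c4) - c3) (t * c5).
have n3 := ler_normB (c1 - t * (c2 + c4)) c3.
have n4 := ler_normB c1 (t * (c2 + c4)).
have n5 := ler_normD c2 c4.
rewrite normrM in n2; rewrite normrM in n4.
have tn := normr_ge0 t.
have m1 : `|t| * `|c5| <= `|t| * ep by apply: ler_wpM2l.
have m2 : `|t| * `|c2 + c4| <= `|t| * (C * (ep * Mf1) + ep).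
  by apply: ler_wpM2l => //; lra.
have EK : ep * (C * M2 + C * Mf1 + C * Mf + 3) * `|t| = C * (ep * `|t| * M2) +
    `|t| * (C * (ep * Mf1) + ep) + C * (ep * `|t| * Mf) + `|t| * ep + ep * `|t| by ring.
rewrite EK; lra.
Qed.

Section Jacobi.
Context {R : realType} {N : nat}.
Notation path := (R -> 'rV[R]_N).
Variables (U : set 'rV[R]_N) (oU : open U).

(** What the computation of a bracket asks of an operator: it yields test functions, its variation
    in [u] is represented by a test covector, and it is bounded near [u]. In the bound the first
    covector enters by its values only, the second also by its first derivative. *)
Definition pre_operator (P : @operator R N) : Prop :=
  [/\ forall u h, field U u -> test_fun h -> test_fun (P u h),
      forall u f h, field U u -> test_fun f -> test_fun h ->
        exists2 G, test_fun G & forall eta, test_fun eta ->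
          is_derive (0 : R) (1 : R) (fun t : R => pairing f (P (fun x => u x + t *: eta x) h))
            (pairing G eta) &
      forall u eta r, field U u -> test_fun eta ->
        exists2 C, 0 <= C & \forall t \near (0 : R), forall (f h : path) (M1 M2 : R),
          test_fun f -> (forall x, r < `|x| -> f x = 0) -> test_fun h ->
          (forall x i, `|f x 0 i| <= M1) ->
          (forall x i, `|h x 0 i| <= M2 /\ `|derive1 h x 0 i| <= M2) ->
          `|pairing f (P (fun x => u x + t *: eta x) h)| <= C * (M1 * M2)].

Definition skew_operator (P : @operator R N) : Prop := forall u f h,
  field U u -> test_fun f -> test_fun h -> pairing f (P u h) = - pairing h (P u f).

Definition dop (P : @operator R N) (u f h eta : path) : R :=
  derive1 (fun t : R => pairing f (P (fun x => u x + t *: eta x) h)) 0.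

(** For P = Q this is the Jacobi expression on three covectors. Keeping two operators makes it
    bilinear, so that the bracket of a sum can be expanded. *)
Definition schouten (P Q : @operator R N) (u f h k : path) : R :=
  dop P u f h (Q u k) + dop P u h k (Q u f) + dop P u k f (Q u h).

Variables (P : @operator R N) (preP : pre_operator P) (skewP : skew_operator P).

Lemma dop_gradient u f h : field U u -> test_fun f -> test_fun h ->
  exists2 G, test_fun G & forall eta, test_fun eta -> dop P u f h eta = pairing G eta.
Proof.
move=> fu tf th; have [_ H _] := preP; have [G tG HG] := H u f h fu tf th.
by exists G => // eta te; exact: (is_derive1 (HG eta te)).
Qed.

Lemma test_bounded1 (f : path) : test_fun f ->
  exists2 M, 0 <= M & forall x i, `|f x 0 i| <= M /\ `|derive1 f x 0 i| <= M.
Proof.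
move=> tf; have [M1 M10 H1] := test_bounded_row tf.
have [M2 M20 H2] := test_bounded_row (test_derive1 tf).
exists (M1 + M2) => [|x i]; first exact: addr_ge0.
by split; [apply: le_trans (H1 x i) _; rewrite lerDl | apply: le_trans (H2 x i) _; rewrite lerDr].
Qed.

Lemma functional_near (I : path -> R) (u eta : path) :
  functional U I -> field U u -> test_fun eta ->
  let v t := vder I (fun x => u x + t *: eta x) in
  exists r M, [/\ 0 <= M,
    \forall t \near (0 : R), [/\ field U (fun x => u x + t *: eta x), test_fun (v t),
        forall x, r < `|x| -> v t x = 0 &
        forall x i, `|v t x 0 i| <= M /\ `|derive1 (v t) x 0 i| <= M],
    forall eps, 0 < eps -> \forall t \near (0 : R), forall x i,
        `|v t x 0 i - vder I u x 0 i| <= eps /\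
        `|v t x 0 i - vder I u x 0 i - t * vder2 I u eta x 0 i| <= eps * `|t| &
    forall x, r < `|x| -> vder I u x = 0 /\ vder2 I u eta x = 0].
Proof.
move=> fI fu te v.
have [e [r [M [[e0 r0 M0] [Hf Hb Hx tv2 v2r]]]]] := functional_expansion oU fI fu te te.
have E t : (fun x => u x + t *: eta x + 0 *: eta x) = (fun x => u x + t *: eta x).
  by apply/funext => x; rewrite scale0r addr0.
have E0 : (fun x => u x + 0 *: eta x + 0 *: eta x) = u.
  by apply/funext => x; rewrite !scale0r !addr0.
exists r, M; split => //.
- apply/near0P; exists e => // t te'; have := Hf t 0; rewrite normr0 => /(_ te' e0) [].
  rewrite E => ft vt; split => //; first by case: (fI.1 _ ft).
  by move=> x i; have := Hb t 0 x i; rewrite normr0 E => /(_ te' e0).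
- move=> eps eps0; have [d d0 Hd] := Hx eps eps0.
  apply/near0P; exists d => // t td x i; have := Hd t 0 x i; rewrite normr0 => /(_ td d0).
  by rewrite (E t) E0 mul0r subr0 addr0.
- move=> x rx; split; last by have [] := v2r x rx.
  by have := Hf 0 0; rewrite normr0 E0 => /(_ e0 e0) [_]; exact.
Qed.

(** A product rule in which the two Hessian terms are moved onto [P h] and [P f] by
    self-adjointness. The expansions control the variational derivatives but not the x-derivatives
    of their errors, so skew-symmetry is used to keep every error in the first slot of the
    pairing. *)
Lemma bracket_is_vder (I J : path -> R) (u G : path) :
  functional U I -> functional U J -> field U u -> test_fun G ->
  (forall eta, test_fun eta ->
    dop P u (vder I u) (vder J u) eta = pairing G eta) ->
  is_vder (bracket P I J) u
    (fun x => vder2 I u (P u (vder J u)) x - vder2 J u (P u (vder I u)) x + G x).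
Proof.
move=> fI fJ fu tG HG; have [N2 N4 N5] := preP.
pose f := vder I u; pose h := vder J u.
have tf : test_fun f by have [] := fI.1 u fu.
have th : test_fun h by have [] := fJ.1 u fu.
pose X := P u h; pose Y := P u f.
have tX : test_fun X by exact: N2.
have tY : test_fun Y by exact: N2.
have tf2 := vder2_test oU fI fu tX; have th2 := vder2_test oU fJ fu tY.
rewrite -/f -/h -/X -/Y; split; first by apply: testD => //; exact: testB.
move=> eta te.
pose f1 := vder2 I u eta; pose h1 := vder2 J u eta.
have tf1 : test_fun f1 by exact: (vder2_test oU fI fu te).
have th1 : test_fun h1 by exact: (vder2_test oU fJ fu te).
have -> : pairing (fun x => vder2 I u X x - vder2 J u Y x + G x) eta =
    pairing f1 X - pairing h1 Y + pairing G eta.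
  have ce := test_continuous te.
  rewrite (pairingDl (testB tf2 th2) tG ce) (pairingBl tf2 th2 ce).
  exact: (congr2 (fun a b => a - b + pairing G eta)
    (vder2_selfadjoint oU fI fu tX te) (vder2_selfadjoint oU fJ fu tY te)).
have Dop a c : test_fun a -> test_fun c -> is_derive (0 : R) 1
    (fun t : R => pairing a (P (fun x => u x + t *: eta x) c)) (dop P u a c eta).
  move=> ta tc; have [G' _ /(_ eta te) D] := N4 u a c fu ta tc.
  by rewrite /dop (is_derive1 D).
have u0 : (fun x => u x + 0 *: eta x) = u by apply/funext => x; rewrite scale0r addr0.
have [r1 [M1 [M10 near1 exp1 v1]]] := functional_near fI fu te.
have [r2 [M2 [M20 near2 exp2 v2]]] := functional_near fJ fu te.
pose r := Num.max r1 r2.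
have [C C0 HC] := N5 u eta r fu te.
have [Mf Mf0 HMf] := test_bounded1 tf; have [Mf1 Mf10 HMf1] := test_bounded1 tf1.
pose K := C * M2 + C * Mf1 + C * Mf + 3.
have K0 : 0 < K by rewrite /K; have := mulr_ge0 C0 M20; have := mulr_ge0 C0 Mf0;
  have := mulr_ge0 C0 Mf10; lra.
apply: is_derive_near => eps eps0.
pose ep := eps / K; have ep0 : 0 < ep by exact: divr_gt0.
pose w t : path := fun x => u x + t *: eta x.
pose vI t := vder I (w t); pose vJ t := vder J (w t).
have ne1 : \forall t \near (0 : R), forall x i, `|vI t x 0 i - f x 0 i| <= ep /\
    `|vI t x 0 i - f x 0 i - t * f1 x 0 i| <= ep * `|t| := exp1 ep ep0.
have ne2 : \forall t \near (0 : R), forall x i, `|vJ t x 0 i - h x 0 i| <= ep /\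
    `|vJ t x 0 i - h x 0 i - t * h1 x 0 i| <= ep * `|t| := exp2 ep ep0.
have nD5 : \forall t \near (0 : R),
    `|pairing f (P (w t) h) - pairing f X - t * pairing G eta| <= ep * `|t|.
  by have := derive_near (Dop f h tf th) ep0; rewrite HG // u0.
have nD2 : \forall t \near (0 : R), `|pairing h (P (w t) f1) - pairing h (P u f1)| <= ep.
  by have := derive_near_cvg (Dop h f1 th tf1) ep0; rewrite u0.
have nD4 : \forall t \near (0 : R), `|pairing h1 (P (w t) f) - pairing h1 Y| <= ep.
  by have := derive_near_cvg (Dop h1 f th1 tf) ep0; rewrite u0.
move: nD4; apply: filter_app; move: nD2; apply: filter_app; move: nD5; apply: filter_app.
move: HC; apply: filter_app; move: ne2; apply: filter_app; move: ne1; apply: filter_app.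
move: near2; apply: filter_app; move: near1; apply: filter_app; apply: filterE => t.
move=> [fut tft ftr ftM] [_ tht htr htM] e1 e2 bC D5 D2 D4.
rewrite -/(w t) in fut tft ftr ftM tht htr htM bC.
rewrite -/(vI t) in tft ftr ftM; rewrite -/(vJ t) in tht htr htM.
rewrite /bracket u0 -/f -/h -/X -/(w t) -/(vI t) -/(vJ t).
have tPf : continuous (P (w t) f) by apply: test_continuous; exact: N2.
have tPf1 : continuous (P (w t) f1) by apply: test_continuous; exact: N2.
have tPht : continuous (P (w t) (vJ t)) by apply: test_continuous; exact: N2.
have rx1 (x : R) : r < `|x| -> r1 < `|x| by apply: le_lt_trans; rewrite le_max lexx.
have rx2 (x : R) : r < `|x| -> r2 < `|x| by apply: le_lt_trans; rewrite le_max lexx orbT.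
have vf (x : R) : r1 < `|x| -> f x = 0 /\ f1 x = 0 by exact: v1.
have vh (x : R) : r2 < `|x| -> h x = 0 /\ h1 x = 0 by exact: v2.
have Tf := testB tft tf; have Th := testB tht th.
have T1 : `|pairing (vI t) (P (w t) (vJ t)) - pairing f (P (w t) (vJ t)) - t * pairing f1 (P (w t) (vJ t))|
    <= C * ((ep * `|t|) * M2).
  have Tz := testZ t tf1.
  rewrite -pairingZl // -pairingBl // -(pairingBl Tf Tz tPht).
  apply: bC => //; first exact: testB.
    by move=> x rx; have [z1 z2] := vf x (rx1 x rx); rewrite (ftr x (rx1 x rx)) z1 z2 scaler0 !subr0.
  by move=> x i; rewrite !mxE; have [] := e1 x i.
have T3 : `|pairing (vJ t) (P (w t) f) - pairing h (P (w t) f) - t * pairing h1 (P (w t) f)|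
    <= C * ((ep * `|t|) * Mf).
  have Tz := testZ t th1.
  rewrite -pairingZl // -pairingBl // -(pairingBl Th Tz tPf).
  apply: bC => //; first exact: testB.
    by move=> x rx; have [z1 z2] := vh x (rx2 x rx); rewrite (htr x (rx2 x rx)) z1 z2 scaler0 !subr0.
  by move=> x i; rewrite !mxE; have [] := e2 x i.
have T2 : `|pairing (vJ t) (P (w t) f1) - pairing h (P (w t) f1)| <= C * (ep * Mf1).
  rewrite -pairingBl //; apply: bC => //.
    by move=> x rx; have [z1 z2] := vh x (rx2 x rx); rewrite (htr x (rx2 x rx)) z1 subr0.
  by move=> x i; rewrite !mxE; have [] := e2 x i.
(* The linear term is turned around to match [T2], where the difference of [vJ t] and [h] stands in
   the first slot. *)
rewrite (skewP fut tf1 tht) in T1.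
have s1 := skewP fu tf1 th; rewrite -/X in s1.
have s2 := skewP fut tf tht; have s3 := skewP fut th tf.
have -> : eps = ep * K by rewrite /ep divfK // gt_eqF.
by apply: (@remainder_bound R) T1 T2 T3 D2 D4 D5 s1 s2 s3.
Qed.

(** Each of the three iterated brackets contributes two Hessian terms; the six cancel in pairs by
    self-adjointness and only the variations of [P] remain. *)
Lemma jacobi_schouten (I J K : path -> R) (u : path) :
  functional U I -> functional U J -> functional U K -> field U u ->
  bracket P (bracket P I J) K u + bracket P (bracket P J K) I u
    + bracket P (bracket P K I) J u =
  schouten P P u (vder I u) (vder J u) (vder K u).
Proof.
move=> fI fJ fK fu; have [N2 _ _] := preP.
have tI : test_fun (vder I u) by have [] := fI.1 u fu.
have tJ : test_fun (vder J u) by have [] := fJ.1 u fu.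
have tK : test_fun (vder K u) by have [] := fK.1 u fu.
have tPI := N2 u _ fu tI; have tPJ := N2 u _ fu tJ; have tPK := N2 u _ fu tK.
have main A B C : functional U A -> functional U B -> functional U C ->
  test_fun (vder A u) -> test_fun (vder B u) -> test_fun (P u (vder C u)) ->
  test_fun (P u (vder A u)) -> test_fun (P u (vder B u)) ->
  bracket P (bracket P A B) C u = pairing (vder2 A u (P u (vder B u))) (P u (vder C u))
    - pairing (vder2 B u (P u (vder A u))) (P u (vder C u))
    + dop P u (vder A u) (vder B u) (P u (vder C u)).
  move=> fA fB fC tA tB tPC tPA tPB; have [G tG HG] := dop_gradient fu tA tB.
  rewrite /bracket (vderE (bracket_is_vder fA fB fu tG HG)) HG //.
  have t1 := vder2_test oU fA fu tPB; have t2 := vder2_test oU fB fu tPA.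
  have ce := test_continuous tPC.
  by rewrite (pairingDl (testB t1 t2) tG ce) (pairingBl t1 t2 ce).
rewrite /schouten !main //.
have E1 := vder2_selfadjoint oU fI fu tPJ tPK.
have E2 := vder2_selfadjoint oU fJ fu tPK tPI.
have E3 := vder2_selfadjoint oU fK fu tPI tPJ.
move: E1 E2 E3.
generalize (pairing (vder2 I u (P u (vder J u))) (P u (vder K u))).
generalize (pairing (vder2 I u (P u (vder K u))) (P u (vder J u))).
generalize (pairing (vder2 J u (P u (vder K u))) (P u (vder I u))).
generalize (pairing (vder2 J u (P u (vder I u))) (P u (vder K u))).
generalize (pairing (vder2 K u (P u (vder I u))) (P u (vder J u))).
generalize (pairing (vder2 K u (P u (vder J u))) (P u (vder I u))).
generalize (dop P u (vder I u) (vder J u) (P u (vder K u))).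
generalize (dop P u (vder J u) (vder K u) (P u (vder I u))).
generalize (dop P u (vder K u) (vder I u) (P u (vder J u))).
by move=> d1 d2 d3 a1 a2 a3 a4 a5 a6 -> -> ->; ring.
Qed.

End Jacobi.

Section Projections.
Context {R : realType}.

Lemma smooth_linear (V W : normedModType R) (A : set V) (L : V -> W) :
  linear L -> continuous L -> smooth_on A L.
Proof.
move=> lL cL k; pose L' := GRing.isLinear.Build _ _ _ _ L lL.
pose LL : {linear V -> W} := HB.pack L L'.
exact: (@Ck_linear _ _ _ k A LL).
Qed.

Lemma smooth_snd (A : set (R * R * R)) : smooth_on A (fun p => p.2).
Proof. by apply: smooth_linear => // p; exact: cvg_snd. Qed.

Lemma smooth_fst1 (A : set (R * R * R)) : smooth_on A (fun p => p.1.1).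
Proof.
by apply: smooth_linear => // p; apply: (cvg_comp fst fst); exact: cvg_fst.
Qed.

End Projections.

(** * Reduction of the Hamiltonian property to test covectors *)

Section LinearFunctionals.
Context {R : realType} {N : nat}.
Notation path := (R -> 'rV[R]_N).
Variables (U : set 'rV[R]_N) (oU : open U).

Definition linear_functional (c : path) : path -> R := pairing c.

Lemma linear_functional_is_vder (c u : path) : test_fun c -> field U u ->
  is_vder (linear_functional c) u c.
Proof.
move=> tc [su _ _]; split => // eta te; apply: is_derive_small => eps eps0.
exists 1 => // t _; rewrite /linear_functional.
have cu := smoothT_continuous su; have ce := test_continuous te.
have ct a : continuous (fun x => a *: eta x) by move=> x; apply: cvgZl_tmp; exact: ce.
rewrite pairingDr // (pairingDr (Y := fun x => 0 *: eta x)) // !pairingZr //.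
rewrite mul0r addr0 (_ : _ - _ - _ = 0) ?normr0; last by ring.
by rewrite mulr_ge0 // ltW.
Qed.

Lemma linear_functional_functional (c : path) : test_fun c ->
  functional U (linear_functional c).
Proof.
move=> tc; have V u : field U u -> vder (linear_functional c) u = c.
  by move=> fu; apply: vderE; exact: linear_functional_is_vder.
split=> [u fu|u eta zeta fu te tz]; first by rewrite V //; exact: linear_functional_is_vder.
have [e e0 He] := field_perturb oU fu te tz; have [sc [r cr]] := tc.
exists e, r; split => // A D; split; last first.
  by move=> p [p1 p2] rp; rewrite /D V ?cr //; exact: He.
apply: (@smooth_ext _ _ _ (strip e) (fun p => c p.2)); first exact: open_strip.
  by move=> p [p1 p2]; rewrite /D V //; exact: He.
apply: smooth_mx => [|i j]; first exact: open_strip.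
have o : open (strip e) by exact: open_strip.
apply: (smooth_comp1 (f := fun x => c x i j) (phi := fun p : R * R * R => p.2)) => //.
  by apply: smooth_coord => //; exact: openT.
exact: smooth_snd.
Qed.

(** Every test covector is the variational derivative of a linear functional, so identities on
    functionals and on covectors are the same. *)
Lemma hamiltonianP (P : @operator R N) : pre_operator U P ->
  hamiltonian U P <-> skew_operator U P /\
    forall u f h k, field U u -> test_fun f -> test_fun h -> test_fun k ->
      schouten P P u f h k = 0.
Proof.
move=> preP.
have V c u : test_fun c -> field U u -> vder (linear_functional c) u = c.
  by move=> tc fu; apply: vderE; exact: linear_functional_is_vder.
split=> [[sk jac]|[sk jac]].
  have skP : skew_operator U P.
    move=> u f h fu tf th.
    have := sk _ _ (linear_functional_functional tf) (linear_functional_functional th) u fu.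
    by rewrite /bracket !V.
  split => // u f h k fu tf th tk.
  have lf := linear_functional_functional tf; have lh := linear_functional_functional th.
  have lk := linear_functional_functional tk.
  by have := jac _ _ _ lf lh lk u fu; rewrite (jacobi_schouten oU preP skP lf lh lk fu) !V.
split=> [I J fI fJ u fu|I J K fI fJ fK u fu].
  by apply: sk => //; [have [] := fI.1 u fu | have [] := fJ.1 u fu].
rewrite (jacobi_schouten oU preP sk fI fJ fK fu); apply: jac => //.
- by have [] := fI.1 u fu.
- by have [] := fJ.1 u fu.
- by have [] := fK.1 u fu.
Qed.

End LinearFunctionals.

#[local] Transparent vder2 vder pairing.

(** * Differentiation under the integral and under [Dinv] *)

Section SmoothFamilies.
Context {R : realType}.

(* A family of scalar functions [F (t, 0, x)] with a common compact support,
   smooth in [(t, x)] for small [t], and its derivative [F1] at [t = 0]. *)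
Definition family (e r : R) (F : R * R * R -> R) (F1 : R -> R) : Prop :=
  [/\ 0 < e, 0 <= r, smooth_on (strip e) F, forall p, strip e p -> r < `|p.2| -> F p = 0 &
      forall x, is_derive (0 : R) (1 : R) (fun t : R => F (t, 0, x)) (F1 x)].

Variables (e r : R).

Lemma strip0 (F : R * R * R -> R) (F1 : R -> R) (x : R) : family e r F F1 -> strip e (0, 0, x).
Proof. by case=> e0 *; rewrite /strip /= normr0. Qed.

Lemma family_deriveE (F : R * R * R -> R) (F1 : R -> R) (x : R) : family e r F F1 -> F1 x = 'D_(1, 0, 0) F (0, 0, x).
Proof.
move=> fF; have in0 := strip0 x fF; have [_ _ sF _ dF] := fF.
have := @is_derive_line _ _ _ F (0, 0, x) (1, 0, 0) 0.
rewrite scale0r addr0 => /(_ (smooth_differentiable sF in0)) D.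
have L (t : R) : (0, 0, x) + t *: (1, 0, 0) = (t, 0, x) :> R * R * R.
  by congr (_, _, _); rewrite /= ?[_ *: 0]mulr0 ?addr0 // [_ *: 1]mulr1 add0r.
have {}D : is_derive (0 : R) (1 : R) (fun t : R => F (t, 0, x)) ('D_(1, 0, 0) F (0, 0, x)).
  by rewrite (_ : (fun t => _) = (fun t : R => F ((0, 0, x) + t *: (1, 0, 0)))) //;
    apply/funext => t; rewrite L.
by have [_ <-] := dF x; have [_ <-] := D.
Qed.

Lemma slice_smooth (F : R * R * R -> R) (t : R) : smooth_on (strip e) F -> `|t| < e ->
  smooth_on [set: R] (fun x => F (t, 0, x)).
Proof.
move=> sF te k.
have L (x : R) : (t, 0, 0) + x *: (0, 0, 1) = (t, 0, x) :> R * R * R.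
  by congr (_, _, _); rewrite /= ?[_ *: 0]mulr0 ?addr0 // [_ *: 1]mulr1 add0r.
rewrite (_ : (fun x => _) = (fun x : R => F ((t, 0, 0) + x *: (0, 0, 1)))); last first.
  by apply/funext => x; rewrite L.
apply: (Ck_line (A := strip e)); [exact: openT| |exact: sF].
move=> x _; rewrite L; apply: strip_line => //.
by rewrite normr0; apply: le_lt_trans te.
Qed.

Lemma family_slice (F : R * R * R -> R) (F1 : R -> R) (t : R) : family e r F F1 -> `|t| < e -> test_fun (fun x => F (t, 0, x)).
Proof.
move=> fF te; have [e0 _ sF Fr _] := fF; split; first exact: slice_smooth.
by exists r => x rx; apply: Fr => //; split => //=; rewrite normr0.
Qed.

Lemma family_supp (F : R * R * R -> R) (F1 : R -> R) (x : R) : family e r F F1 -> r < `|x| -> F1 x = 0.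
Proof.
move=> fF rx; have [e0 _ sF Fr dF] := fF; have [_ <-] := dF x.
rewrite (@near_eq_derive _ _ _ _ (cst 0)) ?derive_cst //.
apply/near0P; exists e => // t te; apply: Fr => //; split => //=; by rewrite normr0.
Qed.

Lemma family_derivative_test (F : R * R * R -> R) (F1 : R -> R) : family e r F F1 -> test_fun F1.
Proof.
move=> fF; have [e0 _ sF Fr dF] := fF; split.
  have -> : F1 = (fun x => (fun p => 'D_(1, 0, 0) F p) (0, 0, x)).
    by apply/funext => x; rewrite (family_deriveE x fF).
  apply: (slice_smooth (F := fun p => 'D_(1, 0, 0) F p)); last by rewrite normr0.
  exact: smooth_derive.
by exists r => x rx; exact: (family_supp fF rx).
Qed.

Lemma family_near (F : R * R * R -> R) (F1 : R -> R) (eps : R) : family e r F F1 -> 0 < eps ->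
  \forall t \near (0 : R), forall x, `|x| <= r ->
    `|F (t, 0, x) - F (0, 0, x) - t * F1 x| <= eps * `|t|.
Proof.
move=> fF eps0; have [e0 _ sF _ _] := fF.
have [d d0 H] := uniform_expansion r e0 eps0 (sF 1%N).
apply/near0P; exists d => // t td x xr; have := H t 0 x td; rewrite normr0 => /(_ d0 xr).
by rewrite mul0r subr0 addr0 (family_deriveE x fF).
Qed.

Lemma family_bound (F : R * R * R -> R) (F1 : R -> R) : family e r F F1 ->
  exists2 M, 0 <= M & \forall t \near (0 : R), forall x, `|x| <= r -> `|F (t, 0, x)| <= M.
Proof.
move=> fF; have [e0 _ sF _ _] := fF.
have cF x : {for (0, 0, x), continuous F} by apply: smooth_continuous sF (strip0 x fF).
have [M [d [d0 [M0 H]]]] := uniform_bound r cF.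
by exists M => //; apply/near0P; exists d => // t td x xr; apply: H; rewrite ?normr0.
Qed.

(** The expansion of the integrand is uniform on the common support, whose length is [2 * r]. *)
Lemma Int_family (F : R * R * R -> R) (F1 : R -> R) : family e r F F1 ->
  is_derive (0 : R) (1 : R) (fun t : R => Int (fun x => F (t, 0, x))) (Int F1).
Proof.
move=> fF; have [e0 r0 sF Fr _] := fF; have tF1 := family_derivative_test fF.
apply: is_derive_near => eps eps0.
pose ep := eps / (2 * r + 1); have ep0 : 0 < ep by apply: divr_gt0 => //; lra.
have near1 := family_near fF ep0.
have near2 : \forall t \near (0 : R), `|t| < e by apply/near0P; exists e.
move: near2; apply: filter_app; move: near1; apply: filter_app; apply: filterE => t H te.
have tt := family_slice fF te.
have t0 : test_fun (fun x => F (0, 0, x)) by apply: family_slice fF _; rewrite normr0.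
have c1 := test_cc tt; have c2 := test_cc t0; have c3 := ccZ t (test_cc tF1).
rewrite -IntZ; last exact: test_cc.
rewrite -(IntB c1 c2) -(IntB (ccB c1 c2) c3).
have [cc1 _] := ccB (ccB c1 c2) c3.
apply: le_trans (Int_bound cc1 r0 _ H) _.
  by move=> x rx; rewrite !Fr ?(family_supp fF rx) ?mulr0 ?subr0 //; split; rewrite //= normr0.
have -> : eps = ep * (2 * r + 1) by rewrite /ep divfK //; lra.
rewrite mulrA; apply: ler_wpM2r; first exact: normr_ge0.
by clear -ep0 r0; nra.
Qed.

(** A product rule: [Dinv] is linear and bounded on functions with a common support, so it can be
    applied to the expansion of [H]. *)
Lemma Int_Dinv_family (F H : R * R * R -> R) (F1 H1 : R -> R) : family e r F F1 -> family e r H H1 ->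
  is_derive (0 : R) (1 : R)
    (fun t : R => Int (fun x => F (t, 0, x) * Dinv (fun y => H (t, 0, y)) x))
    (Int (fun x => F1 x * Dinv (fun y => H (0, 0, y)) x)
     + Int (fun x => F (0, 0, x) * Dinv H1 x)).
Proof.
move=> fF fH; have [e0 r0 sF Fr _] := fF; have [_ _ sH Hr _] := fH.
have tF1 := family_derivative_test fF; have tH1 := family_derivative_test fH.
have e00 : `|0 : R| < e by rewrite normr0.
have tF0 := family_slice fF e00; have tH0 := family_slice fH e00.
have [M1 M10 b1] := family_bound fF; have [M2 M20 b2] := family_bound fH.
have [M3 M30 b3] := test_bounded tF1.
have [M4 M40 b4] := test_bounded tH1.
apply: is_derive_near => eps eps0.
pose K := 2 * r * (2 * r * M2 + M1 * (2 * r) + M3 * (2 * r)) + 1.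
have K0 : 0 < K by rewrite ltr_wpDl // !(mulr_ge0, addr_ge0).
pose ep := eps / K; have ep0 : 0 < ep by exact: divr_gt0.
have Eeps : eps = ep * K by rewrite /ep divfK // gt_eqF.
have n1 := family_near fF ep0; have n2 := family_near fH ep0.
have n3 : \forall t \near (0 : R), `|t| < e by apply/near0P; exists e.
have b0 : forall x, `|x| <= r -> `|F (0, 0, x)| <= M1 by exact: nbhs_singleton b1.
(* Ensures that H at parameter t stays within [ep] of H at parameter 0, given the expansion error
   and the bound [M4] on [H1]. *)
have n4 : \forall t \near (0 : R), `|t| < ep / (ep + M4 + 1).
  by apply/near0P; exists (ep / (ep + M4 + 1)) => //; apply: divr_gt0 => //; lra.
move: n4; apply: filter_app; move: n3; apply: filter_app; move: n2; apply: filter_app.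
move: n1; apply: filter_app; move: b1; apply: filter_app; move: b2; apply: filter_app.
apply: filterE => t Hb Fb Fe He te t4.
rewrite {}Eeps.
have tFt := family_slice fF te; have tHt := family_slice fH te.
have ccHt := test_cc tHt; have ccH0 := test_cc tH0; have ccH1 := test_cc tH1.
have cH0 := continuous_Dinv ccH0; have cH1 := continuous_Dinv ccH1.
have cHt := continuous_Dinv ccHt.
have a1 := ccMr (test_cc tFt) cHt; have a2 := ccMr (test_cc tF0) cH0.
have a3 := ccMr (test_cc tF1) cH0; have a4 := ccMr (test_cc tF0) cH1.
rewrite -(IntD a3 a4) -(IntZ t (ccD a3 a4)) -(IntB a1 a2) -(IntB (ccB a1 a2) (ccZ t (ccD a3 a4))).
have [cc1 _] := ccB (ccB a1 a2) (ccZ t (ccD a3 a4)).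
have Hdiff x : `|Dinv (fun y => H (t, 0, y)) x - Dinv (fun y => H (0, 0, y)) x - t * Dinv H1 x|
    <= 2 * r * (ep * `|t|).
  have -> : Dinv (fun y => H (t, 0, y)) x - Dinv (fun y => H (0, 0, y)) x - t * Dinv H1 x =
    Dinv (fun y => H (t, 0, y) + (- 1 * H (0, 0, y) + (- t) * H1 y)) x.
    rewrite !DinvD //; [|exact: ccZ|exact: ccZ|by apply: ccD; exact: ccZ].
    by rewrite !DinvZ //; ring.
  apply: Dinv_bound => //.
  - by case: (ccD ccHt (ccD (ccZ (- 1) ccH0) (ccZ (- t) ccH1))).
  - move=> y ry; rewrite !Hr ?(family_supp fH ry) ?mulr0 ?addr0 //; by split; rewrite //= normr0.
  - move=> y yr; have := He y yr; rewrite (_ : _ - _ - _ = H (t, 0, y) + (- 1 * H (0, 0, y) + (- t) * H1 y)) //.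
    by ring.
have Hsm x : `|Dinv (fun y => H (t, 0, y)) x - Dinv (fun y => H (0, 0, y)) x| <= 2 * r * ep.
  have -> : Dinv (fun y => H (t, 0, y)) x - Dinv (fun y => H (0, 0, y)) x =
    Dinv (fun y => H (t, 0, y) + - 1 * H (0, 0, y)) x.
    by rewrite DinvD //; [rewrite DinvZ //; ring|exact: ccZ].
  apply: Dinv_bound => //.
  - by case: (ccD ccHt (ccZ (- 1) ccH0)).
  - move=> y ry; rewrite !Hr ?mulr0 ?addr0 //; by split; rewrite //= normr0.
  - move=> y yr; have h1 := He y yr; have h2 := b4 y.
    have := ler_normD (H (t, 0, y) - H (0, 0, y) - t * H1 y) (t * H1 y).
    rewrite subrK normrM mulN1r => h3.
    have tn := normr_ge0 t.
    have h4 : `|t| * `|H1 y| <= `|t| * M4 by apply: ler_wpM2l.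
    have : `|t| * (ep + M4 + 1) <= ep.
      by move: (ltW t4); rewrite ler_pdivlMr //; lra.
    by clear -h1 h3 h4 tn ep0; nra.
have Hbd x : `|Dinv (fun y => H (t, 0, y)) x| <= 2 * r * M2.
  apply: Dinv_bound => //; first by case: ccHt.
  by move=> y ry; rewrite Hr //; split; rewrite //= normr0.
apply: le_trans (Int_bound (M := ep * `|t| * (2 * r * M2 + M1 * (2 * r) + M3 * (2 * r))) cc1 r0 _ _) _.
- move=> x rx; rewrite !Fr ?(family_supp fF rx) ?(mul0r, mulr0, addr0, subr0) //;
    by split; rewrite //= normr0.
- move=> x xr.
  have h1 := Fe x xr; have h2 := Hdiff x; have h3 := Hsm x; have h4 := Hbd x.
  have h5 := b3 x; have h6 := b0 x xr.
  move: (Dinv (fun y => H (t, 0, y)) x) (Dinv (fun y => H (0, 0, y)) x) (Dinv H1 x) h2 h3 h4.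
  move: (F (t, 0, x)) (F (0, 0, x)) (F1 x) h1 h5 h6 => ft f0 f1 h1 h5 h6 dt d0 d1 h2 h3 h4.
  (* Separates the expansion error of F, that of [Dinv] of H, and the product of the two
     increments. *)
  have -> : ft * dt - f0 * d0 - t * (f1 * d0 + f0 * d1) =
    (ft - f0 - t * f1) * dt + f0 * (dt - d0 - t * d1) + t * (f1 * (dt - d0)) by ring.
  apply: le_trans (ler_normD _ _) _.
  have -> : ep * `|t| * (2 * r * M2 + M1 * (2 * r) + M3 * (2 * r)) =
    (ep * `|t| * (2 * r * M2) + M1 * (2 * r * (ep * `|t|))) + `|t| * (M3 * (2 * r * ep)) by ring.
  apply: lerD.
    apply: le_trans (ler_normD _ _) _; rewrite !normrM.
    by apply: lerD; apply: ler_pM => //; exact: normr_ge0.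
  rewrite !normrM; apply: ler_wpM2l; first exact: normr_ge0.
  by apply: ler_pM => //; exact: normr_ge0.
have tn := normr_ge0 t.
have -> : ep * K * `|t| = 2 * r * (ep * `|t| * (2 * r * M2 + M1 * (2 * r) + M3 * (2 * r))) + ep * `|t|.
  by rewrite /K; ring.
by rewrite lerDl mulr_ge0 // ltW.
Qed.

End SmoothFamilies.

(** * Operators of hydrodynamic type and nonlocal tails *)

Section FamilyClosure.
Context {R : realType}.
Variables (e r : R).

Lemma familyD (F H : R * R * R -> R) (F1 H1 : R -> R) :
  family e r F F1 -> family e r H H1 ->
  family e r (fun p => F p + H p) (fun x => F1 x + H1 x).
Proof.
move=> [e0 r0 sF Fr dF] [_ _ sH Hr dH]; split => //.
- by apply: smoothD => //; exact: open_strip.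
- by move=> p pe pr; rewrite Fr // Hr // addr0.
- by move=> x; exact: is_deriveD.
Qed.

Lemma family_sum n (F : 'I_n -> R * R * R -> R) (F1 : 'I_n -> R -> R) :
  0 < e -> 0 <= r -> (forall i, family e r (F i) (F1 i)) ->
  family e r (fun p => \sum_i F i p) (fun x => \sum_i F1 i x).
Proof.
move=> e0 r0 fF; split => //.
- by apply: smooth_sum => [|i]; [exact: open_strip | have [] := fF i].
- by move=> p pe pr; apply: big1 => i _; have [_ _ _ -> //] := fF i.
- move=> x; have dF i : is_derive (0 : R) (1 : R) (fun t : R => F i (t, 0, x)) (F1 i x).
    by have [] := fF i.
  have D := is_derive_sum dF.
  rewrite (_ : (fun t => _) = \sum_i (fun t : R => F i (t, 0, x))) //.
  by apply/funext => t; rewrite fct_sumE.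
Qed.

Lemma familyM (c : R * R * R -> R) (c1 : R -> R) (F : R * R * R -> R) (F1 : R -> R) :
  smooth_on (strip e) c ->
  (forall x, is_derive (0 : R) (1 : R) (fun t : R => c (t, 0, x)) (c1 x)) ->
  family e r F F1 ->
  family e r (fun p => c p * F p) (fun x => c1 x * F (0, 0, x) + c (0, 0, x) * F1 x).
Proof.
move=> sc dc [e0 r0 sF Fr dF]; split => //.
- by apply: smoothM => //; exact: open_strip.
- by move=> p pe pr; rewrite Fr // mulr0.
- move=> x; have D := is_deriveM (dc x) (dF x); apply: (is_derive_eq D).
  by rewrite addrC; congr (_ + _); exact: mulrC.
Qed.

Lemma family_test (f : R -> R) : 0 < e -> 0 <= r -> smooth_on [set: R] f ->
  (forall x, r < `|x| -> f x = 0) -> family e r (fun p => f p.2) (fun=> 0).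
Proof.
move=> e0 r0 sf fr; split => //.
- apply: (smooth_comp1 (f := f) (phi := fun p : R * R * R => p.2)) => //; first exact: open_strip.
  exact: smooth_snd.
- by move=> p _; exact: fr.
- by move=> x; exact: (is_derive_cst (f x) (0 : R) (1 : R)).
Qed.

End FamilyClosure.

(** * Expressions c_k (u) u^k_x and their variations *)

Section FirstOrderForms.
Context {R : realType} {N : nat}.
Notation path := (R -> 'rV[R]_N).
Variables (U : set 'rV[R]_N) (oU : open U).
Implicit Types (u eta : path) (c : 'rV[R]_N -> R) (ck : 'I_N -> 'rV[R]_N -> R).

Definition form ck u (x : R) : R := \sum_k ck k (u x) * derive1 u x 0 k.

(* The derivative of [form ck (u + t eta)] at [t = 0]. *)
Definition dform ck u eta (x : R) : R :=
  \sum_k ('D_(eta x) (ck k) (u x) * derive1 u x 0 k + ck k (u x) * derive1 eta x 0 k).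

Lemma smooth_row_comp (V : normedModType R) (A : set V) u (phi : V -> R) : open A ->
  smooth_on [set: R] u -> smooth_on A phi -> smooth_on A (fun p => u (phi p)).
Proof.
move=> oA su sphi; apply: smooth_mx => // i j.
apply: (smooth_comp1 (f := fun x => u x i j)) => //.
by apply: smooth_coord => //; exact: openT.
Qed.

Lemma smooth_coef c u : smooth_on U c -> field U u -> smooth_on [set: R] (fun x => c (u x)).
Proof. by move=> sc [su Uu _]; apply: (smooth_comp (B := U)) => //; exact: openT. Qed.

Lemma smooth_form ck u : (forall k, smooth_on U (ck k)) -> field U u ->
  smooth_on [set: R] (form ck u).
Proof.
move=> sc fu; apply: smooth_sum => [|k]; first exact: openT.
apply: smoothM; [exact: openT | exact: smooth_coef | ].
apply: smooth_coord; [exact: openT | apply: smooth_derive1].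
by case: fu.
Qed.

Lemma test_form ck u : (forall k, smooth_on U (ck k)) -> field U u -> test_fun (form ck u).
Proof.
move=> sc fu; split; first exact: smooth_form.
have [_ _ [r ur]] := fu; exists r => x rx; apply: big1 => k _.
by rewrite ur // mxE mulr0.
Qed.

Lemma smooth_dcoef c u eta : smooth_on U c -> field U u -> smooth_on [set: R] eta ->
  smooth_on [set: R] (fun x => 'D_(eta x) c (u x)).
Proof.
move=> sc fu se; have [_ Uu _] := fu.
apply: (smooth_ext (f := fun x => \sum_l eta x 0 l * 'D_(delta_mx 0 l) c (u x))).
- exact: openT.
- by move=> x _; rewrite [RHS](derive_rV _ (smooth_differentiable sc (Uu x))).
- apply: smooth_sum => [|l]; first exact: openT.
  apply: smoothM; [exact: openT|by apply: smooth_coord; [exact: openT|]|].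
  by apply: (smooth_coef (c := fun p => 'D_(delta_mx 0 l) c p)) => //; exact: smooth_derive.
Qed.

Lemma smooth_dform ck u eta : (forall k, smooth_on U (ck k)) -> field U u ->
  smooth_on [set: R] eta -> smooth_on [set: R] (dform ck u eta).
Proof.
move=> sc fu se; have [su _ _] := fu; have o := @openT R.
apply: smooth_sum => // k; apply: smoothD => //; apply: smoothM => //.
- exact: smooth_dcoef.
- by apply: smooth_coord => //; exact: smooth_derive1.
- exact: smooth_coef.
- by apply: smooth_coord => //; exact: smooth_derive1.
Qed.

Section Perturbation.
Variables (u eta : path) (e : R).
Hypotheses (fu : field U u) (te : test_fun eta) (e0 : 0 < e).
Hypothesis fe : forall t : R, `|t| < e -> field U (fun x => u x + t *: eta x).

Let w (p : R * R * R) : 'rV[R]_N := u p.2 + p.1.1 *: eta p.2.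

Lemma smooth_w : smooth_on (strip e) w.
Proof.
have o : open (strip e) by exact: open_strip.
have [su _ _] := fu; have [se _] := te.
apply: smoothD => //; first by apply: smooth_row_comp => //; exact: smooth_snd.
apply: smooth_scale => //; first exact: smooth_fst1.
by apply: smooth_row_comp => //; exact: smooth_snd.
Qed.

Lemma smooth_coef_family c : smooth_on U c -> smooth_on (strip e) (fun p => c (w p)).
Proof.
move=> sc; apply: (smooth_comp (B := U)) => //; first exact: open_strip.
  by move=> p [pe _]; have [_ + _] := fe pe; exact.
exact: smooth_w.
Qed.

Lemma is_derive_coef_family c x : smooth_on U c ->
  is_derive (0 : R) (1 : R) (fun t : R => c (u x + t *: eta x)) ('D_(eta x) c (u x)).
Proof.
move=> sc; have := @is_derive_line _ _ _ c (u x) (eta x) 0.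
rewrite scale0r addr0; apply; apply: (smooth_differentiable sc).
by have [_ + _] := fu; exact.
Qed.

Lemma derive1_perturb t (x : R) : derive1 (fun x => u x + t *: eta x) x =
  derive1 u x + t *: derive1 eta x.
Proof.
have [su _ _] := fu; have [se _] := te.
exact: (is_derive1 (is_deriveD (smooth_is_derive x su) (is_deriveZ t (smooth_is_derive x se)))).
Qed.

Lemma smooth_form_family ck : (forall k, smooth_on U (ck k)) ->
  smooth_on (strip e) (fun p => form ck (fun x => u x + p.1.1 *: eta x) p.2).
Proof.
move=> sc; have o : open (strip e) by exact: open_strip.
have [su _ _] := fu; have [se _] := te.
apply: smooth_sum => // k; apply: smoothM => //; first exact: smooth_coef_family.
rewrite (_ : (fun p => _) = (fun p : R * R * R =>
   (derive1 u p.2 + p.1.1 *: derive1 eta p.2) 0 k)); last first.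
  by apply/funext => p; rewrite derive1_perturb.
apply: smooth_coord => //; apply: smoothD => //.
  by apply: smooth_row_comp => //; [exact: smooth_derive1 | exact: smooth_snd].
apply: smooth_scale => //; first exact: smooth_fst1.
by apply: smooth_row_comp => //; [exact: smooth_derive1 | exact: smooth_snd].
Qed.

Lemma is_derive_form_family ck x : (forall k, smooth_on U (ck k)) ->
  is_derive (0 : R) (1 : R) (fun t : R => form ck (fun x => u x + t *: eta x) x)
    (dform ck u eta x).
Proof.
move=> sc; rewrite /dform.
have dk k : is_derive (0 : R) (1 : R)
  (fun t : R => ck k (u x + t *: eta x) * derive1 (fun x => u x + t *: eta x) x 0 k)
  ('D_(eta x) (ck k) (u x) * derive1 u x 0 k + ck k (u x) * derive1 eta x 0 k).
  have d2 : is_derive (0 : R) (1 : R)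
      (fun t : R => derive1 (fun x => u x + t *: eta x) x 0 k) (derive1 eta x 0 k).
    rewrite (_ : (fun t => _) = (fun t : R => derive1 u x 0 k + t * derive1 eta x 0 k)); last first.
      by apply/funext => t; rewrite derive1_perturb !mxE.
    have D := is_deriveD (is_derive_cst (derive1 u x 0 k) (0 : R) 1)
      (is_deriveM (is_derive_id (0 : R) 1) (is_derive_cst (derive1 eta x 0 k) (0 : R) 1)).
    by apply: (is_derive_eq D); rewrite add0r scaler0 add0r; exact: mulr1.
  have D := is_deriveM (is_derive_coef_family x (sc k)) d2.
  apply: (is_derive_eq D); rewrite derive1_perturb !scale0r !addr0 addrC.
  by congr (_ + _); exact: mulrC.
have D := is_derive_sum dk.
rewrite (_ : (fun t => _) = \sum_k (fun t : R => ck k (u x + t *: eta x) *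
  derive1 (fun x => u x + t *: eta x) x 0 k)) //.
by apply/funext => t; rewrite fct_sumE.
Qed.

End Perturbation.

Definition representable (L : path -> R) : Prop :=
  exists2 G : path, test_fun G & forall eta, test_fun eta -> L eta = pairing G eta.

Lemma representable0 : representable (fun=> 0).
Proof.
exists (fun=> 0); first exact: test0.
move=> eta te; rewrite pairingE -[LHS]Int0; congr Int.
by apply/funext => x; rewrite dot0l.
Qed.

Lemma representableD L L' : representable L -> representable L' ->
  representable (fun eta => L eta + L' eta).
Proof.
move=> [G tG HG] [G' tG' HG']; exists (fun x => G x + G' x); first exact: testD.
by move=> eta te; rewrite pairingDl ?HG ?HG' //; exact: test_continuous.
Qed.

Lemma representable_sum (I : Type) (s : seq I) (L : I -> path -> R) :
  (forall i, representable (L i)) -> representable (fun eta => \sum_(i <- s) L i eta).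
Proof.
move=> rL; elim: s => [|i s IH].
  rewrite (_ : (fun eta => _) = fun=> 0); first exact: representable0.
  by apply/funext => eta; rewrite big_nil.
rewrite (_ : (fun eta => _) = (fun eta => L i eta + \sum_(j <- s) L j eta)).
  exact: representableD.
by apply/funext => eta; rewrite big_cons.
Qed.

Lemma representable_ext L L' : (forall eta, test_fun eta -> L eta = L' eta) ->
  representable L -> representable L'.
Proof. by move=> E [G tG HG]; exists G => // eta te; rewrite -E // HG. Qed.

Lemma representable_coef c u (z : R -> R) : smooth_on U c -> field U u -> test_fun z ->
  representable (fun eta => Int (fun x => z x * 'D_(eta x) c (u x))).
Proof.
move=> sc fu tz.
exists (fun x => \row_k (z x * 'D_(delta_mx 0 k) c (u x))).
  apply: test_mx => i j; rewrite (_ : (fun x => _) = (fun x => z x * 'D_(delta_mx 0 j) c (u x))).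
    by apply: testMr => //; apply: (smooth_coef (c := fun p => 'D_(delta_mx 0 j) c p)) => //;
      exact: smooth_derive.
  by apply/funext => x; rewrite mxE.
move=> eta te; rewrite pairingE; congr Int; apply/funext => x.
have Ux : U (u x) by have [_ + _] := fu; exact.
rewrite (derive_rV _ (smooth_differentiable sc Ux)) mulr_sumr.
by apply: eq_bigr => k _; rewrite mxE; ring.
Qed.

Lemma Int_by_parts (f h : R -> R) : smooth_on [set: R] f -> test_fun h ->
  Int (fun x => f x * derive1 h x) = - Int (fun x => derive1 f x * h x).
Proof.
move=> sf th; apply/eqP; rewrite -subr_eq0 opprK; apply/eqP.
have c1 := test_cc (testMl sf (test_derive1 th)).
have c2 := test_cc (testMl (smooth_derive1 sf) th).
rewrite -IntD //; apply: (@Int_derive0 _ (fun x => f x * h x)) => //.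
- exact: test_cc (testMl sf th).
- exact: ccD.
- move=> x; have D := is_deriveM (smooth_is_derive x sf) (smooth_is_derive x th.1).
  by apply: (is_derive_eq D); congr (_ + _); exact: mulrC.
Qed.

(** Integration by parts takes the derivative off [eta]; the test function [z] makes the resulting
    covector compactly supported. *)
Lemma representable_dform ck u (z : R -> R) : (forall k, smooth_on U (ck k)) -> field U u ->
  test_fun z -> representable (fun eta => Int (fun x => z x * dform ck u eta x)).
Proof.
move=> sc fu tz.
have [su Uu _] := fu.
have td k : test_fun (fun x => z x * derive1 u x 0 k).
  apply: testMr => //; apply: smooth_coord; [exact: openT | exact: smooth_derive1].
have tc k : test_fun (fun x => z x * ck k (u x)) by apply: testMr => //; exact: smooth_coef.
have r1 k : representable (fun eta => Int (fun x => (z x * derive1 u x 0 k) * 'D_(eta x) (ck k) (u x))).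
  exact: representable_coef.
have r2 k : representable (fun eta => Int (fun x => (z x * ck k (u x)) * derive1 eta x 0 k)).
  exists (fun x => (- derive1 (fun x => z x * ck k (u x)) x) *: delta_mx 0 k).
    by apply: test_scaler; [apply: testN; exact: test_derive1 | exact: smooth_cst].
  move=> eta te; rewrite pairingE.
  have tek := test_coord 0 k te.
  have -> : (fun x => dot ((- derive1 (fun x => z x * ck k (u x)) x) *: delta_mx 0 k) (eta x)) =
    (fun x => - (derive1 (fun x => z x * ck k (u x)) x * eta x 0 k)).
    apply/funext => x; rewrite /dot (bigD1 k) //= big1 ?addr0.
      by rewrite !mxE !eqxx mulr1 mulNr.
    by move=> j jk; rewrite !mxE (negbTE jk) andbF mulr0 mul0r.
  rewrite IntN; last by apply: test_cc; apply: testMl => //; exact: smooth_derive1 (tc k).1.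
  rewrite -(Int_by_parts (tc k).1 tek); congr Int; apply/funext => x.
  by rewrite (derive1_coord 0 k (smooth_derivable te.1)).
have r3 : representable (fun eta => \sum_k (Int (fun x => (z x * derive1 u x 0 k) * 'D_(eta x) (ck k) (u x)) +
   Int (fun x => (z x * ck k (u x)) * derive1 eta x 0 k))).
  by apply: representable_sum => k; apply: representableD.
apply: representable_ext r3 => eta te.
have sD k := smooth_dcoef (sc k) fu te.1.
have se1 k : smooth_on [set: R] (fun x => derive1 eta x 0 k).
  by apply: smooth_coord; [exact: openT | apply: smooth_derive1; case: te].
have c1 k : cc (fun x => (z x * derive1 u x 0 k) * 'D_(eta x) (ck k) (u x)).
  by apply: test_cc; exact: testMr.
have c2 k : cc (fun x => (z x * ck k (u x)) * derive1 eta x 0 k).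
  by apply: test_cc; exact: testMr.
under eq_bigr => k _ do rewrite -(IntD (c1 k) (c2 k)).
rewrite -Int_sum; last by move=> k; exact: ccD.
congr Int; apply/funext => x; rewrite /dform mulr_sumr; apply: eq_bigr => k _.
by ring.
Qed.

Lemma smooth_Dinv (h : R -> R) : test_fun h -> smooth_on [set: R] (Dinv h).
Proof.
move=> th; apply: (@smooth_primitive _ _ (Dinv h) h); last by case: th.
by move=> x; apply: is_derive_Dinv; exact: test_cc.
Qed.

End FirstOrderForms.

#[local] Opaque Int Dinv.

(** * The local operator *)

Section Operators.
Context {R : realType} {N : nat}.
Notation path := (R -> 'rV[R]_N).
Variables (U : set 'rV[R]_N) (oU : open U).

Lemma smooth_bound_fin (T : finType) (F : T -> R * R * R -> R) (e r : R) :
  0 < e -> (forall i, smooth_on (strip e) (F i)) ->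
  exists2 M, 0 <= M & \forall t \near (0 : R), forall i x, `|x| <= r -> `|F i (t, 0, x)| <= M.
Proof.
move=> e0 sF.
have /choice [M HM] : forall i, exists M, 0 <= M /\
    \forall t \near (0 : R), forall x, `|x| <= r -> `|F i (t, 0, x)| <= M.
  move=> i; have cF x : {for (0, 0, x), continuous (F i)}.
    by apply: smooth_continuous (sF i) _; rewrite /strip /= normr0.
  have [M [d [d0 [M0 H]]]] := uniform_bound r cF.
  by exists M; split => //; apply/near0P; exists d => // t td x xr; apply: H; rewrite ?normr0.
exists (\sum_i M i); first by apply: sumr_ge0 => i _; have [] := HM i.
have : \forall t \near (0 : R), forall i x, `|x| <= r -> `|F i (t, 0, x)| <= M i.
  apply: (@filter_forall _ _ (fun i t => forall x, `|x| <= r -> `|F i (t, 0, x)| <= M i)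
    (nbhs (0 : R))) => i; by have [] := HM i.
apply: filterS => t H i x xr; apply: le_trans (H i x xr) _.
by rewrite (bigD1 i) //= lerDl sumr_ge0 // => j _; have [] := HM j.
Qed.

Lemma family_cz (e r : R) (c : R * R * R -> R) (c1 z : R -> R) : 0 < e -> 0 <= r ->
  smooth_on (strip e) c ->
  (forall x, is_derive (0 : R) (1 : R) (fun t : R => c (t, 0, x)) (c1 x)) ->
  smooth_on [set: R] z -> (forall x, r < `|x| -> z x = 0) ->
  family e r (fun p => z p.2 * c p) (fun x => z x * c1 x).
Proof.
move=> e0 r0 sc dc sz zr; have fz := family_test e0 r0 sz zr.
have [_ _ sF Fr dF] := familyM sc dc fz.
split => //; first by apply: smooth_ext sF; [exact: open_strip | move=> p _; rewrite mulrC].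
- by move=> p _ rp; rewrite zr // mul0r.
- move=> x; have D := dF x.
  rewrite (_ : (fun t => _) = (fun t : R => c (t, 0, x) * z x)); last first.
    by apply/funext => t; rewrite mulrC.
  by apply: (is_derive_eq D); rewrite mulr0 addr0 mulrC.
Qed.

Lemma radius (f : path) : test_fun f -> exists2 r, 0 <= r & forall x, r < `|x| -> f x = 0.
Proof.
move=> [_ [r fr]]; exists (Num.max r 0); first by rewrite le_max lexx orbT.
by move=> x; rewrite gt_max => /andP[rx _]; exact: fr.
Qed.

Lemma field_perturb1 (u eta : path) : field U u -> test_fun eta ->
  exists2 e, 0 < e & forall t, `|t| < e -> field U (fun x => u x + t *: eta x).
Proof.
move=> fu te; have [e e0 He] := field_perturb oU fu te te.
exists e => // t te'; have := He t 0; rewrite normr0 => /(_ te' e0).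
by rewrite (_ : (fun x => _) = (fun x => u x + t *: eta x)) //; apply/funext => x;
  rewrite scale0r addr0.
Qed.

Section Hydro.
Variables (g : 'I_N -> 'I_N -> 'rV[R]_N -> R) (b : 'I_N -> 'I_N -> 'I_N -> 'rV[R]_N -> R).
Hypotheses (smooth_g : forall i j, smooth_on U (g i j))
  (smooth_b : forall i j k, smooth_on U (b i j k)).

Lemma hydroE u h x i : hydro_op g b u h x 0 i =
  \sum_j (g i j (u x) * derive1 h x 0 j + form (b i j) u x * h x 0 j).
Proof.
by rewrite mxE; apply: eq_bigr => j _; rewrite /form mulr_suml.
Qed.

Definition dhydro (u f h eta : path) : R := Int (fun x => \sum_i \sum_j
  ((f x 0 i * derive1 h x 0 j) * 'D_(eta x) (g i j) (u x)
   + (f x 0 i * h x 0 j) * dform (b i j) u eta x)).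

Lemma test_hydro u h : field U u -> test_fun h -> test_fun (hydro_op g b u h).
Proof.
move=> fu th; apply: test_mx => i j; rewrite [i]ord1 {i}.
rewrite (_ : (fun x => _) = (fun x => \sum_l (g j l (u x) * derive1 h x 0 l +
  form (b j l) u x * h x 0 l))); last by apply/funext => x; rewrite hydroE.
apply: test_sum => l; apply: testD; apply: testMl.
- exact: (smooth_coef (smooth_g j l) fu).
- by apply: test_coord; exact: test_derive1.
- exact: (smooth_form (smooth_b j l) fu).
- exact: test_coord.
Qed.

Lemma is_derive_hydro u f h eta : field U u -> test_fun f -> test_fun h -> test_fun eta ->
  is_derive (0 : R) (1 : R)
    (fun t : R => pairing f (hydro_op g b (fun x => u x + t *: eta x) h)) (dhydro u f h eta).
Proof.
move=> fu tf th te; have [e e0 fe] := field_perturb1 fu te.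
have [r r0 fr] := radius tf.
pose w (p : R * R * R) : 'rV[R]_N := u p.2 + p.1.1 *: eta p.2.
have th1 := test_derive1 th.
have sz i j : smooth_on [set: R] (fun x => f x 0 i * derive1 h x 0 j).
  by have [] := testMr (test_coord 0 i tf) (test_coord 0 j th1).1.
have sz' i j : smooth_on [set: R] (fun x => f x 0 i * h x 0 j).
  by have [] := testMr (test_coord 0 i tf) (test_coord 0 j th).1.
have zr i j x : r < `|x| -> f x 0 i * derive1 h x 0 j = 0.
  by move=> rx; rewrite fr // mxE mul0r.
have zr' i j x : r < `|x| -> f x 0 i * h x 0 j = 0.
  by move=> rx; rewrite fr // mxE mul0r.
have F i j := familyD
  (family_cz e0 r0 (smooth_coef_family fu te fe (smooth_g i j))
    (fun x => is_derive_coef_family eta fu x (smooth_g i j)) (sz i j) (zr i j))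
  (family_cz e0 r0 (smooth_form_family fu te fe (smooth_b i j))
    (fun x => is_derive_form_family fu te x (smooth_b i j)) (sz' i j) (zr' i j)).
have D := Int_family (family_sum e0 r0 (fun i => family_sum e0 r0 (F i))).
rewrite /dhydro (_ : (fun t => _) = (fun t : R => Int (fun x => \sum_i \sum_j
  (f x 0 i * derive1 h x 0 j * g i j (u x + t *: eta x) +
   f x 0 i * h x 0 j * form (b i j) (fun x => u x + t *: eta x) x)))) //.
apply/funext => t; rewrite pairingE; congr Int; apply/funext => x.
apply: eq_bigr => i _; rewrite hydroE mulr_sumr; apply: eq_bigr => j _.
by ring.
Qed.

Lemma representable_dhydro u f h : field U u -> test_fun f -> test_fun h ->
  representable (dhydro u f h).
Proof.
move=> fu tf th; have th1 := test_derive1 th.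
have tz i j : test_fun (fun x => f x 0 i * derive1 h x 0 j).
  exact: testMr (test_coord 0 i tf) (test_coord 0 j th1).1.
have tz' i j : test_fun (fun x => f x 0 i * h x 0 j).
  exact: testMr (test_coord 0 i tf) (test_coord 0 j th).1.
have r3 := representable_sum (index_enum 'I_N) (fun i => representable_sum (index_enum 'I_N)
  (fun j => representableD (representable_coef (smooth_g i j) fu (tz i j))
              (representable_dform (smooth_b i j) fu (tz' i j)))).
apply: representable_ext r3 => eta te; rewrite /dhydro.
have c1 i j := test_cc (testMr (tz i j) (smooth_dcoef (smooth_g i j) fu te.1)).
have c2 i j := test_cc (testMr (tz' i j) (smooth_dform (smooth_b i j) fu te.1)).
rewrite Int_sum; last by move=> i; apply: cc_sum => j; exact: ccD.
apply: eq_bigr => i _; rewrite Int_sum; last by move=> j; exact: ccD.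
by apply: eq_bigr => j _; rewrite IntD.
Qed.

Lemma pre_hydro : pre_operator U (hydro_op g b).
Proof.
split=> [u h||u eta r0 fu te]; first exact: test_hydro.
  move=> u f h fu tf th; have [G tG HG] := representable_dhydro fu tf th.
  by exists G => // eta te; rewrite -HG //; exact: is_derive_hydro.
pose r := Num.max r0 0.
have r_ge0 : 0 <= r by rewrite le_max lexx orbT.
have [e e0 fe] := field_perturb1 fu te.
have [K1 K10 H1] := @smooth_bound_fin _ (fun (ij : 'I_N * 'I_N) p => g ij.1 ij.2 (u p.2 + p.1.1 *: eta p.2))
   e r e0 (fun ij => smooth_coef_family fu te fe (smooth_g ij.1 ij.2)).
have [K2 K20 H2] := @smooth_bound_fin _ (fun (ij : 'I_N * 'I_N) p =>
   form (b ij.1 ij.2) (fun x => u x + p.1.1 *: eta x) p.2)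
   e r e0 (fun ij => smooth_form_family fu te fe (smooth_b ij.1 ij.2)).
exists (2 * r * (N%:R * (N%:R * (K1 + K2)))); first by rewrite !(mulr_ge0, addr_ge0).
have H3 : \forall t \near (0 : R), `|t| < e by apply/near0P; exists e.
move: H3; apply: filter_app; move: H2; apply: filter_app; move: H1; apply: filter_app.
apply: filterE => t H1 H2 te' f h M1 M2 tf fr th HM1 HM2.
have fr' x : r < `|x| -> f x = 0.
  by rewrite gt_max => /andP[rx _]; exact: fr.
have cP := test_continuous (test_hydro (fe t te') th).
have := pairing_bound (M2 := N%:R * (K1 + K2) * M2) tf cP r_ge0 fr' HM1.
have -> : 2 * r * (N%:R * (N%:R * (K1 + K2))) * (M1 * M2) =
  2 * r * (N%:R * (M1 * (N%:R * (K1 + K2) * M2))) by ring.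
apply=> x i xr; rewrite hydroE; apply: le_trans (ler_norm_sum _ _ _) _.
have -> : N%:R * (K1 + K2) * M2 = \sum_(j < N) (K1 + K2) * M2.
  by rewrite sumr_const card_ord -mulrA mulr_natl.
apply: ler_sum => j _; apply: le_trans (ler_normD _ _) _.
have [h0 h1] := HM2 x j.
rewrite !normrM mulrDl; apply: lerD; apply: ler_pM; rewrite ?normr_ge0 //.
- exact: (H1 (i, j) x xr).
- exact: (H2 (i, j) x xr).
Qed.

End Hydro.
End Operators.

(** * The nonlocal operator *)

Section Nonlocal.
Context {R : realType} {N L : nat}.
Notation path := (R -> 'rV[R]_N).
Variables (U : set 'rV[R]_N) (oU : open U) (mu : 'M[R]_L).
Variable w : 'I_L -> 'I_N -> 'I_N -> 'rV[R]_N -> R.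
Hypothesis smooth_w : forall n i j, smooth_on U (w n i j).
Implicit Types u f h k eta : path.

(** The right-hand side of the hydrodynamic system u_t = w_m u_x. *)
Definition flow (m : 'I_L) u (x : R) : 'rV[R]_N := \row_i form (w m i) u x.

Definition dflow (m : 'I_L) u eta (x : R) : 'rV[R]_N := \row_i dform (w m i) u eta x.

Definition flux m u h (x : R) : R := dot (flow m u x) (h x).

Lemma fluxE m u h x : flux m u h x = \sum_j form (w m j) u x * h x 0 j.
Proof. by apply: eq_bigr => j _; rewrite mxE. Qed.

Lemma nonlocalE u h x : nonlocal_op mu w u h x =
  \sum_m \sum_n (mu m n * Dinv (flux n u h) x) *: flow m u x.
Proof.
apply/rowP => i; rewrite mxE summxE; apply: eq_bigr => m _; rewrite summxE.
apply: eq_bigr => n _; rewrite !mxE -/(form (w m i) u x) mulrAC; congr (_ * _ * _).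
by congr (Dinv _ x); apply/funext => y; rewrite fluxE.
Qed.

Lemma test_flow m u : field U u -> test_fun (flow m u).
Proof.
move=> fu; apply: test_mx => i j.
rewrite (_ : (fun x => _) = form (w m j) u); first exact: (test_form (smooth_w m j) fu).
by apply/funext => x; rewrite mxE.
Qed.

Lemma smooth_dflow m u eta : field U u -> smooth_on [set: R] eta ->
  smooth_on [set: R] (dflow m u eta).
Proof.
move=> fu se; apply: smooth_mx => [|i j]; first exact: openT.
rewrite (_ : (fun x => _) = dform (w m j) u eta).
  exact: (smooth_dform (smooth_w m j) fu se).
by apply/funext => x; rewrite mxE.
Qed.

Lemma test_dot f h : test_fun f -> smooth_on [set: R] h -> test_fun (fun x => dot (f x) (h x)).
Proof.
move=> tf sh; apply: test_sum => i; apply: testMr; first exact: test_coord.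
by apply: smooth_coord => //; exact: openT.
Qed.

Lemma test_flux m u h : field U u -> smooth_on [set: R] h -> test_fun (flux m u h).
Proof. by move=> fu sh; apply: test_dot => //; exact: test_flow. Qed.

Lemma smooth_Dflux m u h : field U u -> smooth_on [set: R] h ->
  smooth_on [set: R] (Dinv (flux m u h)).
Proof. by move=> fu sh; apply: smooth_Dinv; exact: test_flux. Qed.

Lemma test_nonlocal u h : field U u -> smooth_on [set: R] h ->
  test_fun (nonlocal_op mu w u h).
Proof.
move=> fu sh.
rewrite (_ : nonlocal_op mu w u h = (fun x => \sum_m \sum_n (mu m n * Dinv (flux n u h) x) *: flow m u x)).
  apply: test_sum => m; apply: test_sum => n; apply: test_scalel; last exact: test_flow.
  by apply: smoothM; [exact: openT | exact: smooth_cst | exact: smooth_Dflux].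
by apply/funext => x; exact: nonlocalE.
Qed.

Lemma pairing_nonlocal u f h : field U u -> test_fun f -> smooth_on [set: R] h ->
  pairing f (nonlocal_op mu w u h) =
  \sum_m \sum_n mu m n * Int (fun x => flux m u f x * Dinv (flux n u h) x).
Proof.
move=> fu tf sh; rewrite pairingE.
have c m n : cc (fun x => flux m u f x * Dinv (flux n u h) x).
  by apply: test_cc; apply: testMr; [exact: test_flux fu tf.1 | exact: smooth_Dflux].
under eq_bigr => m _.
  under eq_bigr => n _ do rewrite -(IntZ (mu m n) (c m n)).
  rewrite -Int_sum; last by move=> n; exact: ccZ.
over.
rewrite -Int_sum; last by move=> m; apply: cc_sum => n; exact: ccZ.
congr Int; apply/funext => x; rewrite nonlocalE dot_sumr; apply: eq_bigr => m _.
rewrite dot_sumr; apply: eq_bigr => n _; rewrite dotZr dotC /flux.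
by ring.
Qed.

(** [Dinv] is skew and [mu] is symmetric, so exchanging the two summation indices produces the
    sign. *)
Lemma nonlocal_skew : mu^T = mu -> skew_operator U (nonlocal_op mu w).
Proof.
move=> smu u f h fu tf th; rewrite !pairing_nonlocal //; [|exact: tf.1|exact: th.1].
rewrite exchange_big /= -sumrN; apply: eq_bigr => m _; rewrite -sumrN; apply: eq_bigr => n _.
have cf := test_cc (test_flux n fu tf.1); have ch := test_cc (test_flux m fu th.1).
rewrite -{1}smu mxE (Dinv_skew cf ch) mulrN; congr (- (_ * Int _)).
by apply/funext => x; rewrite mulrC.
Qed.

Definition dnonlocal0 u f h eta : R := \sum_m \sum_n mu m n *
  (Int (fun x => dot (f x) (dflow m u eta x) * Dinv (flux n u h) x)
   + Int (fun x => flux m u f x * Dinv (fun x => dot (h x) (dflow n u eta x)) x)).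

Section Family.
Variables (u eta : path) (e : R).
Hypotheses (fu : field U u) (te : test_fun eta) (e0 : 0 < e).
Hypothesis fe : forall t : R, `|t| < e -> field U (fun x => u x + t *: eta x).

Lemma family_flux m h r : 0 <= r -> smooth_on [set: R] h -> (forall x, r < `|x| -> h x = 0) ->
  family e r (fun p => flux m (fun x => u x + p.1.1 *: eta x) h p.2)
    (fun x => dot (h x) (dflow m u eta x)).
Proof.
move=> r0 sh hr.
have hr' i x : r < `|x| -> h x 0 i = 0 by move=> rx; rewrite hr // mxE.
have F i := family_cz e0 r0 (smooth_form_family fu te fe (smooth_w m i))
   (fun x => is_derive_form_family fu te x (smooth_w m i))
   (smooth_coord 0 i openT sh) (hr' i).
have [_ _ sF Fr dF] := family_sum e0 r0 F.
have E (p : R * R * R) : \sum_i h p.2 0 i * form (w m i) (fun x => u x + p.1.1 *: eta x) p.2 =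
    flux m (fun x => u x + p.1.1 *: eta x) h p.2.
  by rewrite fluxE; apply: eq_bigr => i _; rewrite mulrC.
split => //.
- by apply: smooth_ext sF; [exact: open_strip | move=> p _; rewrite E].
- by move=> p pe rp; rewrite -E Fr.
- move=> x; have D := dF x.
  rewrite (_ : (fun t => _) = (fun t : R => \sum_i h x 0 i * form (w m i) (fun x => u x + t *: eta x) x)).
    by apply: (is_derive_eq D); apply: eq_bigr => i _; rewrite mxE.
  by apply/funext => t; rewrite -(E (t, 0, x)).
Qed.

Lemma is_derive_nonlocal0 f h : test_fun f -> test_fun h ->
  is_derive (0 : R) (1 : R)
    (fun t : R => pairing f (nonlocal_op mu w (fun x => u x + t *: eta x) h))
    (dnonlocal0 u f h eta).
Proof.
move=> tf th; have [rf rf0 fr] := radius tf; have [rh rh0 hr] := radius th.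
pose r := Num.max rf rh; have r0 : 0 <= r by rewrite le_max rf0.
have fr' x : r < `|x| -> f x = 0 by rewrite gt_max => /andP[rx _]; exact: fr.
have hr' x : r < `|x| -> h x = 0 by rewrite gt_max => /andP[_ rx]; exact: hr.
have u0 : (fun x : R => u x + (0 : R) *: eta x) = u.
  by apply/funext => x; rewrite scale0r addr0.
have D m n : is_derive (0 : R) (1 : R) (fun t : R => Int (fun x =>
    flux m (fun x => u x + t *: eta x) f x * Dinv (flux n (fun x => u x + t *: eta x) h) x))
   (Int (fun x => dot (f x) (dflow m u eta x) * Dinv (flux n u h) x)
   + Int (fun x => flux m u f x * Dinv (fun x => dot (h x) (dflow n u eta x)) x)).
  have D := Int_Dinv_family (family_flux m r0 tf.1 fr') (family_flux n r0 th.1 hr').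
  by rewrite /= u0 in D.
have D1 m := is_derive_sum (fun n => is_deriveZ (mu m n) (D m n)).
have {}D1 := is_derive_sum D1.
apply: (near_eq_is_derive _ D1).
apply/near0P; exists e => // t te'; rewrite (pairing_nonlocal (fe te') tf th.1).
by rewrite fct_sumE; apply: eq_bigr => m _; rewrite fct_sumE.
Qed.

End Family.

Hypothesis smu : mu^T = mu.

(* The components [b^m = mu^{mn} (d/dx)^{-1} (w_n u_x . h)] of the nonlocal tail. *)
Definition tail (m : 'I_L) u h (x : R) : R := \sum_n mu m n * Dinv (flux n u h) x.

Lemma nonlocal_tailE u h x : nonlocal_op mu w u h x = \sum_m tail m u h x *: flow m u x.
Proof.
by rewrite nonlocalE; apply: eq_bigr => m _; rewrite /tail scaler_suml.
Qed.

Lemma smooth_tail m u h : field U u -> smooth_on [set: R] h ->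
  smooth_on [set: R] (tail m u h).
Proof.
move=> fu sh; apply: smooth_sum => [|n]; first exact: openT.
by apply: smoothM; [exact: openT | exact: smooth_cst | exact: smooth_Dflux].
Qed.

(** In [dnonlocal0] the variation [eta] also occurs under [Dinv]. Moving [Dinv] off it by
    skew-symmetry leaves an integrand local in [eta], which a test covector can represent. *)
Definition dnonlocal u f h eta : R := Int (fun x =>
  \sum_m dot (tail m u h x *: f x - tail m u f x *: h x) (dflow m u eta x)).

Lemma test_tails m u f h : field U u -> test_fun f -> test_fun h ->
  test_fun (fun x => tail m u h x *: f x - tail m u f x *: h x).
Proof.
by move=> fu tf th; apply: testB; apply: test_scalel => //; apply: smooth_tail => //;
  [exact: th.1 | exact: tf.1].
Qed.

Lemma dnonlocal0E u f h eta : field U u -> test_fun f -> test_fun h -> test_fun eta ->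
  dnonlocal0 u f h eta = dnonlocal u f h eta.
Proof.
move=> fu tf th te.
have se m := smooth_dflow m fu te.1.
have c1 m n := test_cc (testMr (test_dot tf (se m)) (smooth_Dflux n fu th.1)).
have c2 m n := test_cc (testMl (smooth_Dflux n fu tf.1) (test_dot th (se m))).
transitivity (\sum_m \sum_n (Int (fun x => mu m n * (dot (f x) (dflow m u eta x) * Dinv (flux n u h) x))
   - Int (fun x => mu m n * (Dinv (flux n u f) x * dot (h x) (dflow m u eta x))))).
  rewrite /dnonlocal0.
  under eq_bigr => m _ do under eq_bigr => n _ do rewrite mulrDr.
  under eq_bigr => m _ do rewrite big_split.
  rewrite big_split /= [X in _ + X]exchange_big /= -big_split; apply: eq_bigr => m _.
  rewrite -big_split; apply: eq_bigr => n _.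
  rewrite (IntZ _ (c1 m n)) (IntZ _ (c2 m n)); congr (_ + _).
  have X := Dinv_skew (test_cc (test_flux n fu tf.1)) (test_cc (test_dot th (se m))).
  by rewrite X -{1}smu mxE mulrN.
rewrite /dnonlocal.
under eq_bigr => m _.
  under eq_bigr => n _ do rewrite -(IntB (ccZ (mu m n) (c1 m n)) (ccZ (mu m n) (c2 m n))).
  rewrite -Int_sum; last by move=> n; apply: ccB; exact: ccZ.
over.
rewrite -Int_sum; last by move=> m; apply: cc_sum => n; apply: ccB; exact: ccZ.
congr Int; apply/funext => x; apply: eq_bigr => m _.
rewrite dotDl dotNl !dotZl /tail !mulr_suml -sumrB; apply: eq_bigr => n _.
by ring.
Qed.

Lemma is_derive_nonlocal u f h eta : field U u -> test_fun f -> test_fun h -> test_fun eta ->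
  is_derive (0 : R) (1 : R)
    (fun t : R => pairing f (nonlocal_op mu w (fun x => u x + t *: eta x) h))
    (dnonlocal u f h eta).
Proof.
move=> fu tf th te; have [e e0 fe] := field_perturb1 oU fu te.
by rewrite -dnonlocal0E //; exact: (is_derive_nonlocal0 fu te e0 fe).
Qed.

Lemma representable_dnonlocal u f h : field U u -> test_fun f -> test_fun h ->
  representable (dnonlocal u f h).
Proof.
move=> fu tf th.
have tz m := test_tails m fu tf th.
have r3 := representable_sum (index_enum 'I_L) (fun m => representable_sum (index_enum 'I_N)
  (fun i => representable_dform (smooth_w m i) fu (test_coord 0 i (tz m)))).
apply: representable_ext r3 => eta te; rewrite /dnonlocal.
have c1 m i := test_cc (testMr (test_coord 0 i (tz m)) (smooth_dform (smooth_w m i) fu te.1)).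
rewrite -[LHS]/(\sum_m \sum_i Int (fun x => (tail m u h x *: f x - tail m u f x *: h x) 0 i
  * dform (w m i) u eta x)).
under eq_bigr => m _ do rewrite -(Int_sum _ (c1 m)).
rewrite -Int_sum; last by move=> m; apply: cc_sum; exact: c1.
congr Int; apply/funext => x; apply: eq_bigr => m _; apply: eq_bigr => i _.
by rewrite [dflow _ _ _ _ _ _]mxE.
Qed.

Lemma pre_nonlocal : pre_operator U (nonlocal_op mu w).
Proof.
split=> [u h fu th||u eta r1 fu te]; first exact: test_nonlocal fu th.1.
  move=> u f h fu tf th; have [G tG HG] := representable_dnonlocal fu tf th.
  by exists G => // eta te; rewrite -HG //; exact: is_derive_nonlocal.
have [e e0 fe] := field_perturb1 oU fu te.
have [su _ [ru ur]] := fu; have [re re0 er] := radius (test_derive1 te).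
(* Beyond this radius the x-derivatives of [u] and [eta] vanish, hence so do the flows at the
   perturbed field. They cut the integrals off, since the support of the second covector is
   arbitrary. *)
pose r := Num.max (Num.max r1 0) (Num.max ru re).
have r_ge0 : 0 <= r by rewrite !le_max lexx orbT.
have [K K0 HK] := @smooth_bound_fin _ _ (fun (mi : 'I_L * 'I_N) p =>
   form (w mi.1 mi.2) (fun x => u x + p.1.1 *: eta x) p.2)
   e r e0 (fun mi => smooth_form_family fu te fe (smooth_w mi.1 mi.2)).
pose S := \sum_m \sum_n `|mu m n|.
have S0 : 0 <= S by apply: sumr_ge0 => m _; apply: sumr_ge0 => n _.
exists (2 * r * (N%:R * (S * (2 * r * (N%:R * K)) * K))); first by rewrite !(mulr_ge0, addr_ge0).
have H3 : \forall t \near (0 : R), `|t| < e by apply/near0P; exists e.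
move: H3; apply: filter_app; move: HK; apply: filter_app.
apply: filterE => t HK te' f h M1 M2 tf fr th HM1 HM2.
have fut := fe t te'.
have form0 m i x : r < `|x| -> form (w m i) (fun x => u x + t *: eta x) x = 0.
  rewrite !gt_max => /and3P[_ rx ex]; apply: big1 => k _.
  by rewrite (derive1_perturb fu te) ur // er // scaler0 addr0 mxE mulr0.
have form1 m i x : `|form (w m i) (fun x => u x + t *: eta x) x| <= K.
  by have [xr|xr] := leP `|x| r; [exact: (HK (m, i) x xr) | rewrite form0 // normr0].
have fr' x : r < `|x| -> f x = 0.
  by rewrite !gt_max => /andP[/andP[rx _] _]; exact: fr.
have M20 : 'I_N -> 0 <= M2 by move=> i; apply: le_trans (normr_ge0 _) (HM2 0 i).1.
have cP := test_continuous (test_nonlocal fut th.1).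
have := pairing_bound (M2 := S * (2 * r * (N%:R * K * M2)) * K) tf cP r_ge0 fr' HM1.
have -> : 2 * r * (N%:R * (S * (2 * r * (N%:R * K)) * K)) * (M1 * M2) =
  2 * r * (N%:R * (M1 * (S * (2 * r * (N%:R * K * M2)) * K))) by ring.
apply=> x i _.
have HD n : `|Dinv (flux n (fun x => u x + t *: eta x) h) x| <= 2 * r * (N%:R * K * M2).
  apply: Dinv_bound => //.
  - by case: (test_cc (test_flux n fut th.1)).
  - by move=> y ry; rewrite fluxE big1 // => j _; rewrite form0 // mul0r.
  - move=> y _; rewrite fluxE; apply: le_trans (ler_norm_sum _ _ _) _.
    have -> : N%:R * K * M2 = \sum_(j < N) K * M2.
      by rewrite sumr_const card_ord -mulrA mulr_natl.
    by apply: ler_sum => j _; rewrite normrM; apply: ler_pM => //; exact: (HM2 y j).1.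
rewrite nonlocalE summxE /S !mulr_suml; apply: le_trans (ler_norm_sum _ _ _) _.
apply: ler_sum => m _; rewrite summxE !mulr_suml; apply: le_trans (ler_norm_sum _ _ _) _.
apply: ler_sum => n _; rewrite !mxE (normrM (_ * _)) (normrM (mu m n)).
apply: ler_pM; [exact: mulr_ge0 | exact: normr_ge0 | | exact: form1].
by apply: ler_wpM2l.
Qed.

End Nonlocal.

(** * Linear combinations of operators *)

Section Combination.
Context {R : realType} {N : nat}.
Notation path := (R -> 'rV[R]_N).
Variables (U : set 'rV[R]_N) (oU : open U) (P Q : @operator R N) (a c : R).
Hypotheses (preP : pre_operator U P) (preQ : pre_operator U Q).

Lemma pairing_lin_comb (f h u : path) : field U u -> test_fun f -> test_fun h ->
  pairing f (lin_comb a c P Q u h) = a * pairing f (P u h) + c * pairing f (Q u h).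
Proof.
move=> fu tf th; have [P1 _ _] := preP; have [Q1 _ _] := preQ.
have tP := P1 u h fu th; have tQ := Q1 u h fu th.
rewrite /lin_comb pairingDr //; try (by apply: test_continuous; exact: testZ).
by rewrite !pairingZr //; exact: test_continuous.
Qed.

Lemma is_derive_lin_comb (f h u eta : path) : field U u -> test_fun f -> test_fun h ->
  test_fun eta -> is_derive (0 : R) (1 : R)
    (fun t : R => pairing f (lin_comb a c P Q (fun x => u x + t *: eta x) h))
    (a * dop P u f h eta + c * dop Q u f h eta).
Proof.
move=> fu tf th te; have [_ P2 _] := preP; have [_ Q2 _] := preQ.
have [e e0 fe] := field_perturb1 oU fu te.
have [G tG /(_ eta te) D1] := P2 u f h fu tf th.
have [G' tG' /(_ eta te) D2] := Q2 u f h fu tf th.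
rewrite /dop (is_derive1 D1) (is_derive1 D2).
apply: (near_eq_is_derive _ (is_deriveD (is_deriveZ a D1) (is_deriveZ c D2))).
by apply/near0P; exists e => // t te'; rewrite pairing_lin_comb //; exact: fe.
Qed.

Lemma dop_lin_comb (f h u eta : path) : field U u -> test_fun f -> test_fun h ->
  test_fun eta -> dop (lin_comb a c P Q) u f h eta = a * dop P u f h eta + c * dop Q u f h eta.
Proof. by move=> fu tf th te; exact: (is_derive1 (is_derive_lin_comb fu tf th te)). Qed.

Lemma pre_lin_comb : pre_operator U (lin_comb a c P Q).
Proof.
have [P1 P2 P3] := preP; have [Q1 Q2 Q3] := preQ.
split=> [u h fu th|u f h fu tf th|u eta r fu te].
- by apply: testD; apply: testZ; [exact: P1 | exact: Q1].
- have [G tG HG] := dop_gradient preP fu tf th; have [G' tG' HG'] := dop_gradient preQ fu tf th.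
  exists (fun x => a *: G x + c *: G' x); first by apply: testD; exact: testZ.
  move=> eta te; have D := is_derive_lin_comb fu tf th te.
  have ce := test_continuous te.
  by rewrite pairingDl ?pairingZl -?HG -?HG' //; exact: testZ.
- have [C C0 HC] := P3 u eta r fu te; have [C' C0' HC'] := Q3 u eta r fu te.
  have [e e0 fe] := field_perturb1 oU fu te.
  exists (`|a| * C + `|c| * C'); first by rewrite addr_ge0 // mulr_ge0.
  have H3 : \forall t \near (0 : R), `|t| < e by apply/near0P; exists e.
  move: H3; apply: filter_app; move: HC'; apply: filter_app; move: HC; apply: filter_app.
  apply: filterE => t HC HC' te' f h M1 M2 tf fr th HM1 HM2.
  rewrite pairing_lin_comb //; last exact: fe.
  have h1 := HC f h M1 M2 tf fr th HM1 HM2; have h2 := HC' f h M1 M2 tf fr th HM1 HM2.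
  apply: le_trans (ler_normD _ _) _; rewrite !normrM mulrDl -!mulrA.
  by apply: lerD; apply: ler_wpM2l.
Qed.

Lemma skew_lin_comb : skew_operator U P -> skew_operator U Q ->
  skew_operator U (lin_comb a c P Q).
Proof.
by move=> sP sQ u f h fu tf th; rewrite !pairing_lin_comb // (sP u f h) // (sQ u f h) //; ring.
Qed.

(** [dop] is linear in its direction because a covector represents it; expanding both the operator
    and the direction gives a quadratic form in [a] and [c]. *)
Lemma schouten_lin_comb (u f h k : path) : field U u -> test_fun f -> test_fun h -> test_fun k ->
  schouten (lin_comb a c P Q) (lin_comb a c P Q) u f h k =
  a ^+ 2 * schouten P P u f h k + a * c * (schouten P Q u f h k + schouten Q P u f h k)
  + c ^+ 2 * schouten Q Q u f h k.
Proof.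
move=> fu tf th tk; have [P1 _ _] := preP; have [Q1 _ _] := preQ.
have lin f' h' k' : test_fun f' -> test_fun h' -> test_fun k' ->
    dop (lin_comb a c P Q) u f' h' (lin_comb a c P Q u k') =
    a ^+ 2 * dop P u f' h' (P u k') + a * c * (dop P u f' h' (Q u k') + dop Q u f' h' (P u k'))
    + c ^+ 2 * dop Q u f' h' (Q u k').
  move=> tf' th' tk'; have tP := P1 u k' fu tk'; have tQ := Q1 u k' fu tk'.
  have tl : test_fun (lin_comb a c P Q u k') by apply: testD; exact: testZ.
  rewrite (dop_lin_comb fu tf' th' tl).
  have [G tG HG] := dop_gradient preP fu tf' th'; have [G' tG' HG'] := dop_gradient preQ fu tf' th'.
  have pl (X : path) : test_fun X -> pairing X (lin_comb a c P Q u k') =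
      a * pairing X (P u k') + c * pairing X (Q u k') by move=> tX; exact: pairing_lin_comb.
  rewrite (HG _ tl) (HG' _ tl) (HG _ tP) (HG _ tQ) (HG' _ tP) (HG' _ tQ) (pl _ tG) (pl _ tG').
  generalize (pairing G (P u k')) (pairing G (Q u k')) (pairing G' (P u k')) (pairing G' (Q u k')).
  by move=> *; ring.
rewrite /schouten (lin f h k tf th tk) (lin h k f th tk tf) (lin k f h tk tf th).
generalize (dop P u f h (P u k)) (dop P u h k (P u f)) (dop P u k f (P u h)).
generalize (dop P u f h (Q u k)) (dop P u h k (Q u f)) (dop P u k f (Q u h)).
generalize (dop Q u f h (P u k)) (dop Q u h k (P u f)) (dop Q u k f (P u h)).
generalize (dop Q u f h (Q u k)) (dop Q u h k (Q u f)) (dop Q u k f (Q u h)).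
by move=> *; ring.
Qed.

End Combination.

(** * The Schouten bracket of the local part and the curvature *)

Section MatrixIdentity.
Context {R : comNzRingType}.

Lemma mxD_entry m n (A B : 'M[R]_(m, n)) i j : (A + B) i j = A i j + B i j.
Proof. by rewrite mxE. Qed.

Lemma mxN_entry m n (A : 'M[R]_(m, n)) i j : (- A) i j = - A i j.
Proof. by rewrite mxE. Qed.

(** The algebra behind [dhydroE]. G is the metric, H and Th are the connection contracted with the
    variation and with u_x, Ht and Tht their transposes, Hd the x-derivative of H, and Rm the
    curvature. The second group of terms is a total derivative. *)
Lemma connection_identity N (G H Ht Th Tht Hd Rm : 'M[R]_N) (h h1 : 'rV[R]_N)
    (F F1 : 'cV[R]_N) :
  h1 *m (- (G *m Ht) - H *m G) *m F
  + h *m (- (Th *m (- (G *m Ht) - H *m G)) - (Hd + Rm - (H *m Th - Th *m H)) *m G) *m F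
  + (h1 *m H *m G *m F + h *m Hd *m G *m F + h *m H *m (- (G *m Tht) - Th *m G) *m F
     + h *m H *m G *m F1)
  = - ((h1 - h *m Th) *m G *m Ht *m F) + h *m H *m G *m (F1 - Tht *m F) - h *m Rm *m G *m F.
Proof.
rewrite !(mulmxDl, mulmxDr, mulNmx, mulmxN, opprD, opprK, mulmxA).
apply/matrixP => i j; rewrite !(mxD_entry, mxN_entry); ring.
Qed.

End MatrixIdentity.

(** * Variation of the local operator in terms of the connection *)

Section LeviCivita.
Context {R : realType} {N : nat}.
Notation path := (R -> 'rV[R]_N).
Variables (U : set 'rV[R]_N) (oU : open U).
Variables (g : 'I_N -> 'I_N -> 'rV[R]_N -> R) (b Gam : 'I_N -> 'I_N -> 'I_N -> 'rV[R]_N -> R).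

(* [Gam j s k] is [Gamma^j_{sk}], the Levi-Civita connection of [g]. *)
Record levi_civita : Prop := LeviCivita {
  lc_smooth_g : forall i j, smooth_on U (g i j);
  lc_smooth_b : forall i j k, smooth_on U (b i j k);
  lc_smooth_Gam : forall i j k, smooth_on U (Gam i j k);
  lc_sym_g : forall p, U p -> forall i j, g i j p = g j i p;
  lc_sym_Gam : forall p, U p -> forall j s k, Gam j s k p = Gam j k s p;
  lc_bE : forall p, U p -> forall i j k, b i j k p = - \sum_s g i s p * Gam j s k p;
  lc_dgE : forall p, U p -> forall i j k,
    'D_(delta_mx 0 k) (g i j) p = b i j k p + b j i k p }.

Hypothesis LC : levi_civita.
Let smooth_g := lc_smooth_g LC.
Let smooth_b := lc_smooth_b LC.
Let smooth_Gam := lc_smooth_Gam LC.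
Let sym_g := lc_sym_g LC.
Let sym_Gam := lc_sym_Gam LC.
Let bE := lc_bE LC.
Let dgE := lc_dgE LC.
Implicit Types (u f h eta : path).

Definition gm u x : 'M[R]_N := metric_mx g (u x).

(* The connection matrix contracted with [eta]: [(j, s)] entry
   [Gamma^j_{sk} eta^k]. *)
Definition conn u eta x : 'M[R]_N := \matrix_(j, s) \sum_k Gam j s k (u x) * eta x 0 k.

Definition theta u x : 'M[R]_N := conn u (derive1 u) x.

Definition covariant u h x : 'rV[R]_N := derive1 h x - h x *m theta u x.

(** For [Gam := christoffel g] this is convertible to [riemann g]. *)
Definition curvature (j s k l : 'I_N) (p : 'rV[R]_N) : R :=
  partial k (Gam j l s) p - partial l (Gam j k s) p
  + \sum_q (Gam j k q p * Gam q l s p - Gam j l q p * Gam q k s p).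

Definition curvm u eta x : 'M[R]_N :=
  \matrix_(j, s) \sum_l \sum_k curvature j s l k (u x) * eta x 0 l * derive1 u x 0 k.

Lemma gm_sym u x : field U u -> (gm u x)^T = gm u x.
Proof. by move=> [_ Uu _]; apply/matrixP => i j; rewrite !mxE sym_g. Qed.

(** As b = - g Gamma, the term with b completes the derivative of [h] to the covariant one, and the
    metric raises its index. *)
Lemma hydro_nabla u h x : field U u -> hydro_op g b u h x = covariant u h x *m gm u x.
Proof.
move=> [_ Uu _]; apply/rowP => i; rewrite hydroE mxE; apply/esym.
rewrite /covariant; under eq_bigr => j _ do rewrite mxD_entry mxN_entry mulrBl.
rewrite sumrB big_split /= -[X in _ = _ + X]opprK; congr (_ - _).
  by apply: eq_bigr => j _; rewrite mxE sym_g // mulrC.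
under eq_bigr => j _ do rewrite mxE mulr_suml.
rewrite exchange_big -sumrN /=; apply: eq_bigr => l _.
rewrite /form mulr_suml -sumrN.
under [LHS]eq_bigr => j _ do rewrite !mxE mulr_sumr mulr_suml.
rewrite exchange_big /=; apply: eq_bigr => k _.
rewrite bE // !mulNr opprK !mulr_suml; apply: eq_bigr => s _.
by rewrite (sym_g (Uu x) s i); ring.
Qed.

(** The metric is parallel: this is [lc_dgE] contracted with [v], with b replaced by the
    connection. *)
Lemma derive_g u x (v : 'rV[R]_N) : field U u ->
  \matrix_(i, j) 'D_v (g i j) (u x) =
  - (gm u x *m (conn u (fun=> v) x)^T) - conn u (fun=> v) x *m gm u x.
Proof.
move=> [_ Uu _]; apply/matrixP => i j; rewrite mxD_entry !mxN_entry !mxE.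
rewrite (derive_rV _ (smooth_differentiable (smooth_g i j) (Uu x))).
have E k : v 0 k * 'D_(delta_mx 0 k) (g i j) (u x) =
   - (\sum_s g i s (u x) * (Gam j s k (u x) * v 0 k)) - \sum_s (Gam i s k (u x) * v 0 k) * g s j (u x).
  rewrite dgE // !bE // -!opprD mulrN; congr (- _); rewrite mulrDr !mulr_sumr.
  congr (_ + _); apply: eq_bigr => s _; first by ring.
  by rewrite (sym_g (Uu x) j s); ring.
under eq_bigr => k _ do rewrite E.
rewrite sumrB sumrN exchange_big /=; congr (- _ - _).
  by apply: eq_bigr => s _; rewrite !mxE mulr_sumr.
by rewrite exchange_big /=; apply: eq_bigr => s _; rewrite !mxE mulr_suml.
Qed.

Lemma is_derive_coef (c : 'rV[R]_N -> R) u (x : R) : smooth_on U c -> field U u ->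
  is_derive x 1 (fun y => c (u y)) ('D_(derive1 u x) c (u x)).
Proof.
move=> sc [su Uu _].
have D := is_derive_comp_rV (1 : R) (smooth_differentiable sc (Uu x))
  (proj1 (derivable1_diffP u x) (smooth_derivable su)).
by rewrite derive1E.
Qed.

Lemma is_derive_gm u (x : R) : field U u -> is_derive x 1 (gm u)
  (- (gm u x *m (theta u x)^T) - theta u x *m gm u x).
Proof.
move=> fu; have := derive_g x (derive1 u x) fu.
rewrite -[conn u (fun=> derive1 u x) x]/(theta u x) => <-.
apply: is_derive_mx => i j; rewrite mxE.
rewrite (_ : (fun y => _) = (fun y => g i j (u y))); first exact: is_derive_coef.
by apply/funext => y; rewrite mxE.
Qed.

Lemma smooth_gm u : field U u -> smooth_on [set: R] (gm u).
Proof.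
move=> fu; apply: smooth_mx => [|i j]; first exact: openT.
rewrite (_ : (fun y => _) = (fun y => g i j (u y))); first exact: smooth_coef (smooth_g i j) fu.
by apply/funext => y; rewrite mxE.
Qed.

Lemma smooth_conn u eta : field U u -> smooth_on [set: R] eta ->
  smooth_on [set: R] (conn u eta).
Proof.
move=> fu se; have o := @openT R; apply: smooth_mx => // j s.
rewrite (_ : (fun y => _) = (fun y => \sum_k Gam j s k (u y) * eta y 0 k)).
  apply: smooth_sum => // k; apply: smoothM => //; first exact: smooth_coef (smooth_Gam j s k) fu.
  exact: smooth_coord.
by apply/funext => y; rewrite mxE.
Qed.

Lemma smooth_theta u : field U u -> smooth_on [set: R] (theta u).
Proof. by move=> fu; apply: smooth_conn => //; apply: smooth_derive1; case: fu. Qed.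

Lemma smooth_nabla u h : field U u -> smooth_on [set: R] h -> smooth_on [set: R] (covariant u h).
Proof.
move=> fu sh; have o := @openT R; apply: smoothB => //; first exact: smooth_derive1.
by apply: smooth_mulmx => //; exact: smooth_theta.
Qed.

Lemma curv_contract u eta (x : R) j s : field U u ->
  \sum_l \sum_k curvature j s l k (u x) * eta x 0 l * derive1 u x 0 k =
   \sum_k 'D_(eta x) (Gam j s k) (u x) * derive1 u x 0 k
   - \sum_l 'D_(derive1 u x) (Gam j s l) (u x) * eta x 0 l
   + ((conn u eta x *m theta u x) j s - (theta u x *m conn u eta x) j s).
Proof.
move=> [_ Uu _].
have Dv (v : 'rV[R]_N) m1 m2 m3 : 'D_v (Gam m1 m2 m3) (u x) =
    \sum_i v 0 i * 'D_(delta_mx 0 i) (Gam m1 m2 m3) (u x).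
  exact: derive_rV (smooth_differentiable (smooth_Gam m1 m2 m3) (Uu x)).
have Ds l k : partial l (Gam j k s) (u x) = 'D_(delta_mx 0 l) (Gam j s k) (u x).
  apply: near_eq_derive; have := open_nbhs_nbhs (conj oU (Uu x)).
  by apply: filterS => q Uq; rewrite sym_Gam.
have E l k : curvature j s l k (u x) * eta x 0 l * derive1 u x 0 k =
    (eta x 0 l * 'D_(delta_mx 0 l) (Gam j s k) (u x)) * derive1 u x 0 k
    - (derive1 u x 0 k * 'D_(delta_mx 0 k) (Gam j s l) (u x)) * eta x 0 l
    + (\sum_q (Gam j q l (u x) * eta x 0 l) * (Gam q s k (u x) * derive1 u x 0 k)
      - \sum_q (Gam j q k (u x) * derive1 u x 0 k) * (Gam q s l (u x) * eta x 0 l)).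
  rewrite /curvature !Ds -sumrB.
  have -> : \sum_q (Gam j l q (u x) * Gam q k s (u x) - Gam j k q (u x) * Gam q l s (u x)) =
     \sum_q (Gam j q l (u x) * Gam q s k (u x) - Gam j q k (u x) * Gam q s l (u x)).
    by apply: eq_bigr => q _; rewrite (sym_Gam (Uu x) j l) (sym_Gam (Uu x) q k)
      (sym_Gam (Uu x) j k) (sym_Gam (Uu x) q l).
  rewrite -mulrA mulrDl mulr_suml; congr (_ + _); first by ring.
  by apply: eq_bigr => q _; ring.
under eq_bigr => l _ do under eq_bigr => k _ do rewrite E.
under eq_bigr => l _ do rewrite !big_split /= !sumrN.
rewrite !big_split /= !sumrN; congr (_ - _ + (_ - _)).
- rewrite exchange_big /=; apply: eq_bigr => k _; rewrite Dv mulr_suml.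
  by apply: eq_bigr.
- by apply: eq_bigr => l _; rewrite Dv mulr_suml; apply: eq_bigr.
- rewrite mxE; under eq_bigr => l _ do rewrite exchange_big /=.
  rewrite exchange_big /=; apply: eq_bigr => q _; rewrite !mxE mulr_suml.
  by apply: eq_bigr => l _; rewrite mulr_sumr.
- rewrite mxE exchange_big /=.
  under eq_bigr => l _ do rewrite exchange_big /=.
  rewrite exchange_big /=; apply: eq_bigr => q _; rewrite !mxE mulr_suml.
  by apply: eq_bigr => l _; rewrite mulr_sumr.
Qed.

(** The structure equation: varying Gamma u_x along [eta] and differentiating Gamma eta along [u]
    differ by the curvature and a commutator. *)
Lemma dform_theta u eta (x : R) : field U u -> smooth_on [set: R] eta ->
  \matrix_(j, s) dform (Gam j s) u eta x =
  derive1 (conn u eta) x + curvm u eta x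
   - (conn u eta x *m theta u x - theta u x *m conn u eta x).
Proof.
move=> fu se; have [su Uu _] := fu.
have dc j s : derive1 (conn u eta) x j s = \sum_k
   ('D_(derive1 u x) (Gam j s k) (u x) * eta x 0 k + Gam j s k (u x) * derive1 eta x 0 k).
  rewrite derive1_coord; last by apply: smooth_derivable; exact: smooth_conn.
  apply: is_derive1.
  have dk k : is_derive x 1 (fun y => Gam j s k (u y) * eta y 0 k)
    ('D_(derive1 u x) (Gam j s k) (u x) * eta x 0 k + Gam j s k (u x) * derive1 eta x 0 k).
    have D := is_deriveM (is_derive_coef x (smooth_Gam j s k) fu)
      (is_derive_coord 0 k (smooth_is_derive x se)).
    by apply: (is_derive_eq D); rewrite addrC; congr (_ + _); exact: mulrC.
  have D := is_derive_sum dk.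
  rewrite (_ : (fun y => _) = \sum_k (fun y => Gam j s k (u y) * eta y 0 k)) //.
  by apply/funext => y; rewrite mxE fct_sumE.
apply/matrixP => j s; rewrite !mxD_entry !mxN_entry !mxD_entry !mxN_entry dc.
rewrite [LHS]mxE /dform !big_split /=.
rewrite [X in _ = _ + X - _]mxE.
set X := \sum_i _ * derive1 eta x 0 i.
rewrite curv_contract // /X; ring.
Qed.

Lemma dhydro_integrand u f h eta (x : R) : field U u ->
  \sum_i \sum_j ((f x 0 i * derive1 h x 0 j) * 'D_(eta x) (g i j) (u x)
   + (f x 0 i * h x 0 j) * dform (b i j) u eta x) =
  (derive1 h x *m (- (gm u x *m (conn u eta x)^T) - conn u eta x *m gm u x) *m (f x)^T
   + h x *m (- (theta u x *m (- (gm u x *m (conn u eta x)^T) - conn u eta x *m gm u x))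
      - (\matrix_(j, s) dform (Gam j s) u eta x) *m gm u x) *m (f x)^T) 0 0.
Proof.
move=> fu; have [su Uu _] := fu.
have Dg := derive_g x (eta x) fu; rewrite -[conn u (fun=> eta x) x]/(conn u eta x) in Dg.
rewrite -Dg; set DG := \matrix_(i, j) 'D_(eta x) (g i j) (u x) : 'M[R]_N.
have symDG i j : DG i j = DG j i.
  rewrite !mxE; apply: near_eq_derive; have := open_nbhs_nbhs (conj oU (Uu x)).
  by apply: filterS => q Uq; rewrite sym_g.
have dB i j : dform (b i j) u eta x =
    (- (theta u x *m DG) - (\matrix_(j, s) dform (Gam j s) u eta x) *m gm u x) j i.
  rewrite mxD_entry !mxN_entry !mxE /dform.
  have Db k : 'D_(eta x) (b i j k) (u x) =
     - \sum_s (Gam j s k (u x) * DG i s + g i s (u x) * 'D_(eta x) (Gam j s k) (u x)).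
    have nE : \forall q \near u x, (- \sum_s (fun p => g i s p * Gam j s k p)) q = b i j k q.
      have := open_nbhs_nbhs (conj oU (Uu x)); apply: filterS => q Uq.
      by rewrite bE // !fctE fct_sumE.
    have ds s : is_derive (u x) (eta x) (fun p => g i s p * Gam j s k p)
        (Gam j s k (u x) * DG i s + g i s (u x) * 'D_(eta x) (Gam j s k) (u x)).
      have D := is_deriveM
        (derivableP (diff_derivable (v := eta x) (smooth_differentiable (smooth_g i s) (Uu x))))
        (derivableP (diff_derivable (v := eta x) (smooth_differentiable (smooth_Gam j s k) (Uu x)))).
      by apply: (is_derive_eq D); rewrite addrC mxE.
    have D := is_deriveN (is_derive_sum ds).
    by have [_ <-] := near_eq_is_derive nE D.
  under eq_bigr => k _ do rewrite Db bE //.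
  rewrite (eq_bigr (fun k => - (\sum_s (Gam j s k (u x) * derive1 u x 0 k * DG s i)
      + \sum_s (('D_(eta x) (Gam j s k) (u x) * derive1 u x 0 k + Gam j s k (u x) * derive1 eta x 0 k)
         * g s i (u x))))); last first.
    move=> k _; rewrite !mulNr -opprD; congr (- _); rewrite !mulr_suml -!big_split /=.
    apply: eq_bigr => s _; rewrite (symDG i s) (sym_g (Uu x) i s); ring.
  rewrite sumrN big_split /= opprD; congr (- _ - _).
    rewrite exchange_big /=; apply: eq_bigr => s _; rewrite !mxE mulr_suml.
    by apply: eq_bigr => k _; rewrite ?mxE.
  rewrite exchange_big /=; apply: eq_bigr => s _; rewrite !mxE mulr_suml.
  by apply: eq_bigr.
move: (- (theta u x *m DG) - _) dB => X dB.
have symDG' i j : 'D_(eta x) (g i j) (u x) = DG j i by rewrite symDG mxE.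
clearbody DG; rewrite mxD_entry !mxE /=.
under eq_bigr => i _ do rewrite big_split /=.
rewrite big_split /=; congr (_ + _); apply: eq_bigr => i _.
  by rewrite !mxE mulr_suml; apply: eq_bigr => j _; rewrite symDG'; ring.
by rewrite !mxE mulr_suml; apply: eq_bigr => j _; rewrite dB; ring.
Qed.

(** Adding a total derivative replaces the derivatives of [f], [h] and [eta] by [A f] and [A h],
    leaving connection terms and one curvature term. *)
Lemma dhydroE u f h eta : field U u -> test_fun f -> test_fun h -> smooth_on [set: R] eta ->
  dhydro g b u f h eta = Int (fun x =>
    (- (hydro_op g b u h x *m (conn u eta x)^T *m (f x)^T)
     + h x *m conn u eta x *m (hydro_op g b u f x)^T
     - h x *m curvm u eta x *m gm u x *m (f x)^T) 0 0).
Proof.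
move=> fu tf th se; have sf := tf.1; have sh := th.1; have o := @openT R.
have sC := smooth_conn fu se; have sG := smooth_gm fu.
(* The compactly supported function whose derivative, of integral 0, is added. *)
pose phi x := h x *m conn u eta x *m gm u x *m (f x)^T.
have sphi : smooth_on [set: R] phi.
  by apply: smooth_mulmx => //; [apply: smooth_mulmx => //; exact: smooth_mulmx | exact: smooth_trmx].
have tphi : test_fun phi.
  apply: test_mulmxr; last exact: smooth_trmx.
  by apply: test_mulmxr => //; exact: test_mulmxr.
pose dphi x := derive1 h x *m conn u eta x *m gm u x *m (f x)^T
  + h x *m derive1 (conn u eta) x *m gm u x *m (f x)^T
  + h x *m conn u eta x *m (- (gm u x *m (theta u x)^T) - theta u x *m gm u x) *m (f x)^T
  + h x *m conn u eta x *m gm u x *m (derive1 f x)^T.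
have Dphi (x : R) : is_derive x 1 phi (dphi x).
  have D := is_derive_mulmx (is_derive_mulmx (is_derive_mulmx (smooth_is_derive x sh)
    (smooth_is_derive x sC)) (is_derive_gm x fu)) (is_derive_trmx (smooth_is_derive x sf)).
  by apply: (is_derive_eq D); rewrite /dphi !mulmxDl.
have tdphi : test_fun (fun x => dphi x 0 0).
  rewrite (_ : (fun x => _) = (fun x => derive1 phi x 0 0)).
    by apply: test_coord; exact: test_derive1.
  by apply/funext => x; rewrite (is_derive1 (Dphi x)).
have I0 : Int (fun x => dphi x 0 0) = 0.
  apply: (@Int_derive0 _ (fun x => phi x 0 0)); [exact: test_cc (test_coord 0 0 tphi)|exact: test_cc|].
  by move=> x; exact: is_derive_coord (Dphi x).
have tI : test_fun (fun x => \sum_i \sum_j ((f x 0 i * derive1 h x 0 j) * 'D_(eta x) (g i j) (u x)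
   + (f x 0 i * h x 0 j) * dform (b i j) u eta x)).
  apply: test_sum => i; apply: test_sum => j; apply: testD; apply: testMr.
  - exact: testMr (test_coord 0 i tf) (test_coord 0 j (test_derive1 th)).1.
  - exact: smooth_dcoef (smooth_g i j) fu se.
  - exact: testMr (test_coord 0 i tf) (test_coord 0 j th).1.
  - exact: smooth_dform (smooth_b i j) fu se.
rewrite -[LHS]addr0 -I0 -(IntD (test_cc tI) (test_cc tdphi)).
congr Int; apply/funext => x; rewrite dhydro_integrand // -mxD_entry; congr (fun_of_matrix _ 0 0).
rewrite /dphi (dform_theta _ fu se) connection_identity !(hydro_nabla _ _ fu).
have nT : (covariant u f x)^T = (derive1 f x)^T - (theta u x)^T *m (f x)^T.
  by rewrite /covariant [LHS]raddfB /= trmx_mul.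
by rewrite trmx_mul gm_sym // nT !mulmxA.
Qed.

(** Gamma^j_{sk} f_j X^s eta^k. Absence of torsion makes it symmetric in [eta] and [X], the symmetry
    by which these terms cancel in cyclic sums. *)
Definition torsion_form u f eta (X : path) x : R := (f x *m conn u eta x *m (X x)^T) 0 0.

Lemma torsion_formC u f eta (X : path) x : field U u ->
  torsion_form u f eta X x = torsion_form u f X eta x.
Proof.
move=> [_ Uu _]; rewrite /torsion_form.
have E (Y Z : path) : (f x *m conn u Y x *m (Z x)^T) 0 0 =
    \sum_s \sum_k \sum_j f x 0 j * Gam j s k (u x) * Y x 0 k * Z x 0 s.
  rewrite mxE; apply: eq_bigr => s _; rewrite !mxE mulr_suml exchange_big /=.
  apply: eq_bigr => j _; rewrite !mxE mulr_sumr mulr_suml.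
  by apply: eq_bigr => k _; ring.
rewrite !E exchange_big /=; apply: eq_bigr => s _; apply: eq_bigr => k _.
by apply: eq_bigr => j _; rewrite (sym_Gam (Uu x) j k s); ring.
Qed.

Definition curvature_form u f h eta x : R := (h x *m curvm u eta x *m gm u x *m (f x)^T) 0 0.

Lemma dop_hydro u f h eta : field U u -> test_fun f -> test_fun h -> test_fun eta ->
  dop (hydro_op g b) u f h eta = Int (fun x =>
    - torsion_form u f eta (hydro_op g b u h) x + torsion_form u h eta (hydro_op g b u f) x
    - curvature_form u f h eta x).
Proof.
move=> fu tf th te; rewrite /dop (is_derive1 (is_derive_hydro oU smooth_g smooth_b fu tf th te)).
rewrite dhydroE //; last by case: te.
congr Int; apply/funext => x; rewrite !mxD_entry !mxN_entry; congr (- _ + _ - _).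
have trE (M : 'M[R]_1) : M 0 0 = M^T 0 0 by rewrite mxE.
by rewrite /torsion_form [LHS]trE !trmx_mul !trmxK mulmxA.
Qed.

End LeviCivita.

Section FieldJets.
Context {R : realType} {N : nat}.
Variables (U : set 'rV[R]_N) (oU : open U).

Lemma constant_field (p : 'rV[R]_N) : U p -> field U (fun=> p).
Proof.
move=> Up; split => //; first exact: smooth_cst.
by exists 0 => x _; rewrite derive1E derive_cst.
Qed.

Lemma derive1_constant (p : 'rV[R]_N) (x : R) : derive1 (fun _ : R => p) x = 0.
Proof. by rewrite derive1E derive_cst. Qed.

(** A small perturbation of the constant field; the factor [t] keeps it inside [U]. *)
Lemma field_jet (p v : 'rV[R]_N) : U p -> exists u t,
  [/\ field U u, 0 < t, u 0 = p & derive1 u 0 = t *: v].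
Proof.
move=> Up; have fp := constant_field Up.
have [k [tk _ k0 k1 _]] := jet_exists 0 0 v 0 ltr01.
have [e e0 fe] := field_perturb1 oU fp tk.
exists (fun x => p + (e / 2) *: k x), (e / 2); split.
- by apply: fe; rewrite gtr0_norm; lra.
- by lra.
- by rewrite k0 scaler0 addr0.
- by rewrite (derive1_perturb fp tk) derive1_constant k1 add0r.
Qed.

End FieldJets.

(** * The bracket [A, A] and the vanishing of the curvature *)

Section FlatCurvature.
Context {R : realType} {N : nat}.
Notation path := (R -> 'rV[R]_N).
Variables (U : set 'rV[R]_N) (oU : open U).
Variables (g : 'I_N -> 'I_N -> 'rV[R]_N -> R) (b Gam : 'I_N -> 'I_N -> 'I_N -> 'rV[R]_N -> R).
Hypothesis LC : levi_civita U g b Gam.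
Hypothesis det_g : forall p, U p -> \det (metric_mx g p) != 0.
Let smooth_g := lc_smooth_g LC.
Let smooth_b := lc_smooth_b LC.
Let smooth_Gam := lc_smooth_Gam LC.
Let sym_g := lc_sym_g LC.
Let sym_Gam := lc_sym_Gam LC.
Implicit Types (u f h eta : path).
Local Notation A := (hydro_op g b).
Local Notation curv := (curvature Gam).
Local Notation curvm := (curvm Gam).
Local Notation curv_form := (curvature_form g Gam).
Local Notation torsion_form := (torsion_form Gam).
Local Notation conn := (conn Gam).

Lemma smooth_curvm u eta : field U u -> smooth_on [set: R] eta ->
  smooth_on [set: R] (curvm u eta).
Proof.
move=> fu se; have o := @openT R; have [su _ _] := fu.
apply: smooth_mx => // j s.
rewrite (_ : (fun x => _) = (fun x => \sum_l \sum_k curv j s l k (u x) * eta x 0 l * derive1 u x 0 k)).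
  apply: smooth_sum => // l; apply: smooth_sum => // k; apply: smoothM => //; last first.
    by apply: smooth_coord => //; exact: smooth_derive1.
  apply: smoothM => //; last exact: smooth_coord.
  have sc : smooth_on U (curv j s l k).
    apply: smoothD => //; first by apply: smoothB => //; exact: smooth_derive.
    by apply: smooth_sum => // q; apply: smoothB => //; exact: smoothM.
  exact: smooth_coef sc fu.
by apply/funext => x; rewrite mxE.
Qed.

Lemma test_torsion_form u f eta (X : path) : field U u -> test_fun f ->
  smooth_on [set: R] eta -> smooth_on [set: R] X -> test_fun (torsion_form u f eta X).
Proof.
move=> fu tf se sX; apply: (test_coord (f := fun x => f x *m conn u eta x *m (X x)^T)).
apply: test_mulmxr; last by apply: smooth_trmx => //; exact: openT.
by apply: test_mulmxr => //; exact: smooth_conn LC _ _ fu se.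
Qed.

Lemma test_curv_form u f h eta : field U u -> test_fun f -> test_fun h ->
  smooth_on [set: R] eta -> test_fun (curv_form u f h eta).
Proof.
move=> fu tf th se.
apply: (test_coord (f := fun x => h x *m curvm u eta x *m gm g u x *m (f x)^T)).
apply: test_mulmxr; last by apply: smooth_trmx; [exact: openT | case: tf].
apply: test_mulmxr; last exact: smooth_gm LC _ fu.
by apply: test_mulmxr => //; exact: smooth_curvm.
Qed.

(** In the cyclic sum the six connection terms cancel in pairs by [torsion_formC]. *)
Lemma schouten_hydro u f h k : field U u -> test_fun f -> test_fun h -> test_fun k ->
  schouten A A u f h k =
  - (Int (curv_form u f h (A u k)) + Int (curv_form u h k (A u f)) + Int (curv_form u k f (A u h))).
Proof.
move=> fu tf th tk.
have tAf := test_hydro smooth_g smooth_b fu tf; have tAh := test_hydro smooth_g smooth_b fu th.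
have tAk := test_hydro smooth_g smooth_b fu tk.
have D f' h' k' : test_fun f' -> test_fun h' -> test_fun k' ->
    dop A u f' h' (A u k') = - Int (torsion_form u f' (A u k') (A u h'))
     + Int (torsion_form u h' (A u k') (A u f')) - Int (curv_form u f' h' (A u k')).
  move=> tf' th' tk'.
  have tA1 := test_hydro smooth_g smooth_b fu tf'; have tA2 := test_hydro smooth_g smooth_b fu th'.
  have tA3 := test_hydro smooth_g smooth_b fu tk'.
  rewrite (dop_hydro oU LC fu tf' th' tA3).
  have c1 := test_cc (test_torsion_form fu tf' tA3.1 tA2.1).
  have c2 := test_cc (test_torsion_form fu th' tA3.1 tA1.1).
  have c3 := test_cc (test_curv_form fu tf' th' tA3.1).
  by rewrite (IntB (ccD (ccN c1) c2) c3) (IntD (ccN c1) c2) (IntN c1).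
have C f' (X Y : path) : Int (torsion_form u f' X Y) = Int (torsion_form u f' Y X).
  by congr Int; apply/funext => x; exact: torsion_formC LC _ _ _ _ _ fu.
rewrite /schouten (D f h k) // (D h k f) // (D k f h) //.
rewrite (C f (A u k) (A u h)) (C h (A u k) (A u f)) (C k (A u h) (A u f)).
generalize (Int (torsion_form u f (A u h) (A u k))) (Int (torsion_form u h (A u f) (A u k))).
generalize (Int (torsion_form u k (A u f) (A u h))).
generalize (Int (curv_form u f h (A u k))) (Int (curv_form u h k (A u f))).
generalize (Int (curv_form u k f (A u h))).
by move=> *; ring.
Qed.

Lemma flat_schouten_hydro : (forall p, U p -> forall j s k l, curv j s k l p = 0) ->
  forall u f h k, field U u -> test_fun f -> test_fun h -> test_fun k ->
  schouten A A u f h k = 0.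
Proof.
move=> flat u f h k fu tf th tk; rewrite schouten_hydro //.
have Z f' h' eta : Int (curv_form u f' h' eta) = 0.
  rewrite -[RHS]Int0; congr Int; apply/funext => x.
  have E : curvm u eta x = 0.
    have [_ Uu _] := fu; apply/matrixP => j s; rewrite !mxE big1 // => l _.
    by rewrite big1 // => q _; rewrite flat // !mul0r.
  by rewrite /curvature_form E mulmx0 !mul0mx mxE.
by rewrite !Z !addr0 oppr0.
Qed.

Definition curv_row u f h x : 'rV[R]_N :=
  \row_l (h x *m curvm u (fun=> delta_mx 0 l) x *m gm g u x *m (f x)^T) 0 0.

Lemma curvm_sum u eta x : curvm u eta x = \sum_l eta x 0 l *: curvm u (fun=> delta_mx 0 l) x.
Proof.
apply/matrixP => j s; rewrite summxE mxE; apply: eq_bigr => l _; rewrite !mxE.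
rewrite [in RHS](bigD1 l) //= [X in _ + X]big1 ?addr0 => [|m ml]; last first.
  by apply: big1 => k _; rewrite !mxE (negbTE ml) andbF mulr0 mul0r.
by rewrite mulr_sumr; apply: eq_bigr => k _; rewrite !mxE !eqxx /=; ring.
Qed.

Lemma curv_formE u f h eta x : curv_form u f h eta x = dot (curv_row u f h x) (eta x).
Proof.
rewrite /curvature_form curvm_sum mulmx_sumr !mulmx_suml summxE; apply: eq_bigr => l _.
by rewrite -!(scalemxAl, scalemxAr) !mxE mulrC.
Qed.

Lemma test_curv_row u f h : field U u -> test_fun f -> test_fun h -> test_fun (curv_row u f h).
Proof.
move=> fu tf th; apply: test_mx => i l.
rewrite (_ : (fun x => _) = curv_form u f h (fun=> delta_mx 0 l)).
  by apply: test_curv_form => //; exact: smooth_cst.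
by apply/funext => x; rewrite mxE.
Qed.

Section VanishingBracket.
Hypothesis skewA : skew_operator U A.
Hypothesis jacA : forall u f h k, field U u -> test_fun f -> test_fun h -> test_fun k ->
  schouten A A u f h k = 0.

(** [A, A] is linear in [f]. In its second term [f] occurs as [A f], and skew-symmetry moves [A] to
    the other factor; then [f] is arbitrary and the fundamental lemma applies. *)
Lemma curvature_pointwise u h k (x : R) : field U u -> test_fun h -> test_fun k ->
  h x *m curvm u (A u k) x *m gm g u x - A u (curv_row u h k) x
   + k x *m gm g u x *m (curvm u (A u h) x)^T = 0.
Proof.
move=> fu th tk.
have tAh := test_hydro smooth_g smooth_b fu th; have tAk := test_hydro smooth_g smooth_b fu tk.
have tr := test_curv_row fu th tk; have tAr := test_hydro smooth_g smooth_b fu tr.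
have o := @openT R; have sG := smooth_gm LC fu.
have s1 : smooth_on [set: R] (fun x => h x *m curvm u (A u k) x *m gm g u x).
  by apply: smooth_mulmx => //; apply: smooth_mulmx => //; [case: th|exact: smooth_curvm _ tAk.1].
have s3 : smooth_on [set: R] (fun x => k x *m gm g u x *m (curvm u (A u h) x)^T).
  apply: smooth_mulmx => //; first by apply: smooth_mulmx => //; case: tk.
  by apply: smooth_trmx => //; exact: smooth_curvm _ tAh.1.
pose X x := h x *m curvm u (A u k) x *m gm g u x - A u (curv_row u h k) x
   + k x *m gm g u x *m (curvm u (A u h) x)^T.
apply: (@fundamental_lemma _ _ [set: R] X) => //.
  apply: smoothT_continuous; apply: smoothD => //; apply: smoothB => //; exact: tAr.1.
move=> f tf _.
have c1 := smoothT_continuous s1; have c2 := test_continuous tAr; have c3 := smoothT_continuous s3.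
have c2' : continuous (fun x => - A u (curv_row u h k) x) by exact: test_continuous (testN tAr).
have c12 : continuous (fun x => h x *m curvm u (A u k) x *m gm g u x - A u (curv_row u h k) x).
  by move=> y; apply: cvgD; [exact: c1 | exact: c2'].
rewrite /X (pairingDr tf c12 c3) (pairingDr tf c1 c2').
have -> : pairing f (fun x => - A u (curv_row u h k) x) = - pairing f (A u (curv_row u h k)).
  by rewrite pairingC (pairingNl tAr (test_continuous tf)) pairingC.
rewrite (skewA fu tf tr) opprK.
have := jacA fu tf th tk; rewrite schouten_hydro // => /eqP; rewrite oppr_eq0 => /eqP E.
rewrite -[RHS]E; congr (_ + _ + _); rewrite ?pairingE; congr Int; apply/funext => y.
- by rewrite dotC dot_mulmx.
- by rewrite curv_formE.
- have trE (M : 'M[R]_1) : M 0 0 = M^T 0 0 by rewrite mxE.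
  by rewrite dotC dot_mulmx /curvature_form trE !trmx_mul !trmxK (gm_sym LC _ fu) !mulmxA.
Qed.

Lemma gm_unit p : U p -> metric_mx g p \in unitmx.
Proof. by move=> Up; rewrite unitmxE unitfE det_g. Qed.

Lemma mulmx_gm_eq0 u x (v : 'rV[R]_N) : field U u -> v *m gm g u x = 0 -> v = 0.
Proof.
move=> [_ Uu _] v0; have gU := gm_unit (Uu x).
by rewrite -[v](mulmxK gU) -[_ *m metric_mx g (u x)]/(v *m gm g u x) v0 mul0mx.
Qed.

(** Jets at 0 isolate single components: u_x is a multiple of e_k, [h] equals e_a, and [kk] vanishes
    with derivative e_d, which removes the third term of [curvature_pointwise]. *)
Lemma curv_relation p a d l k : U p ->
  \sum_m g d m p * curv a l m k p = \sum_s curv d s l k p * g s a p.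
Proof.
move=> Up; have [u [t [fu t0 u0 u1]]] := field_jet oU (delta_mx 0 k) Up.
have [h [th _ h0 _ _]] := @jet_exists R N 0 1 (delta_mx 0 a) 0 0 ltr01.
have [kk [tk _ k0 k1 _]] := @jet_exists R N 0 1 0 (delta_mx 0 d) 0 ltr01.
have o := @openT R.
have tr := test_curv_row fu th tk.
have := curvature_pointwise 0 fu th tk.
(* Both surviving terms end in the invertible metric, which is cancelled. *)
rewrite k0 !mul0mx addr0 !(hydro_nabla LC _ _ fu) -mulmxBl => /(mulmx_gm_eq0 fu) /eqP.
rewrite subr_eq0 => /eqP E.
have n0 : covariant Gam u kk 0 = delta_mx 0 d by rewrite /covariant k0 k1 mul0mx subr0.
have r0 : curv_row u h kk 0 = 0.
  by apply/rowP => q; rewrite mxE k0 !mul0mx !mxE.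
rewrite /covariant r0 mul0mx subr0 h0 in E.
have /rowP /(_ l) := E.
have -> : ((delta_mx 0 a : 'rV[R]_N) *m curvm u (A u kk) 0) 0 l = t * \sum_m g d m p * curv a l m k p.
  rewrite -rowE 2!mxE mulr_sumr; apply: eq_bigr => m _.
  rewrite (hydro_nabla LC _ _ fu) n0 -rowE.
  rewrite (bigD1 k) //= big1 ?addr0 => [|q qk]; last first.
    by rewrite u1 !mxE (negbTE qk) andbF !mulr0.
  by rewrite u1 !mxE !eqxx u0 /=; ring.
have -> : derive1 (curv_row u h kk) 0 0 l = t * \sum_s curv d s l k p * g s a p.
  rewrite derive1_coord; last by apply: smooth_derivable; case: tr.
  pose M x := curvm u (fun=> delta_mx 0 l) x *m gm g u x *m (h x)^T.
  have sM : smooth_on [set: R] M.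
    apply: smooth_mulmx => //; last by apply: smooth_trmx => //; case: th.
    apply: smooth_mulmx => //; last exact: smooth_gm LC _ fu.
    by apply: smooth_curvm => //; exact: smooth_cst.
  have D := is_derive_coord 0 0 (is_derive_mulmx (smooth_is_derive 0 tk.1) (smooth_is_derive 0 sM)).
  have -> : (fun y => curv_row u h kk y 0 l) = (fun y => (kk y *m M y) 0 0).
    by apply/funext => y; rewrite mxE /M !mulmxA.
  rewrite (is_derive1 D) k0 k1 mul0mx addr0 -rowE /M h0 trmx_delta -colE.
  rewrite -[col a _]/(col a (curvm u (fun=> delta_mx 0 l) 0 *m gm g u 0)) !mxE mulr_sumr.
  apply: eq_bigr => s _; rewrite !mxE mulrA; congr (_ * _); last by rewrite u0.
  rewrite (bigD1 l) //= [X in _ + X]big1 ?addr0 => [|m ml]; last first.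
    by apply: big1 => q _; rewrite !mxE (negbTE ml) andbF mulr0 mul0r.
  rewrite (bigD1 k) //= big1 ?addr0 => [|q qk]; last first.
    by rewrite u1 !mxE (negbTE qk) andbF !mulr0.
  by rewrite u1 !mxE !eqxx u0 /=; ring.
by move=> /(mulfI (lt0r_neq0 t0)).
Qed.

Lemma metric_eq0 p (v : 'I_N -> R) : U p -> (forall s, \sum_m g s m p * v m = 0) ->
  forall m, v m = 0.
Proof.
move=> Up H m; have gU := gm_unit Up.
have E : metric_mx g p *m \col_m v m = 0.
  by apply/colP => s; rewrite !mxE -[RHS](H s); apply: eq_bigr => q _; rewrite !mxE.
have := mulKmx gU (\col_m v m); rewrite E mulmx0 => /colP /(_ m).
by rewrite !mxE.
Qed.

Lemma curv_antisym p j s k l : curv j s k l p = - curv j s l k p.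
Proof.
rewrite /curvature opprD opprB; congr (_ + _); rewrite -sumrN.
by apply: eq_bigr => q _; rewrite opprB.
Qed.

Lemma curv_bianchi p j s k l : U p ->
  curv j s k l p + curv j k l s p + curv j l s k p = 0.
Proof.
move=> Up; rewrite /curvature.
have Ds a c q : partial q (Gam j a c) p = partial q (Gam j c a) p.
  apply: near_eq_derive; have := open_nbhs_nbhs (conj oU Up).
  by apply: filterS => r Ur; rewrite sym_Gam.
rewrite (Ds l s) (Ds k s) (Ds k l) !sumrB.
have S a c e : \sum_q Gam j a q p * Gam q c e p = \sum_q Gam j a q p * Gam q e c p.
  by apply: eq_bigr => q _; rewrite (sym_Gam Up q c e).
rewrite (S k l s) (S l k s) (S s l k); ring.
Qed.

(** Cyclicity in the first three indices and antisymmetry in the last two give antisymmetry in the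
    second and fourth, hence cyclicity in the last three. The three Bianchi terms then coincide, so
    3 Q = 0. *)
Lemma raised_antisymmetric_eq0 (Q : 'I_N -> 'I_N -> 'I_N -> 'I_N -> R) :
  (forall a s l k, Q a s l k = Q l a s k) -> (forall a s l k, Q a s l k = - Q a s k l) ->
  (forall a s l k, Q a s l k + Q a l k s + Q a k s l = 0) ->
  forall a s l k, Q a s l k = 0.
Proof.
move=> C T B a s l k.
have W x1 x2 x3 x4 : Q x1 x2 x3 x4 = - Q x1 x4 x3 x2.
  by rewrite C T C C.
have D x1 x2 x3 x4 : Q x1 x2 x3 x4 = Q x1 x4 x2 x3 by rewrite W T opprK.
have := B a s l k; rewrite -(D a s l k) (D a l k s); lra.
Qed.

Lemma curvature_zero p : U p -> forall j s k l, curv j s k l p = 0.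
Proof.
move=> Up.
pose Q a s l k := \sum_s' \sum_l' \sum_k' g s s' p * g l l' p * g k k' p * curv a s' l' k' p.
have Q0 a s l k : Q a s l k = 0.
  apply: raised_antisymmetric_eq0 => {a s l k} a s l k.
  - transitivity (\sum_s' \sum_k' g s s' p * g k k' p * \sum_m g l m p * curv a s' m k' p).
      apply: eq_bigr => s' _; rewrite exchange_big /=; apply: eq_bigr => k' _.
      by rewrite mulr_sumr; apply: eq_bigr => m _; ring.
    transitivity (\sum_s' \sum_k' \sum_m g a m p * g s s' p * g k k' p * curv l m s' k' p).
      apply: eq_bigr => s' _; apply: eq_bigr => k' _.
      rewrite curv_relation // mulr_sumr; apply: eq_bigr => m _.
      by rewrite (sym_g Up a m); ring.
    rewrite /Q [RHS]exchange_big; apply: eq_bigr => s' _.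
    by rewrite [RHS]exchange_big.
  - rewrite /Q -sumrN; apply: eq_bigr => s' _; rewrite -sumrN exchange_big /=.
    apply: eq_bigr => k' _; rewrite -sumrN; apply: eq_bigr => l' _.
    by rewrite curv_antisym; ring.
  - have E1 : Q a l k s = \sum_s' \sum_l' \sum_k' g s s' p * g l l' p * g k k' p * curv a l' k' s' p.
      rewrite /Q; under eq_bigr => l' _ do rewrite exchange_big /=.
      rewrite exchange_big /=; apply: eq_bigr => s' _; apply: eq_bigr => l' _.
      by apply: eq_bigr => k' _; ring.
    have E2 : Q a k s l = \sum_s' \sum_l' \sum_k' g s s' p * g l l' p * g k k' p * curv a k' s' l' p.
      rewrite /Q exchange_big /=; apply: eq_bigr => s' _.
      rewrite exchange_big /=; apply: eq_bigr => l' _.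
      by apply: eq_bigr => k' _; ring.
    rewrite E1 E2 /Q -!big_split /=; apply: big1 => s' _.
    rewrite -!big_split /=; apply: big1 => l' _.
    rewrite -!big_split /=; apply: big1 => k' _.
    by rewrite -!mulrDr curv_bianchi // mulr0.
(* Three cancellations of the nondegenerate metric, one for each raised index. *)
move=> j s k l; apply: (metric_eq0 (v := fun l => curv j s k l p) Up) => k0.
apply: (metric_eq0 (v := fun k => \sum_m g k0 m p * curv j s k m p) Up) => l0.
apply: (metric_eq0 (v := fun s => \sum_m g l0 m p * \sum_m' g k0 m' p * curv j s m m' p) Up) => s0.
rewrite -[RHS](Q0 j s0 l0 k0); apply: eq_bigr => s' _.
rewrite mulr_sumr; apply: eq_bigr => l' _.
by rewrite !mulr_sumr; apply: eq_bigr => k' _; ring.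
Qed.

End VanishingBracket.
End FlatCurvature.

(** * The local part of a Hamiltonian operator *)

Section Scalars.
Context {R : realType}.

Lemma scalar_fundamental_lemma (X : R -> R) : continuous X ->
  (forall f : R -> R, test_fun f -> Int (fun x => f x * X x) = 0) -> forall x, X x = 0.
Proof.
move=> cX H x.
pose M (y : R) : 'rV[R]_1 := X y *: const_mx 1.
have cM : continuous M by move=> y; apply: cvgZr_tmp; exact: cX.
have H' f : test_fun f -> (forall x : R, ~ [set: R] x -> f x = 0) -> pairing f M = 0.
  move=> tf _; rewrite pairingE -[RHS](H _ (test_coord 0 0 tf)); congr Int; apply/funext => y.
  by rewrite /dot big_ord1 !mxE mulr1.
have /rowP /(_ 0) := fundamental_lemma openT cM H' (x := x) I.
by rewrite !mxE mulr1.
Qed.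

Lemma scalar_jet (x0 d c0 c1 c2 : R) : 0 < d -> exists k : R -> R,
  [/\ test_fun k, forall x, d <= `|x - x0| -> k x = 0,
      k x0 = c0, derive1 k x0 = c1 & derive1 (derive1 k) x0 = c2].
Proof.
move=> d0; have [k [tk kd k0 k1 k2]] := @jet_exists R 1 x0 d c0%:M c1%:M c2%:M d0.
have D1 : derive1 (fun x => k x 0 0) = (fun x => derive1 k x 0 0).
  by apply/funext => x; rewrite derive1_coord //; apply: smooth_derivable; case: tk.
exists (fun x => k x 0 0); split; first exact: test_coord.
- by move=> x /kd ->; rewrite mxE.
- by rewrite k0 mxE mulr1n.
- by rewrite D1 k1 mxE mulr1n.
- rewrite D1 -derive1_coord ?k2 ?mxE ?mulr1n //.
  by apply: smooth_derivable; case: (test_derive1 tk).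
Qed.

End Scalars.

(** * Consequences of the skew-symmetry of the local part *)

Section SkewHydro.
Context {R : realType} {N : nat}.
Notation path := (R -> 'rV[R]_N).
Variables (U : set 'rV[R]_N) (oU : open U).
Variables (g : 'I_N -> 'I_N -> 'rV[R]_N -> R) (b : 'I_N -> 'I_N -> 'I_N -> 'rV[R]_N -> R).
Hypotheses (smooth_g : forall i j, smooth_on U (g i j))
  (smooth_b : forall i j k, smooth_on U (b i j k)).
Hypothesis skewA : skew_operator U (hydro_op g b).
Implicit Types (u f h : path).
Local Notation A := (hydro_op g b).

(** Test skew-symmetry against a covector with the single component [phi] in place i and integrate
    by parts until [phi] is undifferentiated; [phi] is arbitrary. *)
Lemma skew_hydro_pointwise u h (x : R) i : field U u -> test_fun h ->
  \sum_j ((g i j (u x) - g j i (u x)) * derive1 h x 0 j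
    + (form (b i j) u x + form (b j i) u x - 'D_(derive1 u x) (g j i) (u x)) * h x 0 j) = 0.
Proof.
move=> fu th; have [su Uu _] := fu; have o := @openT R.
have sg i' j' : smooth_on [set: R] (fun x => g i' j' (u x)) by exact: smooth_coef (smooth_g i' j') fu.
have sF i' j' : smooth_on [set: R] (form (b i' j') u) by exact: smooth_form.
have sh j : smooth_on [set: R] (fun x => h x 0 j) by apply: smooth_coord => //; case: th.
have sdh j : smooth_on [set: R] (fun x => derive1 h x 0 j).
  by apply: smooth_coord => //; case: (test_derive1 th).
have sdg i' j' : smooth_on [set: R] (derive1 (fun x => g i' j' (u x))) by exact: smooth_derive1.
have dg i' j' (y : R) : derive1 (fun x => g i' j' (u x)) y = 'D_(derive1 u y) (g i' j') (u y).
  have D := is_derive_comp_rV (1 : R) (smooth_differentiable (smooth_g i' j') (Uu y))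
    (proj1 (derivable1_diffP u y) (smooth_derivable su)).
  by rewrite (is_derive1 D) -derive1E.
pose X y := \sum_j ((g i j (u y) - g j i (u y)) * derive1 h y 0 j
    + (form (b i j) u y + form (b j i) u y - derive1 (fun x => g j i (u x)) y) * h y 0 j).
have tX : test_fun X.
  apply: test_sum => j; apply: testD.
    by apply: testMl; [exact: (smoothB o)|apply: test_coord; exact: test_derive1].
  apply: testMl; last exact: test_coord.
  by apply: (smoothB o); [exact: (smoothD o)|exact: sdg].
suff -> : \sum_j ((g i j (u x) - g j i (u x)) * derive1 h x 0 j
    + (form (b i j) u x + form (b j i) u x - 'D_(derive1 u x) (g j i) (u x)) * h x 0 j) = X x.
  apply: scalar_fundamental_lemma => [|phi tphi]; first exact: smoothT_continuous tX.1.
  pose f y : 'rV[R]_N := phi y *: delta_mx 0 i.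
  have tf : test_fun f by apply: test_scaler => //; exact: smooth_cst.
  have df y j : derive1 f y 0 j = derive1 phi y *+ (j == i).
    rewrite derive1_coord; last by apply: smooth_derivable; case: tf.
    have -> : (fun y => f y 0 j) = (fun y => (j == i)%:R * phi y).
      by apply/funext => z; rewrite /f !mxE eqxx mulrC.
    have D := is_deriveZ ((j == i)%:R : R) (smooth_is_derive y tphi.1).
    by rewrite (is_derive1 D) -[_ *: _]/(_ * _) mulrC mulr_natr.
  have E1 : pairing f (A u h) = Int (fun y => phi y *
      \sum_j (g i j (u y) * derive1 h y 0 j + form (b i j) u y * h y 0 j)).
    rewrite pairingE; congr Int; apply/funext => y.
    rewrite /f dotZl; congr (_ * _); rewrite /dot (bigD1 i) //= big1 ?addr0 => [|j ji].
      by rewrite mxE !eqxx mul1r hydroE.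
    by rewrite mxE (negbTE ji) andbF mul0r.
  have E2 : pairing h (A u f) = Int (fun y => \sum_j (h y 0 j * g j i (u y)) * derive1 phi y)
     + Int (fun y => phi y * \sum_j form (b j i) u y * h y 0 j).
    have c1 : cc (fun y => \sum_j (h y 0 j * g j i (u y)) * derive1 phi y).
      apply: test_cc; apply: test_sum => j; apply: testMr; last by apply: smooth_derive1; case: tphi.
      by apply: testMr => //; exact: test_coord.
    have c2 : cc (fun y => phi y * \sum_j form (b j i) u y * h y 0 j).
      apply: test_cc; apply: testMr => //; apply: smooth_sum => // j; exact: smoothM.
    rewrite -(IntD c1 c2) pairingE; congr Int; apply/funext => y.
    rewrite /dot mulr_sumr -big_split /=; apply: eq_bigr => j _.
    rewrite hydroE (bigD1 i) //= big1 ?addr0 => [|k ki]; last first.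
      by rewrite df /f !mxE (negbTE ki) andbF mulr0n !mulr0 addr0.
    rewrite df /f !mxE !eqxx /= (mulr1n (derive1 phi y)) (mulr1 (phi y)); ring.
  have sH j : smooth_on [set: R] (fun y => h y 0 j * g j i (u y)).
    by apply: smoothM => //; apply: smooth_coord => //; case: th.
  have dH j y : derive1 (fun y => h y 0 j * g j i (u y)) y =
      derive1 h y 0 j * g j i (u y) + h y 0 j * derive1 (fun x => g j i (u x)) y.
    have D := is_deriveM (is_derive_coord 0 j (smooth_is_derive y th.1)) (smooth_is_derive y (sg j i)).
    by rewrite (is_derive1 D) addrC -[_ *: _]/(_ * _) -[X in _ + X]/(_ * _) [X in X + _]mulrC.
  have E3 : Int (fun y => \sum_j (h y 0 j * g j i (u y)) * derive1 phi y) =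
      - Int (fun y => \sum_j (derive1 h y 0 j * g j i (u y) + h y 0 j * derive1 (fun x => g j i (u x)) y)
          * phi y).
    rewrite !Int_sum => [||j]; last 2 first.
    - move=> j; apply: test_cc; apply: testMl => //; apply: smoothD => //; exact: smoothM.
    - by apply: test_cc; apply: testMl => //; exact: test_derive1.
    rewrite -sumrN; apply: eq_bigr => j _; rewrite (Int_by_parts (sH j) tphi); congr (- Int _).
    by apply/funext => y; rewrite dH.
  have c1 : cc (fun y => phi y * \sum_j (g i j (u y) * derive1 h y 0 j + form (b i j) u y * h y 0 j)).
    apply: test_cc; apply: testMr => //; apply: smooth_sum => // j; apply: smoothD => //; exact: smoothM.
  have c2 : cc (fun y => \sum_j (derive1 h y 0 j * g j i (u y) + h y 0 j * derive1 (fun x => g j i (u x)) y)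
          * phi y).
    apply: test_cc; apply: test_sum => j; apply: testMl => //; apply: smoothD => //; exact: smoothM.
  have c3 : cc (fun y => phi y * \sum_j form (b j i) u y * h y 0 j).
    apply: test_cc; apply: testMr => //; apply: smooth_sum => // j; exact: smoothM.
  have := skewA fu tf th; rewrite E1 E2 E3 => /eqP; rewrite -addr_eq0 => /eqP <-.
  rewrite addrA -(IntB c1 c2) -(IntD (ccB c1 c2) c3); congr Int; apply/funext => y.
  rewrite /X !mulr_sumr -sumrB -big_split /=; apply: eq_bigr => j _; ring.
by rewrite /X; apply: eq_bigr => j _; rewrite dg.
Qed.

Lemma skew_metric_sym p : U p -> forall i j, g i j p = g j i p.
Proof.
move=> Up i j; have [k [tk _ k0 k1 _]] := @jet_exists R N 0 1 0 (delta_mx 0 j) 0 ltr01.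
have := skew_hydro_pointwise 0 i (constant_field Up) tk.
rewrite (bigD1 j) //= big1 ?addr0 => [|l lj]; last first.
  by rewrite k0 k1 !mxE (negbTE lj) andbF !mulr0 addr0.
by rewrite k0 k1 !mxE !eqxx mulr0 addr0 mulr1 => /eqP; rewrite subr_eq0 => /eqP.
Qed.

Lemma skew_derive_metric p : U p -> forall i j k,
  'D_(delta_mx 0 k) (g i j) p = b i j k p + b j i k p.
Proof.
move=> Up i j k; have [u [t [fu t0 u0 u1]]] := field_jet oU (delta_mx 0 k) Up.
have [h [th _ h0 h1 _]] := @jet_exists R N 0 1 (delta_mx 0 i) 0 0 ltr01.
have := skew_hydro_pointwise 0 j fu th.
rewrite (bigD1 i) //= big1 ?addr0 => [|l lj]; last first.
  by rewrite h0 h1 !mxE (negbTE lj) andbF !mulr0 addr0.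
rewrite h0 h1 !mxE !eqxx mulr0 add0r mulr1 u1 u0.
have F c : form c u 0 = t * c k p.
  rewrite /form (bigD1 k) //= big1 ?addr0 => [|l lk]; last first.
    by rewrite u1 !mxE (negbTE lk) andbF !mulr0.
  rewrite u1 u0 !mxE !eqxx; exact: (etrans (congr1 _ (mulr1 t)) (mulrC _ _)).
have dg := smooth_differentiable (smooth_g i j) Up.
rewrite !F (_ : 'D_(t *: delta_mx 0 k) (g i j) p = t * 'D_(delta_mx 0 k) (g i j) p); last first.
  by rewrite !deriveE // linearZ.
rewrite -mulrDr -mulrBr => /eqP; rewrite mulf_eq0 (gt_eqF t0) /= subr_eq0 => /eqP <-.
by rewrite addrC.
Qed.

End SkewHydro.

(** * The Jacobi identity at constant fields *)

Section ConstantFields.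
Context {R : realType} {N L : nat}.
Notation path := (R -> 'rV[R]_N).
Variables (U : set 'rV[R]_N) (oU : open U).
Variables (g : 'I_N -> 'I_N -> 'rV[R]_N -> R) (b : 'I_N -> 'I_N -> 'I_N -> 'rV[R]_N -> R).
Variables (mu : 'M[R]_L) (w : 'I_L -> 'I_N -> 'I_N -> 'rV[R]_N -> R).
Hypotheses (smooth_g : forall i j, smooth_on U (g i j))
  (smooth_b : forall i j k, smooth_on U (b i j k))
  (smooth_w : forall n i j, smooth_on U (w n i j)).
Hypothesis smu : mu^T = mu.
Local Notation A := (hydro_op g b).
Local Notation B := (nonlocal_op mu w).
Local Notation P := (lin_comb 1 1 A B).

Lemma form_constant (c : 'I_N -> 'rV[R]_N -> R) p (x : R) : form c (fun=> p) x = 0.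
Proof. by apply: big1 => k _; rewrite derive1_constant mxE mulr0. Qed.

Lemma flow_constant m p (x : R) : flow w m (fun=> p) x = 0.
Proof. by apply/rowP => i; rewrite !mxE form_constant. Qed.

Lemma tail_constant m p (h : path) (x : R) : tail mu w m (fun=> p) h x = 0.
Proof.
apply: big1 => n _; rewrite (_ : flux w n (fun=> p) h = fun=> 0) ?Dinv0 ?mulr0 //.
by apply/funext => y; rewrite /flux flow_constant dot0l.
Qed.

(** At a constant field the flows vanish, and with them the tails; the variation of the nonlocal
    part is linear in the tails. *)
Lemma dop_sum_constant p (f h eta : path) : U p -> test_fun f -> test_fun h -> test_fun eta ->
  dop P (fun=> p) f h eta = dhydro g b (fun=> p) f h eta.
Proof.
move=> Up tf th te; have fp := constant_field Up.
rewrite (dop_lin_comb oU 1 1 (pre_hydro oU smooth_g smooth_b) (pre_nonlocal oU smooth_w smu) fp tf th te).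
rewrite /dop (is_derive1 (is_derive_hydro oU smooth_g smooth_b fp tf th te)).
rewrite (is_derive1 (is_derive_nonlocal oU smooth_w smu fp tf th te)) !mul1r.
rewrite (_ : dnonlocal mu w (fun=> p) f h eta = 0) ?addr0 //.
rewrite -[RHS]Int0; congr Int; apply/funext => x; apply: big1 => m _.
by rewrite !tail_constant !scale0r subrr dot0l.
Qed.

Lemma sum_constant p (h : path) : P (fun=> p) h = A (fun=> p) h.
Proof.
apply/funext => x; rewrite /lin_comb !scale1r nonlocal_tailE big1 ?addr0 // => m _.
by rewrite tail_constant scale0r.
Qed.

Lemma derive1_scale_row (phi : R -> R) (v : 'rV[R]_N) (x : R) : smooth_on [set: R] phi ->
  derive1 (fun y => phi y *: v) x = derive1 phi x *: v.
Proof.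
move=> sphi; have D := is_derive_scale (smooth_is_derive x sphi) (is_derive_cst v x (1 : R)).
by rewrite (is_derive1 D) scaler0 addr0.
Qed.

Lemma hydro_constant p (phi : R -> R) i : smooth_on [set: R] phi ->
  A (fun=> p) (fun x => phi x *: delta_mx 0 i) = fun x => derive1 phi x *: \row_l g l i p.
Proof.
move=> sphi; apply/funext => x; apply/rowP => l; rewrite hydroE (bigD1 i) //= big1 ?addr0 => [|j ji].
  by rewrite form_constant mul0r addr0 derive1_scale_row // !mxE !eqxx mulr1 mulrC.
by rewrite form_constant mul0r addr0 derive1_scale_row // !mxE (negbTE ji) andbF !mulr0.
Qed.

Lemma dhydro_constant p (phi eta chi : R -> R) i a c : U p -> test_fun phi -> test_fun eta ->
    test_fun chi ->
  dhydro g b (fun=> p) (fun x => phi x *: delta_mx 0 i) (fun x => eta x *: delta_mx 0 a)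
    (fun x => derive1 chi x *: \row_l g l c p) =
  Int (fun x => phi x * ('D_(\row_l g l c p) (g i a) p * (derive1 eta x * derive1 chi x)
    + (\sum_l b i a l p * g l c p) * (eta x * derive1 (derive1 chi) x))).
Proof.
move=> Up tphi teta tchi; congr Int; apply/funext => x.
rewrite (bigD1 i) //= [X in _ + X]big1 ?addr0 => [|j ji]; last first.
  by apply: big1 => l _; rewrite !mxE (negbTE ji) andbF mulr0 !mul0r addr0.
rewrite (bigD1 a) //= big1 ?addr0 => [|j ja]; last first.
  rewrite derive1_scale_row; last by case: teta.
  by rewrite !mxE (negbTE ja) andbF !mulr0 !mul0r addr0.
rewrite derive1_scale_row; last by case: teta.
have sd := (test_derive1 tchi).1.
have dg := smooth_differentiable (smooth_g i a) Up.
have -> : 'D_(derive1 chi x *: (\row_l g l c p : 'rV[R]_N)) (g i a) p =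
    derive1 chi x * 'D_(\row_l g l c p) (g i a) p by rewrite !deriveE // linearZ.
have -> : dform (b i a) (fun=> p) (fun x => derive1 chi x *: (\row_l g l c p : 'rV[R]_N)) x =
    derive1 (derive1 chi) x * \sum_l b i a l p * g l c p.
  rewrite /dform mulr_sumr; apply: eq_bigr => l _.
  by rewrite derive1_constant derive1_scale_row // !mxE mulr0 add0r mulrCA.
by rewrite !mxE !eqxx !mulr1; ring.
Qed.

Hypothesis jacP : forall u f h k, field U u -> test_fun f -> test_fun h -> test_fun k ->
  schouten P P u f h k = 0.

(** The condition that makes the connection torsion-free, in contravariant form. It is the Jacobi
    identity for covectors with one component each, in the places i, a and c, read off at a single
    point. *)
Lemma jacobi_constant p i a c : U p ->
  \sum_l b i a l p * g l c p - 'D_(\row_l g l i p) (g a c) p + \sum_l b a c l p * g l i p = 0.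
Proof.
move=> Up; have fp := constant_field Up.
have o := @openT R.
(* With 2-jets (1, 0, 0) for [eta] and (0, 0, 1) for [chi] at 0, only terms in which [chi] is
   differentiated twice survive. *)
have [eta [te _ e0 e1 _]] := @scalar_jet R 0 1 1 0 0 ltr01.
have [chi [tc _ c0 c1 c2]] := @scalar_jet R 0 1 0 0 1 ltr01.
have te1 := test_derive1 te; have tc1 := test_derive1 tc.
have te2 := test_derive1 te1; have tc2 := test_derive1 tc1.
pose al i a c := 'D_(\row_l g l c p) (g i a) p : R; pose be i a c := \sum_l b i a l p * g l c p : R.
have tf1 : test_fun (fun x => eta x * derive1 chi x) by apply: testMr tc1.1.
have tf2 : test_fun (fun x => eta x * chi x) by apply: testMr tc.1.
have tf3 : test_fun (fun x => chi x * derive1 eta x) by apply: testMr te1.1.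
(* [X1], [X2], [X3] are the cofactors of [phi] in the three cyclic terms, once the derivatives have
   been integrated off [phi]. *)
pose X1 x := al i a c * (derive1 eta x * derive1 chi x) + be i a c * (eta x * derive1 (derive1 chi) x).
pose X2 x := be a c i * derive1 (derive1 (fun x => eta x * chi x)) x
  - al a c i * derive1 (fun x => eta x * derive1 chi x) x.
pose X3 x := be c i a * (chi x * derive1 (derive1 eta) x)
  - al c i a * derive1 (fun x => chi x * derive1 eta x) x.
have tZ (r : R) (f : R -> R) : test_fun f -> test_fun (fun x => r * f x).
  by move=> tf; apply: testMl => //; exact: smooth_cst.
have tX1 : test_fun X1.
  by apply: testD; apply: tZ; [exact: testMr tc1.1|exact: testMr tc2.1].
have tX2 : test_fun X2.
  by apply: testB; apply: tZ; [exact: test_derive1 (test_derive1 tf2)|exact: test_derive1].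
have tX3 : test_fun X3.
  by apply: testB; apply: tZ; [exact: testMr te2.1|exact: test_derive1].
have tX : test_fun (fun x => X1 x + X2 x + X3 x) by apply: testD tX3; exact: testD.
suff H x : X1 x + X2 x + X3 x = 0.
  have DM (f h : R -> R) (x : R) : test_fun f -> test_fun h ->
      derive1 (fun x => f x * h x) x = derive1 f x * h x + f x * derive1 h x.
    move=> tf th; have D := is_deriveM (smooth_is_derive x tf.1) (smooth_is_derive x th.1).
    by rewrite (is_derive1 D) addrC -[_ *: _]/(_ * _) -[X in _ + X]/(_ * _) [X in X + _]mulrC.
  have DM1 : derive1 (fun x => eta x * chi x) = fun x => derive1 eta x * chi x + eta x * derive1 chi x.
    by apply/funext => x; exact: DM.
  have D2 : derive1 (derive1 (fun x => eta x * chi x)) 0 = 1.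
    rewrite DM1; have D := is_deriveD
      (smooth_is_derive 0 (testMr te1 tc.1).1) (smooth_is_derive 0 (testMr te tc1.1).1).
    rewrite (is_derive1 D) !DM // e0 e1 c0 c1 c2; ring.
  have := H 0; rewrite /X1 /X2 /X3 D2 !DM // e0 e1 c0 c1 c2 => E.
  rewrite -[RHS]E /al /be; ring.
apply: (scalar_fundamental_lemma (X := fun x => X1 x + X2 x + X3 x)) => {x} [|phi tphi].
  exact: smoothT_continuous tX.1.
have tphi1 := test_derive1 tphi; have tphi2 := test_derive1 tphi1.
have tr (f : R -> R) j : test_fun f -> test_fun (fun x => f x *: delta_mx 0 j : 'rV[R]_N).
  by move=> tf; apply: test_scaler => //; exact: smooth_cst.
have tr' (f : R -> R) (v : 'rV[R]_N) : test_fun f -> test_fun (fun x => f x *: v).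
  by move=> tf; apply: test_scaler => //; exact: smooth_cst.
have := jacP fp (tr _ i tphi) (tr _ a te) (tr _ c tc).
rewrite /schouten !sum_constant !hydro_constant; try by [case: tphi|case: te|case: tc].
rewrite !dop_sum_constant //; try exact: tr; try exact: tr'.
rewrite !dhydro_constant // -!/(al _ _ _) -!/(be _ _ _) => E.
have IP (r r' : R) (h1 h2 : R -> R) : test_fun h1 -> test_fun h2 ->
    Int (fun x => phi x * (r * derive1 h1 x - r' * derive1 h2 x)) =
    Int (fun x => - (r * (derive1 phi x * h1 x)) + r' * (derive1 phi x * h2 x)).
  move=> th1 th2; have d1 := test_derive1 th1; have d2 := test_derive1 th2.
  have i1 := test_cc (testMr tphi d1.1); have i2 := test_cc (testMr tphi d2.1).
  have j1 := test_cc (testMr tphi1 th1.1); have j2 := test_cc (testMr tphi1 th2.1).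
  rewrite (IntD (ccN (ccZ r j1)) (ccZ r' j2)) (IntN (ccZ r j1)) (IntZ r j1) (IntZ r' j2).
  have -> : Int (fun x => phi x * (r * derive1 h1 x - r' * derive1 h2 x)) =
      Int (fun x => r * (phi x * derive1 h1 x) - r' * (phi x * derive1 h2 x)).
    by congr Int; apply/funext => x; ring.
  rewrite (IntB (ccZ r i1) (ccZ r' i2)) (IntZ r i1) (IntZ r' i2).
  rewrite (Int_by_parts tphi.1 th1) (Int_by_parts tphi.1 th2); ring.
have I1 : Int (fun x => phi x * X1 x) = Int (fun x => phi x *
    (al i a c * (derive1 eta x * derive1 chi x) + be i a c * (eta x * derive1 (derive1 chi) x))) by [].
have I2 : Int (fun x => phi x * X2 x) = Int (fun x => eta x *
    (al a c i * (derive1 chi x * derive1 phi x) + be a c i * (chi x * derive1 (derive1 phi) x))).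
  rewrite (IP _ _ _ _ (test_derive1 tf2) tf1).
  have j1 := test_cc (testMr tphi2 tf2.1); have j0 := test_cc (testMr tphi1 (test_derive1 tf2).1).
  have j2 := test_cc (testMr tphi1 tf1.1).
  rewrite (IntD (ccN (ccZ (be a c i) j0)) (ccZ (al a c i) j2)) (IntN (ccZ (be a c i) j0)) (IntZ (be a c i) j0).
  rewrite (Int_by_parts tphi1.1 tf2) mulrN opprK -(IntZ (be a c i) j1) -(IntD (ccZ _ j1) (ccZ _ j2)).
  by congr Int; apply/funext => x; ring.
have I3 : Int (fun x => phi x * X3 x) = Int (fun x => chi x *
    (al c i a * (derive1 phi x * derive1 eta x) + be c i a * (phi x * derive1 (derive1 eta) x))).
  have -> : Int (fun x => phi x * X3 x) = Int (fun x => phi x * (0 * derive1 phi x - al c i a *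
      derive1 (fun x => chi x * derive1 eta x) x)) +
      be c i a * Int (fun x => phi x * (chi x * derive1 (derive1 eta) x)).
    have j1 := test_cc (testMr tphi (testMr tc te2.1).1).
    have j2 := test_cc (testMr tphi (test_derive1 tf3).1).
    rewrite -(IntZ (be c i a) j1).
    have -> : (fun x => phi x * (0 * derive1 phi x - al c i a * derive1 (fun x => chi x * derive1 eta x) x))
       = fun x => (- al c i a) * (phi x * derive1 (fun x => chi x * derive1 eta x) x).
      by apply/funext => x; ring.
    rewrite -(IntD (ccZ _ j2) (ccZ _ j1)); congr Int; apply/funext => x; rewrite /X3; ring.
  rewrite (IP _ _ _ _ tphi tf3).
  have j1 := test_cc (testMr tphi (testMr tc te2.1).1).
  have j2 := test_cc (testMr tphi1 tf3.1).
  have -> : (fun x => - (0 * (derive1 phi x * phi x)) + al c i a * (derive1 phi x * (chi x * derive1 eta x)))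
     = fun x => al c i a * (derive1 phi x * (chi x * derive1 eta x)) by apply/funext => x; ring.
  rewrite -(IntZ (be c i a) j1) -(IntD (ccZ _ j2) (ccZ _ j1)); congr Int; apply/funext => x; ring.
have cX := fun Y (tY : test_fun Y) => test_cc (testMr tphi tY.1).
have K : Int (fun x => phi x * (X1 x + X2 x + X3 x)) =
    Int (fun x => phi x * X1 x) + Int (fun x => phi x * X2 x) + Int (fun x => phi x * X3 x).
  rewrite -(IntD (cX _ tX1) (cX _ tX2)) -(IntD (ccD (cX _ tX1) (cX _ tX2)) (cX _ tX3)).
  by congr Int; apply/funext => x; rewrite (mulrDr (phi x) (X1 x + X2 x)) (mulrDr (phi x) (X1 x)).
refine (etrans K (etrans _ E)); exact: congr2 (congr2 _ I1 I2) I3.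
Qed.

End ConstantFields.

Section Determinant.
Context {R : realType}.

Lemma smooth_det (V : normedModType R) n (A : set V) (M : V -> 'M[R]_n) : open A ->
  (forall i j, smooth_on A (fun p => M p i j)) -> smooth_on A (fun p => \det (M p)).
Proof.
move=> oA sM; apply: smooth_sum => // s; apply: smoothM => //; first exact: smooth_cst.
exact: smooth_prod.
Qed.

Lemma smooth_cofactor (V : normedModType R) n (A : set V) (M : V -> 'M[R]_n) i j : open A ->
  (forall i j, smooth_on A (fun p => M p i j)) -> smooth_on A (fun p => cofactor (M p) i j).
Proof.
move=> oA sM; apply: smoothM => //; first exact: smooth_cst.
apply: smooth_det => // i' j'.
by apply: (smooth_ext _ _ (sM (lift i i') (lift j j'))) => // p _; rewrite !mxE.
Qed.

End Determinant.

(** * Identification of b with the Levi-Civita connection *)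

Section Christoffel.
Context {R : realType} {N : nat}.
Variables (U : set 'rV[R]_N) (oU : open U).
Variables (g : 'I_N -> 'I_N -> 'rV[R]_N -> R) (b : 'I_N -> 'I_N -> 'I_N -> 'rV[R]_N -> R).
Hypotheses (smooth_g : forall i j, smooth_on U (g i j))
  (smooth_b : forall i j k, smooth_on U (b i j k)).
Hypothesis det_g : forall p, U p -> \det (metric_mx g p) != 0.
Hypothesis sym_g : forall p, U p -> forall i j, g i j p = g j i p.
Hypothesis dgE : forall p, U p -> forall i j k,
  'D_(delta_mx 0 k) (g i j) p = b i j k p + b j i k p.
Hypothesis torsion_free : forall p, U p -> forall i a c,
  \sum_l g c l p * b i a l p = \sum_l g i l p * b c a l p.

Local Notation c := (cometric g).

Let gU p : U p -> metric_mx g p \in unitmx.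
Proof. by move=> Up; rewrite unitmxE unitfE det_g. Qed.

Lemma cometric_mulrV p i j : U p -> \sum_s g i s p * c s j p = (i == j)%:R.
Proof.
move=> Up; have /matrixP /(_ i j) := mulmxV (gU Up); rewrite !mxE => <-.
by apply: eq_bigr => s _; rewrite !mxE.
Qed.

Lemma cometric_sym p i j : U p -> c i j p = c j i p.
Proof.
move=> Up; rewrite /cometric; have E : (invmx (metric_mx g p))^T = invmx (metric_mx g p).
  by rewrite trmx_inv; congr invmx; apply/matrixP => a d; rewrite !mxE sym_g.
by rewrite -[in LHS]E mxE.
Qed.

Lemma smooth_cometric i j : smooth_on U (c i j).
Proof.
have sg a d : smooth_on U (fun p => metric_mx g p a d).
  by apply: (smooth_ext _ _ (smooth_g a d)) => // p _; rewrite mxE.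
apply: (smooth_ext (f := fun p => (\det (metric_mx g p))^-1 * cofactor (metric_mx g p) j i)) => //.
  by move=> p Up; rewrite /cometric /invmx gU // !mxE.
apply: smoothM => //; last exact: smooth_cofactor.
by apply: smoothV => //; exact: smooth_det.
Qed.

(* [connection j s k] is [Gamma^j_{sk}], recovered from [b]. *)
Definition connection (j s k : 'I_N) (p : 'rV[R]_N) : R := - \sum_i c s i p * b i j k p.

Lemma smooth_connection j s k : smooth_on U (connection j s k).
Proof.
apply: smoothN => //; apply: smooth_sum => // i; apply: smoothM => //; exact: smooth_cometric.
Qed.

Lemma connectionE p i j k : U p -> b i j k p = - \sum_s g i s p * connection j s k p.
Proof.
move=> Up; under eq_bigr => s _ do rewrite mulrN mulr_sumr.
rewrite sumrN opprK exchange_big /=.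
under eq_bigr => a _ do under eq_bigr => s _ do rewrite mulrA.
under eq_bigr => a _ do rewrite -mulr_suml cometric_mulrV //.
rewrite (bigD1 i) //= big1 ?addr0 ?eqxx ?mul1r // => a ai.
by rewrite eq_sym (negbTE ai) mul0r.
Qed.

(** [torsion_free] is this symmetry with both lower indices raised; the nondegenerate metric is
    cancelled twice. *)
Lemma connection_sym p j s k : U p -> connection j s k p = connection j k s p.
Proof.
move=> Up; apply/eqP; rewrite -subr_eq0; apply/eqP.
apply: (metric_eq0 det_g (v := fun s => connection j s k p - connection j k s p) Up) => s0.
apply: (metric_eq0 det_g (v := fun k => \sum_s g s0 s p * (connection j s k p - connection j k s p)) Up) => k0.
have H := torsion_free Up s0 j k0.
have E i0 l0 : \sum_l g l0 l p * b i0 j l p =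
    - \sum_l \sum_m g l0 l p * (g i0 m p * connection j m l p).
  rewrite -sumrN; apply: eq_bigr => l _; rewrite connectionE // mulrN mulr_sumr.
  by congr (- _); apply: eq_bigr => m _; ring.
rewrite !E in H.
have H' := oppr_inj H.
rewrite [X in _ = X]exchange_big /= in H'.
under eq_bigr => m _ do under eq_bigr => q _ do rewrite mulrBr.
under eq_bigr => m _ do rewrite sumrB mulrBr !mulr_sumr.
rewrite sumrB H'; apply/eqP; rewrite subr_eq0; apply/eqP.
by apply: eq_bigr => m _; apply: eq_bigr => q _; ring.
Qed.

(** Differentiate the product of the inverse matrix and the metric, which is the identity near
    [p]. *)
Lemma derive_cometric p a d k : U p -> partial k (c a d) p =
  \sum_j connection j a k p * c j d p + \sum_i c a i p * connection i d k p.
Proof.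
move=> Up; pose M q := invmx (metric_mx g q).
pose dC : 'M[R]_N := \matrix_(i, j) partial k (c i j) p.
pose dG : 'M[R]_N := \matrix_(i, j) (b i j k p + b j i k p).
have DC : is_derive p (delta_mx 0 k : 'rV[R]_N) M dC.
  apply: is_derive_mx => i j; rewrite mxE.
  exact: derivableP (diff_derivable (smooth_differentiable (smooth_cometric i j) Up)).
have DG : is_derive p (delta_mx 0 k : 'rV[R]_N) (metric_mx g) dG.
  apply: is_derive_mx => i j; rewrite mxE -dgE //.
  rewrite (_ : (fun q => metric_mx g q i j) = g i j); last by apply/funext => q; rewrite mxE.
  exact: derivableP (diff_derivable (smooth_differentiable (smooth_g i j) Up)).
have D := is_derive_mulmx DC DG.
have nE : \forall q \near p, (fun=> 1%:M) q = M q *m metric_mx g q.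
  have := open_nbhs_nbhs (conj oU Up); apply: filterS => q Uq.
  by rewrite /M mulVmx // gU.
have /eqP := near_eq_derive (delta_mx 0 k : 'rV[R]_N) nE.
rewrite derive_cst (@derive_val _ _ _ _ _ _ _ D) eq_sym addr_eq0 => /eqP E.
have E' : dC = - (M p *m dG *m M p).
  by rewrite -[LHS](mulmxK (gU Up)) E mulNmx.
pose K : 'M[R]_N := \matrix_(i, s) connection i s k p.
have EG : dG = - (metric_mx g p *m K^T) - K *m metric_mx g p.
  apply/matrixP => i j; rewrite mxD_entry !mxN_entry !mxE !connectionE // addrC.
  rewrite addrC; congr (- _ - _); apply: eq_bigr => s _; rewrite !mxE //.
  by rewrite (sym_g Up j s) mulrC.
have := E'; rewrite EG !(mulmxBr, mulmxBl, mulmxN, mulNmx, opprB, opprK) !mulmxA.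
rewrite mulVmx ?gU // mul1mx -!mulmxA mulmxV ?gU // mulmx1.
move=> /matrixP /(_ a d); rewrite [LHS]mxE mxD_entry => ->; rewrite addrC.
by congr (_ + _); rewrite mxE; apply: eq_bigr => j _; rewrite !mxE.
Qed.

(** The computation of Koszul: the three partial derivatives give six lowered coefficients, of which
    four cancel by symmetry and the other two agree. *)
Lemma christoffel_connection p j s k : U p -> christoffel g j s k p = connection j s k p.
Proof.
move=> Up; pose low a d k := \sum_q connection q a k p * c q d p.
have S a d e : low a d e = low e d a.
  by apply: eq_bigr => q _; rewrite connection_sym.
have D a d e : partial e (c a d) p = low a d e + low d a e.
  rewrite derive_cometric //; congr (_ + _); apply: eq_bigr => q _.
  by rewrite cometric_sym // mulrC.
have E l : partial s (c l k) p + partial k (c l s) p - partial l (c s k) p = 2 * low s l k.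
  rewrite !D (S l k s) (S l s k) (S k l s); ring.
rewrite /christoffel; under eq_bigr => l _ do rewrite E mulrCA.
rewrite -mulr_sumr mulKf ?pnatr_eq0 //.
under eq_bigr => l _ do rewrite mulr_sumr.
rewrite exchange_big /= (bigD1 j) //= [X in _ + X]big1 ?addr0 => [|q qj].
  under eq_bigr => l _ do rewrite mulrCA.
  rewrite -mulr_sumr; under eq_bigr => l _ do rewrite cometric_sym //.
  by rewrite cometric_mulrV // eqxx mulr1.
under eq_bigr => l _ do rewrite mulrCA.
rewrite -mulr_sumr; under eq_bigr => l _ do rewrite cometric_sym //.
by rewrite cometric_mulrV // eq_sym (negbTE qj) mulr0.
Qed.

Lemma levi_civita_christoffel : levi_civita U g b (christoffel g).
Proof.
split => //.
- move=> j s k; apply: (smooth_ext oU _ (smooth_connection j s k)) => p Up.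
  by rewrite christoffel_connection.
- by move=> p Up j s k; rewrite !christoffel_connection // connection_sym.
- by move=> p Up i j k; rewrite connectionE //; under eq_bigr => s _ do rewrite -christoffel_connection //.
Qed.

End Christoffel.

Section Necessity.
Context {R : realType} {N L : nat}.
Variables (U : set 'rV[R]_N) (oU : open U).
Variables (g : 'I_N -> 'I_N -> 'rV[R]_N -> R) (b : 'I_N -> 'I_N -> 'I_N -> 'rV[R]_N -> R).
Variables (mu : 'M[R]_L) (w : 'I_L -> 'I_N -> 'I_N -> 'rV[R]_N -> R).
Hypotheses (smooth_g : forall i j, smooth_on U (g i j))
  (smooth_b : forall i j k, smooth_on U (b i j k))
  (smooth_w : forall n i j, smooth_on U (w n i j)).
Hypothesis det_g : forall p, U p -> \det (metric_mx g p) != 0.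
Hypothesis smu : mu^T = mu.
Hypothesis hamP : hamiltonian U (lin_comb 1 1 (hydro_op g b) (nonlocal_op mu w)).

Let preA := pre_hydro oU smooth_g smooth_b.
Let preB := pre_nonlocal oU smooth_w smu.

(** The nonlocal part is skew by itself and can be subtracted. *)
Lemma hamiltonian_skew_hydro : skew_operator U (hydro_op g b).
Proof.
have [skewP _] := (hamiltonianP oU (pre_lin_comb oU 1 1 preA preB)).1 hamP.
move=> u f h fu tf th; have := skewP u f h fu tf th.
rewrite !(pairing_lin_comb 1 1 preA preB fu) // (nonlocal_skew smooth_w smu fu tf th).
by rewrite !mul1r opprD => /addIr.
Qed.

Lemma hamiltonian_levi_civita : levi_civita U g b (christoffel g).
Proof.
have [_ jacP] := (hamiltonianP oU (pre_lin_comb oU 1 1 preA preB)).1 hamP.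
have skewA := hamiltonian_skew_hydro.
have symg := skew_metric_sym smooth_g smooth_b skewA.
have dg := skew_derive_metric oU smooth_g smooth_b skewA.
apply: levi_civita_christoffel => // p Up i a d.
have Dr (v : 'rV[R]_N) : 'D_v (g a d) p = \sum_l v 0 l * 'D_(delta_mx 0 l) (g a d) p.
  exact: derive_rV (smooth_differentiable (smooth_g a d) Up).
have := jacobi_constant oU smooth_g smooth_b smooth_w smu jacP i a d Up.
rewrite Dr => E.
have E2 : \sum_l (\row_l g l i p : 'rV[R]_N) 0 l * 'D_(delta_mx 0 l) (g a d) p =
    \sum_l b a d l p * g l i p + \sum_l b d a l p * g l i p.
  by rewrite -big_split /=; apply: eq_bigr => l _; rewrite mxE dg // mulrC mulrDl.
rewrite E2 in E.
have -> : \sum_l g d l p * b i a l p = \sum_l b i a l p * g l d p.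
  by apply: eq_bigr => l _; rewrite symg // mulrC.
have -> : \sum_l g i l p * b d a l p = \sum_l b d a l p * g l i p.
  by apply: eq_bigr => l _; rewrite symg // mulrC.
move: E; move: (\sum_l b i a l p * g l d p) (\sum_l b a d l p * g l i p) (\sum_l b d a l p * g l i p).
by move=> x y z E; lra.
Qed.

End Necessity.

(** * The Schouten bracket of the nonlocal part *)

Section Localisation.
Context {R : realType}.
Implicit Types f : R -> R.

Lemma Dinv_after f (x : R) : cc f -> (forall y, x < y -> f y = 0) ->
  Dinv f x = 2^-1 * Int f.
Proof.
move=> cf f0; rewrite DinvE //; have -> : Prim f x = Int f.
  rewrite /Prim Rintegral_mkcond; apply: eq_Rintegral => y _.
  rewrite patchE; case: ifPn => //= /negP yx; rewrite f0 // ltNge; apply/negP => xy.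
  by apply: yx; rewrite inE /= in_itv.
by field.
Qed.

Lemma Dinv_before f (x : R) : cc f -> (forall y, y <= x -> f y = 0) ->
  Dinv f x = - (2^-1 * Int f).
Proof.
move=> cf f0; rewrite DinvE //; have -> : Prim f x = 0.
  rewrite -[RHS]Int0 /Prim Rintegral_mkcond; apply: eq_Rintegral => y _.
  rewrite patchE; case: ifPn => //=; rewrite inE /= in_itv /= => /f0 ->//.
by rewrite add0r.
Qed.

End Localisation.

(** * Reparametrisation of fields near a point *)

Section Fold.
Context {R : realType}.

(* A change of parameter supported near [x0], not necessarily injective, with
   prescribed first and second derivatives at [x0]. *)
Definition fold (x0 d a1 a2 : R) (phi : R -> R) : Prop :=
  [/\ smooth_on [set: R] phi, forall x, d <= `|x - x0| -> phi x = x,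
      phi x0 = x0, derive1 phi x0 = a1 & derive1 (derive1 phi) x0 = a2].

Lemma fold_exists (x0 d a1 a2 : R) : 0 < d -> exists phi, fold x0 d a1 a2 phi.
Proof.
move=> d0; have [k [tk kd k0 k1 k2]] := scalar_jet x0 0 (a1 - 1) a2 d0.
have o := @openT R; have sphi : smooth_on [set: R] (fun x => x + k x).
  by apply: smoothD => //; [exact: smooth_id|case: tk].
have D1 (x : R) : derive1 (fun x => x + k x) x = 1 + derive1 k x.
  have D := is_deriveD (is_derive_id x (1 : R)) (smooth_is_derive x tk.1).
  exact: is_derive1 D.
exists (fun x => x + k x); split; first exact: sphi.
- by move=> x /kd ->; rewrite addr0.
- by rewrite k0 addr0.
- by rewrite D1 k1; ring.
- rewrite (_ : derive1 (fun x => x + k x) = fun x => 1 + derive1 k x); last exact/funext.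
  have D := is_deriveD (is_derive_cst (1 : R) x0 (1 : R)) (smooth_is_derive x0 (test_derive1 tk).1).
  by rewrite (is_derive1 D) add0r k2.
Qed.

Lemma open_derive1 (V : normedModType R) (O : set R) (f g : R -> V) : open O ->
  (forall x, O x -> f x = g x) -> forall x, O x -> derive1 f x = derive1 g x.
Proof.
move=> oO fg x Ox; apply: derive1_near; have := open_nbhs_nbhs (conj oO Ox).
by apply: filterS => y Oy; exact: fg.
Qed.

Lemma open_away (x0 d : R) : open [set y : R | d < `|y - x0|].
Proof.
apply: (@open_comp _ _ (fun y : R => `|y - x0|) [set z | d < z]); last exact: open_gt.
move=> y _; apply: cvg_norm; apply: cvgB; [exact: cvg_id|exact: cvg_cst].
Qed.

Lemma open_close (x0 d : R) : open [set y : R | `|y - x0| < d].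
Proof.
apply: (@open_comp _ _ (fun y : R => `|y - x0|) [set z | z < d]); last exact: open_lt.
move=> y _; apply: cvg_norm; apply: cvgB; [exact: cvg_id|exact: cvg_cst].
Qed.

End Fold.

Section FoldedFields.
Context {R : realType} {N : nat}.
Notation path := (R -> 'rV[R]_N).
Variables (U : set 'rV[R]_N).
Variables (x0 d a1 a2 : R) (phi : R -> R).
Hypothesis Fphi : fold x0 d a1 a2 phi.

Lemma derive1_comp_row m n (v : R -> 'M[R]_(m, n)) (psi : R -> R) (x : R) : smooth_on [set: R] v ->
  smooth_on [set: R] psi -> derive1 (fun y => v (psi y)) x = derive1 psi x *: derive1 v (psi x).
Proof.
move=> sv spsi; apply: is_derive1; apply: is_derive_mx => i j; rewrite mxE.
exact: is_derive_comp1 (is_derive_coord i j (smooth_is_derive _ sv)) (smooth_is_derive x spsi).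
Qed.

Variable u : path.
Hypothesis fu : field U u.
Local Notation u' := (fun x => u (phi x)).

Lemma derive1_fold (x : R) : derive1 u' x = derive1 phi x *: derive1 u (phi x).
Proof. by apply: derive1_comp_row; [case: fu|case: Fphi]. Qed.

Lemma field_fold : field U u'.
Proof.
have [su Uu [r ur]] := fu; have [sphi pE _ _ _] := Fphi; split => //.
  by apply: smooth_row_comp => //; exact: openT.
exists (Num.max r (`|x0| + d)) => x; rewrite gt_max => /andP[rx dx].
rewrite derive1_fold pE ?ur ?scaler0 //.
by have := ler_normB (x - x0) (- x0); rewrite opprK subrK normrN; lra.
Qed.

Lemma form_fold ck (x : R) : form ck u' x = derive1 phi x * form ck u (phi x).
Proof.
rewrite /form mulr_sumr; apply: eq_bigr => k _.
by rewrite derive1_fold mxE mulrCA.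
Qed.

(** Explains the prescribed jets: (-1, 0) flips a form at x0 but keeps its derivative, while (0, 1)
    kills the form and turns its derivative into its old value. *)
Lemma derive1_form_fold ck : (forall k, smooth_on U (ck k)) -> 
  derive1 (form ck u') x0 = a2 * form ck u x0 + a1 ^+ 2 * derive1 (form ck u) x0.
Proof.
move=> sck; have [sphi pE p0 p1 p2] := Fphi.
have -> : form ck u' = fun x => derive1 phi x * form ck u (phi x).
  by apply/funext => x; exact: form_fold.
have sF := smooth_form sck fu.
have D := is_deriveM (smooth_is_derive x0 (smooth_derive1 sphi))
  (is_derive_comp1 (smooth_is_derive (phi x0) sF) (smooth_is_derive x0 sphi)).
rewrite (is_derive1 D) p0 p1 p2 -[_ *: _]/(_ * _) -[X in _ + X]/(_ * _); ring.
Qed.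

Lemma fold_away (x : R) : d < `|x - x0| -> u' x = u x.
Proof. by move=> /ltW dx; have [_ H _ _ _] := Fphi; rewrite H. Qed.

End FoldedFields.

(** * Affinors, flows and tails *)

Section Flows.
Context {R : realType} {N L : nat}.
Notation path := (R -> 'rV[R]_N).
Variables (U : set 'rV[R]_N) (oU : open U) (mu : 'M[R]_L).
Variable w : 'I_L -> 'I_N -> 'I_N -> 'rV[R]_N -> R.
Hypothesis smooth_w : forall n i j, smooth_on U (w n i j).
Implicit Types u f h k eta : path.

Definition afn m u x : 'M[R]_N := metric_mx (w m) (u x).

(* [(i, l)] entry [d_l w^i_j u^j_x]. *)
Definition dafn m u x : 'M[R]_N :=
  \matrix_(i, l) form (fun j => partial l (w m i j)) u x.

(** The density of the tail: the x-derivative of [tail m u h] is its contraction with [h]. *)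
Definition Xi m u x : 'rV[R]_N := \sum_p mu m p *: flow w p u x.

Lemma dflowE m u eta (x : R) : field U u ->
  dflow w m u eta x = eta x *m (dafn m u x)^T + derive1 eta x *m (afn m u x)^T.
Proof.
move=> [_ Uu _]; apply/rowP => i; rewrite mxD_entry !mxE /dform big_split /=; congr (_ + _).
  under eq_bigr => j _ do rewrite (derive_rV _ (smooth_differentiable (smooth_w m i j) (Uu x))) mulr_suml.
  rewrite exchange_big /=; apply: eq_bigr => l _; rewrite !mxE mulr_sumr.
  by apply: eq_bigr => j _; rewrite mulrA.
by apply: eq_bigr => j _; rewrite !mxE mulrC.
Qed.

Lemma smooth_afn m u : field U u -> smooth_on [set: R] (afn m u).
Proof.
move=> fu; apply: smooth_mx => [|i j]; first exact: openT.
rewrite (_ : (fun x => _) = (fun x => w m i j (u x))); first exact: smooth_coef (smooth_w m i j) fu.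
by apply/funext => x; rewrite mxE.
Qed.

Lemma smooth_dafn m u : field U u -> smooth_on [set: R] (dafn m u).
Proof.
move=> fu; apply: smooth_mx => [|i l]; first exact: openT.
rewrite (_ : (fun x => _) = form (fun j => partial l (w m i j)) u).
  by apply: smooth_form fu => j; exact: smooth_derive.
by apply/funext => x; rewrite mxE.
Qed.

Lemma smooth_flow m u : field U u -> smooth_on [set: R] (flow w m u).
Proof. by move=> fu; case: (test_flow smooth_w m fu). Qed.

Lemma smooth_Xi m u : field U u -> smooth_on [set: R] (Xi m u).
Proof.
move=> fu; apply: smooth_sum => [|p]; first exact: openT.
by apply: smoothZ; [exact: openT|exact: smooth_flow].
Qed.

Lemma dflowD m u eta zeta (x : R) : field U u -> smooth_on [set: R] eta -> smooth_on [set: R] zeta ->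
  dflow w m u (fun y => eta y + zeta y) x = dflow w m u eta x + dflow w m u zeta x.
Proof.
move=> fu se sz; rewrite !dflowE //.
rewrite (is_derive1 (is_deriveD (smooth_is_derive x se) (smooth_is_derive x sz))) !mulmxDl.
by rewrite addrACA.
Qed.

Lemma is_derive_tail m u h (x : R) : field U u -> smooth_on [set: R] h ->
  is_derive x 1 (tail mu w m u h) (dot (Xi m u x) (h x)).
Proof.
move=> fu sh.
have D n := is_deriveZ (mu m n) (is_derive_Dinv x (test_cc (test_flux smooth_w n fu sh))).
have D' := is_derive_sum D.
have -> : tail mu w m u h = \sum_n (fun x => mu m n * Dinv (flux w n u h) x).
  by apply/funext => y; rewrite fct_sumE.
by apply: (is_derive_eq D'); rewrite /Xi dot_suml; apply: eq_bigr => n _; rewrite dotZl.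
Qed.

Lemma cc_Xi m u h : field U u -> test_fun h -> cc (fun x => dot (Xi m u x) (h x)).
Proof.
move=> fu th; rewrite (_ : (fun x => _) = fun x => dot (h x) (Xi m u x)).
  by apply: cc_dot => //; apply: smoothT_continuous; exact: smooth_Xi.
by apply/funext => x; rewrite dotC.
Qed.

Lemma tail_Dinv m u h (x : R) : field U u -> test_fun h ->
  tail mu w m u h x = Dinv (fun y => dot (Xi m u y) (h y)) x.
Proof.
move=> fu th; rewrite /tail.
under eq_bigr => n _ do rewrite -(DinvZ (mu m n) x (test_cc (test_flux smooth_w n fu th.1))).
rewrite -(Dinv_sum _ x (fun n => ccZ (mu m n) (test_cc (test_flux smooth_w n fu th.1)))).
congr Dinv; apply/funext => y; rewrite dot_suml.
by apply: eq_bigr => n _; rewrite dotZl.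
Qed.

Lemma nonlocal_eq u h : nonlocal_op mu w u h = fun x => \sum_m tail mu w m u h x *: flow w m u x.
Proof. by apply/funext => x; rewrite nonlocal_tailE. Qed.

Lemma dflow_nonlocal m u h (x : R) : field U u -> smooth_on [set: R] h ->
  dflow w m u (nonlocal_op mu w u h) x =
  \sum_n (tail mu w n u h x *: dflow w m u (flow w n u) x
    + dot (Xi n u x) (h x) *: (flow w n u x *m (afn m u x)^T)).
Proof.
move=> fu sh; rewrite dflowE // nonlocal_eq.
have D n := is_derive_scale (is_derive_tail n x fu sh) (smooth_is_derive x (smooth_flow n fu)).
have E : derive1 (fun x => \sum_n tail mu w n u h x *: flow w n u x) x =
    \sum_n (dot (Xi n u x) (h x) *: flow w n u x + tail mu w n u h x *: derive1 (flow w n u) x).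
  apply: is_derive1; have D' := is_derive_sum D.
  rewrite (_ : (fun x => _) = \sum_n (fun x => tail mu w n u h x *: flow w n u x)) //.
  by apply/funext => y; rewrite fct_sumE.
rewrite E !mulmx_suml -big_split /=; apply: eq_bigr => n _.
rewrite dflowE // mulmxDl -!scalemxAl scalerDr -addrA; congr (_ + _).
by rewrite addrC.
Qed.

(** A combination of tails at [x] is [Dinv] of [h] contracted with a fixed covector density [K].
    Tests supported away from [x] force K = 0 off [x], and continuity gives K = 0 at [x] as well. *)
Lemma tail_density u (X : 'I_L -> R) (x : R) : field U u ->
  (forall h (d : R), test_fun h -> 0 < d -> (forall y, `|y - x| < d -> h y = 0) ->
    \sum_m X m * tail mu w m u h x = 0) ->
  forall h, test_fun h -> \sum_m X m * tail mu w m u h x = 0.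
Proof.
move=> fu H; pose K (y : R) : 'rV[R]_N := \sum_m X m *: Xi m u y.
have o := @openT R.
have sK : smooth_on [set: R] K.
  by apply: smooth_sum => // m; apply: smoothZ => //; exact: smooth_Xi.
have cK := smoothT_continuous sK.
have tE h : test_fun h -> \sum_m X m * tail mu w m u h x = Dinv (fun y => dot (h y) (K y)) x.
  move=> th; under eq_bigr => m _ do rewrite (tail_Dinv m x fu th) -(DinvZ (X m) x (cc_Xi m fu th)).
  rewrite -(Dinv_sum _ x (fun m => ccZ (X m) (cc_Xi m fu th))); congr Dinv; apply/funext => y.
  by rewrite /K dot_sumr; apply: eq_bigr => m _; rewrite dotZr dotC.
have cch h : test_fun h -> cc (fun y => dot (h y) (K y)) by move=> th; exact: cc_dot.
have K0 (y : R) : y != x -> K y = 0.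
  move=> yx; pose d : R := `|y - x| / 2; have d0 : 0 < d by rewrite divr_gt0 // normr_gt0 subr_eq0.
  apply: (fundamental_lemma (@open_close R y d) cK); last by rewrite /= subrr normr0.
  move=> h th h0; have {}h0 z : d <= `|z - y| -> h z = 0.
    by move=> dz; apply: h0 => /=; rewrite ltNge dz.
  have hx z : `|z - x| < d -> h z = 0.
    move=> zx; apply: h0; have := ler_distD z y x.
    have : `|y - x| = 2 * d by rewrite /d; field.
    move: zx; rewrite (distrC y z); clearbody d; move: (`|y - x|) (`|z - y|) (`|z - x|).
    by move=> p q r; lra.
  have E := H h d th d0 hx; rewrite (tE h th) in E.
  (* A density supported on one side of [x] has half its integral, up to sign, as the value of
     [Dinv] at [x]. *)
  rewrite pairingE; have [xy|yx'] := ltP x y.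
    have Z z : z <= x -> dot (h z) (K z) = 0.
      move=> zx; rewrite h0 ?dot0l // /d gtr0_norm ?subr_gt0 // distrC ger0_norm ?subr_ge0; lra.
    have := Dinv_before (cch h th) Z; rewrite E; lra.
  have Z z : x < z -> dot (h z) (K z) = 0.
    have {}yx' : y < x by rewrite lt_neqAle yx yx'.
    move=> zx; rewrite h0 ?dot0l // /d distrC gtr0_norm ?subr_gt0 // ger0_norm ?subr_ge0; lra.
  have := Dinv_after (cch h th) Z; rewrite E; lra.
have Kx : K x = 0.
  have C1 : K @ x^' --> K x by exact: cvg_trans (cvg_app K (@nbhs_dnbhs R x)) (cK x).
  have C0 : K @ x^' --> (0 : 'rV[R]_N).
    by apply: cvg_near_cst; apply: filterS (nbhs_dnbhs_neq x) => y; exact: K0.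
  exact: cvg_unique C1 C0.
move=> h th; rewrite (tE h th) -[RHS](Dinv0 x); congr Dinv; apply/funext => y.
by have [->|/K0 ->] := eqVneq y x; rewrite ?Kx dot0r.
Qed.

End Flows.

Lemma Int_dot_by_parts {R : realType} {N : nat} (Y Z : R -> 'rV[R]_N) : test_fun Y ->
  smooth_on [set: R] Z ->
  Int (fun x => dot (Z x) (derive1 Y x)) = - Int (fun x => dot (derive1 Z x) (Y x)).
Proof.
move=> tY sZ; have o := @openT R.
have sc (V : R -> 'rV[R]_N) i : smooth_on [set: R] V -> smooth_on [set: R] (fun x => V x 0 i).
  by move=> sV; exact: smooth_coord.
have dc (V : R -> 'rV[R]_N) i : smooth_on [set: R] V ->
    derive1 (fun y => V y 0 i) = (fun x => derive1 V x 0 i).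
  by move=> sV; apply/funext => x; rewrite -derive1_coord //; exact: smooth_derivable.
have c1 i : cc (fun x => Z x 0 i * derive1 Y x 0 i).
  by apply: test_cc; apply: testMl; [exact: sc|exact: test_coord (test_derive1 tY)].
have c2 i : cc (fun x => derive1 Z x 0 i * Y x 0 i).
  by apply: test_cc; apply: testMl; [apply: sc; exact: smooth_derive1|exact: test_coord].
rewrite /dot (Int_sum _ c1) (Int_sum _ c2) -sumrN; apply: eq_bigr => i _.
have := Int_by_parts (sc _ i sZ) (test_coord 0 i tY).
by rewrite (dc Y i tY.1) (dc Z i sZ).
Qed.

(** * Expansion of [P, P] over a flat metric *)

Section Expansion.
Context {R : realType} {N L : nat}.
Notation path := (R -> 'rV[R]_N).
Variables (U : set 'rV[R]_N) (oU : open U).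
Variables (g : 'I_N -> 'I_N -> 'rV[R]_N -> R) (b Gam : 'I_N -> 'I_N -> 'I_N -> 'rV[R]_N -> R).
Variables (mu : 'M[R]_L) (w : 'I_L -> 'I_N -> 'I_N -> 'rV[R]_N -> R).
Hypothesis LC : levi_civita U g b Gam.
Hypothesis smooth_w : forall n i j, smooth_on U (w n i j).
Hypothesis smu : mu^T = mu.
Hypothesis skewA : skew_operator U (hydro_op g b).
Hypothesis flat_Gam : forall p, U p -> forall j s k l, curvature Gam j s k l p = 0.
Let smooth_g := lc_smooth_g LC.
Let smooth_b := lc_smooth_b LC.
Implicit Types (u f h k eta X : path).
Local Notation A := (hydro_op g b).
Local Notation B := (nonlocal_op mu w).
Local Notation P := (lin_comb 1 1 A B).
Local Notation T := (torsion_form Gam).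
Local Notation flow := (flow w).
Local Notation dflow := (dflow w).
Local Notation tail := (tail mu w).
Local Notation afn := (afn w).
Local Notation dafn := (dafn w).
Local Notation Xi := (Xi mu w).
Local Notation conn := (conn Gam).

Lemma sumE u h : P u h = fun x => A u h x + B u h x.
Proof. by apply/funext => x; rewrite /lin_comb !scale1r. Qed.

Lemma test_sumop u h : field U u -> test_fun h -> test_fun (P u h).
Proof.
move=> fu th; have t1 := test_hydro smooth_g smooth_b fu th.
by have t2 := test_nonlocal mu smooth_w fu th.1; rewrite sumE; exact: testD t1 t2.
Qed.

Lemma flat_dop_hydro u f h eta : field U u -> test_fun f -> test_fun h -> test_fun eta ->
  dop A u f h eta = Int (fun x => - T u f eta (A u h) x + T u h eta (A u f) x).
Proof.
move=> fu tf th te; rewrite (dop_hydro oU LC fu tf th te); congr Int; apply/funext => x.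
have E : curvm Gam u eta x = 0.
  have [_ Uu _] := fu; apply/matrixP => j s; rewrite !mxE big1 // => l _.
  by rewrite big1 // => q _; rewrite flat_Gam // !mul0r.
have -> : curvature_form g Gam u f h eta x = 0 by rewrite /curvature_form E mulmx0 !mul0mx mxE.
by rewrite subr0.
Qed.

Lemma torsionD u f eta zeta X x :
  T u f (fun y => eta y + zeta y) X x = T u f eta X x + T u f zeta X x.
Proof.
rewrite /torsion_form -mxD_entry -mulmxDl -mulmxDr; congr ((_ *m _ *m _) 0 0).
apply/matrixP => j s; rewrite mxD_entry !mxE -big_split /=; apply: eq_bigr => k _.
by rewrite mxD_entry mulrDr.
Qed.

Lemma conn_sum u (c : 'I_L -> R -> R) (W : 'I_L -> path) x :
  conn u (fun y => \sum_m c m y *: W m y) x = \sum_m c m x *: conn u (W m) x.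
Proof.
apply/matrixP => j s; rewrite summxE mxE.
under eq_bigr => k _ do rewrite summxE mulr_sumr.
rewrite exchange_big /=; apply: eq_bigr => m _; rewrite !mxE mulr_sumr.
by apply: eq_bigr => k _; rewrite !mxE mulrCA.
Qed.

Lemma torsion_nonlocal u f h X x :
  T u f (B u h) X x = \sum_m tail m u h x * T u f (flow m u) X x.
Proof.
rewrite /torsion_form nonlocal_eq conn_sum mulmx_sumr mulmx_suml summxE.
by apply: eq_bigr => m _; rewrite -scalemxAr -scalemxAl !mxE.
Qed.

Lemma torsion_dot u f eta X x : T u f eta X x = dot (f x) (X x *m (conn u eta x)^T).
Proof. by rewrite dot_mulmx trmx_mul trmxK mulmxA. Qed.

Lemma torsion_dot' u f eta X x : T u f eta X x = dot (f x *m conn u eta x) (X x).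
Proof. by rewrite dot_mulmx. Qed.

Definition dop_density u f h eta x : R :=
  - T u f eta (A u h) x + T u h eta (A u f) x
  + \sum_m dot (tail m u h x *: f x - tail m u f x *: h x) (dflow m u eta x).

Lemma test_torsion u f eta X : field U u -> test_fun f ->
  smooth_on [set: R] eta -> smooth_on [set: R] X -> test_fun (T u f eta X).
Proof. exact: test_torsion_form LC u f eta X. Qed.

Lemma test_dop_density u f h eta : field U u -> test_fun f -> test_fun h -> test_fun eta ->
  test_fun (dop_density u f h eta).
Proof.
move=> fu tf th te.
have tAf := test_hydro smooth_g smooth_b fu tf; have tAh := test_hydro smooth_g smooth_b fu th.
apply: testD.
  apply: testD; last exact: test_torsion fu th te.1 tAf.1.
  by apply: testN; exact: test_torsion fu tf te.1 tAh.1.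
apply: test_sum => m; apply: test_dot; first exact: test_tails smooth_w m _ _ _ fu tf th.
exact: smooth_dflow smooth_w m _ _ fu te.1.
Qed.

Lemma dop_sumE u f h eta : field U u -> test_fun f -> test_fun h -> test_fun eta ->
  dop P u f h eta = Int (dop_density u f h eta).
Proof.
move=> fu tf th te.
have preA := pre_hydro oU smooth_g smooth_b; have preB := pre_nonlocal oU smooth_w smu.
have tAf := test_hydro smooth_g smooth_b fu tf; have tAh := test_hydro smooth_g smooth_b fu th.
rewrite (dop_lin_comb oU 1 1 preA preB fu tf th te) !mul1r (flat_dop_hydro fu tf th te).
rewrite {1}/dop (is_derive1 (is_derive_nonlocal oU smooth_w smu fu tf th te)) /dnonlocal.
have c1 := test_cc (test_torsion fu tf te.1 tAh.1); have c2 := test_cc (test_torsion fu th te.1 tAf.1).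
rewrite -(IntD (ccD (ccN c1) c2)) //; apply: test_cc; apply: test_sum => m.
apply: test_dot; first exact: test_tails smooth_w m _ _ _ fu tf th.
exact: smooth_dflow smooth_w m _ _ fu te.1.
Qed.

Definition cross u h k n x : 'rV[R]_N := tail n u k x *: h x - tail n u h x *: k x.

(* The tails of [f] carry [remainder]; the rest of the Schouten bracket is the
   pairing of [f] with [gradient]. *)
Definition remainder u h k m x : R :=
  - T u h (flow m u) (A u k) x + T u k (flow m u) (A u h) x
  - dot (h x) (dflow m u (P u k) x) + dot (k x) (dflow m u (P u h) x)
  + \sum_n dot (cross u h k n x) (dflow n u (flow m u) x).

Definition direct u h k x : 'rV[R]_N :=
  A u k x *m (conn u (B u h) x)^T - A u h x *m (conn u (B u k) x)^T
  + \sum_m (tail m u h x *: dflow m u (P u k) x - tail m u k x *: dflow m u (P u h) x).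

Definition cross0 u h k x : 'rV[R]_N :=
  h x *m conn u (B u k) x - k x *m conn u (B u h) x
  + \sum_n cross u h k n x *m dafn n u x.

Definition cross1 u h k x : 'rV[R]_N := \sum_n cross u h k n x *m afn n u x.

Definition potential u h k x : 'rV[R]_N := cross0 u h k x - derive1 (cross1 u h k) x.

Definition gradient u h k x : 'rV[R]_N :=
  direct u h k x - A u (potential u h k) x
  + \sum_m (\sum_n dot (cross u h k n x) (flow m u x *m (afn n u x)^T)) *: Xi m u x.

Lemma dot_dflow_sum n (v : 'rV[R]_N) u f x : field U u -> test_fun f ->
  dot v (dflow n u (P u f) x) = dot v (dflow n u (A u f) x)
  + \sum_m (tail m u f x * dot v (dflow n u (flow m u) x)
      + dot v (flow m u x *m (afn n u x)^T) * dot (f x) (Xi m u x)).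
Proof.
move=> fu tf; have tAf := test_hydro smooth_g smooth_b fu tf.
have := dflowD smooth_w n x fu tAf.1 (test_nonlocal mu smooth_w fu tf.1).1.
rewrite -sumE => ->; rewrite (dflow_nonlocal mu smooth_w n x fu tf.1) dotDr dot_sumr; congr (_ + _).
apply: eq_bigr => m _; move: (dflow n u (flow m u) x) (flow m u x *m (afn n u x)^T) => p q.
by rewrite dotDr !dotZr (dotC (Xi m u x)); congr (_ + _); exact: mulrC.
Qed.

Lemma density_expansion u f h k x : field U u -> test_fun f -> test_fun h -> test_fun k ->
  dop_density u f h (P u k) x + dop_density u h k (P u f) x + dop_density u k f (P u h) x =
  dot (f x) (direct u h k x)
  + (dot (cross0 u h k x) (A u f x) + dot (cross1 u h k x) (derive1 (A u f) x))
  + \sum_m (\sum_n dot (cross u h k n x) (flow m u x *m (afn n u x)^T)) * dot (f x) (Xi m u x)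
  + \sum_m tail m u f x * remainder u h k m x.
Proof.
move=> fu tf th tk.
have tAf := test_hydro smooth_g smooth_b fu tf.
have E1 : \sum_m dot (tail m u h x *: f x - tail m u f x *: h x) (dflow m u (P u k) x) =
    \sum_m tail m u h x * dot (f x) (dflow m u (P u k) x)
    - \sum_m tail m u f x * dot (h x) (dflow m u (P u k) x).
  by rewrite -sumrB; apply: eq_bigr => m _; rewrite dotDl dotNl !dotZl.
have E3 : \sum_m dot (tail m u f x *: k x - tail m u k x *: f x) (dflow m u (P u h) x) =
    \sum_m tail m u f x * dot (k x) (dflow m u (P u h) x)
    - \sum_m tail m u k x * dot (f x) (dflow m u (P u h) x).
  by rewrite -sumrB; apply: eq_bigr => m _; rewrite dotDl dotNl !dotZl.
have E2 : \sum_n dot (cross u h k n x) (dflow n u (P u f) x) =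
    \sum_n dot (cross u h k n x) (dflow n u (A u f) x)
    + \sum_m tail m u f x * (\sum_n dot (cross u h k n x) (dflow n u (flow m u) x))
    + \sum_m (\sum_n dot (cross u h k n x) (flow m u x *m (afn n u x)^T)) * dot (f x) (Xi m u x).
  refine (etrans (eq_bigr _ (fun n _ => dot_dflow_sum n (cross u h k n x) x fu tf)) _).
  rewrite big_split -[RHS]addrA.
  congr (_ + _); rewrite /= exchange_big /= -big_split; apply: eq_bigr => m _ /=.
  by rewrite mulr_sumr mulr_suml -big_split.
have D1 : dot (f x) (direct u h k x) = T u f (B u h) (A u k) x - T u f (B u k) (A u h) x
    + \sum_m tail m u h x * dot (f x) (dflow m u (P u k) x)
    - \sum_m tail m u k x * dot (f x) (dflow m u (P u h) x).
  rewrite /direct !dotDr dotNr -!torsion_dot dot_sumr -[RHS]addrA -sumrB; congr (_ + _).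
  apply: eq_bigr => m _; move: (dflow m u (P u k) x) (dflow m u (P u h) x) => p q.
  by rewrite dotDr dotNr !dotZr.
have D2 : dot (cross0 u h k x) (A u f x) + dot (cross1 u h k x) (derive1 (A u f) x) =
    T u h (B u k) (A u f) x - T u k (B u h) (A u f) x
    + \sum_n dot (cross u h k n x) (dflow n u (A u f) x).
  rewrite /cross0 /cross1 !dotDl dotNl -!torsion_dot' -addrA !dot_suml -big_split /=; congr (_ + _).
  apply: eq_bigr => n _; rewrite (dflowE smooth_w n _ x fu) dotDr !dot_mulmx.
  by rewrite !trmx_mul !trmxK !mulmxA.
have D3 : \sum_m tail m u f x * remainder u h k m x =
    - T u h (B u f) (A u k) x + T u k (B u f) (A u h) x
    - \sum_m tail m u f x * dot (h x) (dflow m u (P u k) x)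
    + \sum_m tail m u f x * dot (k x) (dflow m u (P u h) x)
    + \sum_m tail m u f x * (\sum_n dot (cross u h k n x) (dflow n u (flow m u) x)).
  rewrite !torsion_nonlocal -!sumrN -!big_split /=; apply: eq_bigr => m _.
  rewrite /remainder mulrDr; congr (_ + _).
  generalize (T u h (flow m u) (A u k) x) (T u k (flow m u) (A u h) x) (tail m u f x).
  generalize (dot (h x) (dflow m u (P u k) x)) (dot (k x) (dflow m u (P u h) x)).
  by move=> *; ring.
have T2 (f' k' X' : path) : T u f' (P u k') X' x = T u f' (A u k') X' x + T u f' (B u k') X' x.
  by rewrite sumE torsionD.
have G1 : dop_density u f h (P u k) x =
    - (T u f (A u k) (A u h) x + T u f (B u k) (A u h) x)
    + (T u h (A u k) (A u f) x + T u h (B u k) (A u f) x) + _ := congr2 _ (congr2 _ (congr1 _ (T2 f k _)) (T2 h k _)) E1.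
have G2 : dop_density u h k (P u f) x =
    - (T u h (A u f) (A u k) x + T u h (B u f) (A u k) x)
    + (T u k (A u f) (A u h) x + T u k (B u f) (A u h) x) + _ := congr2 _ (congr2 _ (congr1 _ (T2 h f _)) (T2 k f _)) E2.
have G3 : dop_density u k f (P u h) x =
    - (T u k (A u h) (A u f) x + T u k (B u h) (A u f) x)
    + (T u f (A u h) (A u k) x + T u f (B u h) (A u k) x) + _ := congr2 _ (congr2 _ (congr1 _ (T2 k h _)) (T2 f h _)) E3.
rewrite D1 D2 D3 G1 G2 G3.
rewrite (torsion_formC LC f (A u k) (A u h) x fu) (torsion_formC LC h (A u f) (A u k) x fu).
rewrite (torsion_formC LC k (A u h) (A u f) x fu).
generalize (T u f (A u h) (A u k) x) (T u h (A u k) (A u f) x) (T u k (A u f) (A u h) x).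
generalize (T u f (B u k) (A u h) x) (T u f (B u h) (A u k) x) (T u h (B u k) (A u f) x).
generalize (T u h (B u f) (A u k) x) (T u k (B u f) (A u h) x) (T u k (B u h) (A u f) x).
generalize (\sum_m tail m u h x * dot (f x) (dflow m u (P u k) x)).
generalize (\sum_m tail m u k x * dot (f x) (dflow m u (P u h) x)).
generalize (\sum_m tail m u f x * dot (h x) (dflow m u (P u k) x)).
generalize (\sum_m tail m u f x * dot (k x) (dflow m u (P u h) x)).
generalize (\sum_n dot (cross u h k n x) (dflow n u (A u f) x)).
generalize (\sum_m tail m u f x * (\sum_n dot (cross u h k n x) (dflow n u (flow m u) x))).
generalize (\sum_m (\sum_n dot (cross u h k n x) (flow m u x *m (afn n u x)^T)) * dot (f x) (Xi m u x)).
by move=> *; ring.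
Qed.

Section Regularity.
Variables (u h k : path).
Hypotheses (fu : field U u) (th : test_fun h) (tk : test_fun k).
Let tAh := test_hydro smooth_g smooth_b fu th.
Let tAk := test_hydro smooth_g smooth_b fu tk.
Let tPh := test_sumop fu th.
Let tPk := test_sumop fu tk.

Lemma test_cross n : test_fun (cross u h k n).
Proof.
have s1 := smooth_tail mu smooth_w n fu tk.1; have s2 := smooth_tail mu smooth_w n fu th.1.
exact: testB (test_scalel s1 th) (test_scalel s2 tk).
Qed.

Lemma test_remainder m : test_fun (remainder u h k m).
Proof.
have sW := smooth_flow smooth_w m fu.
have sP1 := smooth_dflow smooth_w m fu tPk.1; have sP2 := smooth_dflow smooth_w m fu tPh.1.
have t1 := test_torsion fu th sW tAk.1; have t2 := test_torsion fu tk sW tAh.1.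
apply: (testD (testD (testB (testD (testN t1) t2) (test_dot th sP1)) (test_dot tk sP2))).
apply: test_sum => n; apply: test_dot; first exact: test_cross.
exact (smooth_dflow smooth_w n fu sW).
Qed.

Let smooth_conn_nonlocal f : test_fun f -> smooth_on [set: R] (conn u (B u f)).
Proof.
by move=> tf; apply: (smooth_conn LC fu); case: (test_nonlocal mu smooth_w fu tf.1).
Qed.

Lemma test_direct : test_fun (direct u h k).
Proof.
have o := @openT R; have C1 := smooth_conn_nonlocal th; have C2 := smooth_conn_nonlocal tk.
have F m : test_fun (fun x => tail m u h x *: dflow m u (P u k) x - tail m u k x *: dflow m u (P u h) x).
  have tF f : test_fun f -> test_fun (dflow m u (P u f)).
    move=> tf; have tP := test_sumop fu tf.
    rewrite (_ : dflow m u _ = fun x => P u f x *m (dafn m u x)^T + derive1 (P u f) x *m (afn m u x)^T).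
      apply: testD; first by apply: test_mulmxr => //; apply: smooth_trmx => //; exact (smooth_dafn smooth_w m fu).
      apply: test_mulmxr; first exact: test_derive1.
      by apply: smooth_trmx => //; exact (smooth_afn smooth_w m fu).
    by apply/funext => x; exact: dflowE.
  by apply: testB; apply: test_scalel; [exact (smooth_tail mu smooth_w m fu th.1)|exact: tF|
    exact (smooth_tail mu smooth_w m fu tk.1)|exact: tF].
apply: (testD (testB (test_mulmxr tAk (smooth_trmx o C1)) (test_mulmxr tAh (smooth_trmx o C2)))).
exact: test_sum.
Qed.

Lemma test_cross1 : test_fun (cross1 u h k).
Proof.
apply: test_sum => n; apply: test_mulmxr; first exact: test_cross.
exact (smooth_afn smooth_w n fu).
Qed.

Lemma test_cross0 : test_fun (cross0 u h k).
Proof.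
have C1 := smooth_conn_nonlocal th; have C2 := smooth_conn_nonlocal tk.
apply: (testD (testB (test_mulmxr th C2) (test_mulmxr tk C1))).
apply: test_sum => n; apply: test_mulmxr; first exact: test_cross.
exact (smooth_dafn smooth_w n fu).
Qed.

Lemma test_potential : test_fun (potential u h k).
Proof. exact: testB test_cross0 (test_derive1 test_cross1). Qed.

Let coefficient m x := \sum_n dot (cross u h k n x) (flow m u x *m (afn n u x)^T).

Lemma test_coefficient m : test_fun (coefficient m).
Proof.
have o := @openT R; apply: test_sum => n; apply: test_dot; first exact: test_cross.
apply: smooth_mulmx => //; first exact (smooth_flow smooth_w m fu).
by apply: smooth_trmx => //; exact (smooth_afn smooth_w n fu).
Qed.

Let local_part x := \sum_m coefficient m x *: Xi m u x.

Lemma test_local_part : test_fun local_part.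
Proof.
apply: test_sum => m; apply: test_scaler; first exact: test_coefficient.
exact (smooth_Xi mu smooth_w m fu).
Qed.

Lemma test_gradient : test_fun (gradient u h k).
Proof.
have tA := test_hydro smooth_g smooth_b fu test_potential.
exact: testD (testB test_direct tA) test_local_part.
Qed.

Lemma schouten_expansion f : test_fun f -> schouten P P u f h k =
  pairing f (gradient u h k) + Int (fun x => \sum_m tail m u f x * remainder u h k m x).
Proof.
move=> tf; have tAf := test_hydro smooth_g smooth_b fu tf; have tPf := test_sumop fu tf.
have c1 := test_cc (test_dop_density fu tf th tPk).
have c2 := test_cc (test_dop_density fu th tk tPf).
have c3 := test_cc (test_dop_density fu tk tf tPh).
rewrite /schouten (dop_sumE fu tf th tPk) (dop_sumE fu th tk tPf) (dop_sumE fu tk tf tPh).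
rewrite -(IntD c1 c2) -(IntD (ccD c1 c2) c3).
have -> : (fun x => dop_density u f h (P u k) x + dop_density u h k (P u f) x
    + dop_density u k f (P u h) x) = _ := funext (fun x => density_expansion x fu tf th tk).
have tV := test_potential; have tAV := test_hydro smooth_g smooth_b fu tV.
have d1 : cc (fun x => dot (f x) (direct u h k x)).
  by apply: cc_dot => //; apply: test_continuous; exact: test_direct.
have d2 : cc (fun x => dot (cross0 u h k x) (A u f x)).
  by apply: cc_dot; [exact: test_cross0|exact: test_continuous].
have d3 : cc (fun x => dot (cross1 u h k x) (derive1 (A u f) x)).
  by apply: cc_dot; [exact: test_cross1|exact: test_continuous (test_derive1 tAf)].
have d3' : cc (fun x => dot (derive1 (cross1 u h k) x) (A u f x)).
  by apply: cc_dot; [exact: test_derive1 test_cross1|exact: test_continuous].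
have d4 : cc (fun x => \sum_m coefficient m x * dot (f x) (Xi m u x)).
  apply: test_cc; apply: test_sum => m; apply: testMr; first exact: test_coefficient.
  by apply: (test_dot tf _).1; exact (smooth_Xi mu smooth_w m fu).
have d5 : cc (fun x => \sum_m tail m u f x * remainder u h k m x).
  apply: test_cc; apply: test_sum => m; apply: testMl; last exact: test_remainder.
  exact (smooth_tail mu smooth_w m fu tf.1).
rewrite (IntD (ccD (ccD d1 (ccD d2 d3)) d4) d5) (IntD (ccD d1 (ccD d2 d3)) d4) (IntD d1 (ccD d2 d3)) (IntD d2 d3).
congr (_ + _).
rewrite (Int_dot_by_parts tAf test_cross1.1) -(IntB d2 d3').
have -> : Int (fun x => dot (cross0 u h k x) (A u f x) - dot (derive1 (cross1 u h k) x) (A u f x)) =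
    - pairing f (A u (potential u h k)).
  rewrite -(skewA fu tV tf) pairingE; congr Int; apply/funext => x.
  by rewrite /potential dotDl dotNl.
have cD := test_continuous test_direct; have cA := test_continuous (testN tAV).
have cL := test_continuous test_local_part.
rewrite /gradient (pairingDr tf (test_continuous (testB test_direct tAV)) cL).
rewrite (pairingDr tf cD cA).
have -> : pairing f (fun x => - A u (potential u h k) x) = - pairing f (A u (potential u h k)).
  by rewrite pairingC (pairingNl tAV (test_continuous tf)) pairingC.
congr (_ + _ + _); rewrite pairingE //; congr Int; apply/funext => x.
by rewrite /local_part dot_sumr; apply: eq_bigr => m _; rewrite dotZr.
Qed.

End Regularity.

End Expansion.

(** * Locality of the expressions in the field and the covectors *)

Section Vanishing.
Context {R : realType} {N L : nat}.
Notation path := (R -> 'rV[R]_N).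
Variables (O : set R) (oO : open O).
Implicit Types (u f h k eta : path).

Lemma derive1_vanish m n (f : R -> 'M[R]_(m, n)) : (forall x, O x -> f x = 0) ->
  forall x, O x -> derive1 f x = 0.
Proof.
move=> f0 x Ox; rewrite (open_derive1 (g := fun=> 0) oO f0 Ox).
by rewrite derive1E derive_cst.
Qed.

Lemma hydro_vanish g b u h : (forall x, O x -> h x = 0) ->
  forall x, O x -> hydro_op g b u h x = 0.
Proof.
move=> h0 x Ox; apply/rowP => i; rewrite hydroE mxE big1 // => j _.
by rewrite (derive1_vanish h0 Ox) (h0 x Ox) !mxE !mulr0 addr0.
Qed.

Lemma dflow_vanish (w : 'I_L -> 'I_N -> 'I_N -> 'rV[R]_N -> R) m u eta :
  (forall x, O x -> eta x = 0) -> forall x, O x -> dflow w m u eta x = 0.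
Proof.
move=> h0 x Ox; apply/rowP => i; rewrite !mxE; apply: big1 => k _.
rewrite (derive1_vanish h0 Ox) (h0 x Ox) !mxE mulr0 addr0.
(* In the direction 0 every difference quotient is 0, whatever the coefficient. *)
by rewrite /derive (_ : (fun _ => _) = fun=> 0) ?lim_cst ?mul0r //;
  apply/funext => t /=; rewrite scaler0 add0r subrr scaler0.
Qed.

Variables (u v : path).
Hypothesis uv : forall x, O x -> u x = v x.

Lemma derive1_local x : O x -> derive1 u x = derive1 v x.
Proof. exact: open_derive1. Qed.

Lemma form_local ck x : O x -> form ck u x = form ck v x.
Proof. by move=> Ox; rewrite /form derive1_local // uv. Qed.

Lemma flow_local (w : 'I_L -> 'I_N -> 'I_N -> 'rV[R]_N -> R) m x : O x -> flow w m u x = flow w m v x.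
Proof. by move=> Ox; apply/rowP => i; rewrite !mxE form_local. Qed.

Lemma hydro_local g b h x : O x -> hydro_op g b u h x = hydro_op g b v h x.
Proof.
move=> Ox; apply/rowP => i; rewrite !hydroE; apply: eq_bigr => j _.
by rewrite form_local // uv.
Qed.

Lemma dflow_local (w : 'I_L -> 'I_N -> 'I_N -> 'rV[R]_N -> R) m eta zeta x :
  (forall y, O y -> eta y = zeta y) -> O x -> dflow w m u eta x = dflow w m v zeta x.
Proof.
move=> ez Ox; apply/rowP => i; rewrite !mxE; apply: eq_bigr => k _.
by rewrite (derive1_local Ox) (uv Ox) (ez x Ox) (open_derive1 oO ez Ox).
Qed.

Lemma torsion_local Gam h eta zeta (X Y : path) x : O x -> eta x = zeta x -> X x = Y x ->
  torsion_form Gam u h eta X x = torsion_form Gam v h zeta Y x.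
Proof.
move=> Ox ez XY; rewrite /torsion_form XY; congr ((_ *m _ *m _) 0 0).
by apply/matrixP => i j; rewrite !mxE ez uv.
Qed.

End Vanishing.

(** * Vanishing of the contracted commutators *)

Section Commutator.
Context {R : realType} {N L : nat}.
Notation path := (R -> 'rV[R]_N).
Variables (U : set 'rV[R]_N) (oU : open U).
Variables (g : 'I_N -> 'I_N -> 'rV[R]_N -> R) (b Gam : 'I_N -> 'I_N -> 'I_N -> 'rV[R]_N -> R).
Variables (mu : 'M[R]_L) (w : 'I_L -> 'I_N -> 'I_N -> 'rV[R]_N -> R).
Hypothesis LC : levi_civita U g b Gam.
Hypothesis smooth_w : forall n i j, smooth_on U (w n i j).
Hypothesis smu : mu^T = mu.
Hypothesis skewA : skew_operator U (hydro_op g b).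
Hypothesis flat_Gam : forall p, U p -> forall j s k l, curvature Gam j s k l p = 0.
Let smooth_g := lc_smooth_g LC.
Let smooth_b := lc_smooth_b LC.
Implicit Types (u f h k eta X : path).
Local Notation A := (hydro_op g b).
Local Notation B := (nonlocal_op mu w).
Local Notation P := (lin_comb 1 1 A B).
Local Notation T := (torsion_form Gam).
Local Notation flow := (flow w).
Local Notation dflow := (dflow w).
Local Notation tail := (tail mu w).
Local Notation afn := (afn w).
Local Notation dafn := (dafn w).
Local Notation Xi := (Xi mu w).
Local Notation remainder := (remainder g b Gam mu w).
Local Notation gradient := (gradient g b Gam mu w).
Local Notation cross := (cross mu w).
Hypothesis jacP : forall u f h k, field U u -> test_fun f -> test_fun h -> test_fun k ->
  schouten P P u f h k = 0.

Definition flow_commutator m n u x : 'rV[R]_N :=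
  dflow m u (flow n u) x - dflow n u (flow m u) x.

(** In the expansion of [P, P] the tails of [f] are [Dinv] of [f] contracted with [Xi]. Moving
    [Dinv] onto [remainder] leaves [f] bare, and [f] is arbitrary. *)
Lemma gradient_identity u h k (x : R) : field U u -> test_fun h -> test_fun k ->
  gradient u h k x = \sum_m Dinv (remainder u h k m) x *: Xi m u x.
Proof.
move=> fu th tk; have o := @openT R.
have tG := test_gradient mu LC smooth_w fu th tk.
have tr m := test_remainder mu LC smooth_w fu th tk m.
pose Y x := \sum_m Dinv (remainder u h k m) x *: Xi m u x.
have sY : smooth_on [set: R] Y.
  apply: smooth_sum => // m; apply: smooth_scale => //; first exact (smooth_Dinv (tr m)).
  exact (smooth_Xi mu smooth_w m fu).
have cY := smoothT_continuous sY; have cG := test_continuous tG.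
have cNY : continuous (fun x => - Y x).
  by apply: smoothT_continuous; apply: smoothN.
suff : gradient u h k x - Y x = 0 by move=> /eqP; rewrite subr_eq0 => /eqP.
have cZ : continuous (fun x => gradient u h k x - Y x).
  by move=> y; apply: cvgB; [exact: cG | exact: cY].
apply: (@fundamental_lemma R N [set: R] (fun x => gradient u h k x - Y x) openT cZ _ x I).
move=> f tf _; rewrite (pairingDr tf cG cNY).
have := jacP fu tf th tk.
rewrite (schouten_expansion oU LC smooth_w smu skewA flat_Gam fu th tk tf) => E.
rewrite -[RHS]E; congr (_ + _).
have -> : pairing f (fun x => - Y x) = - pairing f Y.
  rewrite !pairingE -IntN; last exact: cc_dot.
  by congr Int; apply/funext => y; rewrite dotNr.
have c1 m : cc (fun x => Dinv (remainder u h k m) x * dot (Xi m u x) (f x)).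
  apply: ccMl; last exact (cc_Xi mu smooth_w m fu tf).
  by apply: continuous_Dinv; exact: test_cc.
have c2 m : cc (fun x => tail m u f x * remainder u h k m x).
  apply: test_cc; apply: testMl => //; exact (smooth_tail mu smooth_w m fu tf.1).
rewrite (Int_sum _ c2).
have -> : pairing f Y = Int (fun x => \sum_m Dinv (remainder u h k m) x * dot (Xi m u x) (f x)).
  rewrite pairingE; congr Int; apply/funext => y; rewrite /Y dot_sumr.
  by apply: eq_bigr => m _; rewrite dotZr dotC.
rewrite (Int_sum _ c1) -sumrN; apply: eq_bigr => m _.
rewrite -(Dinv_skew (test_cc (tr m)) (cc_Xi mu smooth_w m fu tf)); congr Int; apply/funext => y.
by rewrite (tail_Dinv mu smooth_w m y fu tf) mulrC.
Qed.

Lemma dflow_sum_vanish (O : set R) m u k x : open O -> field U u -> test_fun k ->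
  (forall y, O y -> k y = 0) -> O x ->
  dflow m u (P u k) x = \sum_n tail n u k x *: dflow m u (flow n u) x.
Proof.
move=> oO fu tk k0 Ox.
have tA := test_hydro smooth_g smooth_b fu tk; have tB := test_nonlocal mu smooth_w fu tk.1.
rewrite sumE (dflowD smooth_w m x fu tA.1 tB.1).
rewrite (dflow_vanish oO w m u (hydro_vanish oO g b u k0) Ox) add0r.
rewrite (dflow_nonlocal mu smooth_w m x fu tk.1); apply: eq_bigr => n _.
by rewrite k0 // dot0r scale0r addr0.
Qed.

(** Where [h] and [k] vanish so does [cross], and only the nonlocal part of [direct] survives. *)
Lemma gradient_vanish (O : set R) u h k x : open O -> field U u -> test_fun h -> test_fun k ->
  (forall y, O y -> h y = 0) -> (forall y, O y -> k y = 0) -> O x ->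
  gradient u h k x = \sum_m \sum_n (tail m u h x * tail n u k x) *: flow_commutator m n u x.
Proof.
move=> oO fu th tk h0 k0 Ox.
have cr n y : O y -> cross u h k n y = 0.
  by move=> Oy; rewrite /cross h0 // k0 // !scaler0 subrr.
have c0 y : O y -> cross0 Gam mu w u h k y = 0.
  move=> Oy; rewrite /cross0 h0 // k0 // !mul0mx subrr add0r big1 // => n _.
  by rewrite cr // mul0mx.
have c1 y : O y -> cross1 mu w u h k y = 0.
  by move=> Oy; rewrite /cross1 big1 // => n _; rewrite cr // mul0mx.
have pot y : O y -> potential Gam mu w u h k y = 0.
  by move=> Oy; rewrite /potential c0 // (derive1_vanish oO c1 Oy) subrr.
rewrite /gradient (hydro_vanish oO g b u pot Ox) subr0.
rewrite [X in _ + X]big1 ?addr0 => [|m _]; last first.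
  by rewrite big1 ?scale0r // => n _; rewrite cr // dot0l.
rewrite /direct (hydro_vanish oO g b u h0 Ox) (hydro_vanish oO g b u k0 Ox) !mul0mx subrr add0r.
rewrite sumrB.
transitivity (\sum_m (\sum_n (tail m u h x * tail n u k x) *: dflow m u (flow n u) x)
    - \sum_m (\sum_n (tail m u h x * tail n u k x) *: dflow n u (flow m u) x)).
  congr (_ - _); last rewrite [RHS]exchange_big; apply: eq_bigr => m _ /=.
    rewrite (dflow_sum_vanish m oO fu tk k0 Ox) scaler_sumr.
    by apply: eq_bigr => n _; rewrite scalerA.
  rewrite (dflow_sum_vanish m oO fu th h0 Ox) scaler_sumr.
  by apply: eq_bigr => n _; rewrite scalerA mulrC.
rewrite -sumrB; apply: eq_bigr => m _; rewrite -sumrB; apply: eq_bigr => n _.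
by rewrite /flow_commutator scalerBr.
Qed.

Section Folding.
Variables (x0 d D a1 a2 : R) (phi : R -> R) (u : path).
Hypotheses (Fphi : fold x0 d a1 a2 phi) (fu : field U u) (dD : d < D).
Local Notation v := (fun x => u (phi x)).

Let away (y : R) : d < `|y - x0| -> v y = u y := fold_away Fphi u (x := y).

Lemma tail_fold m h : (forall y, `|y - x0| < D -> h y = 0) -> tail m v h = tail m u h.
Proof.
move=> h0.
have F n : flux w n v h = flux w n u h.
  apply/funext => y; rewrite /flux; have [yD|yD] := ltP `|y - x0| D; first by rewrite (h0 y yD) !dot0r.
  by rewrite (flow_local (@open_away R x0 d) away w n) //=; exact: lt_le_trans dD yD.
by apply/funext => x; apply: eq_bigr => n _; rewrite F.
Qed.

(** Within distance D both covectors vanish and so does the remainder; from distance D on, the two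
    fields agree near the point and the tails coincide. *)
Lemma remainder_fold h k m : (forall y, `|y - x0| < D -> h y = 0) ->
  (forall y, `|y - x0| < D -> k y = 0) -> remainder v h k m = remainder u h k m.
Proof.
move=> h0 k0; apply/funext => x.
have oO := @open_away R x0 d; have oD := @open_close R x0 D.
have [xD|xD] := ltP `|x - x0| D.
  have Z u' : remainder u' h k m x = 0.
    have Th e X : T u' h e X x = 0 by rewrite /torsion_form (h0 x xD) !mul0mx mxE.
    have Tk e X : T u' k e X x = 0 by rewrite /torsion_form (k0 x xD) !mul0mx mxE.
    have S0 : \sum_n dot (cross u' h k n x) (dflow n u' (flow m u') x) = 0.
      by apply: big1 => n _; rewrite /cross (h0 x xD) (k0 x xD) !scaler0 subrr dot0l.
    have Q (p q r s t : R) : p = 0 -> q = 0 -> r = 0 -> s = 0 -> t = 0 ->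
        - p + q - r + s + t = 0 by move=> -> -> -> -> ->; ring.
    have E1 : dot (h x) (dflow m u' (P u' k) x) = 0 by rewrite (h0 x xD); exact: dot0l.
    have E2 : dot (k x) (dflow m u' (P u' h) x) = 0 by rewrite (k0 x xD); exact: dot0l.
    exact: (Q _ _ _ _ _ (Th (flow m u') (A u' k)) (Tk (flow m u') (A u' h)) E1 E2 S0).
  by rewrite !Z.
have Ox : [set y | d < `|y - x0|] x by exact: lt_le_trans dD xD.
have fl n y := flow_local oO away w n (x := y).
have hy h' y := hydro_local oO away g b h' (x := y).
have pe h' (h0' : forall y, `|y - x0| < D -> h' y = 0) y : d < `|y - x0| -> P v h' y = P u h' y.
  move=> Oy; have E : B v h' y = B u h' y.
    by rewrite !nonlocal_tailE; apply: eq_bigr => n _; rewrite (tail_fold n h0') (fl n y Oy).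
  by rewrite /lin_comb E (hy h' y Oy).
have Q (p q r s t p' q' r' s' t' : R) : p = p' -> q = q' -> r = r' -> s = s' -> t = t' ->
  - p + q - r + s + t = - p' + q' - r' + s' + t' by move=> -> -> -> -> ->.
apply: Q.
- exact (torsion_local away Gam h Ox (fl m x Ox) (hy k x Ox)).
- exact (torsion_local away Gam k Ox (fl m x Ox) (hy h x Ox)).
- by rewrite (dflow_local oO away w m (pe k k0) Ox).
- by rewrite (dflow_local oO away w m (pe h h0) Ox).
- apply: eq_bigr => n _; rewrite /cross (tail_fold n h0) (tail_fold n k0).
  by rewrite (dflow_local oO away w n (fl m) Ox).
Qed.

End Folding.

Lemma Xi_fold (x0 d a1 a2 : R) phi u m : fold x0 d a1 a2 phi -> field U u ->
  Xi m (fun x => u (phi x)) x0 = a1 *: Xi m u x0.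
Proof.
move=> Fphi fu; rewrite /Xi scaler_sumr; apply: eq_bigr => p _; rewrite scalerA mulrC -scalerA.
congr (_ *: _); apply/rowP => i; rewrite !mxE (form_fold Fphi fu).
by have [_ _ -> -> _] := Fphi.
Qed.

(** The expression is quadratic in u_x plus linear in u_xx, hence even under the reversal of u_x. *)
Lemma dflow_flow_fold (x0 d : R) phi u m n : fold x0 d (-1) 0 phi -> field U u ->
  dflow m (fun x => u (phi x)) (flow n (fun x => u (phi x))) x0 = dflow m u (flow n u) x0.
Proof.
move=> Fphi fu; have fv := field_fold Fphi fu; have [_ _ p0 p1 _] := Fphi.
have E c : form c (fun x => u (phi x)) x0 = - form c u x0.
  by rewrite (form_fold Fphi fu) p0 p1 mulN1r.
have D : derive1 (flow n (fun x => u (phi x))) x0 = derive1 (flow n u) x0.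
  have dc u' i : field U u' -> derive1 (flow n u') x0 0 i = derive1 (form (w n i) u') x0.
    move=> fu'; have sF := smooth_flow smooth_w n fu'.
    have D := is_derive_coord 0 i (smooth_is_derive x0 sF).
    have -> : form (w n i) u' = fun y => flow n u' y 0 i by apply/funext => y; rewrite mxE.
    exact (esym (is_derive1 D)).
  apply/rowP => i; refine (etrans (dc _ i fv) (etrans (derive1_form_fold Fphi fu (smooth_w n i)) _)).
  by rewrite (dc u i fu) mul0r add0r sqrrN expr1n mul1r.
have W1 : flow n (fun x => u (phi x)) x0 = - flow n u x0.
  by apply/rowP => i; rewrite [LHS]mxE E mxN_entry [in RHS]mxE.
have W2 : dafn m (fun x => u (phi x)) x0 = - dafn m u x0.
  by apply/matrixP => i j; rewrite [LHS]mxE E mxN_entry [in RHS]mxE.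
have W3 : afn m (fun x => u (phi x)) x0 = afn m u x0 by rewrite /afn p0.
refine (etrans (dflowE smooth_w m _ x0 fv) (etrans _ (esym (dflowE smooth_w m _ x0 fu)))).
refine (congr2 +%R (etrans (congr2 (@mulmx _ _ _ _) W1 (congr1 trmx W2)) _)
  (congr2 (@mulmx _ _ _ _) D (congr1 trmx W3))).
by rewrite raddfN /= mulmxN mulNmx opprK.
Qed.

Lemma commutator_vanish u h k (x0 D : R) : field U u -> test_fun h -> test_fun k -> 0 < D ->
  (forall y, `|y - x0| < D -> h y = 0) -> (forall y, `|y - x0| < D -> k y = 0) ->
  \sum_m \sum_n (tail m u h x0 * tail n u k x0) *: flow_commutator m n u x0 = 0.
Proof.
(* The fold stays within half the zone where the covectors vanish, so each point of the line has a
   neighbourhood where they vanish or the fields agree. *)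
move=> fu th tk D0 h0 k0; have d0 : 0 < D / 2 by lra.
have dD : D / 2 < D by lra.
have [phi Fphi] := fold_exists x0 (-1) 0 d0.
have fv := field_fold Fphi fu; have oD := @open_close R x0 D.
have x0D : `|x0 - x0| < D by rewrite subrr normr0.
have G1 := gradient_identity x0 fu th tk; have G2 := gradient_identity x0 fv th tk.
rewrite (gradient_vanish oD fu th tk h0 k0 x0D) in G1.
rewrite (gradient_vanish oD fv th tk h0 k0 x0D) in G2.
have E : \sum_m \sum_n (tail m u h x0 * tail n u k x0) *: flow_commutator m n u x0 =
    - \sum_m Dinv (remainder u h k m) x0 *: Xi m u x0.
  rewrite -sumrN; transitivity (\sum_m Dinv (remainder (fun x => u (phi x)) h k m) x0 *:
      Xi m (fun x => u (phi x)) x0).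
    refine (etrans _ G2); apply: eq_bigr => m _; apply: eq_bigr => n _.
    refine (congr2 *:%R (congr2 *%R (esym _) (esym _)) _).
    - exact (congr1 (fun F => F x0) (tail_fold u Fphi dD m h0)).
    - exact (congr1 (fun F => F x0) (tail_fold u Fphi dD n k0)).
    exact (congr2 (fun p q => p - q) (esym (dflow_flow_fold m n Fphi fu)) (esym (dflow_flow_fold n m Fphi fu))).
  apply: eq_bigr => m _; rewrite -scalerN -scaleN1r.
  refine (congr2 *:%R _ (Xi_fold m Fphi fu)).
  exact (congr1 (fun F => Dinv F x0) (remainder_fold u Fphi dD m h0 k0)).
move: E; rewrite G1; move: (\sum_m _) => s /eqP; rewrite -addr_eq0 => /eqP E.
by apply/rowP => i; have /rowP /(_ i) := E; rewrite mxD_entry mxE; lra.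
Qed.

(** The expression is bilinear in the tails of [h] and [k]; [tail_density] removes the support
    condition from one factor at a time. *)
Lemma commutator_eq0 u h k (x : R) : field U u -> test_fun h -> test_fun k ->
  \sum_m \sum_n (tail m u h x * tail n u k x) *: flow_commutator m n u x = 0.
Proof.
move=> fu th tk.
have step h' k' (d : R) : test_fun h' -> test_fun k' -> 0 < d ->
    (forall y, `|y - x| < d -> k' y = 0) -> forall i,
    \sum_m (\sum_n tail n u k' x * flow_commutator m n u x 0 i) * tail m u h' x = 0.
  move=> th' tk' d0 k0 i; apply: (tail_density smooth_w fu _ th') => h2 d' th2 d'0 h0.
  have D0 : 0 < Num.min d d' by rewrite lt_min d0.
  have h0' y : `|y - x| < Num.min d d' -> h2 y = 0 by rewrite lt_min => /andP[_ /h0].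
  have k0' y : `|y - x| < Num.min d d' -> k' y = 0 by rewrite lt_min => /andP[/k0].
  have /rowP /(_ i) := commutator_vanish fu th2 tk' D0 h0' k0'.
  rewrite summxE mxE => E; rewrite -[RHS]E; apply: eq_bigr => m _.
  rewrite summxE mulr_suml; apply: eq_bigr => n _; rewrite [RHS]mxE; ring.
have vanish h' k' (d : R) : test_fun h' -> test_fun k' -> 0 < d ->
    (forall y, `|y - x| < d -> k' y = 0) -> forall i,
    \sum_n (\sum_m tail m u h' x * flow_commutator m n u x 0 i) * tail n u k' x = 0.
  move=> th' tk' d0 k0 i; rewrite -[RHS](step h' k' d th' tk' d0 k0 i).
  under [RHS]eq_bigr => m _ do rewrite mulr_suml.
  rewrite [RHS]exchange_big; apply: eq_bigr => n _ /=; rewrite mulr_suml.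
  by apply: eq_bigr => m _; ring.
apply/rowP => i; rewrite summxE mxE.
have E : \sum_n (\sum_m tail m u h x * flow_commutator m n u x 0 i) * tail n u k x = 0.
  by apply: (tail_density smooth_w fu _ tk) => k' d tk' d0 k0; exact: (vanish h k' d).
rewrite -[RHS]E.
under [RHS]eq_bigr => n _ do rewrite mulr_suml.
rewrite [RHS]exchange_big; apply: eq_bigr => m _ /=; rewrite summxE.
by apply: eq_bigr => n _; rewrite mxE; ring.
Qed.

End Commutator.

(** * Codazzi defects and the local terms of the bracket *)

Section LocalPart.
Context {R : realType} {N L : nat}.
Notation path := (R -> 'rV[R]_N).
Variables (U : set 'rV[R]_N) (oU : open U).
Variables (g : 'I_N -> 'I_N -> 'rV[R]_N -> R) (b Gam : 'I_N -> 'I_N -> 'I_N -> 'rV[R]_N -> R).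
Variables (mu : 'M[R]_L) (w : 'I_L -> 'I_N -> 'I_N -> 'rV[R]_N -> R).
Hypothesis LC : levi_civita U g b Gam.
Hypothesis smooth_w : forall n i j, smooth_on U (w n i j).
Hypothesis smu : mu^T = mu.
Hypothesis skewA : skew_operator U (hydro_op g b).
Hypothesis flat_Gam : forall p, U p -> forall j s k l, curvature Gam j s k l p = 0.
Let smooth_g := lc_smooth_g LC.
Let smooth_b := lc_smooth_b LC.
Implicit Types (u f h k eta X : path).
Local Notation A := (hydro_op g b).
Local Notation B := (nonlocal_op mu w).
Local Notation P := (lin_comb 1 1 A B).
Local Notation T := (torsion_form Gam).
Local Notation flow := (flow w).
Local Notation dflow := (dflow w).
Local Notation tail := (tail mu w).
Local Notation afn := (afn w).
Local Notation dafn := (dafn w).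
Local Notation Xi := (Xi mu w).
Local Notation conn := (conn Gam).
Local Notation remainder := (remainder g b Gam mu w).
Local Notation gradient := (gradient g b Gam mu w).
Local Notation cross := (cross mu w).
Hypothesis jacP : forall u f h k, field U u -> test_fun f -> test_fun h -> test_fun k ->
  schouten P P u f h k = 0.


Local Notation theta := (theta Gam).
Local Notation nabla := (covariant Gam).
Local Notation gm := (gm g).
Local Notation commutator := (flow_commutator w).

Let comm_eq0 u h k (x : R) (fu : field U u) (th : test_fun h) (tk : test_fun k) :
  \sum_m \sum_n (tail m u h x * tail n u k x) *: commutator m n u x = 0 :=
  commutator_eq0 oU LC smooth_w smu skewA flat_Gam jacP x fu th tk.

(* The Codazzi defect [nabla_l w^i_j - nabla_j w^i_l]. *)
Definition codazzi n i l j p : R :=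
  partial l (w n i j) p + \sum_q Gam i l q p * w n q j p
  - partial j (w n i l) p - \sum_q Gam i q j p * w n q l p.

Definition codazzi_mx n u x : 'M[R]_N := \matrix_(i, l) form (codazzi n i l) u x.

Lemma smooth_codazzi n i l j : smooth_on U (codazzi n i l j).
Proof.
have sG := lc_smooth_Gam LC.
apply: smoothB => //; last by apply: smooth_sum => // q; exact: smoothM.
apply: smoothB => //; last exact: smooth_derive.
apply: smoothD => //; first exact: smooth_derive.
by apply: smooth_sum => // q; exact: smoothM.
Qed.

Lemma smooth_codazzi_mx n u : field U u -> smooth_on [set: R] (codazzi_mx n u).
Proof.
move=> fu; apply: smooth_mx => [|i l]; first exact: openT.
rewrite (_ : (fun x => _) = form (codazzi n i l) u); last by apply/funext => x; rewrite mxE.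
by apply: smooth_form fu => j; exact: smooth_codazzi.
Qed.

Lemma derive1_afn n u (x : R) i l : field U u ->
  derive1 (afn n u) x i l = \sum_j derive1 u x 0 j * partial j (w n i l) (u x).
Proof.
move=> fu; have [_ Uu _] := fu.
rewrite -(derive_rV _ (smooth_differentiable (smooth_w n i l) (Uu x))).
have D := is_derive_coord i l (smooth_is_derive x (smooth_afn smooth_w n fu)).
rewrite -(is_derive1 D); apply: is_derive1.
rewrite (_ : (fun y => _) = fun y => w n i l (u y)); last by apply/funext => y; rewrite mxE.
exact: is_derive_coef (smooth_w n i l) fu.
Qed.

Lemma codazzi_mxE n u (x : R) : field U u -> codazzi_mx n u x =
  dafn n u x + conn u (flow n u) x - derive1 (afn n u) x - theta u x *m afn n u x.
Proof.
move=> fu; apply/matrixP => i l.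
rewrite mxD_entry mxN_entry mxD_entry mxN_entry mxD_entry (derive1_afn n x i l fu) mxE /form.
have -> : \sum_j codazzi n i l j (u x) * derive1 u x 0 j =
    \sum_j partial l (w n i j) (u x) * derive1 u x 0 j
    + \sum_j (\sum_q Gam i l q (u x) * w n q j (u x)) * derive1 u x 0 j
    - \sum_j derive1 u x 0 j * partial j (w n i l) (u x)
    - \sum_j (\sum_q Gam i q j (u x) * w n q l (u x)) * derive1 u x 0 j.
  rewrite -big_split -!sumrB; apply: eq_bigr => j _ /=; rewrite /codazzi; ring.
congr (_ + _ - _ - _).
- by rewrite mxE.
- rewrite mxE; under eq_bigr => j _ do rewrite mulr_suml.
  rewrite exchange_big; apply: eq_bigr => q _ /=; rewrite mxE /form mulr_sumr.
  by apply: eq_bigr => j _; rewrite mulrA.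
- rewrite mxE; under eq_bigr => j _ do rewrite mulr_suml.
  rewrite exchange_big; apply: eq_bigr => q _ /=; rewrite !mxE mulr_suml.
  by apply: eq_bigr => j _; ring.
Qed.

(** Where one covector vanishes, the remainder reduces to the other one paired with commutators
    contracted with a tail; contracting also with the tail of [f] gives 0 by [comm_eq0]. *)
Lemma remainder_disjoint (O : set R) u f h k x : open O -> O x -> field U u ->
  test_fun f -> test_fun h -> test_fun k ->
  (forall y, O y -> h y = 0) \/ (forall y, O y -> k y = 0) ->
  \sum_m tail m u f x * remainder u h k m x = 0.
Proof.
move=> oO Ox fu tf th tk hk0.
have T0 (f' e X : path) : f' x = 0 \/ X x = 0 -> T u f' e X x = 0.
  by move=> [E|E]; rewrite /torsion_form E ?trmx0 ?mulmx0 ?mul0mx mxE.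
have hx : h x = 0 \/ A u k x = 0.
  by case: hk0 => [h0|k0]; [left; exact: h0|right; exact: (hydro_vanish oO g b u k0 Ox)].
have kx : k x = 0 \/ A u h x = 0.
  by case: hk0 => [h0|k0]; [right; exact: (hydro_vanish oO g b u h0 Ox)|left; exact: k0].
have Q (t1 t2 r s t : R) : t1 = 0 -> t2 = 0 -> - t1 + t2 - r + s + t = s - r + t.
  by move=> -> ->; ring.
have C1 := comm_eq0 x fu tf th; have C2 := comm_eq0 x fu tf tk.
case: hk0 => [h0|k0].
- have E m : remainder u h k m x = dot (k x) (\sum_n tail n u h x *: commutator m n u x).
    rewrite /remainder (Q _ _ _ _ _ (T0 _ _ _ hx) (T0 _ _ _ kx)) (h0 x Ox).
    rewrite (dot0l (dflow m u (P u k) x)) subr0.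
    rewrite (dflow_sum_vanish mu LC smooth_w m oO fu th h0 Ox) !dot_sumr -big_split.
    apply: eq_bigr => n _ /=; rewrite /cross /flow_commutator (h0 x Ox) scaler0 sub0r.
    move: (dflow n u (flow m u) x) (dflow m u (flow n u) x) => p q.
    by rewrite dotNl dotZl !dotZr dotDr dotNr mulrBr.
  under eq_bigr => m _ do rewrite E -dotZr.
  rewrite -dot_sumr; refine (etrans (congr1 (dot (k x)) _) (etrans (congr1 (dot (k x)) C1) (dot0r _))).
  by apply: eq_bigr => m _; rewrite scaler_sumr; apply: eq_bigr => n _; rewrite scalerA.
- have E m : remainder u h k m x = - dot (h x) (\sum_n tail n u k x *: commutator m n u x).
    rewrite /remainder (Q _ _ _ _ _ (T0 _ _ _ hx) (T0 _ _ _ kx)) (k0 x Ox).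
    rewrite (dot0l (dflow m u (P u h) x)) sub0r.
    rewrite (dflow_sum_vanish mu LC smooth_w m oO fu tk k0 Ox) !dot_sumr -!sumrN -big_split.
    apply: eq_bigr => n _ /=; rewrite /cross /flow_commutator (k0 x Ox) scaler0 subr0.
    move: (dflow n u (flow m u) x) (dflow m u (flow n u) x) => p q.
    by rewrite dotZl !dotZr dotDr dotNr; ring.
  under eq_bigr => m _ do rewrite E mulrN -dotZr.
  rewrite sumrN -dot_sumr -[RHS]oppr0; congr (- _).
  refine (etrans (congr1 (dot (h x)) _) (etrans (congr1 (dot (h x)) C2) (dot0r _))).
  by apply: eq_bigr => m _; rewrite scaler_sumr; apply: eq_bigr => n _; rewrite scalerA.
Qed.

(** By [remainder_disjoint] the nonlocal half of the expansion vanishes identically, so the Jacobi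
    identity says that the gradient pairs to 0 with every [f]. *)
Lemma gradient_disjoint u h k : field U u -> test_fun h -> test_fun k ->
  (forall x, exists O, [/\ open O, O x &
    (forall y, O y -> h y = 0) \/ (forall y, O y -> k y = 0)]) ->
  forall x, gradient u h k x = 0.
Proof.
move=> fu th tk dis x; have tG := test_gradient mu LC smooth_w fu th tk.
apply: (@fundamental_lemma R N [set: R] (gradient u h k) openT (test_continuous tG) _ x I).
move=> f tf _; have := jacP fu tf th tk.
rewrite (schouten_expansion oU LC smooth_w smu skewA flat_Gam fu th tk tf).
have -> : Int (fun x => \sum_m tail m u f x * remainder u h k m x) = 0.
  rewrite -[RHS]Int0; congr Int; apply/funext => y; have [V [oV Vy hk]] := dis y.
  exact: remainder_disjoint oV Vy fu tf th tk hk.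
by rewrite addr0.
Qed.

Definition affine_sum u h x : 'M[R]_N := \sum_n tail n u h x *: afn n u x.
Definition codazzi_total u h x : 'M[R]_N := \sum_n tail n u h x *: codazzi_mx n u x.

(** The part free of derivatives of w. Up to the names of the indices it antisymmetrises, for each
    m, the sum over n of [Xi n] tensor w_m w_n u_x, contracts it with c0 and weights it by the tails
    of [h]. *)
Definition tail_exchange u h (c0 : 'rV[R]_N) x : 'rV[R]_N :=
  \sum_m \sum_n tail m u h x *: (dot (Xi n u x) c0 *: (flow n u x *m (afn m u x)^T))
  - \sum_m (\sum_n tail n u h x * dot c0 (flow m u x *m (afn n u x)^T)) *: Xi m u x.

Lemma smooth_affine_sum u h : field U u -> test_fun h -> smooth_on [set: R] (affine_sum u h).
Proof.
move=> fu th; have o := @openT R; apply: smooth_sum => // n; apply: smooth_scale => //.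
  exact (smooth_tail mu smooth_w n fu th.1).
exact (smooth_afn smooth_w n fu).
Qed.

Lemma smooth_codazzi_total u h : field U u -> test_fun h -> smooth_on [set: R] (codazzi_total u h).
Proof.
move=> fu th; have o := @openT R; apply: smooth_sum => // n; apply: smooth_scale => //.
  exact (smooth_tail mu smooth_w n fu th.1).
exact (smooth_codazzi_mx n fu).
Qed.

(** Where [h] vanishes its tails are locally constant, so the derivative of [cross1] falls on [k]
    and on the affinors; with the connection terms this gives the covariant derivative of [k] and
    the Codazzi matrices. *)
Lemma potential_local (O : set R) u h k x : open O -> O x -> field U u ->
  test_fun h -> test_fun k -> (forall y, O y -> h y = 0) ->
  potential Gam mu w u h k x = nabla u k x *m affine_sum u h x - k x *m codazzi_total u h x.
Proof.
move=> oO Ox fu th tk h0.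
have cr n y : O y -> cross u h k n y = - (tail n u h y *: k y).
  by move=> Oy; rewrite /cross (h0 y Oy) scaler0 sub0r.
have c1 y : O y -> cross1 mu w u h k y = - \sum_n tail n u h y *: (k y *m afn n u y).
  move=> Oy; rewrite /cross1 -sumrN; apply: eq_bigr => n _.
  by rewrite cr // mulNmx scalemxAl.
have D : derive1 (cross1 mu w u h k) x =
    - \sum_n tail n u h x *: (derive1 k x *m afn n u x + k x *m derive1 (afn n u) x).
  rewrite (open_derive1 oO c1 Ox); apply: is_derive1.
  have Dn n := is_derive_scale (is_derive_tail mu smooth_w n x fu th.1)
    (is_derive_mulmx (smooth_is_derive x tk.1) (smooth_is_derive x (smooth_afn smooth_w n fu))).
  have DS := is_deriveN (is_derive_sum Dn).
  rewrite (_ : (fun y => _) = - \sum_n (fun y => tail n u h y *: (k y *m afn n u y))); last first.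
    by apply/funext => y; rewrite !fctE fct_sumE.
  apply: (is_derive_eq DS); congr (- _); apply: eq_bigr => n _.
  by rewrite (h0 x Ox) dot0r scale0r add0r.
rewrite /potential D opprK /cross0 (h0 x Ox) mul0mx sub0r nonlocal_eq conn_sum mulmx_sumr.
have -> : \sum_n cross u h k n x *m dafn n u x = - \sum_n tail n u h x *: (k x *m dafn n u x).
  by rewrite -sumrN; apply: eq_bigr => n _; rewrite cr // mulNmx scalemxAl.
rewrite /affine_sum /codazzi_total !mulmx_sumr -!sumrN -!big_split /=.
apply: eq_bigr => n _ /=; rewrite (codazzi_mxE n x fu) /covariant -!scalemxAr -!scalerN -!scalerDr.
congr (_ *: _); rewrite mulmxBl !mulmxBr mulmxDr mulmxA.
move: (k x *m conn u (flow n u) x) (k x *m dafn n u x) (derive1 k x *m afn n u x).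
move: (k x *m derive1 (afn n u) x) (k x *m theta u x *m afn n u x) => p1 p2 p3 p4 p5.
by apply/rowP => i; rewrite !(mxD_entry, mxN_entry); ring.
Qed.

(** The conditions on the covariant derivative of [k] make [A k] and its derivative vanish at x0.
    The commutators drop out by [comm_eq0], and in [A] of the potential only [codazzi_total] is
    left. *)
Lemma gradient_local (O : set R) u h k (x0 : R) : open O -> O x0 -> field U u ->
  test_fun h -> test_fun k -> (forall y, O y -> h y = 0) ->
  nabla u k x0 = 0 -> derive1 (nabla u k) x0 = 0 ->
  gradient u h k x0 = tail_exchange u h (k x0) x0
   + k x0 *m (theta u x0 *m codazzi_total u h x0 + derive1 (codazzi_total u h) x0
       - codazzi_total u h x0 *m theta u x0) *m gm u x0.
Proof.
move=> oO Ox fu th tk h0 n0 n1; have o := @openT R.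
have Ak : A u k x0 = 0 by rewrite (hydro_nabla LC k x0 fu) n0 mul0mx.
have Ah : A u h x0 = 0 by exact: (hydro_vanish oO g b u h0 Ox).
have sn := smooth_nabla LC fu tk.1; have sG := smooth_gm LC fu.
have dAk : derive1 (A u k) x0 = 0.
  rewrite (_ : A u k = fun x => nabla u k x *m gm u x); last first.
    by apply/funext => x; exact (hydro_nabla LC k x fu).
  rewrite (is_derive1 (is_derive_mulmx (smooth_is_derive x0 sn) (smooth_is_derive x0 sG))).
  by rewrite n0 n1 !mul0mx addr0.
have tA := test_hydro smooth_g smooth_b fu tk; have tB := test_nonlocal mu smooth_w fu tk.1.
have dP m : dflow m u (P u k) x0 = \sum_n (tail n u k x0 *: dflow m u (flow n u) x0
    + dot (Xi n u x0) (k x0) *: (flow n u x0 *m (afn m u x0)^T)).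
  rewrite sumE (dflowD smooth_w m x0 fu tA.1 tB.1) (dflowE smooth_w m (A u k) x0 fu) Ak dAk !mul0mx.
  by rewrite addr0 add0r (dflow_nonlocal mu smooth_w m x0 fu tk.1).
have dirE : direct g b Gam mu w u h k x0 =
    \sum_m \sum_n tail m u h x0 *: (dot (Xi n u x0) (k x0) *: (flow n u x0 *m (afn m u x0)^T)).
  rewrite /direct Ah Ak !mul0mx subrr add0r.
  transitivity (\sum_m \sum_n (tail m u h x0 * tail n u k x0) *: commutator m n u x0
    + \sum_m \sum_n tail m u h x0 *: (dot (Xi n u x0) (k x0) *: (flow n u x0 *m (afn m u x0)^T)));
    last by rewrite (comm_eq0 x0 fu th tk) add0r.
  rewrite sumrB.
  transitivity (\sum_m \sum_n (tail m u h x0 * tail n u k x0) *: dflow m u (flow n u) x0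
    - \sum_m \sum_n (tail m u h x0 * tail n u k x0) *: dflow n u (flow m u) x0
    + \sum_m \sum_n tail m u h x0 *: (dot (Xi n u x0) (k x0) *: (flow n u x0 *m (afn m u x0)^T))).
    rewrite addrAC; congr (_ - _); last first.
      rewrite [RHS]exchange_big; apply: eq_bigr => m _ /=.
      rewrite (dflow_sum_vanish mu LC smooth_w m oO fu th h0 Ox) scaler_sumr.
      by apply: eq_bigr => n _; rewrite scalerA mulrC.
    rewrite -big_split; apply: eq_bigr => m _ /=; rewrite dP scaler_sumr -big_split.
    by apply: eq_bigr => n _ /=; rewrite scalerDr scalerA.
  congr (_ + _); rewrite -sumrB; apply: eq_bigr => m _.
  by rewrite -sumrB; apply: eq_bigr => n _; rewrite -scalerBr.
have sZ := smooth_codazzi_total fu th; have sw := smooth_affine_sum fu th.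
have kt : derive1 k x0 = k x0 *m theta u x0.
  by apply/eqP; rewrite -subr_eq0; apply/eqP; exact: n0.
have potE : A u (potential Gam mu w u h k) x0 =
   - (k x0 *m (theta u x0 *m codazzi_total u h x0 + derive1 (codazzi_total u h) x0
       - codazzi_total u h x0 *m theta u x0) *m gm u x0).
  rewrite (hydro_nabla LC _ x0 fu) -mulNmx; congr (_ *m _).
  have D1 := is_derive_mulmx (smooth_is_derive x0 sn) (smooth_is_derive x0 sw).
  have D2 := is_derive_mulmx (smooth_is_derive x0 tk.1) (smooth_is_derive x0 sZ).
  have D := is_derive1 (is_deriveB D1 D2).
  rewrite /covariant (potential_local oO Ox fu th tk h0).
  rewrite (open_derive1 oO (fun y Oy => potential_local oO Oy fu th tk h0) Ox) D.
  rewrite n0 n1 !mul0mx addr0 !sub0r kt mulmxBr mulmxDr !mulmxA mulNmx opprK.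
  by rewrite opprB addrC opprD.
rewrite /gradient dirE potE opprK /tail_exchange addrAC; congr (_ + _ + _).
rewrite -sumrN; apply: eq_bigr => m _; rewrite -scaleNr -sumrN; congr (_ *: _).
apply: eq_bigr => n _; rewrite /cross (h0 x0 Ox) scaler0 sub0r.
by rewrite dotNl dotZl.
Qed.

End LocalPart.

(** * Vanishing of [B, B] and the equivalence *)

Section Compatibility.
Context {R : realType} {N L : nat}.
Notation path := (R -> 'rV[R]_N).
Variables (U : set 'rV[R]_N) (oU : open U).
Variables (g : 'I_N -> 'I_N -> 'rV[R]_N -> R) (b Gam : 'I_N -> 'I_N -> 'I_N -> 'rV[R]_N -> R).
Variables (mu : 'M[R]_L) (w : 'I_L -> 'I_N -> 'I_N -> 'rV[R]_N -> R).
Hypothesis LC : levi_civita U g b Gam.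
Hypothesis smooth_w : forall n i j, smooth_on U (w n i j).
Hypothesis smu : mu^T = mu.
Hypothesis skewA : skew_operator U (hydro_op g b).
Hypothesis flat_Gam : forall p, U p -> forall j s k l, curvature Gam j s k l p = 0.
Implicit Types (u f h k eta X : path).
Local Notation A := (hydro_op g b).
Local Notation B := (nonlocal_op mu w).
Local Notation P := (lin_comb 1 1 A B).
Local Notation T := (torsion_form Gam).
Local Notation flow := (flow w).
Local Notation dflow := (dflow w).
Local Notation tail := (tail mu w).
Local Notation afn := (afn w).
Local Notation Xi := (Xi mu w).
Hypothesis jacP : forall u f h k, field U u -> test_fun f -> test_fun h -> test_fun k ->
  schouten P P u f h k = 0.


Local Notation theta := (theta Gam).
Local Notation nabla := (covariant Gam).
Local Notation gm := (gm g).
Local Notation commutator := (flow_commutator w).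

Let comm_eq0 u h k (x : R) (fu : field U u) (th : test_fun h) (tk : test_fun k) :
  \sum_m \sum_n (tail m u h x * tail n u k x) *: commutator m n u x = 0 :=
  commutator_eq0 oU LC smooth_w smu skewA flat_Gam jacP x fu th tk.

Local Notation codazzi_mx := (codazzi_mx Gam w).
Local Notation codazzi_sum := (codazzi_total Gam mu w).
Local Notation exchange := (tail_exchange mu w).
Hypothesis det_g : forall p, U p -> \det (metric_mx g p) != 0.

Lemma nabla_jet u (x0 d : R) (c0 : 'rV[R]_N) : field U u -> 0 < d -> exists k,
  [/\ test_fun k, forall x, d <= `|x - x0| -> k x = 0, k x0 = c0,
    nabla u k x0 = 0 & derive1 (nabla u k) x0 = 0].
Proof.
move=> fu d0; have sT := smooth_theta LC fu.
(* The parallel transport equation k' = k theta and its derivative at x0. *)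
pose c1 := c0 *m theta u x0; pose c2 := c1 *m theta u x0 + c0 *m derive1 (theta u) x0.
have [k [tk kd k0 k1 k2]] := jet_exists x0 c0 c1 c2 d0.
exists k; split => //; first by rewrite /covariant k0 k1 subrr.
have D := is_derive1 (is_deriveB (smooth_is_derive x0 (test_derive1 tk).1)
  (is_derive_mulmx (smooth_is_derive x0 tk.1) (smooth_is_derive x0 sT))).
by rewrite /covariant D k0 k1 k2 subrr.
Qed.

(** Take [k] supported within d/2 of x0, with value c0 and covariant derivative zero to first order
    there. Near each point [h] or [k] vanishes, so the gradient vanishes, and [gradient_local]
    evaluates it at x0. *)
Lemma local_identity u h (x0 d : R) (c0 : 'rV[R]_N) : field U u -> test_fun h -> 0 < d ->
  (forall y, `|y - x0| < d -> h y = 0) ->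
  exchange u h c0 x0 + c0 *m (theta u x0 *m codazzi_sum u h x0 + derive1 (codazzi_sum u h) x0
    - codazzi_sum u h x0 *m theta u x0) *m gm u x0 = 0.
Proof.
move=> fu th d0 h0; have d2 : 0 < d / 2 by lra.
have [k [tk kd k0 n0 n1]] := nabla_jet x0 c0 fu d2.
have x0d : `|x0 - x0| < d by rewrite subrr normr0.
have := gradient_local oU LC smooth_w smu skewA flat_Gam jacP (@open_close R x0 d) x0d fu th tk h0 n0 n1.
rewrite k0 => <-; apply: (gradient_disjoint oU LC smooth_w smu skewA flat_Gam jacP fu th tk) => x.
have [xd|xd] := ltP `|x - x0| d.
  by exists [set y | `|y - x0| < d]; split => //; [exact: open_close|left].
exists [set y | d / 2 < `|y - x0|]; split; first exact: open_away.
  by rewrite /=; lra.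
by right => y /= dy; apply: kd; exact: ltW.
Qed.

Lemma codazzi_sum_vanish u h (x0 d : R) : field U u -> test_fun h -> 0 < d ->
  (forall y, `|y - x0| < d -> h y = 0) -> codazzi_sum u h x0 = 0.
Proof.
move=> fu th d0 h0; have d2 : 0 < d / 2 by lra.
have dd : d / 2 < d by lra.
have [phi Fphi] := fold_exists x0 0 1 d2.
have fv := field_fold Fphi fu; pose v x := u (phi x).
have fv' : field U v by exact: fv.
have [_ _ p0 p1 _] := Fphi.
(* The folded field has zero velocity at x0, so every expression linear in u_x vanishes there; of
   [local_identity] only the derivative of the Codazzi sum remains. *)
have F0 c : form c v x0 = 0 by rewrite (form_fold Fphi fu) p1 mul0r.
have T0 : theta v x0 = 0 by apply/matrixP => i j; rewrite mxE [RHS]mxE; exact: F0.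
have X0 m : Xi m v x0 = 0 by rewrite (Xi_fold mu w m Fphi fu) scale0r.
have tE n : tail n v h x0 = tail n u h x0.
  exact (congr1 (fun F => F x0) (tail_fold mu w u Fphi dd n h0)).
have E0 c0 : exchange v h c0 x0 = 0.
  rewrite /tail_exchange [X in _ - X]big1 ?subr0 => [|m _]; last by rewrite X0 scaler0.
  by apply: big1 => m _; apply: big1 => n _; rewrite X0 dot0l scale0r scaler0.
have D : derive1 (codazzi_sum v h) x0 = codazzi_sum u h x0.
  have Dn n := is_derive_scale (is_derive_tail mu smooth_w n x0 fv' th.1)
    (smooth_is_derive x0 (smooth_codazzi_mx oU LC smooth_w n fv')).
  have DS := is_derive_sum Dn; rewrite /codazzi_total.
  rewrite (_ : (fun y => _) = \sum_n (fun y => tail n v h y *: codazzi_mx n v y)); last first.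
    by apply/funext => y; rewrite fct_sumE.
  rewrite (is_derive1 DS); apply: eq_bigr => n _; rewrite X0 dot0l scale0r add0r tE; congr (_ *: _).
  apply/matrixP => i l.
  have D1 := is_derive_coord i l (smooth_is_derive x0 (smooth_codazzi_mx oU LC smooth_w n fv')).
  rewrite -(is_derive1 D1) [RHS]mxE.
  have -> : (fun y => codazzi_mx n v y i l) = form (codazzi Gam w n i l) v.
    by apply/funext => y; rewrite mxE.
  rewrite (derive1_form_fold Fphi fu (smooth_codazzi oU LC smooth_w n i l)).
  by rewrite mul1r expr0n mul0r addr0.
apply/row_matrixP => i; rewrite row0 rowE.
have := local_identity (delta_mx 0 i) fv' th d0 h0.
rewrite E0 T0 mul0mx mulmx0 subr0 !add0r D.
exact (mulmx_gm_eq0 det_g fv').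
Qed.

Lemma exchange_local u h (x0 d : R) c0 : field U u -> test_fun h -> 0 < d ->
  (forall y, `|y - x0| < d -> h y = 0) -> exchange u h c0 x0 = 0.
Proof.
move=> fu th d0 h0; have x0d : `|x0 - x0| < d by rewrite subrr normr0.
(* Vanishing on a whole neighbourhood is needed, since [local_identity] also contains the
   derivative. *)
have C0 x : `|x - x0| < d -> codazzi_sum u h x = 0.
  move=> xd; have d1 : 0 < d - `|x - x0| by lra.
  apply: (codazzi_sum_vanish fu th d1) => y yx; apply: h0.
  by have := ler_distD x y x0; lra.
have := local_identity c0 fu th d0 h0.
rewrite (C0 x0 x0d) (derive1_vanish (@open_close R x0 d) C0 x0d).
by rewrite mulmx0 mul0mx subr0 addr0 mulmx0 mul0mx addr0.
Qed.

(** Each component is linear in the tails of [h], so [tail_density] extends [exchange_local] to all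
    covectors. *)
Lemma exchange_eq0 u h (x : R) c0 : field U u -> test_fun h -> exchange u h c0 x = 0.
Proof.
move=> fu th; apply/rowP => i.
pose X m := \sum_n dot (Xi n u x) c0 * (flow n u x *m (afn m u x)^T) 0 i
  - \sum_n dot c0 (flow n u x *m (afn m u x)^T) * Xi n u x 0 i.
have E h' : exchange u h' c0 x 0 i = \sum_m X m * tail m u h' x.
  rewrite /tail_exchange mxD_entry mxN_entry !summxE.
  have -> : \sum_m ((\sum_n tail n u h' x * dot c0 (flow m u x *m (afn n u x)^T)) *: Xi m u x) 0 i =
      \sum_m \sum_n tail m u h' x * (dot c0 (flow n u x *m (afn m u x)^T) * Xi n u x 0 i).
    rewrite [RHS]exchange_big; apply: eq_bigr => m _ /=; rewrite mxE mulr_suml.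
    by apply: eq_bigr => n _; rewrite mulrA.
  rewrite -sumrB; apply: eq_bigr => m _; rewrite /X mulrC mulrBr !mulr_sumr summxE; congr (_ - _).
  by apply: eq_bigr => n _; rewrite !mxE.
rewrite E mxE; apply: (tail_density smooth_w fu _ th) => h' d th' d0 h0.
by rewrite -E (exchange_local c0 fu th' d0 h0) mxE.
Qed.

Lemma schouten_nonlocal u f h k : field U u -> test_fun f -> test_fun h -> test_fun k ->
  schouten B B u f h k = 0.
Proof.
move=> fu tf th tk.
(* The bracket is an alternating sum of six such terms, and S = Phi + Psi. [Phi] is symmetric in its
   last two covectors by [comm_eq0], [Psi] in the two covectors without a tail by [exchange_eq0];
   these symmetries make the six terms cancel. *)
pose S (f h k : path) x := \sum_m tail m u h x * dot (f x) (dflow m u (B u k) x).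
pose Phi (f h k : path) x := \sum_m \sum_n tail m u h x * tail n u k x * dot (f x) (dflow m u (flow n u) x).
pose Psi (h f k : path) x := \sum_m \sum_n tail m u h x *
  (dot (Xi n u x) (k x) * dot (f x) (flow n u x *m (afn m u x)^T)).
have SE (f' h' k' : path) x : test_fun k' -> S f' h' k' x = Phi f' h' k' x + Psi h' f' k' x.
  move=> tk'; rewrite -big_split; apply: eq_bigr => m _ /=.
  rewrite (dflow_nonlocal mu smooth_w m x fu tk'.1) dot_sumr mulr_sumr -big_split.
  apply: eq_bigr => n _ /=; move: (dflow m u (flow n u) x) (flow n u x *m (afn m u x)^T) => p q.
  by rewrite dotDr !dotZr; ring.
have PhiC (f' h' k' : path) x : test_fun h' -> test_fun k' -> Phi f' h' k' x = Phi f' k' h' x.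
  move=> th' tk'; apply/eqP; rewrite -subr_eq0; apply/eqP.
  rewrite -[RHS](dot0r (f' x)) -(comm_eq0 x fu th' tk') dot_sumr /Phi [X in _ - X]exchange_big -sumrB.
  apply: eq_bigr => m _ /=; rewrite dot_sumr -sumrB; apply: eq_bigr => n _.
  rewrite /flow_commutator; move: (dflow m u (flow n u) x) (dflow n u (flow m u) x) => p q.
  by rewrite dotZr dotDr dotNr; ring.
have PsiC (f' h' k' : path) x : test_fun h' -> Psi h' f' k' x = Psi h' k' f' x.
  move=> th'; apply/eqP; rewrite -subr_eq0; apply/eqP.
  have E := exchange_eq0 x (k' x) fu th'.
  transitivity (dot (f' x) (exchange u h' (k' x) x)); last by rewrite E dot0r.
  rewrite /tail_exchange dotDr dotNr !dot_sumr; congr (_ - _).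
    apply: eq_bigr => m _; rewrite dot_sumr; apply: eq_bigr => n _.
    by move: (flow n u x *m (afn m u x)^T) => q; rewrite !dotZr.
  rewrite /Psi [LHS]exchange_big; apply: eq_bigr => m _ /=; rewrite dotZr mulr_suml.
  by apply: eq_bigr => n _; rewrite (dotC (Xi m u x)); ring.
have tB f' : test_fun f' -> test_fun (B u f').
  by move=> tf'; exact (test_nonlocal mu smooth_w fu tf'.1).
have c f' h' eta : test_fun f' -> test_fun h' -> test_fun eta ->
    cc (fun x => \sum_m dot (tail m u h' x *: f' x - tail m u f' x *: h' x) (dflow m u eta x)).
  move=> tf' th' te; apply: test_cc; apply: test_sum => m; apply: test_dot.
    exact (test_tails mu smooth_w m fu tf' th').
  exact (smooth_dflow smooth_w m fu te.1).
have dE f' h' eta : test_fun f' -> test_fun h' -> test_fun eta ->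
    dop B u f' h' eta = dnonlocal mu w u f' h' eta.
  by move=> tf' th' te; exact (is_derive1 (is_derive_nonlocal oU smooth_w smu fu tf' th' te)).
rewrite /schouten (dE f h _ tf th (tB k tk)) (dE h k _ th tk (tB f tf)) (dE k f _ tk tf (tB h th)).
have c1 := c f h _ tf th (tB k tk); have c2 := c h k _ th tk (tB f tf); have c3 := c k f _ tk tf (tB h th).
rewrite /dnonlocal -(IntD c1 c2) -(IntD (ccD c1 c2) c3) -[RHS]Int0; congr Int; apply/funext => x.
have split3 (f' h' k' : path) :
    \sum_m dot (tail m u h' x *: f' x - tail m u f' x *: h' x) (dflow m u (B u k') x) =
    S f' h' k' x - S h' f' k' x.
  rewrite /S -sumrB; apply: eq_bigr => m _; move: (dflow m u (B u k') x) => q.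
  by rewrite dotDl dotNl !dotZl.
have Q (p q r s t v pf pg ph sf sg sh : R) : p = pf + sf -> q = pg + sg -> r = pg + sh ->
    s = ph + sf -> t = ph + sg -> v = pf + sh -> p - q + (r - s) + (t - v) = 0.
  by move=> -> -> -> -> -> ->; ring.
refine (etrans (congr2 +%R (congr2 +%R (split3 f h k) (split3 h k f)) (split3 k f h)) _).
apply: (Q _ _ _ _ _ _ (Phi f h k x) (Phi h f k x) (Phi k f h x) (Psi h k f x) (Psi f h k x) (Psi k f h x)).
- exact (etrans (SE f h k x tk) (congr1 _ (PsiC f h k x th))).
- exact (SE h f k x tk).
- exact (etrans (SE h k f x tf) (congr2 +%R (PhiC h k f x tk tf) (PsiC h k f x tk))).
- exact (etrans (SE k h f x tf) (congr1 (+%R^~ _) (PhiC k h f x th tf))).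
- exact (etrans (SE k f h x th) (congr1 _ (PsiC k f h x tf))).
- exact (etrans (SE f k h x th) (congr1 (+%R^~ _) (PhiC f k h x tk th))).
Qed.

End Compatibility.

Theorem lemma2p1 (R : realType) (N L : nat) (U : set 'rV[R]_N)
    (g : 'I_N -> 'I_N -> 'rV[R]_N -> R)
    (b : 'I_N -> 'I_N -> 'I_N -> 'rV[R]_N -> R)
    (mu : 'M[R]_L)
    (w : 'I_L -> 'I_N -> 'I_N -> 'rV[R]_N -> R)
    (openU : open U)
    (smooth_g : forall i j, smooth_on U (g i j))
    (smooth_b : forall i j k, smooth_on U (b i j k))
    (smooth_w : forall n i j, smooth_on U (w n i j))
    (det_g : forall p, U p -> \det (metric_mx g p) != 0)
    (sym_mu : mu^T = mu)
    (det_mu : \det mu != 0)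
    (hamP : hamiltonian U (lin_comb 1 1 (hydro_op g b) (nonlocal_op mu w))) :
  flat U g <->
  (forall lambda1 lambda2 : R,
     hamiltonian U
       (lin_comb lambda1 lambda2 (hydro_op g b) (nonlocal_op mu w))).
Proof.
have preA := pre_hydro openU smooth_g smooth_b; have preB := pre_nonlocal openU smooth_w sym_mu.
have LC := hamiltonian_levi_civita openU smooth_g smooth_b smooth_w det_g sym_mu hamP.
have skewA := hamiltonian_skew_hydro openU smooth_g smooth_b smooth_w sym_mu hamP.
have hamE l1 l2 := hamiltonianP openU (pre_lin_comb openU l1 l2 preA preB).
have [_ jacP] := (hamE 1 1).1 hamP.
split => [flat_g l1 l2|H].
  apply/hamE; split; first exact (skew_lin_comb l1 l2 preA preB skewA (nonlocal_skew smooth_w sym_mu)).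
  move=> u f h k fu tf th tk; rewrite (schouten_lin_comb openU l1 l2 preA preB fu tf th tk).
  have AA := flat_schouten_hydro openU LC flat_g fu tf th tk.
  have BB := schouten_nonlocal openU LC smooth_w sym_mu skewA flat_g jacP det_g fu tf th tk.
  (* With both pure brackets zero, the Jacobi identity of the given operator leaves exactly the
     mixed bracket. *)
  have E := jacP u f h k fu tf th tk; rewrite (schouten_lin_comb openU 1 1 preA preB fu tf th tk) in E.
  rewrite AA BB mulr0 add0r addr0 mulr1 mul1r in E.
  by rewrite AA BB E !mulr0 !addr0.
(* The member (1, 0) of the pencil is the local part alone. *)
have [_ jacA] := (hamE 1 0).1 (H 1 0).
have AA u f h k : field U u -> test_fun f -> test_fun h -> test_fun k ->
    schouten (hydro_op g b) (hydro_op g b) u f h k = 0.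
  move=> fu tf th tk; have := jacA u f h k fu tf th tk.
  rewrite (schouten_lin_comb openU 1 0 preA preB fu tf th tk).
  by rewrite mulr0 mul0r addr0 expr0n mul0r addr0 expr1n mul1r.
move=> p Up; exact (curvature_zero openU LC det_g skewA AA Up).
Qed.
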